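(* Let $k\ge0$ be an integer and $0<\alpha<1$. Suppose the Legendre coefficients $m_l(\rho)$ of the contrast $m$ and $u_s(\rho)$ of the total field $u$ satisfy $$\|m_l\|_\infty=O\!\left(\frac{1}{l^{k+\alpha}}\right)\ (l\to\infty),\qquad \|u_s\|_\infty=O\!\left(\frac{1}{s^{k+2+\alpha}}\right)\ (s\to\infty).$$ Assume that there is a constant $B$, independent of $F$, such that $\|(I-\tfrac i2K^F)^{-1}\|_\infty\le B$ for all $F$. Then, as $F\to\infty$, $$\varepsilon_F:=\|u^F-v^F\|_{\infty}=\begin{cases} O\!\left(\dfrac{1}{F^{\,k+2.5+\alpha+\min(1.5,\,k-2+\alpha)}}\right) & \text{if } k\ge 3,\\[2mm] O\!\left(\dfrac{\log F}{F^{\,4.5+\alpha+\min(1,\,0.5+\alpha)}}\right) & \text{if } k=2,\\[2mm] O\!\left(\dfrac{1}{F^{3+2\alpha}}\right) & \text{if } k=1,\\[2mm] O\!\left(\dfrac{1}{F^{1+2\alpha}}\right) & \text{if } k=0. \end{cases}$$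
   Context: Let $\kappa>0$ be the wavenumber and $R>0$. The axisymmetric refractive index $n$ on $\mathbb{R}^3$ equals $1$ outside a bounded scatterer contained in the ball of radius $R$ about the origin, and $m=1-n^2$ (the contrast), viewed as a function $m(\rho,\cos\theta)$ of spherical coordinates $0\le\rho\le R$, $0\le\theta\le\pi$. The total field $u=u(\rho,\cos\theta)$ is the axisymmetric solution of the Lippmann-Schwinger equation $$u(x)=u^i(x)-\kappa^2\int_{|y|\le R}\frac{e^{i\kappa|x-y|}}{4\pi|x-y|}\,u(y)\,m(y)\,dy,$$ where $u^i$ is an axisymmetric incident field with $\Delta u^i+\kappa^2u^i=0$ in $\mathbb{R}^3$. Let $P_n$ be the Legendre polynomials. The Legendre expansions are $m(\rho,\cos\theta)=\sum_{l\ge0}m_l(\rho)P_l(\cos\theta)$, $u(\rho,\cos\theta)=\sum_{s\ge0}u_s(\rho)P_s(\cos\theta)$ and $u^i(\rho,\cos\theta)=\sum_{n\ge0}u^i_n(\rho)P_n(\cos\theta)$, where the $n$-th Legendre coefficient of a function $g$ is $g_n(\rho)=\frac{2n+1}{2}\int_0^\pi g(\rho,\cos\theta)P_n(\cos\theta)\sin\theta\,d\theta$. $\|m_l\|_\infty,\|u_s\|_\infty$ are suprema over $0\le\rho\le R$. For a function $w(\rho,\cos\theta)$ define $$(K_nw)(\widetilde\rho)=-(2n+1)\kappa^3\int_0^R\!\!\int_0^\pi h_n^{(1)}(\kappa\rho_>)\,j_n(\kappa\rho_<)\,w(\rho,\cos\theta)\,m(\rho,\cos\theta)\,P_n(\cos\theta)\sin\theta\,\rho^2\,d\theta\,d\rho,$$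 with $\rho_>=\max(\widetilde\rho,\rho)$, $\rho_<=\min(\widetilde\rho,\rho)$, $j_n$ the spherical Bessel function of the first kind and $h_n^{(1)}$ the spherical Hankel function of the first kind, and $$(K^Fw)(\widetilde\rho,\cos\widetilde\theta)=\sum_{n=0}^F(K_nw)(\widetilde\rho)\,P_n(\cos\widetilde\theta).$$ For a positive integer $F$, $u^F(\rho,\cos\theta)=\sum_{n=0}^Fu_n(\rho)P_n(\cos\theta)$ and $u^{i,F}(\rho,\cos\theta)=\sum_{n=0}^Fu^i_n(\rho)P_n(\cos\theta)$. The approximate solution $v=v^F$ is the solution of the truncated integral equation $$v^F=u^{i,F}+\tfrac i2K^Fv^F,$$ so that its Legendre coefficients of index $n>F$ vanish. $\|\cdot\|_\infty$ denotes the supremum norm for functions of $(\rho,\theta)$ with $0<\rho\le R$, $0\le\theta\le\pi$; $I-\frac i2K^F$ is regarded as an operator on the bounded functions of $(\rho,\theta)$, assumed invertible, and $\|(I-\frac i2K^F)^{-1}\|_\infty$ is the induced operator norm. The numbers $\kappa$, $R$, and the functions $m,u$ are fixed; the implied constants in the $O(\cdot)$ are independent of $F$. *)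

(* Defs.v *)
From HB Require Import structures.
From mathcomp Require Import all_boot all_order all_algebra.
From mathcomp Require Import all_classical all_reals all_analysis.
From mathcomp Require Export complex.

Set Implicit Arguments.
Unset Strict Implicit.
Unset Printing Implicit Defensive.
Import Order.TTheory GRing.Theory Num.Theory.
Import numFieldNormedType.Exports.
Local Open Scope classical_set_scope.
Local Open Scope complex_scope.
Local Open Scope ring_scope.

(* MathComp-Analysis has no integral of complex-valued functions: integrate the
   real and imaginary parts. *)
Definition cintegral (d : measure_display) (T : measurableType d)
    (R : realType) (mu : {measure set T -> \bar R}) (D : set T)
    (f : T -> R[i]) : R[i] :=
  (\int[mu]_(x in D) complex.Re (f x)) +i* (\int[mu]_(x in D) complex.Im (f x)).

Definition cmeasurable (d : measure_display) (T : measurableType d)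
    (R : realType) (D : set T) (f : T -> R[i]) : Prop :=
  measurable_fun D (fun x => complex.Re (f x)) /\
  measurable_fun D (fun x => complex.Im (f x)).

Definition bounded_on (R : realType) (T : Type) (D : set T) (f : T -> R[i]) :
    Prop :=
  exists M : R, forall x, D x -> Normc.normc (f x) <= M.

(* The value lives in [\bar R], so that the norm of an unbounded function is
   [+oo] (the supremum in [R] of an unbounded set is 0). *)
Definition supnorm (R : realType) (T : Type) (D : set T) (f : T -> R[i]) :
    \bar R :=
  ereal_sup [set (Normc.normc (f x))%:E | x in D].

(* [a n = O(b n)] as [n --> oo], for a nonnegative extended-real sequence [a]. *)
Definition bigO_seq (R : realType) (a : nat -> \bar R) (b : nat -> R) : Prop :=
  exists C : R, \forall n \near \oo, (a n <= (C * b n)%:E)%E.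

Definition enorm (R : realType) (x : R * R * R) : R :=
  Num.sqrt (x.1.1 ^+ 2 + x.1.2 ^+ 2 + x.2 ^+ 2).

Definition cball3 (R : realType) (r : R) : set (R * R * R) :=
  [set x | enorm x <= r].

Definition axisymmetric (R : realType) (T : Type) (g : R * R * R -> T) : Prop :=
  forall phi x y z : R,
    g (cos phi * x - sin phi * y, sin phi * x + cos phi * y, z) = g (x, y, z).

(* An axisymmetric [g] on R^3 as a function of the pair (rho, theta): its value
   in the half-plane of azimuth 0. *)
Definition sph (R : realType) (T : Type) (g : R * R * R -> T) (p : R * R) : T :=
  g (p.1 * sin p.2, 0, p.1 * cos p.2).

Definition basis3 (R : realType) : seq (R * R * R) :=
  [:: (1, 0, 0); (0, 1, 0); (0, 0, 1)].

Definition twice_continuously_diff (R : realType) (f : R * R * R -> R) : Prop :=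
  forall v w, v \in basis3 R -> w \in basis3 R ->
    [/\ forall x, derivable f x v,
        forall x, derivable (fun y => 'D_v f y) x w
      & continuous (fun x => 'D_w (fun y => 'D_v f y) x)].

Definition laplacian (R : realType) (f : R * R * R -> R) (x : R * R * R) : R :=
  \sum_(v <- basis3 R) 'D_v (fun y => 'D_v f y) x.

(* Classical solutions of [Delta f + kappa^2 f = 0] on R^3. *)
Definition helmholtz (R : realType) (kappa : R) (f : R * R * R -> R[i]) : Prop :=
  let re x := complex.Re (f x) in
  let im x := complex.Im (f x) in
  [/\ twice_continuously_diff re, twice_continuously_diff im
    & forall x, (laplacian re x +i* laplacian im x) + (kappa ^+ 2)%:C * f x = 0].

Definition contrast (R : realType) (nref : R * R * R -> R[i])
    (x : R * R * R) : R[i] :=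
  1 - nref x ^+ 2.

Definition green (R : realType) (kappa r : R) : R[i] :=
  (cos (kappa * r) +i* sin (kappa * r)) / (4 * pi * r)%:C.

Definition lippmann_schwinger (R : realType) (kappa rad : R)
    (m ui u : R * R * R -> R[i]) : Prop :=
  forall x, u x = ui x - (kappa ^+ 2)%:C *
    cintegral ((@lebesgue_measure R \x @lebesgue_measure R)
                 \x @lebesgue_measure R)%E
      (cball3 rad) (fun y => green kappa (enorm (x - y)) * u y * m y).

(* Rodrigues' formula. *)
Definition legendre (R : realType) (n : nat) : {poly R} :=
  (2 ^+ n * n`!%:R)^-1 *: (('X^2 - 1) ^+ n)^`(n).

Definition legendre_coef (R : realType) (g : R * R -> R[i]) (n : nat)
    (rho : R) : R[i] :=
  ((2 * n + 1)%:R / 2)%:C *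
  cintegral (@lebesgue_measure R) `[0, pi]
    (fun theta => g (rho, theta) * ((legendre R n).[cos theta] * sin theta)%:C).

Definition legendre_trunc (R : realType) (g : R * R -> R[i]) (F : nat)
    (p : R * R) : R[i] :=
  \sum_(n < F.+1) legendre_coef g n p.1 * ((legendre R n).[cos p.2])%:C.

(* Power series of the spherical Bessel functions:
     j_n(t) = sum_p (-1)^p t^(n+2p) / (2^p p! 1.3...(2n+2p+1)),
     y_n(t) = - (2n)! / (2^n n!)
                sum_p (-1)^p t^(2p-n-1) / (2^p p! (1-2n)(3-2n)...(2p-1-2n)). *)
Definition sph_bessel_j (R : realType) (n : nat) (t : R) : R :=
  limn (series (fun p : nat => (-1) ^+ p * t ^+ (n + 2 * p) /
    (2 ^+ p * p`!%:R * \prod_(0 <= i < n + p + 1) (2 * i + 1)%:R))).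

Definition sph_bessel_y (R : realType) (n : nat) (t : R) : R :=
  - ((2 * n)`!%:R / (2 ^+ n * n`!%:R)) *
  limn (series (fun p : nat => (-1) ^+ p * (t ^+ (2 * p) / t ^+ (n + 1)) /
    (2 ^+ p * p`!%:R *
     \prod_(1 <= i < p + 1) ((2 * i)%:R - 1 - (2 * n)%:R)))).

Definition sph_hankel1 (R : realType) (n : nat) (t : R) : R[i] :=
  sph_bessel_j n t +i* sph_bessel_y n t.

Definition Kn (R : realType) (kappa rad : R) (m : R * R -> R[i]) (n : nat)
    (w : R * R -> R[i]) (rho' : R) : R[i] :=
  - ((2 * n + 1)%:R * kappa ^+ 3)%:C *
  cintegral (@lebesgue_measure R) `[0, rad] (fun rho =>
    cintegral (@lebesgue_measure R) `[0, pi] (fun theta =>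
      sph_hankel1 n (kappa * Num.max rho' rho) *
      (sph_bessel_j n (kappa * Num.min rho' rho))%:C *
      w (rho, theta) * m (rho, theta) *
      ((legendre R n).[cos theta] * sin theta * rho ^+ 2)%:C)).

Definition KF (R : realType) (kappa rad : R) (m : R * R -> R[i]) (F : nat)
    (w : R * R -> R[i]) (p : R * R) : R[i] :=
  \sum_(n < F.+1) Kn kappa rad m n w p.1 * ((legendre R n).[cos p.2])%:C.

Definition halfKF (R : realType) (kappa rad : R) (m : R * R -> R[i]) (F : nat)
    (w : R * R -> R[i]) (p : R * R) : R[i] :=
  ('i / 2) * KF kappa rad m F w p.

Definition domain (R : realType) (rad : R) : set (R * R) :=
  `]0, rad] `*` `[0, pi].

(* Bounded functions on a domain [D], represented by total functions whose
   values outside [D] are irrelevant. *)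
Definition bounded_measurable (d : measure_display) (T : measurableType d)
    (R : realType) (D : set T) (f : T -> R[i]) : Prop :=
  cmeasurable D f /\ bounded_on D f.

Definition eq_on (T U : Type) (D : set T) (f g : T -> U) : Prop :=
  forall x, D x -> f x = g x.

(* [S] is the inverse of [A] on the space of bounded functions on [D]. *)
Definition inverse_operator (d : measure_display) (T : measurableType d)
    (R : realType) (D : set T) (A S : (T -> R[i]) -> (T -> R[i])) : Prop :=
  [/\ forall f, bounded_measurable D f -> bounded_measurable D (S f),
      forall f g, bounded_measurable D f -> bounded_measurable D g ->
        eq_on D f g -> eq_on D (S f) (S g),
      forall f, bounded_measurable D f -> eq_on D (A (S f)) f
    & forall f, bounded_measurable D f -> eq_on D (S (A f)) f].

Definition opnorm (d : measure_display) (T : measurableType d)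
    (R : realType) (D : set T) (S : (T -> R[i]) -> (T -> R[i])) : \bar R :=
  ereal_sup [set supnorm D (S f) |
    f in [set f | bounded_measurable D f /\ (supnorm D f <= 1)%E]].

(* Main.v *)
Require Import Defs.
From HB Require Import structures.
From mathcomp Require Import all_boot all_order all_algebra.
From mathcomp Require Import all_classical all_reals all_analysis.
From mathcomp Require Import measurable_realfun complex ring lra zify.

Set Implicit Arguments.
Unset Strict Implicit.
Unset Printing Implicit Defensive.
Import Order.TTheory GRing.Theory Num.Theory.
Import numFieldNormedType.Exports.
Local Open Scope classical_set_scope.
Local Open Scope complex_scope.
Local Open Scope ring_scope.

(** Write [u^F] for the truncated Legendre expansion of [u], [A = I - (i/2) K^F],
    and [e = u^F - v^F].  The Lippmann-Schwinger equation yields, radius by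
    radius, [u_n = u^i_n + (i/2) K_n u] ([radial_equation]).  Summing over
    [n <= F] and subtracting the equation of [v^F] gives
    [A e = (i/2) K^F (u - u^F)], so the bound on the resolvent reduces the theorem
    to an estimate of [K^F] on the tail of [u] ([resolvent_bound]).

    The radial equation is the expansion of the Green function in Legendre
    polynomials.  For two points at distances [t < s] from the origin that
    subtend an angle of cosine [x], and [r = sqrt (s^2 + t^2 - 2 s t x)], the
    integrals of [sin r / r * P_n x] and [cos r / r * P_n x] over [-1, 1] are
    [2 j_n(s) j_n(t)] and [- 2 y_n(s) j_n(t)] ([sin_multipole], [cos_multipole]).
    They are obtained from Rodrigues' formula and an induction on Gegenbauer's
    integrals, in which only the recurrence and the derivative rule of the
    spherical Bessel functions intervene ([bessel_seq], [q_closed]).  The azimuth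
    is integrated by the Funk-Hecke formula ([funk_hecke]), which rests on the
    product formula for Legendre polynomials ([avgpoly_legendre]); Fubini's
    theorem and spherical coordinates then give the Legendre coefficients of the
    volume potential ([potential_legendre]).

    For the tail, the coefficient of index [n] of [(u - u^F) m] is a sum of
    products [u_s m_l] with [s > F] and [s - n <= l <= s + n], weighted by
    integrals of [P_s P_n P_l], which are at most
    [2 / sqrt ((2 s + 1) (2 n + 1))] by Cauchy-Schwarz ([product_tail]).  The
    radial kernel of [K_n] has mass of order [1 / n] once the factor [2 n + 1] is
    included ([kernel_mass]).  With [b = k + alpha], [m_l = O(l^-b)] and
    [u_s = O(s^-(b+2))], splitting the double sum according to [2 n <= s] or
    [s < 2 n] and summing over [n <= F] yields
    [O (F^-(2b+1) + F^-(b+4) * sum of l^(2-b) over 1 <= l <= 3 F)]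
    ([tail_majorantP], [tail_majorant_sum]).  The four cases of the theorem are
    the behaviours of the last sum: bounded for [k >= 3], at most a constant
    times [F^(1-alpha) log F] for [k = 2], and [F^(3-b)] for [k <= 1]
    ([rate_ge3], [rate_eq2], [rate_le1]). *)

(** * Legendre polynomials *)
Section LegendreAlgebra.
Variable R : realType.
Implicit Types p q r : {poly R}.
Notation P := (@legendre R).

Definition prim p : {poly R} :=
  \poly_(i < (size p).+1) (p`_i.-1 *+ (i != 0)%N / i%:R).

Lemma coef_prim p i : (prim p)`_i = p`_i.-1 *+ (i != 0)%N / i%:R.
Proof.
rewrite coef_poly; case: ltnP => //; case: i => [|i] //= hi.
by rewrite nth_default ?mul0rn ?mul0r.
Qed.

Lemma deriv_prim p : (prim p)^`() = p.
Proof.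
apply/polyP => i; rewrite coef_deriv coef_prim /= mulr1n.
by rewrite -[LHS]mulr_natr mulfVK// pnatr_eq0.
Qed.

Lemma prim_deriv p : prim (p^`()) = p - (p`_0)%:P.
Proof.
apply/polyP => -[|i]; rewrite coef_prim coefB coefC/=.
  by rewrite mulr0n mul0r subrr.
by rewrite coef_deriv mulr1n -[X in X / _]mulr_natr mulfK ?subr0// pnatr_eq0.
Qed.

Fact prim_is_linear : linear prim.
Proof.
move=> c p q; apply/polyP => i; rewrite coefD coefZ !coef_prim coefD coefZ.
by rewrite mulrnDl mulrDl -mulrnAr !mulrA.
Qed.
HB.instance Definition _ := GRing.isLinear.Build R {poly R} {poly R} _ prim prim_is_linear.

(** The integral over [-1, 1], defined algebraically so that integration by
    parts and orthogonality are identities between formal derivatives. *)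
Definition pint p : R := (prim p).[1] - (prim p).[-1].

Fact pint_is_linear : scalar pint.
Proof. by move=> c p q; rewrite /pint linearP/= !(hornerD, hornerZ) mulrBr opprD addrACA. Qed.
HB.instance Definition _ := GRing.isLinear.Build R {poly R} R _ pint pint_is_linear.

Lemma pint_deriv p : pint p^`() = p.[1] - p.[-1].
Proof. by rewrite /pint prim_deriv !hornerE opprB addrA subrK. Qed.

Lemma pint_parts p q :
  pint (p^`() * q) = p.[1] * q.[1] - p.[-1] * q.[-1] - pint (p * q^`()).
Proof. by rewrite -!hornerM -pint_deriv derivM linearD/= addrK. Qed.

Definition rodrigues n : {poly R} := ('X^2 - 1) ^+ n.

Lemma legendreE n : P n = (2 ^+ n * n`!%:R)^-1 *: (rodrigues n)^`(n).
Proof. by []. Qed.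

Lemma rodrigues_fact n : rodrigues n = ('X - 1%:P) ^+ n * ('X + 1%:P) ^+ n.
Proof. by rewrite /rodrigues -exprMn; congr (_ ^+ _); ring. Qed.

Lemma size_rodrigues n : size (rodrigues n) = (n.*2.+1)%N.
Proof.
rewrite rodrigues_fact; have -> : 'X + 1%:P = 'X - (-1)%:P :> {poly R} by rewrite polyCN opprK.
rewrite size_Mmonic ?monic_exp ?monicXsubC//; last by rewrite expf_neq0// polyXsubC_eq0.
by rewrite !size_exp_XsubC addnS/= addSn addnn.
Qed.

Lemma lead_coef_rodrigues n : lead_coef (rodrigues n) = 1.
Proof.
apply/eqP; rewrite -/(rodrigues n \is monic) rodrigues_fact.
have -> : 'X + 1%:P = 'X - (-1)%:P :> {poly R} by rewrite polyCN opprK.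
by rewrite -[_ == 1]/(_ \is monic) monicMr monic_exp ?monicXsubC.
Qed.

Lemma size_legendre n : size (P n) = n.+1.
Proof.
have nz : (2 ^+ n * n`!%:R)^-1 != 0 :> R.
  by rewrite invr_eq0 mulf_neq0 ?expf_neq0 ?pnatr_eq0 -?lt0n ?fact_gt0.
rewrite legendreE size_scale//; apply/eqP; rewrite eqn_leq; apply/andP; split.
  apply/leq_sizeP => j hj; rewrite coef_derivn nth_default ?mul0rn//.
  by rewrite size_rodrigues -addnn ltn_add2l.
rewrite ltnNge; apply/negP => /leq_sizeP /(_ n (leqnn n)).
rewrite coef_derivn => /eqP; rewrite mulrn_eq0.
have -> : (rodrigues n)`_(n + n) = 1.
  by rewrite -(lead_coef_rodrigues n) lead_coefE size_rodrigues -addnn.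
by rewrite oner_eq0 orbF -leqn0 leqNgt ffact_gt0 leq_addr.
Qed.

Lemma legendre_lead n : (P n)`_n != 0.
Proof.
rewrite -[n in _`_n]/(n.+1.-1) -(size_legendre n).
by rewrite -lead_coefE lead_coef_eq0 -size_poly_eq0 size_legendre.
Qed.

Lemma legendre_neq0 n : P n != 0.
Proof. by rewrite -size_poly_eq0 size_legendre. Qed.

(** A zero of order [n] still has order [n - j] after [j] derivatives; this gives
    the boundary terms in Rodrigues' formula. *)
Lemma dvdp_derivn (a : R) n j r : (j <= n)%N ->
  exists s : {poly R}, (('X - a%:P) ^+ n * r)^`(j) = ('X - a%:P) ^+ (n - j) * s.
Proof.
elim: j => [|j IH] jn; first by exists r; rewrite subn0.
have [s hs] := IH (ltnW jn); rewrite derivnS hs.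
exists (s *+ (n - j) + ('X - a%:P) * s^`()).
rewrite derivM deriv_exp derivXsubC mul1r.
have -> : (n - j = (n - j.+1).+1)%N by rewrite subnSK.
rewrite /= exprS; set A := _ ^+ _; set B := 'X - _.
by rewrite -[s *+ _]mulr_natr -[_ *+ (n - j.+1).+1]mulr_natr; ring.
Qed.

Lemma derivn_root (a : R) n j r : (j < n)%N -> ((('X - a%:P) ^+ n * r)^`(j)).[a] = 0.
Proof.
move=> jn; have [s ->] := dvdp_derivn a r (ltnW jn).
by rewrite hornerM horner_exp !hornerE subrr expr0n subn_eq0 leqNgt jn mul0r.
Qed.

Lemma derivn_at (a : R) n r : ((('X - a%:P) ^+ n * r)^`(n)).[a] = n`!%:R * r.[a].
Proof.
elim: n r => [|n IH] r; first by rewrite expr0 mul1r fact0 mul1r.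
have -> : ('X - a%:P) ^+ n.+1 * r = ('X - a%:P) ^+ n * (('X - a%:P) * r).
  by rewrite exprSr mulrA.
rewrite derivSn derivM deriv_exp derivXsubC.
have -> : 1 * ('X - a%:P) ^+ n.-1 *+ n * (('X - a%:P) * r) = ('X - a%:P) ^+ n * (r *+ n).
  case: n {IH} => [|n]; first by rewrite !mulr0n mul0r mulr0.
  by rewrite /= mul1r exprS mulrnAl mulrnAr; congr (_ *+ _); ring.
rewrite -mulrDr IH !derivM derivXsubC !hornerE hornerMn factS natrM subrr.
by rewrite /= -[r.[a] *+ n]mulr_natr -natr1; ring.
Qed.

Lemma legendre1 n : (P n).[1] = 1.
Proof.
rewrite legendreE hornerZ rodrigues_fact derivn_at horner_exp !hornerE.
rewrite /= (_ : 1 + 1 = 2)//.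
have h1 : 2 ^+ n != 0 :> R by rewrite expf_neq0.
have h2 : n`!%:R != 0 :> R by rewrite pnatr_eq0 -lt0n fact_gt0.
by field; rewrite h1 h2.
Qed.

Lemma legendreN1 n : (P n).[-1] = (-1) ^+ n.
Proof.
rewrite legendreE hornerZ rodrigues_fact [_ ^+ n * _ ^+ n]mulrC.
have -> : 'X + 1%:P = 'X - (-1)%:P :> {poly R} by rewrite polyCN opprK.
rewrite derivn_at horner_exp !hornerE /=.
rewrite (_ : -1 - 1 = (-1) * 2 :> R); last by ring.
rewrite exprMn.
have h1 : 2 ^+ n != 0 :> R by rewrite expf_neq0.
have h2 : n`!%:R != 0 :> R by rewrite pnatr_eq0 -lt0n fact_gt0.
by field; rewrite h1 h2.
Qed.

Lemma rodrigues_derivn_root n j : (j < n)%N ->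
  ((rodrigues n)^`(j)).[1] = 0 /\ ((rodrigues n)^`(j)).[-1] = 0.
Proof.
move=> jn; split; first by rewrite rodrigues_fact derivn_root.
rewrite rodrigues_fact mulrC; have -> : 'X + 1%:P = 'X - (-1)%:P :> {poly R} by rewrite polyCN opprK.
by rewrite derivn_root.
Qed.

Lemma pint_rodrigues_parts n q j : (j <= n)%N ->
  pint ((rodrigues n)^`(n) * q) = (-1) ^+ j * pint ((rodrigues n)^`(n - j) * q^`(j)).
Proof.
elim: j => [|j IH] jn; first by rewrite subn0 mul1r.
rewrite (IH (ltnW jn)) -(subnSK jn) derivnS pint_parts.
have [|-> ->] := @rodrigues_derivn_root n (n - j.+1); first by rewrite -subSn// subSS leq_subr.
by rewrite !mul0r subrr sub0r -derivnS exprS; ring.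
Qed.

(** Repeated integration by parts moves the [n] derivatives of Rodrigues'
    formula onto the other factor, which they annihilate. *)
Lemma legendre_orth n q : (size q <= n)%N -> pint (P n * q) = 0.
Proof.
move=> sq; rewrite legendreE -scalerAl linearZ/= (pint_rodrigues_parts _ (leqnn n)).
by rewrite (derivn_poly0 sq) (mulr0 (_ : {poly R})) linear0 !mulr0.
Qed.

Lemma legendre_orth2 n m : n != m -> pint (P n * P m) = 0.
Proof.
rewrite neq_ltn => /orP[h|h]; last by rewrite legendre_orth ?size_legendre.
by rewrite mulrC legendre_orth ?size_legendre.
Qed.

(** [x P_n' = n P_n + lower terms], so integrating [x P_n P_n'] by parts, with
    [P_n(1)^2 = P_n(-1)^2 = 1], determines the norm of [P_n]. *)
Lemma legendre_norm n : pint (P n * P n) = 2 / (2 * n + 1)%:R.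
Proof.
set p := P n.
have h1 : pint (p * ('X * p^`() - p *+ n)) = 0.
  apply: legendre_orth; apply/leq_sizeP => j hj.
  rewrite coefB coefMn coefXM coef_deriv.
  case: j hj => [|j] hj.
    by move: hj; rewrite leqn0 => /eqP ->; rewrite mulr0n subr0.
  rewrite /=; move: hj; rewrite leq_eqVlt => /orP[/eqP ->|hj]; first by rewrite subrr.
  by rewrite nth_default ?mul0rn ?subr0// size_legendre.
have h2 := pint_deriv ('X * p * p).
have {}h2 : pint (p * p) + 2 * pint (p * ('X * p^`())) = 2.
  transitivity (pint ('X * p * p)^`()); last first.
    rewrite h2 !hornerM !hornerX legendre1 legendreN1 /=.
    have := sqrr_sign R n; rewrite expr2 => hs.
    by rewrite mul1r mulr1 -mulrA hs; ring.
  rewrite -[2 * _]/(2 *: pint _) -linearZ/= -linearD/=; congr pint.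
  by rewrite !derivM derivX scaler_nat; ring.
move: h1; rewrite mulrBr linearB/= mulrnAr linearMn => /eqP; rewrite subr_eq0 => /eqP h1.
move: h2; rewrite h1 -mulr_natr => h2.
have h3 : (2 * n + 1)%:R = 2 * n%:R + 1 :> R by rewrite natrD natrM.
have h4 : 0 < (2 * n + 1)%:R :> R by rewrite ltr0n addn1.
apply: (mulIf (lt0r_neq0 h4)); rewrite mulfVK ?lt0r_neq0// -{}h2 h3; ring.
Qed.

(** Dividing out the leading term, every polynomial is a combination of
    Legendre polynomials. *)
Lemma legendre_span p : exists c : nat -> R, p = \sum_(m < size p) c m *: P m.
Proof.
suff H N : forall p, (size p <= N)%N -> exists c : nat -> R, p = \sum_(m < N) c m *: P m.
  exact: H.
elim: N => [|N IH] {}p sp.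
  by exists (fun=> 0); rewrite big_ord0; apply/eqP; rewrite -size_poly_leq0.
pose a := p`_N / (P N)`_N.
have nz := legendre_lead N.
have [|c hc] := IH (p - a *: P N).
  apply/leq_sizeP => j; rewrite leq_eqVlt => /orP[/eqP <-|hj].
    by rewrite coefB coefZ mulfVK ?subrr.
  rewrite coefB coefZ !nth_default ?mulr0 ?subr0 ?size_legendre//.
  by rewrite (leq_trans sp).
exists (fun m => if m == N then a else c m).
rewrite big_ord_recr/= eqxx -[LHS](subrK (a *: P N)) {1}hc; congr (_ + _).
by apply: eq_bigr => i _; rewrite ltn_eqF.
Qed.

Lemma pint_sum_legendre N (c : nat -> R) n : (n < N)%N ->
  pint ((\sum_(m < N) c m *: P m) * P n) = c n * (2 / (2 * n + 1)%:R).
Proof.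
move=> nN; rewrite mulr_suml linear_sum/= (bigD1 (Ordinal nN))//= big1.
  by rewrite addr0 -scalerAl linearZ/= legendre_norm.
move=> i hi; rewrite -scalerAl linearZ/= legendre_orth2 ?mulr0//.
Qed.

Lemma legendre_expand N p : (size p <= N)%N ->
  p = \sum_(m < N) ((2 * m + 1)%:R / 2 * pint (p * P m)) *: P m.
Proof.
move=> sp; have [c hc] := legendre_span p.
have {}hc : p = \sum_(m < N) (if (m < size p)%N then c m else 0) *: P m.
  rewrite {1}hc (big_ord_widen _ (fun m => c m *: P m) sp) [LHS]big_mkcond.
  by apply: eq_bigr => i _; case: ifP; rewrite ?scale0r.
rewrite {1}hc; apply: eq_bigr => i _; congr (_ *: _).
have := @pint_sum_legendre N (fun m => if (m < size p)%N then c m else 0) i (ltn_ord i).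
rewrite -hc => ->; set x := if _ then _ else _.
have h4 : (2 * i + 1)%:R != 0 :> R by rewrite pnatr_eq0 addn1.
by field.
Qed.

(** The Legendre differential operator. *)
Definition legop p : {poly R} := ((1 - 'X^2) * p^`())^`().

Fact legop_is_linear : linear legop.
Proof. by move=> c p q; rewrite /legop !(linearP, linearD, linearZ)/= mulrDr -scalerAr linearP. Qed.
HB.instance Definition _ := GRing.isLinear.Build R {poly R} {poly R} _ legop legop_is_linear.

Lemma coef_legop p i :
  (legop p)`_i = p`_i.+2 *+ (i.+1 * i.+2) - p`_i *+ (i * i.+1).
Proof.
rewrite /legop coef_deriv mulrBl mul1r coefB coefXnM coef_deriv.
case: i => [|i].
  by rewrite /= mulr1n.
rewrite subSS subn1 /= coef_deriv mulrnBl -!mulrnA; congr (_ - _); congr (_ *+ _).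
by rewrite mulnC.
Qed.

Lemma size_legop p : (size (legop p) <= size p)%N.
Proof.
apply/leq_sizeP => j hj; rewrite coef_legop !nth_default ?mul0rn ?subr0//.
by rewrite (leq_trans hj)// leqW.
Qed.

(** [legop] is self-adjoint and does not raise degrees, so [legop P_n] is
    orthogonal to all lower degrees; comparing leading coefficients gives the
    Legendre differential equation. *)
Lemma legop_legendre n : legop (P n) = - (n * n.+1)%:R *: P n.
Proof.
have sa p q : pint (legop p * q) = - pint ((1 - 'X^2) * p^`() * q^`()).
  rewrite /legop pint_parts !hornerE.
  by rewrite sqrrN expr1n subrr !mul0r subrr sub0r.
have orth m : (m < n)%N -> pint (legop (P n) * P m) = 0.
  move=> mn; rewrite sa.
  have -> : (1 - 'X^2) * (P n)^`() * (P m)^`() = (1 - 'X^2) * (P m)^`() * (P n)^`() by ring.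
  rewrite -sa mulrC legendre_orth// (leq_trans (size_legop _))// size_legendre//.
have sz : (size (legop (P n)) <= n.+1)%N by rewrite (leq_trans (size_legop _))// size_legendre.
rewrite [LHS](legendre_expand sz) big_ord_recr/= big1 ?add0r; last first.
  by move=> i _; rewrite orth// mulr0 scale0r.
set c := _ * _; congr (_ *: _).
have : (legop (P n))`_n = (c *: P n)`_n.
  rewrite {1}[legop _](legendre_expand sz) big_ord_recr/= big1 ?add0r//.
  by move=> i _; rewrite orth// mulr0 scale0r.
rewrite coef_legop (coefZ c (P n) n).
have -> : (P n)`_n.+2 = 0 by rewrite nth_default// size_legendre leqW.
rewrite mul0rn add0r; move=> h; apply: (mulIf (legendre_lead n)).
by rewrite -h mulNr mulr_natl.
Qed.

Lemma legop_eigen n p : legop p = - (n * n.+1)%:R *: p -> exists c, p = c *: P n.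
Proof.
have lead q : q != 0 -> legop q = - (n * n.+1)%:R *: q -> (size q).-1 = n.
  move=> q0 /(congr1 (fun r : {poly R} => r`_(size q).-1)).
  rewrite coef_legop coefZ nth_default; last by rewrite leqW// leqSpred.
  have h : lead_coef q != 0 by rewrite lead_coef_eq0.
  rewrite mul0rn sub0r -/(lead_coef q) mulNr mulr_natl => /oppr_inj.
  rewrite -[LHS]mulr_natr -[RHS]mulr_natr => /(mulfI h)/eqP; rewrite eqr_nat => /eqP.
  by set d := (size q).-1 => hd; nia.
move=> hp; have [->|p0] := eqVneq p 0; first by exists 0; rewrite scale0r.
have sp := lead _ p0 hp.
have szp : size p = n.+1 by rewrite -sp prednK// size_poly_gt0.
have nz := legendre_lead n.
exists (p`_n / (P n)`_n); set c := _ / _.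
apply/eqP; rewrite -subr_eq0; apply/eqP; apply: contrapT => /eqP q0.
have hs : (size (p - c *: P n)%R).-1 = n.
  apply: lead => //; rewrite linearB/= linearZ/= hp legop_legendre scalerBr.
  by rewrite (scalerA c _ (P n)) mulrC -(scalerA _ c (P n)).
suff : (size ((p - c *: P n)%R : {poly R}) <= n)%N.
  by move: q0 hs; rewrite -size_poly_gt0; case: (size _) => // d _ /= ->; rewrite ltnn.
apply/leq_sizeP => j; rewrite leq_eqVlt => /orP[/eqP <-|hj].
  by rewrite coefB coefZ mulfVK ?subrr.
by rewrite coefB coefZ !nth_default ?mulr0 ?subr0 ?size_legendre ?szp.
Qed.

(** [avgc i] is [c_(2i) / (2i)!], with [c_k] the mean of [cos^k]. *)
Definition avgc (i : nat) : R := (4 ^+ i * i`!%:R ^+ 2)^-1.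

Lemma avgcS i : avgc i.+1 * (4 * i.+1%:R ^+ 2) = avgc i.
Proof.
rewrite /avgc factS natrM exprS.
have h2 : i`!%:R != 0 :> R by rewrite pnatr_eq0 -lt0n fact_gt0.
have h3 : i.+1%:R != 0 :> R by rewrite pnatr_eq0.
have h4 : 4 ^+ i != 0 :> R by rewrite expf_neq0.
by field; rewrite h2 h4 /= ?andbT addrC natr1.
Qed.

(** Expanding [h] by Taylor's formula around [b x], the mean over [phi] of
    [h (b x + sqrt (1 - b^2) sqrt (1 - x^2) cos phi)] is this polynomial in
    [x]. *)
Definition avgpoly (b : R) (h : {poly R}) : {poly R} :=
  \sum_(i < size h) (avgc i * (1 - b ^+ 2) ^+ i) *:
     ((1 - 'X^2) ^+ i * (h^`(i.*2) \Po (b *: 'X))).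

Lemma avgpolyE b (h : {poly R}) N : (size h <= N)%N -> avgpoly b h =
  \sum_(i < N) (avgc i * (1 - b ^+ 2) ^+ i) *:
     ((1 - 'X^2) ^+ i * (h^`(i.*2) \Po (b *: 'X))).
Proof.
move=> hN; rewrite /avgpoly (big_ord_widen _ (fun i => (avgc i * (1 - b ^+ 2) ^+ i) *:
     ((1 - 'X^2) ^+ i * (h^`(i.*2) \Po (b *: 'X)))) hN) big_mkcond.
apply: eq_bigr => i _; case: ltnP => // hi.
rewrite derivn_poly0 ?comp_poly0 ?mulr0 ?scaler0//.
by rewrite (leq_trans hi)// -addnn leq_addr.
Qed.

Fact avgpoly_is_linear b : linear (avgpoly b).
Proof.
move=> c p q; set N := maxn (size (p : {poly R})) (size (q : {poly R})).
have hs : (size ((c *: p + q)%R : {poly R}) <= N)%N.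
  by rewrite (leq_trans (size_polyD _ _))// geq_max leq_maxr (leq_trans (size_scale_leq _ _)) ?leq_maxl.
rewrite (avgpolyE _ hs) (avgpolyE b (leq_maxl (size (p : {poly R})) (size (q : {poly R})))) -/N.
rewrite (avgpolyE b (leq_maxr (size (p : {poly R})) (size (q : {poly R})))) -/N scaler_sumr -big_split/=.
apply: eq_bigr => i _; rewrite derivnD derivnZ comp_polyD comp_polyZ mulrDr scalerDr.
by rewrite -scalerAr !scalerA [c * _]mulrC.
Qed.
HB.instance Definition _ b := GRing.isLinear.Build R {poly R} {poly R} _ (avgpoly b)
  (avgpoly_is_linear b).

Lemma derivn_legop p n : (legop p)^`(n) =
  (1 - 'X^2) * p^`(n.+2) - (2 * n.+1)%:R *: ('X * p^`(n.+1)) - (n * n.+1)%:R *: p^`(n).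
Proof.
elim: n => [|n IH].
  rewrite derivn0 muln1 mul0n scale0r subr0 /legop derivM linearB/= derivXn.
  rewrite -[1^`()]/(1%:P^`()) derivC /= expr1 scaler_nat; ring.
rewrite derivnS IH !derivB !derivZ !derivM derivB derivXn derivX.
rewrite -[1^`()]/(1%:P^`()) derivC -!derivnS/= expr1 !scaler_nat; ring.
Qed.

(** Both sides are sums over [i] of the same products; the term of
    [legop (y ^ i g)] that lowers the power of [y] is moved to the next index,
    where the recurrence of [avgc] turns it into the missing part of [y]. *)
Lemma legop_avgpoly b h : legop (avgpoly b h) = avgpoly b (legop h).
Proof.
pose N := size h; pose y : {poly R} := 1 - 'X^2.
pose g j := h^`(j) \Po (b *: 'X); pose w := 1 - b ^+ 2.
have dg j : (g j)^`() = b *: g j.+1.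
  by rewrite /g deriv_comp derivZ derivX derivnS alg_polyC mulrC mul_polyC.
have dy : y^`() = - ('X *+ 2) by rewrite /y derivB derivXn -[1^`()]/(1%:P^`()) derivC sub0r expr1.
have term1 i : legop (y ^+ i * g i.*2) =
  (4 * i%:R ^+ 2) *: (y ^+ i.-1 * g i.*2) - (i.*2 * i.*2.+1)%:R *: (y ^+ i * g i.*2)
  - (2 * i.*2.+1)%:R *: ('X * y ^+ i * (b *: g i.*2.+1)) + b ^+ 2 *: (y ^+ i.+1 * g i.*2.+2).
  have X2 : 'X^2 = 1 - y by rewrite /y; ring.
  rewrite /legop -/y derivM deriv_exp dy !dg.
  case: i => [|i].
    rewrite !mulr0n mul0r expr0 add0r mul1r derivM dy derivZ dg /=.
    rewrite -[0.*2]/0%N expr0n mulr0 !scale0r muln1 -!mul_polyC polyC_exp polyC_natr.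
    set G1 := g _; set G2 := g _; ring.
  have -> : y * ((- ('X *+ 2) * y ^+ i.+1.-1 *+ i.+1) * g i.+1.*2 + y ^+ i.+1 * (b *: g i.+1.*2.+1))
     = - ((i.+1 * 2)%:R *: ('X * y ^+ i.+1 * g i.+1.*2)) + b *: (y ^+ i.+2 * g i.+1.*2.+1).
    rewrite -!mul_polyC polyC_natr !exprS natrM /= -[_ *+ i.+1]mulr_natr.
    set G0 := g _; set G1 := g _; set Y := y ^+ i.
    ring.
  have dY j : (y ^+ j.+1)^`() = - (j.+1%:R * 2 * 'X * y ^+ j).
    rewrite deriv_exp dy -[_ *+ j.+1]mulr_natr; set Y := y ^+ j.+1.-1; ring.
  have := dY i.+1; have := dY i; have := exprS y i.+1; have := exprS y i.
  move: (y ^+ i.+2) (y ^+ i.+1) (y ^+ i) => Y2 Y1 Y eY1 eY2 dY1 dY2.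
  rewrite derivD derivN !derivZ !derivM derivX dY1 dY2 !dg eY2 eY1 /=.
  rewrite -mul2n -!mul_polyC !polyCM ?polyC_exp !polyC_natr !natrM.
  set G0 := g _; set G1 := g _; set G2 := g _; rewrite /y; ring.
have sL := size_legop h.
rewrite (avgpolyE b (leqnSn N)) (avgpolyE b (leq_trans sL (leqnSn _))) linear_sum/=.
transitivity (\sum_(i < N.+1) ((avgc i * w ^+ i) *: ((4 * i%:R ^+ 2) *: (y ^+ i.-1 * g i.*2))
  + (avgc i * w ^+ i) *: ( - (i.*2 * i.*2.+1)%:R *: (y ^+ i * g i.*2)
  - (2 * i.*2.+1)%:R *: ('X * y ^+ i * (b *: g i.*2.+1)) + b ^+ 2 *: (y ^+ i.+1 * g i.*2.+2)))).
  by apply: eq_bigr => i _; rewrite linearZ/= term1 -scalerDr !addrA scaleNr.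
transitivity (\sum_(i < N.+1) ((avgc i * w ^+ i) *: (w *: (y ^+ i * g i.*2.+2))
  + (avgc i * w ^+ i) *: ( - (i.*2 * i.*2.+1)%:R *: (y ^+ i * g i.*2)
  - (2 * i.*2.+1)%:R *: ('X * y ^+ i * (b *: g i.*2.+1)) + b ^+ 2 *: (y ^+ i.+1 * g i.*2.+2)))).
  rewrite !big_split/=; congr (_ + _).
  (* shift of the index: the first term of one side and the last one of the
     other vanish *)
  rewrite big_ord_recl big_ord_recr/= expr0n mulr0 !scale0r scaler0 add0r.
  have -> : g N.*2.+2 = 0.
    by rewrite /g derivn_poly0 ?comp_poly0// -addnn -/N -addnS -addnS leq_addr.
  rewrite mulr0 !scaler0 addr0; apply: eq_bigr => i _.
  by rewrite -[bump 0 i]/(i.+1) add0n doubleS !scalerA -(avgcS i) exprS; congr (_ *: _); ring.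
apply: eq_bigr => i _; rewrite -scalerDr; congr (_ *: _).
rewrite derivn_legop; set d2 := h^`(_); set d1 := h^`(_); set d0 := h^`(i.*2).
rewrite !comp_polyB !comp_polyZ !comp_polyM comp_polyB comp_Xn_poly comp_polyX.
rewrite -[1 \Po _]/(1%:P \Po _) comp_polyC -/(g _) -/(g _) -/(g _) [y ^+ i.+1]exprS.
rewrite -!mul_polyC /w polyCB polyCN polyCM !polyC_natr; set Y := (_ ^+ i).
set G0 := g _; set G1 := g _; set G2 := g _; rewrite /y; ring.
Qed.

(** The product formula [mean P_n = P_n(x) P_n(b)]: the mean commutes with the
    Legendre operator, so it sends [P_n] to a multiple of [P_n], and the factor
    is read off at [x = 1]. *)
Lemma avgpoly_legendre b n : avgpoly b (P n) = (P n).[b] *: P n.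
Proof.
have [c hc] : exists c, avgpoly b (P n) = c *: P n.
  by apply: legop_eigen; rewrite legop_avgpoly legop_legendre linearZ.
rewrite hc; congr (_ *: _); have := congr1 (fun p : {poly R} => p.[1]) hc.
rewrite /= hornerZ legendre1 mulr1 => <-.
rewrite /avgpoly size_legendre horner_sum big_ord_recl big1 ?addr0.
  rewrite -[ord0 : nat]/0%N.
  by rewrite hornerZ hornerM horner_comp /avgc !hornerE /= fact0 !expr1n ?mulr1 invr1 !mul1r.
move=> i _; rewrite hornerZ hornerM horner_exp hornerD hornerN hornerXn (hornerC 1) expr1n subrr expr0n /=.
by rewrite mul0r mulr0.
Qed.

End LegendreAlgebra.

(** * One-variable calculus *)
Section Calculus.
Variable R : realType.
Notation mu := (@lebesgue_measure R).
Implicit Types (f g F : R -> R) (x a b : R).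

Lemma is_deriveDf f g x a b : is_derive x 1 f a -> is_derive x 1 g b ->
  is_derive x 1 (fun y => f y + g y) (a + b).
Proof. by move=> *; apply: is_deriveD. Qed.

Lemma is_deriveNf f x a : is_derive x 1 f a -> is_derive x 1 (fun y => - f y) (- a).
Proof. by move=> *; apply: is_deriveN. Qed.

Lemma is_deriveBf f g x a b : is_derive x 1 f a -> is_derive x 1 g b ->
  is_derive x 1 (fun y => f y - g y) (a - b).
Proof. by move=> *; apply: is_deriveB. Qed.

Lemma is_deriveMf f g x a b : is_derive x 1 f a -> is_derive x 1 g b ->
  is_derive x 1 (fun y => f y * g y) (a * g x + f x * b).
Proof.
move=> fa gb; have := is_deriveM fa gb; rewrite /= addrC [g x *: _]mulrC.
exact.
Qed.

Lemma is_deriveZf f c x a : is_derive x 1 f a -> is_derive x 1 (fun y => c * f y) (c * a).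
Proof. by move=> *; apply: is_deriveZ. Qed.

Lemma is_deriveXf f n x a : is_derive x 1 f a ->
  is_derive x 1 (fun y => f y ^+ n) (n%:R * f x ^+ n.-1 * a).
Proof.
move=> fa; have := @is_deriveX _ _ f n x 1 a fa.
rewrite (_ : f ^+ n = (fun y => f y ^+ n))//.
by apply/funext => y; elim: n => [|n IH]; rewrite ?expr0// !exprS -IH.
Qed.

Lemma is_derive_compf f g x a b : is_derive (f x) 1 g b -> is_derive x 1 f a ->
  is_derive x 1 (fun y => g (f y)) (b * a).
Proof.
by move=> gb fa; have := is_derive1_comp gb fa; rewrite /= mulrC => h.
Qed.

Lemma is_deriveVf f x a : f x != 0 -> is_derive x 1 f a ->
  is_derive x 1 (fun y => (f y)^-1) (- a / f x ^+ 2).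
Proof.
move=> f0 fa; have := is_deriveV f0 fa.
by rewrite /= mulNr -mulrN mulrC => h.
Qed.

Lemma is_derive_cont f x a : is_derive x 1 f a -> {for x, continuous f}.
Proof.
move=> [fx _]; apply: differentiable_continuous; exact/derivable1_diffP.
Qed.

Lemma cont_within f a b : (forall x, a <= x <= b -> {for x, continuous f}) ->
  {within `[a, b], continuous f}.
Proof.
move=> cf; apply: continuous_in_subspaceT => x.
by rewrite inE/= in_itv/=; exact: cf.
Qed.

Lemma within_integrable f a b : {within `[a, b], continuous f} ->
  mu.-integrable `[a, b] (EFin \o f).
Proof. by move=> cf; apply: continuous_compact_integrable => //; exact: segment_compact. Qed.

Lemma cont_integrable f a b : (forall x, a <= x <= b -> {for x, continuous f}) ->
  mu.-integrable `[a, b] (EFin \o f).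
Proof. by move=> cf; apply/within_integrable/cont_within. Qed.

Lemma Rintegral_FTC f F a b : a <= b ->
  (forall x, a <= x <= b -> is_derive x 1 F (f x)) ->
  (forall x, a <= x <= b -> {for x, continuous f}) ->
  \int[mu]_(x in `[a, b]) f x = F b - F a.
Proof.
rewrite le_eqVlt => /orP[/eqP<- _ _|ab dF cf].
  by rewrite set_itv1 Rintegral_set1 subrr.
have cF x : a <= x <= b -> {for x, continuous F} by move=> /dF/is_derive_cont.
rewrite /Rintegral (@continuous_FTC2 _ f F)//.
- exact: cont_within.
- split.
  + move=> x; rewrite in_itv/= => /andP[ax xb].
    have axb : a <= x <= b by rewrite !ltW.
    by have [] := dF x axb.
  + by apply: cvg_at_right_filter; apply: cF; rewrite lexx ltW.
  + by apply: cvg_at_left_filter; apply: cF; rewrite lexx ltW.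
- move=> x; rewrite in_itv/= => /andP[ax xb]; rewrite derive1E.
  have axb : a <= x <= b by rewrite !ltW.
  by have [_ ->] := dF x axb.
Qed.

Lemma Rintegral_sum (I : Type) (s : seq I) (f : I -> R -> R) a b :
  (forall i, mu.-integrable `[a, b] (EFin \o f i)) ->
  \int[mu]_(x in `[a, b]) (\sum_(i <- s) f i x) = \sum_(i <- s) \int[mu]_(x in `[a, b]) f i x.
Proof.
move=> fi; suff [] : mu.-integrable `[a, b] (EFin \o (fun x => \sum_(i <- s) f i x)) /\
  \int[mu]_(x in `[a, b]) (\sum_(i <- s) f i x) = \sum_(i <- s) \int[mu]_(x in `[a, b]) f i x by [].
elim: s => [|i s [IH1 IH2]].
  split; last by rewrite big_nil /Rintegral integral0_eq// => x _; rewrite big_nil.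
  rewrite (_ : _ \o _ = cst 0%E); first exact: integrable0.
  by apply/funext => x; rewrite /= big_nil.
have e : EFin \o (fun x => \sum_(j <- i :: s) f j x) =
   ((EFin \o f i) \+ (EFin \o (fun x => (\sum_(j <- s) f j x)%R)))%E.
  by apply/funext => x; rewrite /= big_cons EFinD.
split; first by rewrite e; apply: integrableD.
rewrite big_cons -IH2 -RintegralD//; apply: eq_Rintegral => x _.
by rewrite big_cons.
Qed.

(** Heine's theorem, by compactness of the segment. *)
Lemma heine01 f : continuous f -> forall e : R, 0 < e -> exists2 d : R, 0 < d &
  forall x y : R, 0 <= x <= 1 -> `|x - y| < d -> `|f x - f y| < e.
Proof.
move=> cf e e0.
have := @segment_compact R 0 1; move/compact_near_coveringP.
move=> /(_ R (0^'+) (fun d x => forall y, `|x - y| < d -> `|f x - f y| < e)).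
case.
  move=> x _; have e20 : 0 < e / 2 by rewrite divr_gt0.
  have /cvgrPdist_lt/(_ _ e20) := cf x; rewrite -filter_from_ballE => -[r/= r0 hr].
  exists (ball x (r / 2), [set d | 0 < d < r / 2]) => /=.
    split; first by apply: nbhsx_ballx; rewrite divr_gt0.
    near=> d; apply/andP; split; first by near: d; exact: nbhs_right_gt.
    by near: d; apply: nbhs_right_lt; rewrite divr_gt0.
  move=> [x' d] /= [xx' /andP[d0 dr]] y hy.
  have h1 : `|f x - f x'| < e / 2.
    by apply: hr; apply: le_ball xx'; lra.
  have h2 : `|f x - f y| < e / 2.
    apply: hr; rewrite /ball/= (le_lt_trans (ler_distD x' _ _))// [ltRHS](splitr r).
    by rewrite ltrD// (lt_trans hy).
  rewrite (le_lt_trans (ler_distD (f x) _ _))// [ltRHS](splitr e) ltrD//.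
  by rewrite distrC.
move=> d/= d0 hd; exists (d / 2); first by rewrite divr_gt0.
move=> x y x01 xy.
have := hd (d / 2); apply => //=.
- by rewrite sub0r normrN gtr0_norm ?divr_gt0// ltr_pdivrMr// ltr_pMr// ltr1n.
- by rewrite divr_gt0.
Unshelve. all: by end_near. Qed.

Lemma bernstein_sum1 (n : nat) (x : R) :
  \sum_(k < n.+1) 'C(n, k)%:R * x ^+ k * (1 - x) ^+ (n - k) = 1.
Proof.
have := exprDn (1 - x) x n; rewrite subrK expr1n => e; rewrite [RHS]e.
by apply: eq_bigr => i _; rewrite -[RHS]mulr_natl; ring.
Qed.

Lemma bernstein_shift (n : nat) (x : R) (g : nat -> R) :
  \sum_(k < n.+2) k%:R * g k * ('C(n.+1, k)%:R * x ^+ k * (1 - x) ^+ (n.+1 - k)) =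
  n.+1%:R * x * \sum_(k < n.+1) g k.+1 * ('C(n, k)%:R * x ^+ k * (1 - x) ^+ (n - k)).
Proof.
rewrite big_ord_recl/= !mul0r add0r mulr_sumr; apply: eq_bigr => i _.
rewrite /bump/= add1n subSS exprS.
have := mul_bin_diag n.+1 i => /(congr1 (fun k => k%:R : R)); rewrite !natrM /= => h.
transitivity (g i.+1 * x ^+ i * (1 - x) ^+ (n - i) * x * (i.+1%:R * 'C(n.+1, i.+1)%:R)); first ring.
by rewrite -h; ring.
Qed.

(** The variance of the binomial distribution. *)
Lemma bernstein_var (n : nat) (x : R) :
  \sum_(k < n.+1) (k%:R - n%:R * x) ^+ 2 * ('C(n, k)%:R * x ^+ k * (1 - x) ^+ (n - k))
  = n%:R * x * (1 - x).
Proof.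
case: n => [|n]; first by rewrite big_ord_recl big_ord0 /=; ring.
set b := fun k : nat => 'C(n.+1, k)%:R * x ^+ k * (1 - x) ^+ (n.+1 - k).
have s1 : \sum_(k < n.+2) k%:R * b k = n.+1%:R * x.
  have := bernstein_shift n x (fun=> 1).
  under [in X in _ = X -> _]eq_bigr do rewrite mul1r.
  by rewrite bernstein_sum1 mulr1 => <-; apply: eq_bigr => i _; rewrite mulr1.
have s2 : \sum_(k < n.+2) k%:R * k%:R * b k = n.+1%:R * x * (1 + n%:R * x).
  rewrite (bernstein_shift n x (fun k => k%:R)); congr (_ * _).
  transitivity (\sum_(k < n.+1) (('C(n, k)%:R * x ^+ k * (1 - x) ^+ (n - k)) +
     k%:R * 1 * ('C(n, k)%:R * x ^+ k * (1 - x) ^+ (n - k)))).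
    by apply: eq_bigr => i _; rewrite -natr1; ring.
  rewrite big_split/= bernstein_sum1; congr (_ + _).
  case: n {b s1} => [|n]; first by rewrite big_ord_recl big_ord0 /= mul0r !mul0r addr0.
  rewrite (bernstein_shift n x (fun=> 1)).
  by under eq_bigr do rewrite mul1r; rewrite bernstein_sum1 mulr1.
transitivity (\sum_(k < n.+2) (k%:R * k%:R * b k - 2 * (n.+1%:R * x) * (k%:R * b k)
   + (n.+1%:R * x) ^+ 2 * b k)).
  by apply: eq_bigr => i _; rewrite /b; ring.
rewrite big_split sumrB/= -!mulr_sumr s1 s2 bernstein_sum1 -natr1; ring.
Qed.

(** Weierstrass' approximation theorem by Bernstein polynomials: far from [x]
    the weights are controlled by their variance, of order [1/n]. *)
Lemma weierstrass01 f : continuous f -> forall e : R, 0 < e ->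
  exists p : {poly R}, forall x : R, 0 <= x <= 1 -> `|f x - p.[x]| <= e.
Proof.
move=> cf e e0; have e20 : 0 < e / 2 by rewrite divr_gt0.
have [d d0 hd] := heine01 cf e20.
have [M0 hM0] : exists M : R, forall x, 0 <= x <= 1 -> `|f x| <= M.
  have cw : {within `[0, 1], continuous (fun x => `|f x|)}.
    apply: cont_within => x _; apply: cvg_norm; exact: cf.
  have [c _ hc] := EVT_max ler01 cw.
  by exists (`|f c|) => x x01; apply: hc; rewrite in_itv.
pose M : R := `|M0| + 1; have M1 : 0 < M by rewrite ltr_wpDl.
have hM x : 0 <= x <= 1 -> `|f x| <= M.
  by move=> /hM0 h; rewrite (le_trans h)// ler_wpDr// ler_norm.
have [n hn] : exists n : nat, 4 * M / (d ^+ 2 * e) < n.+1%:R.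
  exists (Num.truncn (4 * M / (d ^+ 2 * e))).
  have h0 : 0 <= 4 * M / (d ^+ 2 * e).
    by apply: divr_ge0; apply: mulr_ge0; rewrite ?ler0n ?sqr_ge0// ltW.
  by have /andP[] := Num.Theory.truncn_itv h0.
pose N := n.+1; have N0 : 0 < N%:R :> R by rewrite ltr0n.
pose bp (k : nat) : {poly R} := ('C(N, k)%:R)%:P * 'X ^+ k * (1 - 'X) ^+ (N - k).
pose b (x : R) (k : nat) := 'C(N, k)%:R * x ^+ k * (1 - x) ^+ (N - k).
have bpE x k : (bp k).[x] = b x k.
  by rewrite /bp /b !hornerM !horner_exp hornerC hornerD hornerN !hornerX (hornerC 1).
exists (\sum_(k < N.+1) f (k%:R / N%:R) *: bp k) => x x01.
have b0 k : 0 <= b x k.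
  by case/andP: x01 => x0 x1; rewrite /b !mulr_ge0// exprn_ge0// subr_ge0.
rewrite horner_sum; under eq_bigr do rewrite hornerZ bpE.
have -> : f x = \sum_(k < N.+1) f x * b x k by rewrite -mulr_sumr bernstein_sum1 mulr1.
rewrite -sumrB (le_trans (ler_norm_sum _ _ _))//.
apply: (@le_trans _ _ (\sum_(k < N.+1) (e / 2 * b x k +
    (2 * M / (d ^+ 2 * N%:R ^+ 2)) * ((k%:R - N%:R * x) ^+ 2 * b x k)))).
  apply: ler_sum => k _; rewrite -mulrBl normrM (ger0_norm (b0 k)) [X in _ <= X](_ : _ =
    (e / 2 + 2 * M / (d ^+ 2 * N%:R ^+ 2) * (k%:R - N%:R * x) ^+ 2) * b x k); last ring.
  apply: ler_wpM2r => //.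
  have k01 : 0 <= (k%:R / N%:R : R) <= 1.
    apply/andP; split; first by rewrite divr_ge0.
    by rewrite ler_pdivrMr// mul1r ler_nat -ltnS; exact: ltn_ord.
  have [xk|xk] := ltP `|x - k%:R / N%:R| d.
    rewrite (le_trans (ltW (hd _ _ x01 xk)))// lerDl mulr_ge0 ?sqr_ge0//.
    by rewrite divr_ge0 ?mulr_ge0 ?sqr_ge0 ?ltW.
  have h1 : `|f x - f (k%:R / N%:R)| <= 2 * M.
    by rewrite (le_trans (ler_normB _ _))// [leRHS]mulr_natl mulr2n lerD ?hM.
  rewrite (le_trans h1)// -[leLHS]add0r lerD ?(ltW e20)//.
  rewrite -[2 * M / _ * _]mulrA ler_pMr ?mulr_gt0// mulrC ler_pdivlMr ?mul1r; last first.
    by rewrite mulr_gt0// exprn_gt0.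
  have -> : k%:R - N%:R * x = - ((x - k%:R / N%:R) * N%:R).
    by field; rewrite lt0r_neq0.
  rewrite sqrrN exprMn ler_pM2r ?exprn_gt0//.
  by rewrite -[leRHS](real_normK (num_real _)) ler_sqr// nnegrE ltW.
rewrite big_split/= -!mulr_sumr bernstein_sum1 bernstein_var mulr1.
rewrite [leRHS](splitr e) lerD2l.
have x1x : x * (1 - x) <= 1.
  case/andP: x01 => x0 x1; rewrite -[leRHS]mulr1 ler_pM// ?subr_ge0//.
  by rewrite lerBlDr lerDl.
have -> : 2 * M / (d ^+ 2 * N%:R ^+ 2) * (N%:R * x * (1 - x)) =
   2 * M / (d ^+ 2 * N%:R) * (x * (1 - x)).
  by field; rewrite !lt0r_neq0 ?exprn_gt0.
apply: (@le_trans _ _ (2 * M / (d ^+ 2 * N%:R))).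
  by rewrite ler_piMr// divr_ge0 ?mulr_ge0 ?sqr_ge0 ?ltW.
rewrite ler_pdivrMr ?mulr_gt0 ?exprn_gt0//.
move: hn; rewrite ltr_pdivrMr ?mulr_gt0 ?exprn_gt0// -/N => hn.
have -> : e / 2 * (d ^+ 2 * N%:R) = (N%:R * (d ^+ 2 * e)) / 2 by field.
rewrite ler_pdivlMr//; apply: le_trans (ltW hn); lra.
Qed.

Lemma weierstrass f : continuous f -> forall e : R, 0 < e ->
  exists p : {poly R}, forall x : R, -1 <= x <= 1 -> `|f x - p.[x]| <= e.
Proof.
move=> cf e e0.
have cg : continuous (fun t : R => f (2 * t - 1)).
  move=> t; apply: continuous_comp; last exact: cf.
  apply: cvgB; last exact: cvg_cst.
  by apply: cvgM; [exact: cvg_cst|exact: cvg_id].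
have [p hp] := weierstrass01 cg e0.
exists (p \Po (2^-1 *: ('X + 1%:P))) => x /andP[x1 x2].
have := hp ((x + 1) / 2); rewrite horner_comp hornerZ hornerD hornerX hornerC.
have -> : 2 * ((x + 1) / 2) - 1 = x by field.
by rewrite [(x + 1) / 2]mulrC; apply; apply/andP; split; lra.
Qed.

(** Differentiation under the integral sign: the constant [M] dominates the
    difference quotients. *)
Lemma derive_Rintegral (f df : R -> R -> R) (x0 a b u v M : R) :
  u < x0 < v -> a <= b ->
  (forall x y, u < x < v -> a <= y <= b -> is_derive x 1 (f ^~ y) (df x y)) ->
  (forall x, u < x < v -> {within `[a, b], continuous (f x)}) ->
  (forall x y, u < x < v -> a <= y <= b -> `|df x y| <= M) ->
  is_derive x0 1 (fun x => \int[mu]_(y in `[a, b]) f x y)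
     (\int[mu]_(y in `[a, b]) df x0 y).
Proof.
move=> ux0v ab df1 cf dfM.
have mD : measurable `[a, b] by exact: measurable_itv.
have I x0' : `]u, v[%classic x0' -> u < x0' < v by rewrite /= in_itv.
have intf x : `]u, v[%classic x -> mu.-integrable `[a, b] (EFin \o f x).
  by move=> /I uxv; apply: within_integrable; exact: cf.
have derf (x y : R) : `]u, v[%classic x -> `[a, b]%classic y -> derivable (f ^~ y) x 1.
  by move=> /I ux /=; rewrite in_itv/= => aby; have [] := df1 x y ux aby.
have intM : mu.-integrable `[a, b] (EFin \o (fun=> M)).
  by apply: cont_integrable => x _; exact: cvg_cst.
have M0 (y : R) : 0 <= M.
  by have := dfM x0 a ux0v; rewrite lexx ab => /(_ isT); apply: le_trans.
have leM (x y : R) : `]u, v[%classic x -> `[a, b]%classic y -> `|partial1of2 f x y| <= M.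
  move=> /I ux /=; rewrite in_itv/= => aby; rewrite /partial1of2 derive1E.
  have [_ ->] := df1 x y ux aby; exact: dfM.
have Ix0 : `]u, v[%classic x0 by rewrite /= in_itv.
have Ix0' : x0 \in `]u, v[%classic by rewrite inE.
split.
  exact: (@derivable_under_integral R _ (measurableTypeR R) mu f _ mD _ _ _ Ix0 intf derf _ M0 intM leM).
rewrite -derive1E (@differentiation_under_integral R _ (measurableTypeR R) mu f _ mD _ _ _ Ix0 intf derf _ M0 intM leM).
apply: eq_Rintegral => y; rewrite inE/= in_itv/= => aby.
by rewrite /partial1of2 derive1E; have [_ ->] := df1 x0 y ux0v aby.
Qed.

End Calculus.

(** * Fubini for real-valued integrals *)
Section FubiniReal.
Context d1 d2 (T1 : measurableType d1) (T2 : measurableType d2) (R : realType).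
Variables (m1 : {sigma_finite_measure set T1 -> \bar R})
          (m2 : {sigma_finite_measure set T2 -> \bar R}).
Variables (D : set T1) (E : set T2) (f : T1 * T2 -> R).
Hypotheses (mD : measurable D) (mE : measurable E).
Hypothesis intf : (m1 \x m2)%E.-integrable (D `*` E) (EFin \o f).

Let F : T1 * T2 -> \bar R := (EFin \o f) \_ (D `*` E).

Local Lemma intF : (m1 \x m2)%E.-integrable setT F.
Proof.
have mDE : measurable (D `*` E) by exact: measurableX.
suff H : (m1 \x m2)%E.-integrable (D `*` E) (EFin \o f) <-> (m1 \x m2)%E.-integrable setT F.
  exact: H.1.
exact: integrable_mkcond.
Qed.

Local Lemma F1 x : D x -> fubini_F m2 F x = (\int[m2]_(y in E) (f (x, y))%:E)%E.
Proof.
move=> Dx; rewrite /fubini_F [RHS]integral_mkcond; apply: eq_integral => y _.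
rewrite /F /patch; case: ifPn => [/set_mem[_ Ey]|].
  by rewrite mem_set.
rewrite notin_setE => h; rewrite memNset// => Ey; exact: h.
Qed.

Local Lemma F1N x : ~ D x -> fubini_F m2 F x = 0%E.
Proof.
move=> Dx; rewrite /fubini_F integral0_eq// => y _.
by rewrite /F /patch memNset// => -[].
Qed.

Local Lemma G1 y : E y -> fubini_G m1 F y = (\int[m1]_(x in D) (f (x, y))%:E)%E.
Proof.
move=> Ey; rewrite /fubini_G [RHS]integral_mkcond; apply: eq_integral => x _.
rewrite /F /patch; case: ifPn => [/set_mem[Dx _]|].
  by rewrite mem_set.
rewrite notin_setE => h; rewrite memNset// => Dx; exact: h.
Qed.

Local Lemma G1N y : ~ E y -> fubini_G m1 F y = 0%E.
Proof.
move=> Ey; rewrite /fubini_G integral0_eq// => x _.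
by rewrite /F /patch memNset// => -[].
Qed.

Local Lemma intG : m2.-integrable setT (fubini_G m1 F).
Proof.
have mF := measurable_int _ intF.
have mG : measurable_fun setT (fubini_G m1 F) by apply: measurable_fubini_G; exact: intF.
apply/integrableP; split => //.
have H := (@integrable21ltyP _ _ _ _ _ m1 m2 F mF).1 intF.
apply: (le_lt_trans _ H).
apply: ge0_le_integral => //.
- exact: measurableT_comp.
- apply: (measurable_fun_fubini_tonelli_G (abse \o F)) => //.
    exact: measurableT_comp.
  by move=> z; exact: abse_ge0.
- by move=> y _; apply: le_abse_integral => //; exact: measurableT_comp.
Qed.

Local Lemma fine_fubini d (T : measurableType d) (m : {measure set T -> \bar R})
    (A : set T) (G : T -> \bar R) (g : T -> R) : measurable A ->
  m.-integrable setT G -> (forall x, A x -> g x = fine (G x)) ->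
  (forall x, ~ A x -> G x = 0%E) ->
  m.-integrable A (EFin \o g) /\ \int[m]_(x in A) g x = fine (\int[m]_x G x)%E.
Proof.
move=> mA iG gG G0.
have mG := measurable_int m iG.
have eg : (EFin \o g) \_ A = EFin \o (fine \o G).
  apply/funext => x; rewrite /patch /=; case: ifPn => [/set_mem Ax|].
    by rewrite gG.
  by rewrite notin_setE => Ax; rewrite G0.
have mfG : measurable_fun setT (EFin \o (fine \o G)).
  by apply/measurable_EFinP; apply: measurableT_comp.
have aeG : ae_eq m setT (EFin \o (fine \o G)) G.
  have := integrable_ae measurableT iG.
  by apply: filterS => x /(_ I) Gx _; rewrite /= fineK.
split.
  apply/integrable_mkcond => //; rewrite eg.
  apply/integrableP; split => //.
  have -> : (\int[m]_x `|(EFin \o (fine \o G)) x| = \int[m]_x `|G x|)%E.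
    apply: ae_eq_integral => //; [exact: measurableT_comp|exact: measurableT_comp|].
    by apply: filterS aeG => x /[apply] h; exact: congr1.
  by move/integrableP : iG => [].
rewrite /Rintegral integral_mkcond.
rewrite (_ : (fun x => (g x)%:E) \_ A = EFin \o (fine \o G))//.
by congr fine; exact: ae_eq_integral.
Qed.

Lemma Rintegral_fubini12 :
  m1.-integrable D (EFin \o (fun x => \int[m2]_(y in E) f (x, y))) /\
  \int[m1]_(x in D) \int[m2]_(y in E) f (x, y) = \int[(m1 \x m2)%E]_(z in D `*` E) f z.
Proof.
have [||i ->] := fine_fubini mD (integrable_fubini_F intF)
    (g := fun x => \int[m2]_(y in E) f (x, y)).
- by move=> x Dx; rewrite F1.
- exact: F1N.
split=> //; congr fine; rewrite [RHS]integral_mkcond -/F -integral12_prod_meas1//.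
exact: intF.
Qed.

Lemma Rintegral_fubini21 :
  m2.-integrable E (EFin \o (fun y => \int[m1]_(x in D) f (x, y))) /\
  \int[m2]_(y in E) \int[m1]_(x in D) f (x, y) = \int[(m1 \x m2)%E]_(z in D `*` E) f z.
Proof.
have [||i ->] := fine_fubini mE intG
    (g := fun y => \int[m1]_(x in D) f (x, y)).
- by move=> y Ey; rewrite G1.
- exact: G1N.
split=> //; congr fine; rewrite [RHS]integral_mkcond -/F -integral21_prod_meas1//.
exact: intF.
Qed.

Lemma Rintegral_swap :
  \int[m1]_(x in D) \int[m2]_(y in E) f (x, y) =
  \int[m2]_(y in E) \int[m1]_(x in D) f (x, y).
Proof. by rewrite Rintegral_fubini12.2 Rintegral_fubini21.2. Qed.

End FubiniReal.

Lemma bounded_integrable d (T : measurableType d) (R : realType)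
    (m : {measure set T -> \bar R}) (D : set T) (f : T -> R) (M : R) :
  measurable D -> (m D < +oo)%E -> measurable_fun D f ->
  (forall x, D x -> `|f x| <= M) -> m.-integrable D (EFin \o f).
Proof.
move=> mD Doo mf fM; apply: measurable_bounded_integrable => //.
exists M; split; first exact: num_real.
by move=> N MN x Dx; apply: (le_trans (fM x Dx)); exact: ltW.
Qed.

Lemma bounded_integrable2 d1 d2 (T1 : measurableType d1) (T2 : measurableType d2)
    (R : realType) (m1 : {sigma_finite_measure set T1 -> \bar R})
    (m2 : {sigma_finite_measure set T2 -> \bar R}) (D : set T1) (E : set T2)
    (f : T1 * T2 -> R) (M : R) :
  measurable D -> measurable E -> (m1 D < +oo)%E -> (m2 E < +oo)%E ->
  measurable_fun (D `*` E) f -> (forall x y, D x -> E y -> `|f (x, y)| <= M) ->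
  (m1 \x m2)%E.-integrable (D `*` E) (EFin \o f).
Proof.
move=> mD mE Doo Eoo mf fM; apply: (bounded_integrable (M := M)) => //.
- exact: measurableX.
- rewrite [X in (X < _)%E](_ : _ = m1 D * m2 E)%E; last exact: product_measure1E.
  by rewrite lte_mul_pinfty ?ge0_fin_numE.
- by move=> [x y] [] /=; exact: fM.
Qed.

(** * Polar and spherical coordinates *)
Section Polar.
Variable R : realType.
Notation mu := (@lebesgue_measure R).
Notation M := (measurableTypeR R).
Local Open Scope ereal_scope.

Lemma measurable_invr : measurable_fun [set: R] (@GRing.inv R).
Proof.
rewrite (_ : @GRing.inv R = (fun x => x * (x ^+ 2) `^ (-1))%R).
  apply: measurable_funM => //.
  have h1 : measurable_fun [set: R] (fun x : R => x `^ (-1))%R by exact: measurable_powR.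
  have h2 : measurable_fun [set: R] (fun x : R => x ^+ 2)%R by exact: exprn_measurable.
  exact: (measurableT_comp h1 h2).
apply/funext => x; rewrite powR_inv1 ?sqr_ge0//.
by have [->|x0] := eqVneq x 0%R; [rewrite invr0 mul0r|field].
Qed.

Lemma measurable_sqrtr : measurable_fun [set: R] (@Num.sqrt R).
Proof. by apply: continuous_measurable_fun; exact: sqrt_continuous. Qed.

Lemma measurable_sin : measurable_fun [set: R] (@sin R).
Proof. by apply: continuous_measurable_fun; exact: continuous_sin. Qed.

Lemma measurable_cos : measurable_fun [set: R] (@cos R).
Proof. by apply: continuous_measurable_fun; exact: continuous_cos. Qed.

Lemma ge0_integral_mrestr d (T : measurableType d) (m : {measure set T -> \bar R})
    (S : set T) (mS : measurable S) (f : T -> \bar R) :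
  measurable_fun setT f -> (forall x, 0 <= f x) ->
  \int[mrestr m mS]_x f x = \int[m]_(x in S) f x.
Proof.
move=> mf f0; have mSC : measurable (~` S) by exact: measurableC.
rewrite -(setvU S) ge0_integral_setU//; last 2 first.
- by rewrite setvU.
- by apply/disj_setPS => x [].
rewrite (_ : \int[_]_(x in ~` S) f x = 0) ?add0e; last first.
  rewrite (eq_measure_integral mzero) ?integral_measure_zero// => A mA AS.
  have AS0 : A `&` S = set0 by apply/seteqP; split => x // [/AS].
  by rewrite -[LHS]/(m (A `&` S)) AS0 measure0.
apply: eq_measure_integral => A mA AS; rewrite /mrestr /=.
by congr (m _); apply/setIidPl.
Qed.

(** Lebesgue measure is determined by the length of intervals, so any measure
    pushed forward to it computes Lebesgue integrals. *)
Lemma ge0_integral_push d (T : measurableType d) (m : {measure set T -> \bar R})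
    (phi : T -> R) (h : R -> \bar R) : measurable_fun setT phi ->
  (forall a b : R, (a < b)%R -> m (phi @^-1` `]a, b]%classic) = (b - a)%:E) ->
  measurable_fun [set: R] h -> (forall x, 0 <= h x) ->
  \int[mu]_x h x = \int[m]_x h (phi x).
Proof.
move=> mphi mab mh h0.
have mphi' : measurable_fun setT (phi : T -> M) by exact: mphi.
have -> : \int[m]_x h (phi x) = \int[pushforward m (phi : T -> M)]_x h x.
  by apply/esym/(@ge0_integral_pushforward _ _ T M R phi mphi' m setT h measurableT).
apply: eq_measure_integral => A mA _; move: A mA.
apply: (@lebesgue_measure_unique R (pushforward m (phi : T -> M))) => _ [[a b] _ <-].
rewrite lebesgue_measure_itv/= lte_fin /pushforward.
case: ltP => ab; first by rewrite -EFinB; exact/esym/mab.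
by rewrite set_itv_ge ?preimage_set0 ?measure0// bnd_simp -leNgt.
Qed.

Lemma lebesgue_measure_oc (a b : R) : (a < b)%R -> mu `]a, b]%classic = (b - a)%:E.
Proof. by move=> ab; rewrite lebesgue_measure_itv/= lte_fin ab. Qed.

Lemma integral_scale (c : R) (h : R -> \bar R) : (0 < c)%R ->
  measurable_fun [set: R] h -> (forall x, 0 <= h x) ->
  \int[mu]_x h x = c%:E * \int[mu]_x h (c * x)%R.
Proof.
move=> c0 mh h0.
rewrite (@ge0_integral_push _ _ (mscale (NngNum (ltW c0)) mu) (fun x : M => (c * x)%R))//.
- by rewrite ge0_integral_mscale//; apply: (measurableT_comp mh); exact: mulrl_measurable.
- exact: mulrl_measurable.
move=> a b ab; rewrite -[LHS]/(c%:E * mu _).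
have -> : ( *%R c) @^-1` `]a, b]%classic = `](a / c)%R, (b / c)%R]%classic.
  apply/seteqP; split => x /=; rewrite !in_itv/=.
    by rewrite ltr_pdivrMr// ler_pdivlMr// ![(x * c)%R]mulrC.
  by rewrite ltr_pdivrMr// ler_pdivlMr// ![(x * c)%R]mulrC.
rewrite lebesgue_measure_oc ?ltr_pM2r ?invr_gt0//.
by rewrite -EFinM; congr EFin; field; rewrite lt0r_neq0.
Qed.

Lemma integral_shift (c : R) (h : R -> \bar R) :
  measurable_fun [set: R] h -> (forall x, 0 <= h x) ->
  \int[mu]_x h x = \int[mu]_x h (x + c)%R.
Proof.
move=> mh h0; rewrite (@ge0_integral_push _ _ mu (fun x : M => (x + c)%R))//.
  exact: measurable_funD.
move=> a b ab.
have -> : (fun x => (x + c)%R) @^-1` `]a, b]%classic = `](a - c)%R, (b - c)%R]%classic.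
  by apply/seteqP; split => x /=; rewrite !in_itv/= ltrBlDr lerBrDr.
rewrite [LHS]lebesgue_measure_oc ?ltrD2r//; congr EFin; ring.
Qed.

Definition cot (x : R) : R := (cos x / sin x)%R.

Lemma cot_tan (x : R) : cot x = tan (pi / 2 - x).
Proof.
have h := cosBpihalf x; have h' := sinBpihalf x.
by rewrite /cot /tan -[(pi / 2 - x)%R]opprB cosN sinN h h' opprK.
Qed.

Lemma derive_cot (x : R) : (sin x != 0)%R -> is_derive x (1 : R)%R cot (- (sin x ^- 2))%R.
Proof.
move=> s0; have := is_deriveMf (is_derive_cos x) (is_deriveVf s0 (is_derive_sin x)).
rewrite (_ : _ + _ = - (sin x ^- 2))%R//.
apply: (@eq_trans _ _ (- ((cos x ^+ 2 + sin x ^+ 2) / sin x ^+ 2))%R); first by field.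
by rewrite cos2Dsin2 mul1r.
Qed.

Lemma cot_itv (a b x : R) : (0 < x < pi)%R ->
  (a < cot x <= b)%R = (pi / 2 - atan b <= x < pi / 2 - atan a)%R.
Proof.
move=> /andP[x0 xpi].
have xI : (pi / 2 - x)%R \in `](- (pi / 2))%R, (pi / 2)%R[.
  rewrite in_itv/=; move: x0 xpi; set p := pi => x0 xpi.
  by apply/andP; split; lra.
have mtan := @ltr_tan R; rewrite cot_tan.
have lt1 c : (c < tan (pi / 2 - x))%R = (atan c < pi / 2 - x)%R.
  rewrite -{1}(atanK c) mtan// in_itv/=.
  by rewrite atan_gtNpi2 atan_ltpi2.
rewrite lt1 leNgt lt1 -leNgt ltrBrDr [(_ + x)%R]addrC -ltrBrDr andbC; congr andb.
by rewrite lerBlDr [RHS]lerBlDr addrC.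
Qed.

(** Both sides define measures in [h = \1_A]; they agree on intervals because
    [- cot] is an antiderivative of [1 / sin^2].  The weight is realized as the
    length of a fibre of the region below its graph, which reduces the change
    of variables to a push-forward. *)
Lemma integral_cot (h : R -> \bar R) : measurable_fun [set: R] h -> (forall x, 0 <= h x) ->
  \int[mu]_t h t = \int[mu]_(x in `]0%R, pi[) (h (cot x) * (sin x ^- 2)%:E).
Proof.
move=> mh h0.
pose w (x : R) : R := (sin x ^- 2)%R.
have mw : measurable_fun [set: R] w.
  apply: (measurableT_comp measurable_invr); apply: measurable_funX; exact: measurable_sin.
have mcot : measurable_fun [set: R] cot.
  apply: measurable_funM; first exact: measurable_cos.
  exact: (measurableT_comp measurable_invr measurable_sin).
pose S : set (M * M) := [set z | (`]0%R, pi[%classic : set M) z.1 /\ (0 < z.2)%R /\ (z.2 < w z.1)%R].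
have mwz : measurable_fun setT (fun z : M * M => (w z.1 - z.2)%R).
  by apply: measurable_funB => //; exact: (measurableT_comp mw measurable_fst).
have mS : measurable S.
  rewrite (_ : S = (fst @^-1` `]0%R, pi[%classic) `&` ((snd @^-1` `]0%R, +oo[%classic) `&`
     ((fun z : M * M => (w z.1 - z.2)%R) @^-1` `]0%R, +oo[%classic))).
    apply: measurableI; first by rewrite -[X in measurable X]setTI; exact: measurable_fst.
    apply: measurableI; first by rewrite -[X in measurable X]setTI; exact: measurable_snd.
    by rewrite -[X in measurable X]setTI; exact: mwz.
  by apply/seteqP; split => z /=; rewrite !in_itv/= !andbT subr_gt0.
have mT : measurable_fun setT (fun z : M * M => cot z.1).
  exact: (measurableT_comp mcot measurable_fst).
have key (g : R -> \bar R) : measurable_fun [set: R] g -> (forall x, 0 <= g x) ->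
    \int[(mu \x mu)%E]_(z in S) g (cot z.1) = \int[mu]_(x in `]0%R, pi[) (g (cot x) * (w x)%:E).
  move=> mg g0; rewrite integral_mkcond fubini_tonelli1; last 2 first.
  - apply/(measurable_restrictT _ _).1 => //; apply: measurable_funTS.
    exact: (measurableT_comp mg mT).
  - by move=> z; apply: erestrict_ge0.
  rewrite [RHS]integral_mkcond; apply: eq_integral => x _; rewrite /fubini_F.
  rewrite patchE; case: ifPn => [/set_mem xI|xI]; last first.
    rewrite integral0_eq// => y _; rewrite patchE memNset// => -[/= h1 _].
    by move: xI; rewrite notin_setE; apply.
  rewrite (eq_integral ((cst (g (cot x))) \_ (`]0%R, (w x)[%classic : set M))); last first.
    move=> y _; rewrite !patchE; congr (if _ then _ else _).
    apply/idP/idP => /set_mem/=.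
      by rewrite /S/= => -[_ [y0 yw]]; apply/mem_set; rewrite /= in_itv/= y0.
    rewrite in_itv/= => /andP[y0 yw]; apply/mem_set; split => //.
  rewrite -integral_mkcond integral_cst//= lebesgue_measure_itv/= lte_fin.
  have w0 : (0 < w x)%R.
    move: xI; rewrite /= in_itv/= => xI.
    by rewrite invr_gt0 exprn_gt0// sin_gt0_pi.
  by rewrite w0 sube0.
apply: etrans; last exact: (key h mh h0).
have mhT : measurable_fun setT (fun z : M * M => h (cot z.1)) by exact: (measurableT_comp mh mT).
rewrite -(ge0_integral_mrestr (mu \x mu) mS mhT); last by move=> z; exact: h0.
apply: (@ge0_integral_push _ _ (mrestr (mu \x mu) mS) (fun z : M * M => cot z.1) h mT _ mh h0).
move=> a b ab; rewrite -[LHS]/((mu \x mu) (((fun z : M * M => cot z.1) @^-1` `]a, b]%classic) `&` S)).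
have mab : measurable (`]a, b]%classic : set M) by exact: measurable_itv.
have -> : (mu \x mu) (((fun z : M * M => cot z.1) @^-1` `]a, b]%classic) `&` S) =
    \int[mu]_(x in `]0%R, pi[) ((\1_(`]a, b]%classic : set M) (cot x))%:E * (w x)%:E).
  rewrite -(key (fun x => (\1_(`]a, b]%classic : set M) x)%:E))//; last first.
    by apply/measurable_EFinP; exact: measurable_indic.
  rewrite -[RHS]/(\int[_]_(z in S)
     (\1_((fun z : M * M => cot z.1) @^-1` `]a, b]%classic) z)%:E).
  by rewrite integral_indic//; rewrite -[X in measurable X]setTI; exact: mT.
  pose A := (pi / 2 - atan b)%R; pose B := (pi / 2 - atan a)%R.
  have AB : (A < B)%R by rewrite /A /B ltrD2l ltrN2 lt_atan.
  have A0 : (0 < A)%R by rewrite /A subr_gt0 atan_ltpi2.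
  have Bpi : (B < pi)%R.
    by rewrite /B ltrBlDr [ltLHS](_ : _ = pi + - (pi / 2))%R ?ltrD2l ?atan_gtNpi2//; field.
  have sn (x : R) : (A <= x <= B)%R -> (0 < sin x)%R.
    move=> /andP[Ax xB]; apply: sin_gt0_pi.
    by rewrite (lt_le_trans A0 Ax) (le_lt_trans xB Bpi).
  rewrite (_ : \int[mu]_(x in _) _ = \int[mu]_(x in `[A, B[) (w x)%:E); last first.
    rewrite integral_mkcond [RHS]integral_mkcond; apply: eq_integral => x _.
    rewrite !patchE; case: ifPn => [/set_mem|].
      rewrite /= in_itv/= => xI; rewrite indicE.
      have := cot_itv a b xI; rewrite -/A -/B => e.
      have -> : (cot x \in (`]a, b]%classic : set M)) = (x \in (`[A, B[%classic : set M)).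
        by apply/idP/idP => /set_mem; rewrite /= in_itv/= ?e -?e => ?; apply/mem_set; rewrite /= in_itv/= ?e -?e.
      by case: ifPn => _; rewrite ?mul1e ?mul0e.
    rewrite notin_setE/= in_itv/= => xI; case: ifPn => // /set_mem /=.
    rewrite in_itv/= => /andP[Ax xB]; exfalso; apply: xI.
    by rewrite (lt_le_trans A0 Ax) (lt_trans xB Bpi).
  have cw (x : R) : (A <= x <= B)%R -> {for x, continuous w}.
    move=> /sn sx; have s2 : (sin x ^+ 2 != 0)%R by rewrite expf_neq0// lt0r_neq0.
    have d := is_deriveXf 2 (is_derive_sin x).
    apply: (@is_derive_cont R w x); exact: (@is_deriveVf R (fun y : R => sin y ^+ 2)%R x _ s2 d).
  have iw : mu.-integrable `[A, B] (EFin \o w) by apply: cont_integrable.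
  rewrite integral_itv_bndo_bndc; last first.
    by apply: measurable_funTS; exact/measurable_EFinP.
  have h1 (x : R) : (A <= x <= B)%R -> is_derive x (1 : R)%R (fun x => - cot x)%R (w x).
    move=> AxB; rewrite -[w x]opprK; apply: is_deriveNf; apply: derive_cot.
    by rewrite lt0r_neq0// sn.
  have h2 := @Rintegral_FTC R w (fun x => - cot x)%R A B (ltW AB) h1 cw.
  rewrite -[LHS]fineK; last exact: integrable_fin_num.
  rewrite -[fine _]/(\int[mu]_(x in `[A, B]) w x)%R h2 !cot_tan /A /B !subKr !atanK.
  by rewrite opprK addrC.
Qed.

End Polar.

Section ProdSigmaFinite.
Local Open Scope ereal_scope.
Context d1 d2 (T1 : measurableType d1) (T2 : measurableType d2) (R : realType).
Variable m1 : {sigma_finite_measure set T1 -> \bar R}.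
Variable m2 : {sigma_finite_measure set T2 -> \bar R}.

Lemma prod_sigma_finite : sigma_finite setT (m1 \x m2).
Proof.
have /sigma_finiteP[F [TF ndF Foo]] := sigma_finiteT m1.
have /sigma_finiteP[G [TG ndG Goo]] := sigma_finiteT m2.
exists (fun n => F n `*` G n).
  apply/seteqP; split => // -[x y] _.
  have [i _ Fx] : (\bigcup_i F i) x by rewrite -TF.
  have [j _ Gy] : (\bigcup_i G i) y by rewrite -TG.
  exists (maxn i j) => //; split => /=.
    by move: x Fx; exact/subsetPset/ndF/leq_maxl.
  by move: y Gy; exact/subsetPset/ndG/leq_maxr.
move=> k; have [mF Fk] := Foo k; have [mG Gk] := Goo k.
split; first exact: measurableX.
rewrite [X in (X < _)%E](_ : _ = m1 (F k) * m2 (G k))%E; last exact: product_measure1E.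
by rewrite lte_mul_pinfty// ge0_fin_numE.
Qed.

(** The sigma-finite structure on [m1 \x m2], so that products can be iterated. *)
Definition prod_sf : {sigma_finite_measure set (T1 * T2)%type -> \bar R} :=
  HB.pack (product_measure1 m1 m2) 
    (Measure_isSigmaFinite.Build _ _ _ (product_measure1 m1 m2) prod_sigma_finite).
End ProdSigmaFinite.

Section PolarCoordinates.
Variable R : realType.
Notation mu := (@lebesgue_measure R).
Local Open Scope ereal_scope.

Lemma tonelli1 (f : R * R -> \bar R) : measurable_fun [set: R * R] f -> (forall z, 0 <= f z) ->
  \int[mu \x mu]_z f z = \int[mu]_x \int[mu]_y f (x, y).
Proof. move=> mf f0; exact: (@fubini_tonelli1 _ _ (measurableTypeR R) (measurableTypeR R) R mu mu f mf f0). Qed.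

Lemma tonelli2 (f : R * R -> \bar R) : measurable_fun [set: R * R] f -> (forall z, 0 <= f z) ->
  \int[mu \x mu]_z f z = \int[mu]_y \int[mu]_x f (x, y).
Proof. move=> mf f0; exact: (@fubini_tonelli2 _ _ (measurableTypeR R) (measurableTypeR R) R mu mu f mf f0). Qed.

Definition mu2 := @prod_sf _ _ (measurableTypeR R) (measurableTypeR R) R mu mu.

Lemma tonelli3 (f : R * R * R -> \bar R) : measurable_fun [set: R * R * R] f -> (forall z, 0 <= f z) ->
  \int[(mu \x mu) \x mu]_z f z = \int[mu]_z \int[mu \x mu]_p f (p, z).
Proof.
move=> mf f0; exact: (@fubini_tonelli2 _ _ (measurableTypeR R * measurableTypeR R)%type
  (measurableTypeR R) R mu2 mu f mf f0).
Qed.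

Definition ind_pos (x : R) : R := \1_(`]0%R, +oo[%classic : set R) x.
Definition ind_pi (x : R) : R := \1_(`]0%R, pi[%classic : set R) x.

Lemma ind_posE (x : R) : ind_pos x = if (0 < x)%R then 1%R else 0%R.
Proof.
rewrite /ind_pos indicE; case: ltP => h; first by rewrite mem_set//= in_itv/= h.
by rewrite memNset//= in_itv/= andbT; apply/negP; rewrite -leNgt.
Qed.

Lemma ind_piE (x : R) : ind_pi x = if (0 < x < pi)%R then 1%R else 0%R.
Proof.
rewrite /ind_pi indicE; case: ifPn => h; first by rewrite mem_set//= in_itv.
by rewrite memNset//= in_itv/=; exact/negP.
Qed.

Lemma ind_pos_ge0 (x : R) : (0 <= ind_pos x)%R. Proof. exact: ler0n. Qed.
Lemma ind_pi_ge0 (x : R) : (0 <= ind_pi x)%R. Proof. exact: ler0n. Qed.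

Lemma measurable_ind_pos : measurable_fun [set: R] ind_pos.
Proof. by apply: measurable_indic; exact: measurable_itv. Qed.
Lemma measurable_ind_pi : measurable_fun [set: R] ind_pi.
Proof. by apply: measurable_indic; exact: measurable_itv. Qed.

Lemma ind_pos_mul_ge0 (x : R) : (0 <= x * ind_pos x)%R.
Proof. by rewrite ind_posE; case: ltP => h; rewrite ?mulr1 ?mulr0// ltW. Qed.

(** Polar coordinates in the upper half plane: with [x = y t], [t = cot phi] and
    [y = r sin phi], the Jacobian is [y / sin^2 phi * sin phi = r]. *)
Lemma polar_half (f : R * R -> \bar R) : measurable_fun [set: R * R] f ->
  (forall z, 0 <= f z) ->
  \int[mu \x mu]_z (f z * (ind_pos z.2)%:E) =
  \int[mu \x mu]_p (f (p.1 * cos p.2, p.1 * sin p.2)%R * (p.1 * ind_pos p.1 * ind_pi p.2)%:E).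
Proof.
move=> mf f0.
have m1 : measurable_fun [set: R * R] (@fst R R) by exact: measurable_fst.
have m2 : measurable_fun [set: R * R] (@snd R R) by exact: measurable_snd.
have mI : measurable_fun [set: R * R] (fun z : R * R => ind_pos z.2).
  exact: (measurableT_comp measurable_ind_pos m2).
pose K (z : R * R) := f (z.2 * z.1, z.2)%R * (z.2 * ind_pos z.2)%:E.
have mK : measurable_fun [set: R * R] K.
  apply: emeasurable_funM.
    apply: (measurableT_comp mf); apply/measurable_fun_pairP; split => //=.
    exact: measurable_funM.
  by apply/measurable_EFinP; exact: measurable_funM.
have K0 z : 0 <= K z by apply: mule_ge0 => //; rewrite lee_fin ind_pos_mul_ge0.
have mf1 (y : R) : measurable_fun [set: R] (fun x : R => f (x, y)).
  by apply: (measurableT_comp mf); exact: measurable_pair2.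
rewrite tonelli2; last 2 first.
- by apply: emeasurable_funM => //; exact/measurable_EFinP.
- by move=> z; apply: mule_ge0 => //; rewrite lee_fin ind_pos_ge0.
transitivity (\int[mu]_y \int[mu]_t K (t, y)).
  apply: eq_integral => y _; rewrite /K /= ind_posE.
  case: ltP => y0; last by rewrite !integral0_eq// => x _; rewrite ?mulr0 mule0.
  rewrite (integral_scale y0); last 2 first.
  - by apply: emeasurable_funM => //; exact: measurable_cst.
  - by move=> x; apply: mule_ge0.
  rewrite -ge0_integralZl//; last 3 first.
  - apply: emeasurable_funM; last exact: measurable_cst.
    by apply: (measurableT_comp (mf1 y)); exact: mulrl_measurable.
  - by move=> x _; apply: mule_ge0.
  - by rewrite lee_fin ltW.
  by apply: eq_integral => x _; rewrite mule1 mulr1 muleC.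
rewrite -(tonelli2 mK K0) (tonelli1 mK K0).
rewrite (@integral_cot R (fun t => \int[mu]_y K (t, y))); last 2 first.
- exact: (@measurable_fun_fubini_tonelli_F _ _ (measurableTypeR R) (measurableTypeR R) R mu K mK K0).
- by move=> x; apply: integral_ge0.
rewrite [RHS]tonelli2; last 2 first.
- apply: emeasurable_funM.
    apply: (measurableT_comp mf); apply/measurable_fun_pairP; split => /=.
      by apply: measurable_funM => //; apply: (measurableT_comp _ m2); exact: measurable_cos.
    by apply: measurable_funM => //; apply: (measurableT_comp _ m2); exact: measurable_sin.
  apply/measurable_EFinP; apply: measurable_funM.
    by apply: measurable_funM => //; exact: (measurableT_comp measurable_ind_pos m1).
  exact: (measurableT_comp measurable_ind_pi m2).
- by move=> z; apply: mule_ge0 => //; rewrite lee_fin mulr_ge0 ?ind_pos_mul_ge0 ?ind_pi_ge0.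
rewrite integral_mkcond; apply: eq_integral => a _; rewrite patchE.
case: ifPn => [/set_mem|]; last first.
  rewrite notin_setE/= in_itv/= => /negP aI.
  rewrite integral0_eq// => r _; rewrite /= ind_piE (negbTE aI) mulr0 mule0//.
rewrite /= in_itv/= => aI; have s0 : (0 < sin a)%R by exact: sin_gt0_pi.
rewrite (integral_scale s0); last 2 first.
- by apply: (measurableT_comp mK); exact: measurable_pair1.
- by move=> x; exact: K0.
pose L (r : R) := f (r * cos a, r * sin a)%R * (r * ind_pos r)%:E.
have mL : measurable_fun [set: R] L.
  apply: emeasurable_funM.
    apply: (measurableT_comp mf); apply/measurable_fun_pairP.
    by split => /=; exact: mulrr_measurable.
  by apply/measurable_EFinP; apply: measurable_funM => //; exact: measurable_ind_pos.
have L0 r : 0 <= L r by apply: mule_ge0 => //; rewrite lee_fin ind_pos_mul_ge0.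
have KL (r : R) : K (cot a, (sin a * r)%R) = (sin a)%:E * L r.
  rewrite /K /L /= !ind_posE pmulr_rgt0//.
  have -> : (sin a * r * cot a = r * cos a)%R by rewrite /cot; field; rewrite lt0r_neq0.
  rewrite [(sin a * r)%R]mulrC; case: ltP => _; last by rewrite !mulr0 !mule0.
  by rewrite !mulr1 EFinM [r%:E * _]muleC muleCA.
under eq_integral do rewrite KL.
rewrite ge0_integralZl//; last by rewrite lee_fin ltW.
rewrite muleA -EFinM muleAC -EFinM.
have -> : (sin a * sin a * sin a ^- 2 = 1)%R by field; rewrite lt0r_neq0.
rewrite mul1e; apply: eq_integral => r _.
by rewrite /L /= ind_piE aI mulr1.
Qed.

Lemma integral_even (g : R -> \bar R) : measurable_fun [set: R] g -> (forall x, 0 <= g x) ->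
  (forall x, g (- x)%R = g x) -> \int[mu]_x g x = 2%:E * \int[mu]_x (g x * (ind_pos x)%:E).
Proof.
move=> mg g0 ge.
have -> : \int[mu]_x (g x * (ind_pos x)%:E) = \int[mu]_(x in `[0%R, +oo[) g x.
  rewrite -integral_itv_obnd_cbnd; last exact: measurable_funTS.
  rewrite [RHS]integral_mkcond; apply: eq_integral => x _.
  rewrite patchE ind_posE; case: ltP => x0.
    by rewrite mem_set ?mule1//= in_itv/= x0.
  by rewrite memNset ?mule0//= in_itv/= andbT; apply/negP; rewrite -leNgt.
have h := @ge0_integration_by_substitution0 R g mg g0.
have e2 : \int[mu]_(x in `]-oo, 0%R]) g (- x)%R = \int[mu]_(x in `]-oo, 0%R]) g x.
  by apply: eq_integral => x _; rewrite ge.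
rewrite e2 in h.
have -> : \int[mu]_x g x = \int[mu]_(x in `]-oo, 0%R[ `|` `[0%R, +oo[) g x.
  congr (integral _ _ _); apply/seteqP; split => x //= _.
  by rewrite !in_itv/= andbT; case: ltP => _; [left|right].
rewrite ge0_integral_setU//; last 2 first.
- exact: measurable_funTS mg.
- apply/disj_setPS => x [] /=; rewrite !in_itv/= andbT => x0.
  by rewrite leNgt x0.
rewrite integral_itv_bndo_bndc; last exact: measurable_funTS.
by rewrite -h -[2%:E]/((1 + 1)%:E) EFinD ge0_muleDl ?mul1e.
Qed.

Definition spherical (q : R * R * R) : R * R * R :=
  ((q.1.1 * sin q.1.2 * cos q.2)%R, (q.1.1 * sin q.1.2 * sin q.2)%R, (q.1.1 * cos q.1.2)%R).

(** The azimuth runs over a half turn only, hence the factor [2]: the integrands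
    are even in the second coordinate. *)
Definition sph_jac (q : R * R * R) : R :=
  (2 * (q.1.1 ^+ 2 * ind_pos q.1.1) * (sin q.1.2 * ind_pi q.1.2) * ind_pi q.2)%R.

Lemma sin_ind_ge0 (x : R) : (0 <= sin x * ind_pi x)%R.
Proof. by rewrite ind_piE; case: ifPn => h; rewrite ?mulr0// mulr1 ltW// sin_gt0_pi. Qed.

Lemma sph_jac_ge0 q : (0 <= sph_jac q)%R.
Proof.
apply: mulr_ge0; last exact: ind_pi_ge0.
apply: mulr_ge0; last exact: sin_ind_ge0.
by apply: mulr_ge0 => //; apply: mulr_ge0; [exact: sqr_ge0|exact: ind_pos_ge0].
Qed.

Let c1 : measurable_fun [set: R * R * R] (fun q : R * R * R => q.1.1).
Proof. exact: (measurableT_comp measurable_fst measurable_fst). Qed.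
Let c2 : measurable_fun [set: R * R * R] (fun q : R * R * R => q.1.2).
Proof. exact: (measurableT_comp measurable_snd measurable_fst). Qed.
Let c3 : measurable_fun [set: R * R * R] (fun q : R * R * R => q.2).
Proof. exact: measurable_snd. Qed.

Lemma measurable_spherical : measurable_fun [set: R * R * R] spherical.
Proof.
have s2 : measurable_fun setT (fun q : R * R * R => sin q.1.2).
  exact: (measurableT_comp (@measurable_sin R) c2).
have d2 : measurable_fun setT (fun q : R * R * R => cos q.1.2).
  exact: (measurableT_comp (@measurable_cos R) c2).
have s3 : measurable_fun setT (fun q : R * R * R => sin q.2).
  exact: (measurableT_comp (@measurable_sin R) c3).
have d3 : measurable_fun setT (fun q : R * R * R => cos q.2).
  exact: (measurableT_comp (@measurable_cos R) c3).
apply/measurable_fun_pairP; split => /=; last exact: measurable_funM.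
apply/measurable_fun_pairP; split => /=.
  by apply: measurable_funM => //; exact: measurable_funM.
by apply: measurable_funM => //; exact: measurable_funM.
Qed.

Lemma measurable_sph_jac : measurable_fun [set: R * R * R] sph_jac.
Proof.
apply: measurable_funM; last exact: (measurableT_comp measurable_ind_pi c3).
apply: measurable_funM.
  apply: measurable_funM; first exact: measurable_cst.
  apply: measurable_funM; first exact: measurable_funX.
  exact: (measurableT_comp measurable_ind_pos c1).
apply: measurable_funM; first exact: (measurableT_comp (@measurable_sin R) c2).
exact: (measurableT_comp measurable_ind_pi c2).
Qed.

(** Spherical coordinates, by polar coordinates in the plane [(x, y)] and then
    in the half plane [(z, r)], for functions even in [y]. *)
Lemma spherical_coordinates (F : R * R * R -> \bar R) :
  measurable_fun [set: R * R * R] F -> (forall y, 0 <= F y) ->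
  (forall x y z, F (x, (- y)%R, z) = F (x, y, z)) ->
  \int[(mu \x mu) \x mu]_y F y =
  \int[(mu \x mu) \x mu]_q (F (spherical q) * (sph_jac q)%:E).
Proof.
move=> mF F0 Fe.
have m1 : measurable_fun [set: R * R] (@fst R R) by exact: measurable_fst.
have m2 : measurable_fun [set: R * R] (@snd R R) by exact: measurable_snd.
have mFz (z : R) : measurable_fun [set: R * R] (fun p : R * R => F (p, z)).
  by apply: (measurableT_comp mF); exact: measurable_pair2.
pose w (p : R * R) : R := (p.1 * ind_pos p.1 * ind_pi p.2)%R.
have w0 p : (0 <= w p)%R by rewrite /w mulr_ge0 ?ind_pos_mul_ge0 ?ind_pi_ge0.
have mw : measurable_fun [set: R * R] w.
  apply: measurable_funM; last exact: (measurableT_comp measurable_ind_pi m2).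
  by apply: measurable_funM => //; exact: (measurableT_comp measurable_ind_pos m1).
pose G (t : R * R * R) := 2%:E * (F (t.1.1 * cos t.1.2, t.1.1 * sin t.1.2, t.2)%R * (w t.1)%:E).
have mG : measurable_fun [set: R * R * R] G.
  apply: measurable_funeM; apply: emeasurable_funM; last first.
    by apply/measurable_EFinP; exact: (measurableT_comp mw measurable_fst).
  apply: (measurableT_comp mF); apply/measurable_fun_pairP; split => //=.
  apply/measurable_fun_pairP; split => /=.
    by apply: measurable_funM => //; exact: (measurableT_comp (@measurable_cos R) c2).
  by apply: measurable_funM => //; exact: (measurableT_comp (@measurable_sin R) c2).
have G0 t : 0 <= G t by rewrite /G mule_ge0// mule_ge0// lee_fin.
transitivity (\int[(mu \x mu) \x mu]_t G t).
  rewrite (tonelli3 mF F0) (tonelli3 mG G0).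
  apply: eq_integral => z _; rewrite /G /=.
  rewrite ge0_integralZl//=; last 2 first.
  - apply: emeasurable_funM; last exact/measurable_EFinP.
    apply: (measurableT_comp (mFz z)); apply/measurable_fun_pairP; split => /=.
      by apply: measurable_funM => //; exact: (measurableT_comp (@measurable_cos R) m2).
    by apply: measurable_funM => //; exact: (measurableT_comp (@measurable_sin R) m2).
  - by move=> p _; rewrite mule_ge0// lee_fin.
  rewrite -(polar_half (f := fun p => F (p, z)))//.
  have Fz0 p : 0 <= F (p, z) by [].
  rewrite (tonelli2 (mFz z) Fz0).
  have mg : measurable_fun [set: R] (fun y : R => \int[mu]_x F (x, y, z)).
    exact: (@measurable_fun_fubini_tonelli_G _ _ (measurableTypeR R) (measurableTypeR R) R mu _ (mFz z) Fz0).
  rewrite (integral_even mg); last 2 first.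
  - by move=> y; apply: integral_ge0.
  - by move=> y; apply: eq_integral => x _; rewrite Fe.
  congr (_ * _); rewrite [RHS]tonelli2; last 2 first.
  - by apply: emeasurable_funM => //; apply/measurable_EFinP; exact: (measurableT_comp measurable_ind_pos m2).
  - by move=> p; rewrite mule_ge0// lee_fin ind_pos_ge0.
  apply: eq_integral => y _; rewrite /= ge0_integralZr//.
  - by apply: (measurableT_comp (mFz z)); exact: measurable_pair2.
  - by rewrite lee_fin ind_pos_ge0.
pose H (t : R * R * R) := G (t.1.2, t.2, t.1.1).
have mH : measurable_fun [set: R * R * R] H.
  apply: (measurableT_comp mG); apply/measurable_fun_pairP; split => //=.
  by apply/measurable_fun_pairP; split => /=.
have mGr (p : R * R) : measurable_fun [set: R] (fun r : R => G (r, p.1, p.2)).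
  apply: (measurableT_comp mG); apply/measurable_fun_pairP; split; last exact: measurable_cst.
  by apply/measurable_fun_pairP; split; [exact: measurable_id|exact: measurable_cst].
(* the axial coordinate has to be paired with the planar radius *)
have swap : \int[(mu \x mu) \x mu]_t G t = \int[(mu \x mu) \x mu]_t H t.
  have H0 t : 0 <= H t by exact: G0.
  rewrite (tonelli3 mG G0) (tonelli3 mH H0).
  have i1 (z : R) : \int[mu \x mu]_p G (p, z) = \int[mu]_a \int[mu]_r G (r, a, z).
    rewrite tonelli2//.
    by apply: (measurableT_comp mG); exact: measurable_pair2.
  have i2 (a : R) : \int[mu \x mu]_p H (p, a) = \int[mu]_z \int[mu]_r G (r, a, z).
    rewrite tonelli1//.
    by apply: (measurableT_comp mH); exact: measurable_pair2.
  under eq_integral do rewrite i1.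
  under [RHS]eq_integral do rewrite i2.
  pose k (p : R * R) := \int[mu]_r G (r, p.1, p.2).
  have mk : measurable_fun [set: R * R] k.
    pose G' (t : R * (R * R)) := G (t.1, t.2.1, t.2.2).
    have mG' : measurable_fun [set: R * (R * R)] G'.
      apply: (measurableT_comp mG); apply/measurable_fun_pairP; split => /=.
        apply/measurable_fun_pairP; split; first exact: measurable_fst.
        exact: (measurableT_comp m1 measurable_snd).
      exact: (measurableT_comp m2 measurable_snd).
    apply: (@measurable_fun_fubini_tonelli_G _ _ (measurableTypeR R) (measurableTypeR R * measurableTypeR R)%type R mu G' mG').
    by move=> t; exact: G0.
  have k0 p : 0 <= k p by apply: integral_ge0.
  exact: (etrans (esym (tonelli2 mk k0)) (tonelli1 mk k0)).
have H0 t : 0 <= H t by exact: G0.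
rewrite swap (tonelli3 mH H0) [RHS]tonelli3; last 2 first.
- apply: emeasurable_funM; first exact: (measurableT_comp mF measurable_spherical).
  by apply/measurable_EFinP; exact: measurable_sph_jac.
- by move=> q; rewrite mule_ge0// lee_fin sph_jac_ge0.
apply: eq_integral => a _.
pose f (p : R * R) := 2%:E * (F (p.2 * cos a, p.2 * sin a, p.1)%R * (p.2 * ind_pos p.2 * ind_pi a)%:E).
have f0 p : 0 <= f p.
  by rewrite /f mule_ge0// mule_ge0// lee_fin mulr_ge0 ?ind_pos_mul_ge0 ?ind_pi_ge0.
have mf : measurable_fun [set: R * R] f.
  apply: measurable_funeM; apply: emeasurable_funM.
    apply: (measurableT_comp mF); apply/measurable_fun_pairP; split => //=.
    apply/measurable_fun_pairP; split => /=.
      by apply: measurable_funM => //; exact: measurable_cst.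
    by apply: measurable_funM => //; exact: measurable_cst.
  apply/measurable_EFinP; apply: measurable_funM; last exact: measurable_cst.
  by apply: measurable_funM => //; exact: (measurableT_comp measurable_ind_pos m2).
transitivity (\int[mu \x mu]_p (f p * (ind_pos p.2)%:E)).
  apply: eq_integral => -[z r] _; rewrite /H /G /f /w /= ind_posE.
  by case: ltP => _; rewrite ?mule1// !mulr0 !mul0r !mule0.
rewrite polar_half//; apply: eq_integral => -[r t] _.
rewrite /f /spherical /sph_jac /=.
rewrite !ind_posE !ind_piE.
have [r0|_] := boolP (0 < r)%R; last by rewrite !(mulr0, mul0r) !mule0.
have [tI|_] := boolP (0 < t < pi)%R; last by rewrite !(mulr0, mul0r) !mule0.
have st : (0 < r * sin t)%R by rewrite mulr_gt0// sin_gt0_pi.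
rewrite st -muleA -muleA -EFinM muleCA -EFinM; congr (_ * _%:E); ring.
Qed.

End PolarCoordinates.

(** * Integrals over polar angles *)
Section Theta.
Variable R : realType.
Notation mu := (@lebesgue_measure R).
Notation P := (@legendre R).
Implicit Types (p q : {poly R}) (f h : R -> R) (x t a b : R).

Lemma Rintegral_bound d (T : measurableType d) (m : {measure set T -> \bar R})
    (D : set T) (g : T -> R) (M : R) : measurable D -> (m D < +oo)%E ->
  m.-integrable D (EFin \o g) -> (forall z : T, D z -> `|g z| <= M) ->
  `|\int[m]_(z in D) g z| <= M * fine (m D).
Proof.
move=> mD Doo ig gM; apply: le_trans (le_normr_Rintegral mD ig) _.
rewrite -Rintegral_cst//; apply: le_Rintegral => //.
- by apply: integrable_norm.
- apply: (bounded_integrable (M := `|M|)) => // x _; exact: lexx.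
Qed.

Lemma fubini_lebesgue (D E : set R) (g : R * R -> R) : measurable D -> measurable E ->
  (mu \x mu)%E.-integrable (D `*` E) (EFin \o g) ->
  mu.-integrable D (EFin \o (fun x => \int[mu]_(y in E) g (x, y))) /\
  \int[mu]_(x in D) \int[mu]_(y in E) g (x, y) = \int[(mu \x mu)%E]_(z in D `*` E) g z.
Proof.
by move=> mD mE ig; exact: (@Rintegral_fubini12 _ _ (measurableTypeR R) (measurableTypeR R) R mu mu D E g mD mE ig).
Qed.

Lemma swap_lebesgue (D E : set R) (g : R * R -> R) : measurable D -> measurable E ->
  (mu \x mu)%E.-integrable (D `*` E) (EFin \o g) ->
  \int[mu]_(x in D) \int[mu]_(y in E) g (x, y) = \int[mu]_(y in E) \int[mu]_(x in D) g (x, y).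
Proof.
by move=> mD mE ig; exact: (@Rintegral_swap _ _ (measurableTypeR R) (measurableTypeR R) R mu mu D E g mD mE ig).
Qed.

Lemma mu_itv a b : a <= b -> mu `[a, b]%classic = (b - a)%:E.
Proof.
move=> ab; rewrite lebesgue_measure_itv/= lte_fin; case: ltP => //= ba.
by rewrite (@le_anti _ _ a b) ?ab ?subrr.
Qed.

Lemma mu_itv_oo a b : (mu `[a, b]%classic < +oo)%E.
Proof. by rewrite lebesgue_measure_itv/=; case: ifP => _; rewrite ltry. Qed.

Lemma Rintegral_itv_bound f (M : R) a b : a <= b -> mu.-integrable `[a, b] (EFin \o f) ->
  (forall x, a <= x <= b -> `|f x| <= M) -> `|\int[mu]_(x in `[a, b]) f x| <= M * (b - a).
Proof.
move=> ab fi fM.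
have fM' (x : R) : `[a, b]%classic x -> `|f x| <= M by rewrite /= in_itv; exact: fM.
have := @Rintegral_bound _ (measurableTypeR R) mu `[a, b] f M (measurable_itv _) (mu_itv_oo a b) fi fM'.
move=> h; apply: le_trans h _; rewrite (_ : fine _ = b - a)//.
by have := mu_itv ab => /= ->.
Qed.

Lemma is_derive_horner_cos p t :
  is_derive t 1 (fun t => p.[cos t]) (- (p^`().[cos t] * sin t)).
Proof.
have := is_derive_compf (is_derive_poly p (cos t)) (is_derive_cos t).
by rewrite mulrN.
Qed.

Lemma cont_horner_cos p : continuous (fun t => p.[cos t]).
Proof. by move=> t; exact: (is_derive_cont (is_derive_horner_cos p t)). Qed.

Lemma cont_theta p : continuous (fun t => p.[cos t] * sin t).
Proof. by move=> t; apply: cvgM; [exact: cont_horner_cos|exact: continuous_sin]. Qed.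

Lemma Rintegral_theta_poly p : \int[mu]_(t in `[0, pi]) (p.[cos t] * sin t) = pint p.
Proof.
have -> : pint p = (fun t => - (prim p).[cos t]) pi - (fun t => - (prim p).[cos t]) 0.
  by rewrite cospi cos0 /pint opprK addrC.
apply: (@Rintegral_FTC R _ (fun t => - (prim p).[cos t])); first exact: pi_ge0.
- move=> t _; have := is_deriveNf (is_derive_horner_cos (prim p) t).
  by rewrite opprK deriv_prim.
- by move=> t _; exact: cont_theta.
Qed.

(** The substitution [x = cos t]. *)
Lemma Rintegral_theta h : {within `[-1, 1], continuous h} ->
  \int[mu]_(t in `[0, pi]) (h (cos t) * sin t) = \int[mu]_(x in `[-1, 1]) h x.
Proof.
move=> ch; rewrite /Rintegral; congr fine.
have dcos : derive1 (@cos R) = (fun x : R => - sin x).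
  by apply/funext => y; rewrite derive1E; have [_ ->] := is_derive_cos y.
have csin (z : R) : (fun x : R => - sin x) @ z --> - sin z by apply: cvgN; exact: continuous_sin.
have := @integration_by_substitution_decreasing R cos h 0 pi (pi_ge0 R).
rewrite cos0 cospi dcos => ->//.
- by apply: eq_integral => t _ /=; rewrite opprK.
- by move=> x y xI yI yx; rewrite ltr_cos.
- by move=> x _; exact: csin.
- by apply/cvg_ex; exists (- sin 0); apply: cvg_at_right_filter; exact: csin.
- by apply/cvg_ex; exists (- sin pi); apply: cvg_at_left_filter; exact: csin.
- split => [x _||]; first exact: derivable_cos.
  + by apply: cvg_at_right_filter; exact: continuous_cos.
  + by apply: cvg_at_left_filter; exact: continuous_cos.
Qed.

Definition cosmom (j : nat) : R := \int[mu]_(t in `[0, pi]) (cos t ^+ j).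

Lemma cont_cosX j : continuous (fun t : R => cos t ^+ j).
Proof. by move=> t; exact: (is_derive_cont (is_deriveXf j (is_derive_cos t))). Qed.

Lemma cosmom0 : cosmom 0 = pi.
Proof.
rewrite /cosmom (@Rintegral_FTC R (fun t => cos t ^+ 0) id 0 pi (pi_ge0 R)) ?subr0//.
by move=> x _; exact: cont_cosX.
Qed.

Lemma cosmom1 : cosmom 1 = 0.
Proof.
transitivity (sin pi - sin 0 : R); last by rewrite sinpi sin0 subrr.
apply: (@Rintegral_FTC R (fun t => cos t ^+ 1) sin); first exact: pi_ge0.
by move=> x _; exact: cont_cosX.
Qed.

Lemma cosmom_rec j : j.+2%:R * cosmom j.+2 = j.+1%:R * cosmom j.
Proof.
apply/eqP; rewrite -subr_eq0; apply/eqP.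
have int k : mu.-integrable `[0, pi] (EFin \o (fun t => cos t ^+ k)).
  by apply: cont_integrable => x _; exact: cont_cosX.
have intZ c k : mu.-integrable `[0, pi] (EFin \o (fun t => c * cos t ^+ k)).
  by apply: cont_integrable => x _; apply: cvgM; [exact: cvg_cst|exact: cont_cosX].
rewrite /cosmom -!RintegralZl// -RintegralB//.
transitivity (sin pi * cos pi ^+ j.+1 - sin 0 * cos 0 ^+ j.+1 : R); last first.
  by rewrite sinpi sin0 !mul0r subrr.
apply: (@Rintegral_FTC R _ (fun t => sin t * cos t ^+ j.+1)); first exact: pi_ge0.
- move=> x _; have h := is_deriveMf (is_derive_sin x) (is_deriveXf j.+1 (is_derive_cos x)).
  apply: (is_derive_eq h) => /=; have := sin2cos2 x; rewrite expr2.
  rewrite -[j.+2%:R]natr1 !exprS expr0; move: (cos x) (sin x) (cos x ^+ j) => c s z e.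
  have -> : s * (j.+1%:R * z * - s) = - (j.+1%:R * z * (s * s)) by ring.
  by rewrite e; ring.
- move=> x _; apply: cvgB; (apply: cvgM; [exact: cvg_cst|exact: cont_cosX]).
Qed.

Lemma cosmom_odd i : cosmom i.*2.+1 = 0.
Proof.
elim: i => [|i IH]; first exact: cosmom1.
have := cosmom_rec i.*2.+1; rewrite IH mulr0 doubleS => /eqP.
by rewrite mulf_eq0 pnatr_eq0/= => /eqP.
Qed.

Lemma cosmom_even i : cosmom i.*2 = pi * (avgc R i * (i.*2)`!%:R).
Proof.
elim: i => [|i IH]; first by rewrite cosmom0 /avgc fact0 expr0 expr1n !mulr1 invr1 mulr1.
have := cosmom_rec i.*2; rewrite IH -avgcS doubleS !factS !natrM.
have h1 : i.*2.+2%:R = 2 * i.+1%:R :> R by rewrite -natrM; congr (_%:R); lia.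
have h0 : i.*2.+2%:R != 0 :> R by rewrite pnatr_eq0.
by move=> e; apply: (mulfI h0); rewrite e h1; ring.
Qed.

Lemma sum_double (F : nat -> R) n :
  \sum_(j < n.*2) F j = \sum_(i < n) (F i.*2 + F i.*2.+1).
Proof.
elim: n => [|n IH]; first by rewrite !big_ord0.
by rewrite doubleS !big_ord_recr/= IH addrA.
Qed.

(** In Taylor's formula about [a b] the odd moments of the cosine vanish and the
    even ones are the coefficients [avgc]. *)
Lemma Rintegral_avgpoly p a b (c d : R) : c ^+ 2 = 1 - a ^+ 2 -> d ^+ 2 = 1 - b ^+ 2 ->
  \int[mu]_(t in `[0, pi]) p.[a * b + c * d * cos t] = pi * (avgpoly b p).[a].
Proof.
move=> hc hd; set n := size p.
have sn : (size p <= n.*2)%N by rewrite -addnn leq_addr.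
have e t : p.[a * b + c * d * cos t] =
    \sum_(j <- index_iota 0 n.*2) (p^`N(j)).[a * b] * (c * d) ^+ j * cos t ^+ j.
  rewrite (nderiv_taylor_wide (mulrC _ _) sn).
  rewrite big_mkord; apply: eq_bigr => j _; rewrite exprMn; ring.
under eq_Rintegral do rewrite e.
rewrite Rintegral_sum; last first.
  by move=> j; apply: cont_integrable => x _; apply: cvgM; [exact: cvg_cst|exact: cont_cosX].
transitivity (\sum_(j < n.*2) (p^`N(j)).[a * b] * (c * d) ^+ j * cosmom j).
  rewrite big_mkord; apply: eq_bigr => j _; rewrite RintegralZl//.
  by apply: cont_integrable => x _; exact: cont_cosX.
rewrite (sum_double (fun j => (p^`N(j)).[a * b] * (c * d) ^+ j * cosmom j)).
rewrite /avgpoly horner_sum mulr_sumr; apply: eq_bigr => i _.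
rewrite cosmom_odd mulr0 addr0 cosmom_even hornerZ hornerM horner_comp hornerZ hornerX.
rewrite horner_exp hornerD hornerN hornerXn (hornerC 1).
have -> : (c * d) ^+ i.*2 = (1 - a ^+ 2) ^+ i * (1 - b ^+ 2) ^+ i.
  by rewrite -mul2n exprM (exprMn 2 c d) hc hd exprMn.
by rewrite [b * a]mulrC nderivn_def hornerMn -mulr_natr; ring.
Qed.

Lemma zonal_le1 (s t k : R) : `|k| <= 1 -> -1 <= cos s * cos t + sin s * sin t * k <= 1.
Proof.
move=> k1; rewrite -ler_norml.
have h : `|sin s * sin t * k| <= `|sin s * sin t|.
  by rewrite normrM ler_piMr.
apply: le_trans (ler_normD _ _) _.
have h1 := cos2Dsin2 s; have h2 := cos2Dsin2 t.
have a1 : `|cos s * cos t| <= (cos s ^+ 2 + cos t ^+ 2) / 2.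
  rewrite ler_norml; have := sqr_ge0 (cos s - cos t); have := sqr_ge0 (cos s + cos t).
  by move=> p1 p2; apply/andP; split; nra.
have a2 : `|sin s * sin t| <= (sin s ^+ 2 + sin t ^+ 2) / 2.
  rewrite ler_norml; have := sqr_ge0 (sin s - sin t); have := sqr_ge0 (sin s + sin t).
  by move=> p1 p2; apply/andP; split; nra.
move: h a1 a2; lra.
Qed.

(** At a maximum [c] of [|P_n|] the product formula writes [P_n(c)^2] as a mean
    of values of [P_n]. *)
Lemma legendre_le1 n x : -1 <= x <= 1 -> `|(P n).[x]| <= 1.
Proof.
have cw : {within `[-1, 1], continuous (fun x => `|(P n).[x]|)}.
  apply: cont_within => y _; apply: cvg_norm; exact: continuous_horner.
have [c c11 hc] : exists2 c : R, -1 <= c <= 1 & forall y : R, -1 <= y <= 1 -> `|(P n).[y]| <= `|(P n).[c]|.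
  have [|c] := EVT_max _ cw; first by lra.
  by rewrite in_itv/= => c11 hc; exists c => // y y11; apply: hc; rewrite in_itv.
set M := `|(P n).[c]| in hc.
move=> x11; apply: le_trans (hc x x11) _.
have s0 : 0 <= 1 - c ^+ 2.
  by case/andP: c11 => c1 c2; nra.
have := Rintegral_avgpoly (P n) (a := c) (b := c) (sqr_sqrtr s0) (sqr_sqrtr s0).
rewrite avgpoly_legendre hornerZ -expr2 => e.
have M2 : pi * M ^+ 2 <= M * pi.
  rewrite /M real_normK ?num_real// -e -[leRHS]/(M * pi) -[X in _ <= _ * X](subr0 pi).
  apply: le_trans (ler_norm _) _.
  have ct : continuous (fun t : R => (P n).[c * c + Num.sqrt (1 - c ^+ 2) * Num.sqrt (1 - c ^+ 2) * cos t]).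
    move=> t; apply: (@continuous_comp _ _ _ _ (horner (P n)) t); last exact: continuous_horner.
    apply: cvgD; first exact: cvg_cst.
    by apply: cvgM; [exact: cvg_cst|exact: continuous_cos].
  apply: Rintegral_itv_bound; rewrite ?pi_ge0//.
    by apply: cont_integrable => t _; exact: ct.
  move=> t _; apply: hc; rewrite -[X in _ + X * _]expr2 (sqr_sqrtr s0).
  have := cos_geN1 t; have := cos_le1 t; move: (cos t) => k k1 k2.
  by apply/andP; split; nra.
have M0 : 0 <= M by rewrite /M.
have pi0 := pi_gt0 R; move: M2; rewrite [pi * _]mulrC ler_pM2r// expr2 => M2.
by rewrite leNgt; apply/negP => M1; nra.
Qed.

Lemma legendre_cos_le1 n t : `|(P n).[cos t]| <= 1.
Proof. by apply: legendre_le1; rewrite cos_geN1 cos_le1. Qed.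

Lemma sin_abs_le1 t : `|sin t| <= 1.
Proof. exact: sin_max. Qed.

Lemma pint_avgpoly b n p : pint (avgpoly b p * P n) = (P n).[b] * pint (p * P n).
Proof.
have [c ->] := legendre_span p.
rewrite linear_sum/= !mulr_suml !linear_sum/= mulr_sumr; apply: eq_bigr => m _.
have -> : avgpoly b (c m *: P m) = c m *: avgpoly b (P m) by exact: linearZ.
have pZ k q : pint (k *: q) = k * pint q by exact: linearZ.
rewrite avgpoly_legendre -!(scalerAl (c m)) -(scalerAl (P m).[b]) (pZ (c m)) (pZ ((P m).[b])) (pZ (c m)).
have [->|mn] := eqVneq (m : nat) n; first by ring.
by rewrite (legendre_orth2 _ mn) !mulr0.
Qed.

Lemma cont_bounded f : continuous f -> exists2 M, 0 <= M & forall x, -1 <= x <= 1 -> `|f x| <= M.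
Proof.
move=> cf; have cw : {within `[-1, 1], continuous (fun x => `|f x|)}.
  by apply: cont_within => y _; apply: cvg_norm; exact: cf.
have [|c _ hc] := EVT_max _ cw; first by lra.
by exists `|f c| => // x x11; apply: hc; rewrite in_itv.
Qed.

Section ZonalAverage.
Variables (n : nat) (t' : R).
Let Q : set (R * R) := `[0, pi]%classic `*` `[0, pi]%classic.
Let G f (z : R * R) : R :=
  f (cos z.2 * cos t' + sin z.2 * sin t' * cos z.1) * (P n).[cos z.2] * sin z.2.
Let A f : R := \int[mu]_(s in `[0, pi]) \int[mu]_(t in `[0, pi]) G f (s, t).
Let B f : R := pi * (P n).[cos t'] * \int[mu]_(t in `[0, pi]) (f (cos t) * (P n).[cos t] * sin t).

Local Lemma G_bound f M : (forall x, -1 <= x <= 1 -> `|f x| <= M) -> forall z, `|G f z| <= M.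
Proof.
move=> fM [s t]; rewrite /G/= !normrM.
have M0 : 0 <= M by apply: le_trans (fM 1 _); rewrite ?lexx ?andbT//; lra.
rewrite -[leRHS]mulr1 ler_pM ?mulr_ge0 ?sin_abs_le1// -[leRHS]mulr1.
rewrite ler_pM ?legendre_cos_le1// fM//.
by apply: zonal_le1; exact: cos_max.
Qed.

Local Lemma G_meas f : continuous f -> measurable_fun setT (G f).
Proof.
move=> cf.
have m1 : measurable_fun setT (fun z : R * R => cos z.1).
  by apply: measurableT_comp => //; exact: measurable_cos.
have m2 : measurable_fun setT (fun z : R * R => cos z.2).
  by apply: measurableT_comp => //; exact: measurable_cos.
have m3 : measurable_fun setT (fun z : R * R => sin z.2).
  by apply: measurableT_comp => //; exact: measurable_sin.
apply: measurable_funM => //; apply: measurable_funM.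
  apply: (measurableT_comp (continuous_measurable_fun cf)).
  apply: measurable_funD; first exact: measurable_funM.
  by apply: measurable_funM => //; apply: measurable_funM.
apply: (measurableT_comp _ m2).
by apply: continuous_measurable_fun; exact: continuous_horner.
Qed.

Lemma zonal_integrable f : continuous f -> (mu \x mu)%E.-integrable Q (EFin \o G f).
Proof.
move=> cf; have [M M0 fM] := cont_bounded cf.
apply: (bounded_integrable2 (M := M)); rewrite ?mu_itv_oo//.
  by apply: measurable_funTS; exact: G_meas.
by move=> x y _ _; exact: G_bound.
Qed.

Local Lemma AE f : continuous f -> A f = \int[(mu \x mu)%E]_(z in Q) G f z.
Proof.
move=> cf; rewrite /A.
by have [_ ->] := fubini_lebesgue (measurable_itv `[0, pi]) (measurable_itv `[0, pi]) (zonal_integrable cf).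
Qed.

Local Lemma B_int f : continuous f ->
  mu.-integrable `[0, pi] (EFin \o (fun t => f (cos t) * (P n).[cos t] * sin t)).
Proof.
move=> cf; apply: cont_integrable => t _; apply: cvgM; last exact: continuous_sin.
apply: cvgM; last exact: cont_horner_cos.
by apply: continuous_comp; [exact: continuous_cos|exact: cf].
Qed.

(** For polynomials this is the product formula integrated against [P_n]. *)
Local Lemma A_poly p : A (horner p) = B (horner p).
Proof.
have cp : continuous (horner p) by exact: continuous_horner.
rewrite /A (swap_lebesgue (measurable_itv `[0, pi]) (measurable_itv `[0, pi]) (zonal_integrable cp)).
rewrite /B -mulrA -[X in pi * X](_ : pint (avgpoly (cos t') p * P n) = _); last first.
  rewrite pint_avgpoly -Rintegral_theta_poly; congr (_ * _).
  by apply: eq_Rintegral => t _; rewrite hornerM.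
rewrite -Rintegral_theta_poly -RintegralZl//; last first.
  by apply: cont_integrable => t _; exact: cont_theta.
apply: eq_Rintegral => t _; rewrite hornerM /G/=.
under eq_Rintegral do rewrite -mulrA.
rewrite RintegralZr//; last first.
  apply: cont_integrable => s _; apply: continuous_comp; last exact: continuous_horner.
  apply: cvgD; first exact: cvg_cst.
  by apply: cvgM; [exact: cvg_cst|exact: continuous_cos].
rewrite (@Rintegral_avgpoly p (cos t) (cos t') (sin t) (sin t')) ?sin2cos2//.
by rewrite !mulrA.
Qed.

(** The Funk-Hecke formula, in spherical coordinates: averaging a zonal kernel
    over the azimuth acts on [P_n] as a multiplier.  It holds for polynomial
    kernels by the product formula and extends by uniform approximation. *)
Lemma funk_hecke f : continuous f ->
  \int[mu]_(s in `[0, pi]) \int[mu]_(t in `[0, pi])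
    (f (cos t * cos t' + sin t * sin t' * cos s) * (P n).[cos t] * sin t) =
  pi * (P n).[cos t'] * \int[mu]_(t in `[0, pi]) (f (cos t) * (P n).[cos t] * sin t).
Proof.
move=> cf; rewrite -/(A f) -/(B f).
apply/eqP; rewrite -subr_eq0 -normr_le0; apply/ler_addgt0Pr => /= e e0.
have pi0 := pi_gt0 R; have pi2 : 0 < pi ^+ 2 :> R by rewrite exprn_gt0.
have he : 0 < e / (2 * pi ^+ 2) by rewrite divr_gt0 ?mulr_gt0.
have [p hp] := weierstrass cf he.
pose g x := f x - p.[x].
have cp : continuous (horner p) by exact: continuous_horner.
have cg : continuous g by move=> x; apply: cvgB; [exact: cf|exact: cp].
have ge x : -1 <= x <= 1 -> `|g x| <= e / (2 * pi ^+ 2).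
  exact: hp.
have mQ : (measurable : set (set (measurableTypeR R * measurableTypeR R)%type)) Q.
  by apply: measurableX; exact: measurable_itv.
have muQ : (mu \x mu)%E Q = (pi * pi)%:E.
  have := mu_itv (pi_ge0 R); rewrite subr0 => h.
  transitivity (mu `[0%R, pi]%classic * mu `[0%R, pi]%classic)%E; last by rewrite h.
  by apply: product_measure1E; exact: measurable_itv.
have Ag : A f - A (horner p) = \int[(mu \x mu)%E]_(z in Q) G g z.
  rewrite !AE// -RintegralB//; try exact: zonal_integrable.
  by apply: eq_Rintegral => z _; rewrite /G /g; ring.
have Bg : B f - B (horner p) = pi * (P n).[cos t'] *
     \int[mu]_(t in `[0, pi]) (g (cos t) * (P n).[cos t] * sin t).
  rewrite /B -mulrBr -RintegralB//; try exact: B_int.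
  by congr (_ * _); apply: eq_Rintegral => t _; rewrite /g; ring.
have -> : A f - B f = (A f - A (horner p)) - (B f - B (horner p)).
  by rewrite A_poly; ring.
rewrite add0r Ag Bg; apply: le_trans (ler_normB _ _) _.
have b1 : `|\int[(mu \x mu)%E]_(z in Q) G g z| <= e / (2 * pi ^+ 2) * (pi * pi).
  have Qoo : ((mu \x mu)%E Q < +oo)%E by rewrite muQ ltry.
  have gM (z : R * R) : Q z -> `|G g z| <= e / (2 * pi ^+ 2) by move=> _; exact: G_bound.
  have := Rintegral_bound mQ Qoo (zonal_integrable cg) gM.
  by move=> h; apply: le_trans h _; move: muQ => /= ->.
have b2 : `|\int[mu]_(t in `[0, pi]) (g (cos t) * (P n).[cos t] * sin t)| <= e / (2 * pi ^+ 2) * (pi - 0).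
  apply: Rintegral_itv_bound; rewrite ?pi_ge0//; first exact: B_int.
  move=> t _; rewrite !normrM -[leRHS]mulr1 ler_pM ?mulr_ge0 ?sin_abs_le1// -[leRHS]mulr1.
  by rewrite ler_pM ?legendre_cos_le1// ge// cos_geN1 cos_le1.
have b3 : `|pi * (P n).[cos t'] * \int[mu]_(t in `[0, pi]) (g (cos t) * (P n).[cos t] * sin t)| <=
    pi * (e / (2 * pi ^+ 2) * (pi - 0)).
  rewrite normrM ler_pM// normrM (gtr0_norm pi0) -[leRHS]mulr1.
  by rewrite ler_pM2l// legendre_cos_le1.
apply: le_trans (lerD b1 b3) _.
have := lt0r_neq0 pi0; move: (pi : R) => w w0.
have -> : e / (2 * w ^+ 2) * (w * w) + w * (e / (2 * w ^+ 2) * (w - 0)) = e by field.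
by [].
Qed.

End ZonalAverage.

(** Retraction to [-1, 1]: it makes a function that is continuous on this segment
    continuous everywhere, as approximation by polynomials requires. *)
Definition clamp (x : R) : R := Num.max (-1) (Num.min 1 x).

Lemma clamp_itv x : -1 <= clamp x <= 1.
Proof. by rewrite /clamp le_max lexx ge_max ge_min lexx andbT; lra. Qed.

Lemma clamp_id x : -1 <= x <= 1 -> clamp x = x.
Proof. by move=> /andP[x1 x2]; rewrite /clamp (min_r x2) (max_r x1). Qed.

Lemma cont_clamp f : (forall x, -1 <= x <= 1 -> {for x, continuous f}) ->
  continuous (fun x => f (clamp x)).
Proof.
move=> cf x; apply: (@continuous_comp _ _ _ clamp f); last exact: cf (clamp_itv x).
apply: (@continuous_max _ _ (fun=> -1) (fun x => Num.min 1 x)); first exact: cvg_cst.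
by apply: (@continuous_min _ _ (fun=> 1) id); [exact: cvg_cst|exact: cvg_id].
Qed.

End Theta.

(** * Spherical Bessel functions *)
Section Bessel.
Variable R : realType.
Implicit Types (t x : R) (m n p q : nat).

(** [oddfact m] is the double factorial [(2 m - 1)!!]. *)
Definition oddfact m : R := \prod_(0 <= i < m) (2 * i + 1)%:R.
(** The product in the series of [y_n], for [m = n + 1]. *)
Definition shiftfact m p : R := \prod_(1 <= i < p + 1) ((2 * i)%:R + 1 - (2 * m)%:R).

Lemma oddfactS m : oddfact m.+1 = oddfact m * (2 * m + 1)%:R.
Proof. by rewrite /oddfact big_nat_recr. Qed.

Lemma oddfact_ge1 m : 1 <= oddfact m.
Proof.
elim: m => [|m IH]; first by rewrite /oddfact big_nil.
by rewrite oddfactS -[leLHS]mulr1 ler_pM// ler1n addn1.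
Qed.

Lemma oddfact_gt0 m : 0 < oddfact m.
Proof. exact: lt_le_trans (oddfact_ge1 m). Qed.

Lemma oddfact_neq0 m : oddfact m != 0.
Proof. by rewrite lt0r_neq0// oddfact_gt0. Qed.

Lemma oddfactD m p : oddfact m <= oddfact (m + p).
Proof.
elim: p => [|p IH]; first by rewrite addn0.
rewrite addnS oddfactS -[leLHS]mulr1 ler_pM//; first exact: ltW (oddfact_gt0 m).
by rewrite ler1n addn1.
Qed.

Lemma oddfact_fact m : (m.*2)`!%:R = 2 ^+ m * m`!%:R * oddfact m.
Proof.
elim: m => [|m IH]; first by rewrite /oddfact big_nil fact0 !mul1r.
rewrite doubleS !factS !natrM IH exprS oddfactS -!mul2n.
rewrite -[(2 * m).+2%:R]natr1 -[(2 * m).+1%:R]natr1 natrD natrM -[m.+1%:R]natr1; ring.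
Qed.

Lemma shiftfactS m p : shiftfact m p.+1 = shiftfact m p * ((2 * p.+1)%:R + 1 - (2 * m)%:R).
Proof. by rewrite /shiftfact addn1 big_nat_recr//= addn1. Qed.

Lemma shiftfact_shift m p :
  shiftfact m.+1 p.+1 = (1 - (2 * m)%:R) * shiftfact m p.
Proof.
elim: p => [|p IH].
  by rewrite shiftfactS /shiftfact !big_geq// mulnS natrD; ring.
by rewrite shiftfactS IH shiftfactS !mulnS !natrD; ring.
Qed.

Lemma odd_abs_ge1 (a b : nat) : 1 <= `|(2 * a)%:R + 1 - (2 * b)%:R : R|.
Proof.
have [ab|ab] := leqP b a.
  have -> : (2 * a)%:R + 1 - (2 * b)%:R = (2 * (a - b) + 1)%:R :> R.
    by rewrite natrD !natrM natrB//; ring.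
  by rewrite ger0_norm ?ler0n// ler1n addn1.
have -> : (2 * a)%:R + 1 - (2 * b)%:R = - (2 * (b - a.+1) + 1)%:R :> R.
  by rewrite natrD !natrM natrB// -natr1; ring.
by rewrite normrN ger0_norm ?ler0n// ler1n addn1.
Qed.

Lemma shiftfact_abs_ge1 m p : 1 <= `|shiftfact m p|.
Proof.
elim: p => [|p IH]; first by rewrite /shiftfact big_geq// normr1.
by rewrite shiftfactS normrM -[leLHS]mulr1 ler_pM// odd_abs_ge1.
Qed.

Lemma shiftfact_neq0 m p : shiftfact m p != 0.
Proof. by rewrite -normr_gt0 (lt_le_trans _ (shiftfact_abs_ge1 m p)). Qed.

Definition wcoef m t p : R := (-1) ^+ p * t ^+ (2 * p) / (2 ^+ p * p`!%:R * oddfact (m + p)).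
Definition ncoef m t p : R := (-1) ^+ p * t ^+ (2 * p) / (2 ^+ p * p`!%:R * shiftfact m p).

(** [W m t] is [j_(m-1)(t) / t^(m-1)] and [Z m t] is [y_(m-1)(t) / t^(m-1)],
    with [W 0 = cos] and [Z 0 = sin] by convention. *)
Definition W m t : R := limn (series (wcoef m t)).
Definition Nser m t : R := limn (series (ncoef m t)).
Definition Z m t : R := (\prod_(0 <= i < m) ((2 * i)%:R - 1)) * t * Nser m t / t ^+ (2 * m).

Lemma coef_le c t p : 1 <= `|c| ->
  `|(-1) ^+ p * t ^+ (2 * p) / (2 ^+ p * p`!%:R * c)| <= `|c|^-1 * exp_coeff (t ^+ 2) p.
Proof.
move=> c1; have c0 : 0 < `|c| by exact: lt_le_trans c1.
rewrite /exp_coeff/= exprM normrM normrM normrX normrN1 expr1n mul1r.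
rewrite (ger0_norm (exprn_ge0 _ (sqr_ge0 t))) normfV !normrM normrX !normr_nat.
have f0 : 0 < p`!%:R :> R by rewrite ltr0n fact_gt0.
have e2 : 1 <= 2 ^+ p :> R by rewrite exprn_ege1// ler1n.
have e20 : 0 < 2 ^+ p :> R by exact: lt_le_trans e2.
rewrite -[leRHS]mul1r [leRHS](_ : _ = (t ^+ 2) ^+ p / (p`!%:R * `|c|)); last first.
  by field; rewrite !lt0r_neq0.
apply: ler_wpM2l; first by rewrite exprn_ge0// sqr_ge0.
by rewrite lef_pV2 ?posrE ?mulr_gt0// -mulrA ler_peMl// mulr_ge0 ?ltW.
Qed.

(** Every series at hand is dominated by the exponential series of [t ^ 2]. *)
Lemma coef_cvg (c : nat -> R) (C : R) t : 1 <= C -> (forall p, C <= `|c p|) ->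
  let a p := (-1) ^+ p * t ^+ (2 * p) / (2 ^+ p * p`!%:R * c p) in
  cvgn (series a) /\ `|limn (series a)| <= C^-1 * expR (t ^+ 2).
Proof.
move=> C1 hc a; have C0 : 0 < C by exact: lt_le_trans C1.
have aC p : `|a p| <= C^-1 * exp_coeff (t ^+ 2) p.
  apply: le_trans (coef_le _ _ (le_trans C1 (hc p))) _.
  apply: ler_wpM2r; first by rewrite exp_coeff_ge0// sqr_ge0.
  by rewrite lef_pV2 ?posrE ?(lt_le_trans C0 (hc p)).
have ce : cvgn (series (fun p => C^-1 * exp_coeff (t ^+ 2) p)).
  by apply: is_cvg_seriesZ; exact: is_cvg_series_exp_coeff.
have ca : cvgn [normed series a].
  apply: (series_le_cvg _ _ _ ce) => p //.
    by rewrite /= normr_ge0.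
    by rewrite mulr_ge0 ?invr_ge0 ?(ltW C0) ?exp_coeff_ge0 ?sqr_ge0.
  exact: aC.
split; first exact: normed_cvg.
apply: le_trans (lim_series_norm ca) _.
have -> : C^-1 * expR (t ^+ 2) = limn (series (fun p => C^-1 * exp_coeff (t ^+ 2) p)).
  rewrite /expR.
  by rewrite -[RHS]/(limn (series (C^-1 *: exp_coeff (t ^+ 2)))) lim_seriesZ//; exact: is_cvg_series_exp_coeff.
exact: lim_series_le.
Qed.

Lemma W_bound m t : cvgn (series (wcoef m t)) /\ `|W m t| <= (oddfact m)^-1 * expR (t ^+ 2).
Proof.
apply: (coef_cvg (c := fun p => oddfact (m + p))); first exact: oddfact_ge1.
by move=> p; rewrite ger0_norm ?oddfactD// ltW// oddfact_gt0.
Qed.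

Lemma Nser_bound m t : cvgn (series (ncoef m t)) /\ `|Nser m t| <= expR (t ^+ 2).
Proof.
have := @coef_cvg (shiftfact m) 1 t (lexx 1) (shiftfact_abs_ge1 m).
by rewrite invr1 mul1r.
Qed.

Lemma shift_series (v b : nat -> R) (c : R) : v 0%N = 0 ->
  (forall q, v q.+1 = c * b q) -> cvgn (series b) ->
  series v @ \oo --> c * limn (series b).
Proof.
move=> v0 vS cb; rewrite -(cvg_shiftS (series v)).
have -> : (fun n => series v n.+1) = (fun n => c * series b n).
  apply/funext => n; rewrite /series/= big_nat_recl//= v0 add0r mulr_sumr.
  by apply: eq_bigr => i _; rewrite vS.
by apply: cvgM => //; exact: cvg_cst.
Qed.

(** The first term of the left series cancels; the others are those of the right
    series shifted by one index. *)
Lemma W_rec m t : (2 * m + 1)%:R * W m.+1 t - W m t = t ^+ 2 * W m.+2 t.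
Proof.
have [c0 _] := W_bound m t; have [c1 _] := W_bound m.+1 t; have [c2 _] := W_bound m.+2 t.
have h1 : series (fun p => (2 * m + 1)%:R * wcoef m.+1 t p - wcoef m t p) @ \oo -->
    (2 * m + 1)%:R * W m.+1 t - W m t.
  have -> : series (fun p => (2 * m + 1)%:R * wcoef m.+1 t p - wcoef m t p) =
    (fun n => (2 * m + 1)%:R * series (wcoef m.+1 t) n - series (wcoef m t) n).
    by apply/funext => n; rewrite /series/= sumrB mulr_sumr.
  by apply: cvgB => //; apply: cvgM => //; exact: cvg_cst.
have h2 := shift_series (v := fun p => (2 * m + 1)%:R * wcoef m.+1 t p - wcoef m t p)
  (b := wcoef m.+2 t) (c := t ^+ 2) _ _ c2.
apply: (cvg_unique _ h1); first exact: Rhausdorff.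
apply: h2.
  rewrite /wcoef !addn0 oddfactS muln0 !expr0 fact0; field.
  by rewrite oddfact_neq0 -natrM natr1 pnatr_eq0.
have i1 q : (m.+1 + q.+1 = (m + q).+2)%N by lia.
have i2 q : (m + q.+1 = (m + q).+1)%N by lia.
have i3 q : (m.+2 + q = (m + q).+2)%N by lia.
move=> q; rewrite /wcoef i1 i2 i3 !oddfactS mulnS exprD !exprS factS natrM expr0 mulr1.
have a01 : (2 * (m + q).+1 + 1)%:R = (2 * m + 1)%:R + 2 * q.+1%:R :> R.
  by rewrite -natrM -natrD; congr (_%:R); lia.
have a1 : (2 * (m + q).+1 + 1)%:R != 0 :> R by rewrite pnatr_eq0 addn1.
have a0 : (2 * (m + q) + 1)%:R != 0 :> R by rewrite pnatr_eq0 addn1.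
have q0 : q.+1%:R != 0 :> R by rewrite pnatr_eq0.
have f0 : q`!%:R != 0 :> R by rewrite pnatr_eq0 -lt0n fact_gt0.
have e0 : 2 ^+ q != 0 :> R by rewrite expf_neq0.
move: a1; rewrite a01; move: (2 * m + 1)%:R (2 * (m + q) + 1)%:R a0 q.+1%:R q0 (q`!%:R) f0 (2 ^+ q) e0.
move=> c A a0 Q q0 F f0 X e0 a1.
by field; rewrite oddfact_neq0 f0 e0 a0 a1 q0.
Qed.

Lemma N_rec m t : ((2 * m)%:R + 1) * ((2 * m)%:R - 1) * (Nser m.+1 t - Nser m.+2 t)
  = t ^+ 2 * Nser m t.
Proof.
have [c0 _] := Nser_bound m t; have [c1 _] := Nser_bound m.+1 t; have [c2 _] := Nser_bound m.+2 t.
pose K := ((2 * m)%:R + 1) * ((2 * m)%:R - 1) : R.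
have h1 : series (fun p => K * (ncoef m.+1 t p - ncoef m.+2 t p)) @ \oo -->
    K * (Nser m.+1 t - Nser m.+2 t).
  have -> : series (fun p => K * (ncoef m.+1 t p - ncoef m.+2 t p)) =
    (fun n => K * (series (ncoef m.+1 t) n - series (ncoef m.+2 t) n)).
    by apply/funext => n; rewrite /series/= -sumrB mulr_sumr.
  by apply: cvgM; [exact: cvg_cst|exact: cvgB].
have h2 := shift_series (v := fun p => K * (ncoef m.+1 t p - ncoef m.+2 t p))
  (b := ncoef m t) (c := t ^+ 2) _ _ c0.
apply: (cvg_unique _ h1); first exact: Rhausdorff.
apply: h2.
  by rewrite /ncoef /shiftfact !big_geq// subrr mulr0.
move=> q; rewrite /ncoef shiftfact_shift (shiftfact_shift m.+1).
have e1 : shiftfact m.+1 q * ((2 * q.+1)%:R + 1 - (2 * m.+1)%:R) = (1 - (2 * m)%:R) * shiftfact m q.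
  by rewrite -shiftfactS shiftfact_shift.
have s0 := shiftfact_neq0 m q; have s1 := shiftfact_neq0 m.+1 q.
have s2 := shiftfact_neq0 m.+1 q.+1; rewrite shiftfact_shift in s2.
rewrite mulnS exprD !exprS factS natrM expr0 mulr1.
have q0 : q.+1%:R != 0 :> R by rewrite pnatr_eq0.
have f0 : q`!%:R != 0 :> R by rewrite pnatr_eq0 -lt0n fact_gt0.
have e0 : 2 ^+ q != 0 :> R by rewrite expf_neq0.
have b0 : 1 - (2 * m)%:R != 0 :> R by move: s2; rewrite mulf_eq0 negb_or => /andP[].
have b1 : (1 - (2 * m.+1)%:R) = - ((2 * m)%:R + 1) :> R by rewrite mulnS natrD; ring.
have b2 : (2 * m)%:R + 1 != 0 :> R by rewrite natr1 pnatr_eq0.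
rewrite b1.
have b3 : (2 * q.+1)%:R + 1 - (2 * m.+1)%:R != 0 :> R.
  by rewrite -normr_gt0 (lt_le_trans _ (odd_abs_ge1 _ _)).
have {e1} -> : shiftfact m q =
   shiftfact m.+1 q * ((2 * q.+1)%:R + 1 - (2 * m.+1)%:R) / (1 - (2 * m)%:R).
  by rewrite e1 mulrAC divff ?mul1r.
have b4 : (2 * q.+1)%:R + 1 - (2 * m.+1)%:R = 2 * q.+1%:R - 1 - (2 * m)%:R :> R.
  by rewrite natrM mulnS natrD; ring.
rewrite b4 in b3 *.
rewrite /K; move: (shiftfact m.+1 q) s1 (2 ^+ q) e0 (q`!%:R) f0 => S s1 E e0 F f0.
move: q.+1%:R q0 (2 * m)%:R b0 b2 b3 => Q q0 M b0 b2 b3.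
by field; repeat (apply/andP; split => //).
Qed.

Lemma Z_rec m t : 0 < t -> (2 * m + 1)%:R * Z m.+1 t - Z m t = t ^+ 2 * Z m.+2 t.
Proof.
move=> t0; have tn0 : t != 0 by rewrite lt0r_neq0.
have := N_rec m t; rewrite /Z !big_nat_recr//= => h.
set e := \prod_(0 <= i < m) _.
have -> : (2 * m + 1)%:R = (2 * m)%:R + 1 :> R by rewrite natrD.
have -> : (2 * m.+1)%:R - 1 = (2 * m)%:R + 1 :> R by rewrite mulnS natrD; ring.
have x0 : t ^+ (2 * m) != 0 by rewrite expf_neq0.
have x1 : t ^+ (2 * m.+1) = t ^+ 2 * t ^+ (2 * m) by rewrite mulnS exprD.
have x2 : t ^+ (2 * m.+2) = t ^+ 2 * (t ^+ 2 * t ^+ (2 * m)) by rewrite !mulnS !exprD.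
rewrite x1 x2; set X := t ^+ (2 * m) in x0 *.
transitivity (e * t / (t ^+ 2 * X) *
    (((2 * m)%:R + 1) * ((2 * m)%:R - 1) * (Nser m.+1 t - Nser m.+2 t) - t ^+ 2 * Nser m t)
    + t ^+ 2 * (e * ((2 * m)%:R - 1) * ((2 * m)%:R + 1) * t * Nser m.+2 t / (t ^+ 2 * (t ^+ 2 * X)))).
  by field; rewrite tn0 x0.
by rewrite h subrr mulr0 add0r.
Qed.

Lemma W0 t : W 0 t = cos t.
Proof.
have := @cvg_cos_coeff' R t => /cvg_lim <- //; congr (limn (series _)).
apply/funext => p; rewrite /wcoef /cos_coeff' add0n oddfact_fact mul2n.
by rewrite /exprz.
Qed.

Lemma W1 t : t * W 1 t = sin t.
Proof.
have [c1 _] := W_bound 1 t.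
have h : series (sin_coeff' t) @ \oo --> t * W 1 t.
  have -> : series (sin_coeff' t) = (fun n => t * series (wcoef 1 t) n).
    apply/funext => n; rewrite /series/= mulr_sumr; apply: eq_bigr => p _.
    rewrite /wcoef /sin_coeff' add1n oddfactS -mul2n factS natrM.
    have := oddfact_fact p; rewrite -mul2n => ->.
    have -> : (2 * p).+1%:R = (2 * p + 1)%:R :> R by rewrite addn1.
    have E0 := oddfact_neq0 p.
    have f0 : p`!%:R != 0 :> R by rewrite pnatr_eq0 -lt0n fact_gt0.
    have e0 : 2 ^+ p != 0 :> R by rewrite expf_neq0.
    have a0 : (2 * p + 1)%:R != 0 :> R by rewrite pnatr_eq0 addn1.
    rewrite /exprz exprS; move: (2 * p + 1)%:R a0 => A a0.
    by field; rewrite E0 f0 e0 a0.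
  by apply: cvgM => //; exact: cvg_cst.
by apply: (cvg_unique _ h); [exact: Rhausdorff|exact: cvg_sin_coeff'].
Qed.

Lemma Nser1 t : Nser 1 t = cos t.
Proof.
rewrite -W0; congr (limn (series _)); apply/funext => p.
rewrite /ncoef /wcoef; congr (_ / (_ * _)); rewrite add0n /shiftfact /oddfact addn1 big_add1 /=.
by apply: eq_bigr => i _; rewrite mulnS natrD muln1 natrD; ring.
Qed.

Lemma Nser0 t : Nser 0 t = W 1 t.
Proof.
congr (limn (series _)); apply/funext => p.
rewrite /ncoef /wcoef; congr (_ / (_ * _)); rewrite add1n /shiftfact /oddfact addn1.
rewrite [RHS]big_nat_recl//= muln0 add0n mul1r big_add1 /=.
by apply: eq_bigr => i _; rewrite subr0 natrD.
Qed.

Lemma Z0 t : Z 0 t = sin t.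
Proof. by rewrite /Z big_nil mul1r muln0 expr0 divr1 Nser0 W1. Qed.

Lemma Z1 t : 0 < t -> Z 1 t = - cos t / t.
Proof.
move=> t0; rewrite /Z big_nat1 muln0 sub0r Nser1 muln1 expr2; field.
by rewrite lt0r_neq0.
Qed.

Lemma bessel_jE n t : sph_bessel_j n t = t ^+ n * W n.+1 t.
Proof.
have [c1 _] := W_bound n.+1 t.
rewrite /sph_bessel_j.
have -> : series (fun p : nat => (-1) ^+ p * t ^+ (n + 2 * p) /
    (2 ^+ p * p`!%:R * \prod_(0 <= i < n + p + 1) (2 * i + 1)%:R)) =
   (fun N => t ^+ n * series (wcoef n.+1 t) N).
  apply/funext => N; rewrite /series/= mulr_sumr; apply: eq_bigr => p _.
  by rewrite /wcoef exprD -/(oddfact _) addn1 addSn; ring.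
by apply/cvg_lim => //; apply: cvgM => //; exact: cvg_cst.
Qed.

Lemma prod_2im1 n : \prod_(0 <= i < n.+1) ((2 * i)%:R - 1) = - oddfact n :> R.
Proof.
rewrite big_nat_recl//= muln0 sub0r mulN1r; congr (- _).
by apply: eq_bigr => i _; rewrite mulnS !natrD; ring.
Qed.

Lemma bessel_yE n t : 0 < t -> sph_bessel_y n t = t ^+ n * Z n.+1 t.
Proof.
move=> t0; have tn0 : t != 0 by rewrite lt0r_neq0.
have [c1 _] := Nser_bound n.+1 t.
rewrite /sph_bessel_y.
have -> : series (fun p : nat => (-1) ^+ p * (t ^+ (2 * p) / t ^+ (n + 1)) /
    (2 ^+ p * p`!%:R * \prod_(1 <= i < p + 1) ((2 * i)%:R - 1 - (2 * n)%:R))) =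
   (fun N => (t ^+ (n + 1))^-1 * series (ncoef n.+1 t) N).
  apply/funext => N; rewrite /series/= mulr_sumr; apply: eq_bigr => p _.
  rewrite /ncoef /shiftfact.
  rewrite (eq_bigr (fun i => (2 * i)%:R + 1 - (2 * n.+1)%:R)).
    by ring.
  by move=> i _; rewrite mulnS natrD; ring.
have -> : limn (fun N => (t ^+ (n + 1))^-1 * series (ncoef n.+1 t) N) =
   (t ^+ (n + 1))^-1 * Nser n.+1 t.
  by apply/cvg_lim => //; apply: cvgM => //; exact: cvg_cst.
have -> : (2 * n)`!%:R / (2 ^+ n * n`!%:R) = oddfact n :> R.
  rewrite mul2n oddfact_fact.
  have f0 : n`!%:R != 0 :> R by rewrite pnatr_eq0 -lt0n fact_gt0.
  have e0 : 2 ^+ n != 0 :> R by rewrite expf_neq0.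
  by field; rewrite e0 f0.
rewrite /Z prod_2im1 mulnS addn1 exprS exprD mul2n -addnn exprD expr2.
have x0 : t ^+ n != 0 by rewrite expf_neq0.
by field; rewrite tn0 x0.
Qed.

Lemma bessel_j_bound n t : `|sph_bessel_j n t| <= `|t| ^+ n * ((oddfact n.+1)^-1 * expR (t ^+ 2)).
Proof.
rewrite bessel_jE normrM normrX ler_wpM2l ?exprn_ge0//.
by have [] := W_bound n.+1 t.
Qed.

Lemma bessel_y_bound n t : 0 < t -> `|sph_bessel_y n t| <= oddfact n / t ^+ n.+1 * expR (t ^+ 2).
Proof.
move=> t0; have tn0 : t != 0 by rewrite lt0r_neq0.
rewrite bessel_yE// /Z prod_2im1 mulnS exprD mul2n -addnn exprD expr2.
have x0 : 0 < t ^+ n by rewrite exprn_gt0.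
have -> : t ^+ n * (- oddfact n * t * Nser n.+1 t / (t * t * (t ^+ n * t ^+ n))) =
   - (oddfact n / t ^+ n.+1 * Nser n.+1 t).
  by rewrite exprS; field; rewrite tn0 lt0r_neq0.
rewrite normrN normrM ger0_norm ?divr_ge0 ?exprn_ge0 ?(ltW (oddfact_gt0 n)) ?(ltW t0)//.
apply: ler_wpM2l; first by rewrite divr_ge0 ?exprn_ge0 ?(ltW (oddfact_gt0 n)) ?(ltW t0).
by have [] := Nser_bound n.+1 t.
Qed.

(** The two properties of [j_n] and [y_n] that the addition theorem uses, after
    division by the power [t ^ n]. *)
Record bessel_seq (w : nat -> R -> R) : Prop := BesselSeq {
  bseq_rec : forall m t, 0 < t -> (2 * m + 1)%:R * w m.+1 t - w m t = t ^+ 2 * w m.+2 t;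
  bseq_d : forall m t, 0 < t -> is_derive t 1 (w m) (- t * w m.+1 t) }.

(** The recurrence propagates the derivative rule from the first two members. *)
Lemma bessel_seq_intro (w : nat -> R -> R) :
  (forall m t, 0 < t -> (2 * m + 1)%:R * w m.+1 t - w m t = t ^+ 2 * w m.+2 t) ->
  (forall t, 0 < t -> is_derive t 1 (w 0%N) (- t * w 1%N t)) ->
  (forall t, 0 < t -> is_derive t 1 (w 1%N) (- t * w 2%N t)) -> bessel_seq w.
Proof.
move=> rec d0 d1; split => // m t.
suff : (forall t, 0 < t -> is_derive t 1 (w m) (- t * w m.+1 t)) /\
  (forall t, 0 < t -> is_derive t 1 (w m.+1) (- t * w m.+2 t)) by case => h _; exact: h.
elim: m {t} => [//|m [IH0 IH1]]; split => // t t0.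
have tn0 : t != 0 by rewrite lt0r_neq0.
have d2 : is_derive t 1 (fun x => ((2 * m + 1)%:R * w m.+1 x - w m x) * (x ^+ 2)^-1)
   (- t * w m.+3 t).
  have := is_deriveMf (is_deriveBf (is_deriveZf (2 * m + 1)%:R (IH1 t t0)) (IH0 t t0))
    (is_deriveVf (f := fun x => x ^+ 2) _ (is_deriveXf 2 (is_derive_id t 1))).
  rewrite sqrf_eq0 tn0 => /(_ isT) h; apply: (is_derive_eq h).
  have e3 : w m.+3 t = (((2 * m + 1)%:R + 2) * w m.+2 t - w m.+1 t) / t ^+ 2.
    have -> : (2 * m + 1)%:R + 2 = (2 * m.+1 + 1)%:R :> R by rewrite -natrD; congr (_%:R); lia.
    by rewrite rec// mulrC mulKf// expf_neq0.
  rewrite /= expr1 rec// e3; move: (2 * m + 1)%:R => c.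
  by field.
have nearE : {near t, (fun x => ((2 * m + 1)%:R * w m.+1 x - w m x) * (x ^+ 2)^-1) =1 w m.+2}.
  near=> x; have x0 : 0 < x by near: x; exact: lt_nbhsr.
  by rewrite rec// mulrC mulKf// expf_neq0// lt0r_neq0.
exact: (near_eq_is_derive nearE d2).
Unshelve. all: by end_near. Qed.

Lemma W_seq : bessel_seq W.
Proof.
apply: bessel_seq_intro => [m t _|t t0|t t0]; first exact: W_rec.
  have -> : W 0 = cos by apply/funext => x; exact: W0.
  by rewrite mulNr W1; exact: is_derive_cos.
have tn0 : t != 0 by rewrite lt0r_neq0.
have d : is_derive t 1 (fun x => sin x * x^-1) (- t * W 2 t).
  have := is_deriveMf (is_derive_sin t) (is_deriveVf tn0 (is_derive_id t 1)).
  move=> h; apply: (is_derive_eq h); rewrite -[W 2 t](mulKf (expf_neq0 2 tn0)) -W_rec W0 -W1.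
  by field.
apply: (near_eq_is_derive _ d).
near=> x; have x0 : 0 < x by near: x; exact: lt_nbhsr.
by rewrite -W1 mulrC mulKf// lt0r_neq0.
Unshelve. all: by end_near. Qed.

Lemma Z_seq : bessel_seq Z.
Proof.
apply: bessel_seq_intro => [m t t0|t t0|t t0]; first exact: Z_rec.
  have -> : Z 0 = sin by apply/funext => x; exact: Z0.
  rewrite Z1// mulNr mulNr mulrN opprK mulrC mulfVK ?lt0r_neq0//.
  exact: is_derive_sin.
have tn0 : t != 0 by rewrite lt0r_neq0.
have d : is_derive t 1 (fun x => - cos x * x^-1) (- t * Z 2 t).
  have := is_deriveMf (is_deriveNf (is_derive_cos t)) (is_deriveVf tn0 (is_derive_id t 1)).
  move=> h; apply: (is_derive_eq h); rewrite -[Z 2 t](mulKf (expf_neq0 2 tn0)) -Z_rec// Z0 Z1//.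
  by field.
apply: (near_eq_is_derive _ d).
near=> x; have x0 : 0 < x by near: x; exact: lt_nbhsr.
by rewrite Z1.
Unshelve. all: by end_near. Qed.

End Bessel.

(** * The multipole expansion of the kernels *)
Section Gegenbauer.
Variable R : realType.
Notation mu := (@lebesgue_measure R).
Notation P := (@legendre R).
Implicit Types (s t x y : R).

(** [dist2 s t x] is the squared distance of two points at distances [s] and
    [t] from the origin that subtend an angle of cosine [x]. *)
Definition dist2 (s t x : R) : R := s ^+ 2 + t ^+ 2 - 2 * s * t * x.

Lemma dist2_bounds s t x : 0 <= s -> 0 <= t -> -1 <= x <= 1 ->
  (s - t) ^+ 2 <= dist2 s t x <= (s + t) ^+ 2.
Proof.
move=> s0 t0 /andP[x1 x2]; have st : 0 <= s * t by exact: mulr_ge0.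
by rewrite /dist2; apply/andP; split; nra.
Qed.

Lemma dist2_gt0 s t x : 0 < t < s -> -1 <= x <= 1 -> 0 < dist2 s t x.
Proof.
move=> /andP[t0 ts] x1; have s0 : 0 < s by exact: lt_trans ts.
have /andP[h _] := dist2_bounds (ltW s0) (ltW t0) x1.
by apply: lt_le_trans h; rewrite exprn_gt0// subr_gt0.
Qed.

Lemma is_derive_eq_near (f g : R -> R) x (a b : R) :
  is_derive x 1 f a -> is_derive x 1 g b -> (\near x, f x = g x) -> a = b.
Proof.
move=> [_ <-] [_ <-] fg; exact: near_eq_derive.
Qed.

Variable w : nat -> R -> R.
Hypothesis bw : bessel_seq w.

(** In the variable [r ^ 2] the derivatives involve no square root. *)
Let v (m : nat) (y : R) : R := w m (Num.sqrt y).

Local Lemma v_rec m y : 0 < y -> (2 * m + 1)%:R * v m.+1 y - v m y = y * v m.+2 y.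
Proof.
move=> y0; rewrite /v (bseq_rec bw) ?sqrtr_gt0//.
by rewrite sqr_sqrtr// ltW.
Qed.

Local Lemma v_d m y : 0 < y -> is_derive y 1 (v m) (- v m.+1 y / 2).
Proof.
move=> y0; have s0 : 0 < Num.sqrt y by rewrite sqrtr_gt0.
have h := is_derive_compf (bseq_d bw m s0) (is_derive1_sqrt y0).
apply: (is_derive_eq h); rewrite /v; field.
by rewrite lt0r_neq0.
Qed.

Local Lemma v_comp m (f : R -> R) x (a : R) : 0 < f x -> is_derive x 1 f a ->
  is_derive x 1 (fun y => v m (f y)) (- v m.+1 (f x) / 2 * a).
Proof. by move=> fx fa; exact: (is_derive_compf (v_d m fx) fa). Qed.

Local Lemma v_cont m y : 0 < y -> {for y, continuous (v m)}.
Proof. by move=> y0; exact: (is_derive_cont (v_d m y0)). Qed.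

Local Lemma v_bounded m (a b : R) : 0 < a -> exists2 M : R, 0 <= M &
  forall y, a <= y <= b -> `|v m y| <= M.
Proof.
move=> a0; have [ab|ba] := leP a b; last first.
  by exists 0 => // y /andP[h1 h2]; move: ba; rewrite ltNge (le_trans h1 h2).
have cw : {within `[a, b], continuous (fun y => `|v m y|)}.
  apply: cont_within => y /andP[ay _]; apply: cvg_norm; apply: v_cont.
  exact: lt_le_trans ay.
have [c _ hc] := EVT_max ab cw.
by exists `|v m c| => // y yab; apply: hc; rewrite in_itv.
Qed.

Local Lemma dist2_dx s t x : is_derive x 1 (dist2 s t) (- (2 * s * t)).
Proof.
have h := is_deriveBf (is_derive_cst (s ^+ 2 + t ^+ 2) x 1) (is_deriveZf (2 * s * t) (is_derive_id x 1)).
by apply: (is_derive_eq h); rewrite mulr1 sub0r.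
Qed.

Local Lemma dist2_dt s t x : is_derive t 1 (fun t => dist2 s t x) (2 * (t - s * x)).
Proof.
have h1 := is_deriveDf (is_derive_cst (s ^+ 2) t 1) (is_deriveXf 2 (is_derive_id t 1)).
have h2 := is_deriveMf (is_deriveZf (2 * s) (is_derive_id t 1)) (is_derive_cst x t 1).
by apply: (is_derive_eq (is_deriveBf h1 h2)) => /=; ring.
Qed.

Local Lemma dist2C s t x : dist2 s t x = dist2 t s x.
Proof. by rewrite /dist2; ring. Qed.

Local Lemma vx m s t x : 0 < t < s -> -1 <= x <= 1 ->
  is_derive x 1 (fun x => v m (dist2 s t x)) (s * t * v m.+1 (dist2 s t x)).
Proof.
move=> ts x1; have h := v_comp m (dist2_gt0 ts x1) (dist2_dx s t x).
by apply: (is_derive_eq h); field.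
Qed.

Local Lemma vt m s t x : 0 < t < s -> -1 <= x <= 1 ->
  is_derive t 1 (fun t => v m (dist2 s t x)) (- (t - s * x) * v m.+1 (dist2 s t x)).
Proof.
move=> ts x1; have h := @v_comp m (fun t => dist2 s t x) t _ (dist2_gt0 ts x1) (dist2_dt s t x).
by apply: (is_derive_eq h); field.
Qed.

Local Lemma vs m s t x : 0 < t < s -> -1 <= x <= 1 ->
  is_derive s 1 (fun s => v m (dist2 s t x)) (- (s - t * x) * v m.+1 (dist2 s t x)).
Proof.
move=> ts x1; have h0 := dist2_dt t s x.
have {}h0 : is_derive s 1 (fun s => dist2 s t x) (2 * (s - t * x)).
  by rewrite (_ : (fun s => _) = (fun s => dist2 t s x))//; apply/funext => z; exact: dist2C.
have h := @v_comp m (fun s => dist2 s t x) s _ (dist2_gt0 ts x1) h0.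
by apply: (is_derive_eq h); field.
Qed.

Local Lemma vx_cont m s t x : 0 < t < s -> -1 <= x <= 1 ->
  {for x, continuous (fun x => v m (dist2 s t x))}.
Proof. by move=> ts x1; exact: (is_derive_cont (vx m ts x1)). Qed.

Let pw (n : nat) : {poly R} := (1 - 'X^2) ^+ n.

Local Lemma pwE n x : (pw n).[x] = (1 - x ^+ 2) ^+ n.
Proof. by rewrite /pw horner_exp hornerD hornerN hornerXn hornerC. Qed.

Local Lemma pw_le1 n x : -1 <= x <= 1 -> `|(pw n).[x]| <= 1.
Proof.
move=> /andP[x1 x2]; rewrite pwE normrX exprn_ile1// ler_norml.
by apply/andP; split; nra.
Qed.

Local Lemma int_within (f : R -> R) : (forall x, -1 <= x <= 1 -> {for x, continuous f}) ->
  mu.-integrable `[-1, 1] (EFin \o f).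
Proof. exact: cont_integrable. Qed.

Let q (n : nat) s t : R := \int[mu]_(x in `[-1, 1]) ((pw n).[x] * v n.+1 (dist2 s t x)).
Let qt (n : nat) s t : R := \int[mu]_(x in `[-1, 1])
  ((pw n).[x] * (- (t - s * x) * v n.+2 (dist2 s t x))).
Let qts (n : nat) s t : R := \int[mu]_(x in `[-1, 1])
  ((pw n).[x] * (x * v n.+2 (dist2 s t x) + (t - s * x) * (s - t * x) * v n.+3 (dist2 s t x))).

Local Lemma n11 : -1 <= 1 :> R. Proof. by lra. Qed.

Local Lemma q_dt n s t : 0 < t < s -> is_derive t 1 (q n s) (qt n s t).
Proof.
move=> /andP[t0 ts]; have s0 : 0 < s by exact: lt_trans ts.
pose b := (t + s) / 2; have tb : t < b by rewrite /b; lra.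
have bs : b < s by rewrite /b; lra.
have sb0 : 0 < (s - b) ^+ 2 by rewrite exprn_gt0// subr_gt0.
have [M M0 hM] := v_bounded n.+2 ((s + b) ^+ 2) sb0.
have rg y x : 0 < y < b -> -1 <= x <= 1 -> (s - b) ^+ 2 <= dist2 s y x <= (s + b) ^+ 2.
  move=> /andP[y0 yb] x1; have /andP[h1 h2] := dist2_bounds (ltW s0) (ltW y0) x1.
  apply/andP; split; [apply: le_trans h1|apply: le_trans h2 _]; by rewrite lerXn2r ?nnegrE; lra.
have ybs y : 0 < y < b -> 0 < y < s.
  by move=> /andP[-> yb]; exact: lt_trans bs.
apply: (@derive_Rintegral R (fun t x => (pw n).[x] * v n.+1 (dist2 s t x))
  (fun t x => (pw n).[x] * (- (t - s * x) * v n.+2 (dist2 s t x))) t (-1) 1 0 b (2 * s * M)).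
- by rewrite t0.
- exact: n11.
- by move=> y x yb x1; apply: is_deriveZf; apply: vt => //; exact: ybs.
- move=> y yb; apply: cont_within => x x1; apply: cvgM; first exact: continuous_horner.
  by apply: vx_cont => //; exact: ybs.
- move=> y x yb x1; rewrite normrM -[leRHS]mul1r ler_pM ?pw_le1// normrM.
  apply: ler_pM => //; last by apply: hM; exact: rg.
  by rewrite ler_norml; case/andP: x1 => x1 x2; case/andP: yb => y0 yb; apply/andP; split; nra.
Qed.

Local Lemma qt_ds n s t : 0 < t < s -> is_derive s 1 (fun s => qt n s t) (qts n s t).
Proof.
move=> /andP[t0 ts]; have s0 : 0 < s by exact: lt_trans ts.
pose a := (t + s) / 2; have ta : t < a by rewrite /a; lra.
have as_ : a < s by rewrite /a; lra.
have at0 : 0 < (a - t) ^+ 2 by rewrite exprn_gt0// subr_gt0.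
pose b := 2 * s; have sb : s < b by rewrite /b; lra.
have [M M0 hM] := v_bounded n.+2 ((b + t) ^+ 2) at0.
have [N N0 hN] := v_bounded n.+3 ((b + t) ^+ 2) at0.
have rg y x : a < y < b -> -1 <= x <= 1 -> (a - t) ^+ 2 <= dist2 y t x <= (b + t) ^+ 2.
  move=> /andP[y0 yb] x1; have y00 : 0 <= y by lra.
  have /andP[h1 h2] := dist2_bounds y00 (ltW t0) x1.
  apply/andP; split; [apply: le_trans h1|apply: le_trans h2 _]; by rewrite lerXn2r ?nnegrE; lra.
have yas y : a < y < b -> 0 < t < y.
  by move=> /andP[ay _]; rewrite t0 (lt_trans ta).
apply: (@derive_Rintegral R (fun s x => (pw n).[x] * (- (t - s * x) * v n.+2 (dist2 s t x)))
  (fun s x => (pw n).[x] * (x * v n.+2 (dist2 s t x) + (t - s * x) * (s - t * x) * v n.+3 (dist2 s t x)))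
  s (-1) 1 a b (M + (2 * b) * (2 * b) * N)).
- by rewrite as_.
- exact: n11.
- move=> y x yb x1; apply: is_deriveZf.
  have h1 := is_deriveNf (is_deriveBf (is_derive_cst t y 1) (is_deriveMf (is_derive_id y 1) (is_derive_cst x y 1))).
  have h := is_deriveMf h1 (vs n.+2 (yas _ yb) x1).
  by apply: (is_derive_eq h) => /=; ring.
- move=> y yb; apply: cont_within => x x1; apply: cvgM; first exact: continuous_horner.
  apply: cvgM; last by apply: vx_cont => //; exact: yas.
  apply: cvgN; apply: cvgB; first exact: cvg_cst.
  by apply: cvgM; [exact: cvg_cst|exact: cvg_id].
- move=> y x yb x1; rewrite normrM -[leRHS]mul1r ler_pM ?pw_le1//.
  have hM' := hM _ (rg _ _ yb x1); have hN' := hN _ (rg _ _ yb x1).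
  case/andP: x1 => x1 x2; case/andP: yb => y0 yb.
  apply: le_trans (ler_normD _ _) _; apply: lerD.
    by rewrite normrM -[leRHS]mul1r ler_pM// ler_norml x1.
  rewrite normrM ler_pM// normrM ler_pM//.
    by rewrite ler_norml; apply/andP; split; nra.
  by rewrite ler_norml; apply/andP; split; nra.
Qed.

Local Lemma pw_deriv n : (pw n.+1)^`() = - (2 * n.+1%:R) *: ('X * pw n).
Proof.
rewrite /pw deriv_exp derivB derivXn -[1]/(1%:P) derivC sub0r expr1 /=.
by rewrite scaleNr -natrM scaler_nat mulNr mulNrn [_ *+ 2 * _]mulrnAl -mulrnA.
Qed.

Local Lemma pw_end n : (pw n.+1).[1] = 0 /\ (pw n.+1).[-1] = 0.
Proof. by rewrite !pwE sqrrN expr1n subrr !exprS !mul0r. Qed.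

Local Lemma parts (p : {poly R}) m s t : 0 < t < s -> p.[1] = 0 -> p.[-1] = 0 ->
  \int[mu]_(x in `[-1, 1]) (p^`().[x] * v m (dist2 s t x)) =
  - (s * t * \int[mu]_(x in `[-1, 1]) (p.[x] * v m.+1 (dist2 s t x))).
Proof.
move=> ts p1 pN1.
have c1 (r : {poly R}) k x : -1 <= x <= 1 ->
    {for x, continuous (fun x => r.[x] * v k (dist2 s t x))}.
  by move=> x1; apply: cvgM; [exact: continuous_horner|exact: vx_cont].
have i1 r k : mu.-integrable `[-1, 1] (EFin \o (fun x => r.[x] * v k (dist2 s t x))).
  by apply: int_within => x; exact: c1.
apply/eqP; rewrite -addr_eq0 -RintegralZl//; apply/eqP.
rewrite -RintegralD//; last first.
  by apply: int_within => x x1; apply: cvgM; [exact: cvg_cst|exact: c1].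
transitivity (p.[1] * v m (dist2 s t 1) - p.[-1] * v m (dist2 s t (-1))); last first.
  by rewrite p1 pN1 !mul0r subrr.
apply: (@Rintegral_FTC R _ (fun x => p.[x] * v m (dist2 s t x))); first exact: n11.
- move=> x x1; have h := is_deriveMf (is_derive_poly p x) (vx m ts x1).
  by apply: (is_derive_eq h); ring.
- move=> x x1; apply: cvgD; first exact: c1.
  by apply: cvgM; [exact: cvg_cst|exact: c1].
Qed.

(** [(s - t x) (t - s x) = s t (1 - x ^ 2) - x r ^ 2] and the recurrence turn
    the mixed derivative into a total [x]-derivative plus a term that is
    integrated by parts. *)
Local Lemma qtsE n s t : 0 < t < s -> qts n s t = s * t / (2 * n.+1%:R) * q n.+1 s t.
Proof.
move=> ts.
have c1 (r : {poly R}) k x : -1 <= x <= 1 ->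
    {for x, continuous (fun x => r.[x] * v k (dist2 s t x))}.
  by move=> x1; apply: cvgM; [exact: continuous_horner|exact: vx_cont].
have i1 r k : mu.-integrable `[-1, 1] (EFin \o (fun x => r.[x] * v k (dist2 s t x))).
  by apply: int_within => x; exact: c1.
have i2 c r k : mu.-integrable `[-1, 1] (EFin \o (fun x => c * (r.[x] * v k (dist2 s t x)))).
  by apply: int_within => x x1; apply: cvgM; [exact: cvg_cst|exact: c1].
have n0 : n.+1%:R != 0 :> R by rewrite pnatr_eq0.
have [e1 eN1] := pw_end n.
have X1 := parts n.+2 ts e1 eN1.
have X2 := parts n.+1 ts e1 eN1.
have dp x : (pw n.+1)^`().[x] = - (2 * n.+1%:R) * (x * (pw n).[x]).
  by rewrite pw_deriv hornerZ hornerM hornerX.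
transitivity (s * t * (\int[mu]_(x in `[-1, 1]) ((pw n.+1).[x] * v n.+3 (dist2 s t x)))
  + \int[mu]_(x in `[-1, 1]) ((pw n.+1)^`().[x] * v n.+2 (dist2 s t x))
  + - (2 * n.+1%:R)^-1 * \int[mu]_(x in `[-1, 1]) ((pw n.+1)^`().[x] * v n.+1 (dist2 s t x))).
  rewrite -!RintegralZl// -RintegralD// -RintegralD//; last first.
    by apply: int_within => x x1; apply: cvgD; [apply: cvgM; [exact: cvg_cst|]|]; exact: c1.
  apply: eq_Rintegral => x; rewrite inE/= in_itv/= => x1.
  have d0 := dist2_gt0 ts x1; have := v_rec n.+1 d0.
  rewrite dp !pwE [_ ^+ n.+1]exprS; move: (v n.+1 _) (v n.+2 _) (v n.+3 _) => v1 v2 v3 e.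
  have -> : (t - s * x) * (s - t * x) * v3 = s * t * (1 - x ^+ 2) * v3 - x * (dist2 s t x * v3).
    by rewrite /dist2; ring.
  rewrite -e; have -> : (2 * n.+1 + 1)%:R = 2 * n.+1%:R + 1 :> R by rewrite natrD natrM.
  by move: (n.+1%:R : R) n0 => c c0; field.
rewrite X1 X2 addrN add0r /q; move: (n.+1%:R : R) n0 => c c0; field.
exact: c0.
Qed.

Local Lemma q0 s t : 0 < t < s -> q 0 s t = (w 0 (s - t) - w 0 (s + t)) / (s * t).
Proof.
move=> /[dup] ts /andP[t0 ts']; have s0 : 0 < s by exact: lt_trans ts'.
have st0 : s * t != 0 by rewrite mulf_neq0// lt0r_neq0.
apply: (canRL (mulfK st0)); rewrite mulrC /q -RintegralZl//; last first.
  by apply: int_within => x x1; apply: cvgM; [exact: continuous_horner|exact: vx_cont].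
have -> : w 0 (s - t) - w 0 (s + t) = v 0 (dist2 s t 1) - v 0 (dist2 s t (-1)).
  rewrite /v /dist2 (_ : _ - _ * 1 = (s - t) ^+ 2); last by ring.
  rewrite (_ : _ - _ * -1 = (s + t) ^+ 2); last by ring.
  by rewrite !sqrtr_sqr !ger0_norm; lra.
apply: (@Rintegral_FTC R _ (fun x => v 0 (dist2 s t x))); first exact: n11.
- move=> x x1; apply: (is_derive_eq (vx 0 ts x1)).
  by rewrite pwE expr0 mul1r.
- move=> x x1; apply: cvgM; first exact: cvg_cst.
  by apply: cvgM; [exact: continuous_horner|exact: vx_cont].
Qed.

(* addition theorem for the elementary functions of index 0 *)
Hypothesis base : forall s t, 0 < t < s ->
  w 0 (s - t) - w 0 (s + t) = 2 * (s * w 1 s) * (t * @W R 1 t).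

(** Gegenbauer's addition theorem, by induction: differentiating the known closed
    form in [t] and then in [s] gives the mixed derivative, which is the next
    integral up to a factor. *)
Local Lemma q_closed n s t : 0 < t < s ->
  q n s t = 2 ^+ n.+1 * n`!%:R * w n.+1 s * W n.+1 t.
Proof.
elim: n s t => [|n IH] s t /[dup] ts /andP[t0 ts'];
  have s0 : 0 < s by exact: lt_trans ts'.
  rewrite q0// base// fact0; field.
  by rewrite !lt0r_neq0.
pose C : R := 2 ^+ n.+1 * n`!%:R.
have A s' t' : 0 < t' < s' -> qt n s' t' = - C * w n.+1 s' * t' * W n.+2 t'.
  move=> /[dup] ts1 /andP[t1 ts1'].
  have h1 := q_dt n ts1.
  have h2 := is_deriveZf (C * w n.+1 s') (bseq_d (@W_seq R) n.+1 t1).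
  rewrite (is_derive_eq_near h1 h2); first by ring.
  have : \forall y \near t', y \in `]0, s'[ by apply: near_in_itv; rewrite in_itv/= t1.
  by apply: filterS => y; rewrite in_itv/= => ys; rewrite IH.
have B : qts n s t = C * s * t * w n.+2 s * W n.+2 t.
  have h1 := qt_ds n ts.
  have h2 := is_deriveZf (- C * t * W n.+2 t) (bseq_d bw n.+1 s0).
  rewrite (is_derive_eq_near h1 h2); first by ring.
  have : \forall y \near s, y \in `]t, s + 1[ by apply: near_in_itv; rewrite in_itv/= ts'; lra.
  apply: filterS => y; rewrite in_itv/= => /andP[ty _]; rewrite A; last by rewrite t0.
  by ring.
move: B; rewrite qtsE// /C factS natrM => B.
have n0 : n.+1%:R != 0 :> R by rewrite pnatr_eq0.
have c0 : s * t / (2 * n.+1%:R) != 0.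
  by rewrite !mulf_neq0 ?invr_eq0 ?mulf_neq0// lt0r_neq0.
apply: (mulfI c0); rewrite B [2 ^+ n.+2]exprS; move: (2 ^+ n.+1) => z.
by move: (n.+1%:R : R) n0 (n`!%:R : R) => c c1 d; field.
Qed.

Lemma kernel_cont m s t x : 0 < t < s -> -1 <= x <= 1 ->
  {for x, continuous (fun x => w m (Num.sqrt (dist2 s t x)))}.
Proof. exact: vx_cont. Qed.

(** By Rodrigues' formula, [n] integrations by parts in [x] trade [P_n] for the
    weight [(1 - x ^ 2) ^ n]. *)
Lemma legendre_multipole n s t : 0 < t < s ->
  \int[mu]_(x in `[-1, 1]) (w 1 (Num.sqrt (dist2 s t x)) * (P n).[x]) =
  2 * (s ^+ n * w n.+1 s) * (t ^+ n * W n.+1 t).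
Proof.
move=> ts.
have c1 (r : {poly R}) k x : -1 <= x <= 1 ->
    {for x, continuous (fun x => r.[x] * v k (dist2 s t x))}.
  by move=> x1; apply: cvgM; [exact: continuous_horner|exact: vx_cont].
have i1 r k : mu.-integrable `[-1, 1] (EFin \o (fun x => r.[x] * v k (dist2 s t x))).
  by apply: int_within => x; exact: c1.
have H j : (j <= n)%N -> \int[mu]_(x in `[-1, 1]) ((rodrigues R n)^`(n).[x] * v 1 (dist2 s t x)) =
    (- (s * t)) ^+ j * \int[mu]_(x in `[-1, 1]) ((rodrigues R n)^`(n - j).[x] * v j.+1 (dist2 s t x)).
  elim: j => [|j IHj] jn; first by rewrite subn0 expr0 mul1r.
  rewrite (IHj (ltnW jn)) -(subnSK jn) derivnS parts//; last 2 first.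
  - by have [] := @rodrigues_derivn_root R n (n - j.+1)%N; first lia.
  - by have [] := @rodrigues_derivn_root R n (n - j.+1)%N; first lia.
  by rewrite exprSr; ring.
have -> : \int[mu]_(x in `[-1, 1]) (w 1 (Num.sqrt (dist2 s t x)) * (P n).[x]) =
   (2 ^+ n * n`!%:R)^-1 * \int[mu]_(x in `[-1, 1]) ((rodrigues R n)^`(n).[x] * v 1 (dist2 s t x)).
  rewrite -RintegralZl//; apply: eq_Rintegral => x _.
  by rewrite legendreE hornerZ /v; ring.
rewrite (H n (leqnn n)) subnn.
have -> : \int[mu]_(x in `[-1, 1]) ((rodrigues R n)^`(0).[x] * v n.+1 (dist2 s t x)) = (-1) ^+ n * q n s t.
  rewrite /q -RintegralZl//; apply: eq_Rintegral => x _.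
  by rewrite derivn0 /rodrigues pwE horner_exp hornerD hornerN hornerXn hornerC mulrA -exprMn mulN1r opprB.
rewrite q_closed// mulrA -exprMn mulrN1 opprK exprMn exprS.
have f0 : n`!%:R != 0 :> R by rewrite pnatr_eq0 -lt0n fact_gt0.
have z0 : 2 ^+ n != 0 :> R by rewrite expf_neq0.
by field; rewrite f0.
Qed.

End Gegenbauer.

Section Multipole.
Variable R : realType.
Notation mu := (@lebesgue_measure R).
Notation P := (@legendre R).

Lemma sin_multipole n (s t : R) : 0 < t < s ->
  \int[mu]_(x in `[-1, 1]) (sin (Num.sqrt (dist2 s t x)) / Num.sqrt (dist2 s t x) * (P n).[x]) =
  2 * sph_bessel_j n s * sph_bessel_j n t.
Proof.
move=> ts; rewrite !bessel_jE -(legendre_multipole (@W_seq R)) => [|s' t' _|//].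
  apply: eq_Rintegral => x; rewrite inE/= in_itv/= => x1; congr (_ * _).
  have d0 : 0 < Num.sqrt (dist2 s t x) by rewrite sqrtr_gt0 dist2_gt0.
  by rewrite -W1 mulrC mulKf// lt0r_neq0.
by rewrite !W0 !W1 cosB cosD; ring.
Qed.

Lemma cos_multipole n (s t : R) : 0 < t < s ->
  \int[mu]_(x in `[-1, 1]) (cos (Num.sqrt (dist2 s t x)) / Num.sqrt (dist2 s t x) * (P n).[x]) =
  - (2 * sph_bessel_y n s * sph_bessel_j n t).
Proof.
move=> /[dup] ts /andP[t0 ts']; have s0 : 0 < s by exact: lt_trans ts'.
rewrite bessel_jE bessel_yE// -(legendre_multipole (@Z_seq R)) => [|s' t' /andP[t1 ts1]|//].
  rewrite -[RHS]mulN1r -RintegralZl//; last first.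
    apply: cont_integrable => x x1.
    have c1 : {for x, continuous (fun y => Z 1 (Num.sqrt (dist2 s t y)))}.
      by apply: kernel_cont => //; exact: Z_seq.
    by apply: cvgM; [exact: c1|exact: continuous_horner].
  apply: eq_Rintegral => x; rewrite inE/= in_itv/= => x1; rewrite mulrA; congr (_ * _).
  have d0 : 0 < Num.sqrt (dist2 s t x) by rewrite sqrtr_gt0 dist2_gt0.
  by rewrite Z1// mulN1r mulNr opprK.
have s1 : 0 < s' by exact: lt_trans ts1.
rewrite !Z0 Z1// W1 sinB sinD; field.
by rewrite lt0r_neq0.
Qed.

End Multipole.

(** * The volume potential *)
Section Newton.
Variable R : realType.
Notation mu := (@lebesgue_measure R).
Local Open Scope ereal_scope.

Definition mu3 := @prod_sf _ _ (measurableTypeR R * measurableTypeR R)%type (measurableTypeR R) R (mu2 R) mu.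

Lemma enormE (x : R * R * R) : enorm x = Num.sqrt (x.1.1 ^+ 2 + x.1.2 ^+ 2 + x.2 ^+ 2)%R.
Proof. by []. Qed.

Lemma enormBE (x y : R * R * R) : enorm (x - y)%R =
  Num.sqrt ((x.1.1 - y.1.1) ^+ 2 + (x.1.2 - y.1.2) ^+ 2 + (x.2 - y.2) ^+ 2)%R.
Proof. by []. Qed.

Lemma enorm_ge0 (x : R * R * R) : (0 <= enorm x)%R.
Proof. exact: sqrtr_ge0. Qed.

Lemma sqr_enorm (x : R * R * R) : (enorm x ^+ 2 = x.1.1 ^+ 2 + x.1.2 ^+ 2 + x.2 ^+ 2)%R.
Proof. by rewrite sqr_sqrtr// !addr_ge0 ?sqr_ge0. Qed.

Lemma enormC (x y : R * R * R) : enorm (x - y)%R = enorm (y - x)%R.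
Proof. by rewrite !enormBE; congr (Num.sqrt _); ring. Qed.

Lemma enorm_spherical (r a b : R) : (0 <= r)%R -> enorm (spherical (r, a, b)) = r.
Proof.
move=> r0; rewrite enormE /spherical /= -[RHS]ger0_norm// -sqrtr_sqr; congr (Num.sqrt _).
rewrite !exprMn !(mulrC _ (cos b ^+ 2)%R) !(mulrC _ (sin b ^+ 2)%R) -mulrDl.
by rewrite cos2Dsin2 mul1r -mulrDr addrC cos2Dsin2 mulr1.
Qed.

Lemma enormB_le (d : R) (x y : R * R * R) : (enorm x <= d)%R -> (enorm y <= d)%R ->
  (enorm (x - y) <= 2 * d)%R.
Proof.
move=> xd yd; have x0 := enorm_ge0 x; have y0 := enorm_ge0 y.
have d0 : (0 <= d)%R by exact: le_trans xd.
rewrite -(ler_pXn2r (n := 2))// ?nnegrE ?enorm_ge0 ?mulr_ge0//.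
have hx : (enorm x ^+ 2 <= d ^+ 2)%R by rewrite lerXn2r ?nnegrE.
have hy : (enorm y ^+ 2 <= d ^+ 2)%R by rewrite lerXn2r ?nnegrE.
move: hx hy; rewrite !sqr_enorm /=.
move: (x.1.1) (x.1.2) (x.2) (y.1.1) (y.1.2) (y.2) => a b c a' b' c'.
have := sqr_ge0 (a + a')%R; have := sqr_ge0 (b + b')%R; have := sqr_ge0 (c + c')%R.
by rewrite !expr2; nra.
Qed.

Let c1 : measurable_fun [set: R * R * R] (fun q : R * R * R => q.1.1).
Proof. exact: (measurableT_comp measurable_fst measurable_fst). Qed.
Let c2 : measurable_fun [set: R * R * R] (fun q : R * R * R => q.1.2).
Proof. exact: (measurableT_comp measurable_snd measurable_fst). Qed.
Let c3 : measurable_fun [set: R * R * R] (fun q : R * R * R => q.2).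
Proof. exact: measurable_snd. Qed.

Lemma measurable_enorm : measurable_fun [set: R * R * R] (@enorm R).
Proof.
apply: (measurableT_comp (@measurable_sqrtr R)).
by apply: measurable_funD; [apply: measurable_funD|]; exact: measurable_funX.
Qed.

Lemma measurable_subl3 (c : R * R * R) : measurable_fun [set: R * R * R] (fun y => c - y)%R.
Proof.
apply/measurable_fun_pairP; split => /=.
  apply/measurable_fun_pairP; split => /=.
    by apply: measurable_funB; [exact: measurable_cst|exact: c1].
  by apply: measurable_funB; [exact: measurable_cst|exact: c2].
by apply: measurable_funB; [exact: measurable_cst|exact: c3].
Qed.

Lemma measurable_subr3 (c : R * R * R) : measurable_fun [set: R * R * R] (fun y => y - c)%R.
Proof.
apply/measurable_fun_pairP; split => /=.
  apply/measurable_fun_pairP; split => /=.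
    by apply: measurable_funB; [exact: c1|exact: measurable_cst].
  by apply: measurable_funB; [exact: c2|exact: measurable_cst].
by apply: measurable_funB; [exact: c3|exact: measurable_cst].
Qed.

Lemma measurable_cball3 (d : R) : measurable (cball3 d : set (R * R * R)).
Proof.
have := measurable_enorm measurableT (measurable_itv `]-oo, d]).
by rewrite setTI; congr measurable; apply/seteqP; split => x; rewrite /cball3 /= in_itv.
Qed.

Lemma integral_shift3 (c : R * R * R) (h : R * R * R -> \bar R) :
  measurable_fun [set: R * R * R] h -> (forall x, 0 <= h x) ->
  \int[mu3]_y h y = \int[mu3]_y h (y + c)%R.
Proof.
move=> mh h0; have mhc : measurable_fun [set: R * R * R] (fun y => h (y + c)%R).
  apply: (measurableT_comp mh).
  apply/measurable_fun_pairP; split => /=; last exact: measurable_funD.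
  by apply/measurable_fun_pairP; split => /=; exact: measurable_funD.
have hc0 y : 0 <= h (y + c)%R by [].
have m2 (g : R * R * R -> \bar R) (z : R) : measurable_fun [set: R * R * R] g ->
    measurable_fun [set: R * R] (fun p : R * R => g (p, z)).
  by move=> mg; apply: (measurableT_comp mg); exact: measurable_pair2.
have mg (g : R * R * R -> \bar R) : measurable_fun [set: R * R * R] g -> (forall x, 0 <= g x) ->
    measurable_fun [set: R] (fun z : R => \int[mu \x mu]_p g (p, z)).
  move=> mg g0; exact: (@measurable_fun_fubini_tonelli_G _ _ (measurableTypeR R * measurableTypeR R)%type
    (measurableTypeR R) R (mu2 R) g mg g0).
rewrite [LHS](tonelli3 mh h0) [RHS](tonelli3 mhc hc0).
rewrite (integral_shift c.2 (mg h mh h0)); last by move=> z; exact: integral_ge0.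
apply: eq_integral => z _.
have m4 : measurable_fun [set: R * R] (fun p : R * R => h (p, (z + c.2)%R)) by exact: m2.
have m5 : measurable_fun [set: R * R] (fun p : R * R => h ((p, z) + c)%R).
  exact: (m2 (fun y => h (y + c)%R)).
rewrite (tonelli2 m4)// [RHS](tonelli2 m5)//.
rewrite (integral_shift c.1.2); last 2 first.
- exact: (@measurable_fun_fubini_tonelli_G _ _ (measurableTypeR R) (measurableTypeR R) R mu _ m4).
- by move=> y; exact: integral_ge0.
apply: eq_integral => y _; apply: integral_shift => //.
by apply: (measurableT_comp m4); exact: measurable_pair2.
Qed.

Definition box (d : R) : set (R * R * R) :=
  (`[0%R, d]%classic `*` `[0%R, pi]%classic) `*` `[0%R, pi]%classic.

Lemma measurable_box (d : R) : measurable (box d).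
Proof. by apply: measurableX; [apply: measurableX|]; exact: measurable_itv. Qed.

Lemma mu3_box (d : R) : (0 <= d)%R -> mu3 (box d) = (d * pi * pi)%:E.
Proof.
move=> d0; have h0 := mu_itv d0; have h1 := mu_itv (pi_ge0 R); rewrite !subr0 in h0 h1.
transitivity (mu `[0%R, d]%classic * mu `[0%R, pi]%classic * mu `[0%R, pi]%classic).
  transitivity ((mu2 R) (`[0%R, d]%classic `*` `[0%R, pi]%classic) * mu `[0%R, pi]%classic).
    apply: (@product_measure1E _ _ (measurableTypeR R * measurableTypeR R)%type (measurableTypeR R) R (mu2 R) mu).
      by apply: measurableX; exact: measurable_itv.
    exact: measurable_itv.
  congr (_ * _); apply: (@product_measure1E _ _ (measurableTypeR R) (measurableTypeR R) R mu mu).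
    exact: measurable_itv.
  exact: measurable_itv.
by rewrite h0 h1 -!EFinM.
Qed.

(** Translation to the pole and spherical coordinates: the Jacobian [r ^ 2]
    cancels the singularity. *)
Lemma newton_bound (d : R) (x : R * R * R) : (0 <= d)%R -> (enorm x <= d)%R ->
  \int[mu3]_(y in cball3 d) ((enorm (x - y))^-1)%:E <= (2 * (2 * d) * (2 * d * pi * pi))%:E.
Proof.
move=> d0 xd.
pose I (r : R) : R := \1_(`]-oo, (2 * d)%R]%classic : set R) r.
have IE (r : R) : I r = ((nat_of_bool (r <= 2 * d)%R)%:R)%R.
  rewrite /I indicE; congr (((nat_of_bool _)%:R)%R); apply/idP/idP; rewrite inE/= in_itv//=.
have mI : measurable_fun [set: R] I by apply: measurable_indic; exact: measurable_itv.
pose h (y : R * R * R) : \bar R := (I (enorm y) * (enorm y)^-1)%:E.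
have mh : measurable_fun [set: R * R * R] h.
  apply/measurable_EFinP; apply: measurable_funM.
    exact: (measurableT_comp mI measurable_enorm).
  exact: (measurableT_comp (@measurable_invr R) measurable_enorm).
have h0 y : 0 <= h y by rewrite lee_fin mulr_ge0// ?IE// invr_ge0 enorm_ge0.
have mB := measurable_cball3 d.
have mN : measurable_fun [set: R * R * R] (fun y => (enorm (x - y))^-1%R).
  apply: (measurableT_comp (@measurable_invr R)); apply: (measurableT_comp measurable_enorm).
  exact: measurable_subl3.
have mr : measurable_fun [set: R * R * R] ((fun y => ((enorm (x - y)%R)^-1)%:E) \_ (cball3 d)).
  apply: (measurable_restrictT _ mB).1.
  by apply: measurable_funTS; exact/measurable_EFinP.
(* the ball lies in the ball of radius [2 d] about [x] *)
apply: (@le_trans _ _ (\int[mu3]_y h (y - x)%R)).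
  rewrite integral_mkcond; apply: ge0_le_integral => //.
  - by move=> y _; rewrite patchE; case: ifPn => // _; rewrite lee_fin invr_ge0 enorm_ge0.
  - apply: (measurableT_comp mh).
    exact: measurable_subr3.
  - move=> y _; rewrite patchE; case: ifPn => [/set_mem yd|_]; last exact: h0.
    by rewrite lee_fin IE enormC enormB_le ?mul1r.
rewrite -(integral_shift3 (- x)%R mh h0).
have he y : h y = h (y.1.1, y.1.2, y.2) by case: y => [[]].
rewrite (_ : \int[mu3]_y h y = \int[(mu \x mu) \x mu]_y h y)//.
rewrite spherical_coordinates//; last first.
  by move=> a b c; rewrite /h !enormE /= sqrrN.
pose k q := h (spherical q) * (sph_jac q)%:E.
have mk : measurable_fun [set: R * R * R] k.
  apply: emeasurable_funM; first exact: (measurableT_comp mh (@measurable_spherical R)).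
  by apply/measurable_EFinP; exact: measurable_sph_jac.
have kE : \int[mu3]_q k q = \int[mu3]_(q in box (2 * d)%R) k q.
  rewrite [RHS]integral_mkcond; apply: eq_integral => -[[r a] b] _; rewrite patchE.
  case: ifPn => //; rewrite notin_setE /box /= => hq; rewrite /k /sph_jac /= !ind_piE ind_posE.
  have [r0|_] := boolP (0 < r)%R; last by rewrite !(mulr0, mul0r) mule0.
  have [a0|_] := boolP (0 < a < pi)%R; last by rewrite !(mulr0, mul0r) mule0.
  have [b0|_] := boolP (0 < b < pi)%R; last by rewrite !(mulr0, mul0r) mule0.
  rewrite /h enorm_spherical ?ltW// IE.
  have [rd|_] := boolP (r <= 2 * d)%R; last by rewrite mul0r mul0e.
  exfalso; apply: hq; split; first split; rewrite /= in_itv/=.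
  - by rewrite ltW.
  - by case/andP: a0 => ? ?; rewrite !ltW.
  - by case/andP: b0 => ? ?; rewrite !ltW.
have key (r a b : R) : (0 <= r)%R -> (r <= 2 * d)%R -> k (r, a, b) <= (2 * (2 * d))%:E.
  move=> r0 rd; rewrite /k /sph_jac /= /h enorm_spherical// IE rd mul1r -EFinM lee_fin ind_posE.
  move: r0; rewrite le_eqVlt => /predU1P[<-|r0]; first by rewrite ltxx invr0 mul0r !mulr_ge0.
  rewrite r0 mulr1.
  have s1 : (sin a * ind_pi a <= 1)%R.
    by rewrite ind_piE; case: ifPn => _; rewrite ?mulr0// mulr1 sin_le1.
  have i1 : (ind_pi b <= 1)%R by rewrite ind_piE; case: ifPn.
  have -> : (r^-1 * (2 * r ^+ 2 * (sin a * ind_pi a) * ind_pi b) =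
     2 * r * ((sin a * ind_pi a) * ind_pi b))%R by field; rewrite lt0r_neq0.
  have s0 := sin_ind_ge0 a; have i0 := ind_pi_ge0 b.
  have h1 : (sin a * ind_pi a * ind_pi b <= 1)%R by rewrite mulr_ile1.
  have h2 : (2 * r <= 2 * (2 * d))%R by rewrite ler_pM2l.
  apply: le_trans h2; rewrite -[leRHS]mulr1 ler_wpM2l//.
  by apply: mulr_ge0 => //; exact: ltW.
rewrite -[X in X <= _]/(\int[mu3]_q k q) kE EFinM -(mu3_box (mulr_ge0 (ler0n R 2) d0)).
rewrite -integral_cst//; last exact: measurable_box.
apply: ge0_le_integral => //.
- exact: measurable_box.
- by move=> q _; rewrite /k mule_ge0// lee_fin sph_jac_ge0.
- exact: measurable_funTS.
- by move=> [[r a] b] [[/= + _] _]; rewrite in_itv/= => /andP[]; exact: key.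
Qed.

End Newton.

(** * Legendre coefficients of the volume potential *)
Section IntegrableProduct.
Context d1 d2 (T1 : measurableType d1) (T2 : measurableType d2) (R : realType).
Variables (m1 : {sigma_finite_measure set T1 -> \bar R})
          (m2 : {sigma_finite_measure set T2 -> \bar R}).

(** Tonelli's criterion. *)
Lemma integrable_prod_bound (D : set T1) (E : set T2) (f : T1 * T2 -> R) (B : R) :
  measurable D -> measurable E -> (m1 D < +oo)%E -> measurable_fun setT f ->
  (forall x, D x -> (\int[m2]_(y in E) `|f (x, y)|%:E <= B%:E)%E) ->
  (m1 \x m2)%E.-integrable (D `*` E) (EFin \o f).
Proof.
move=> mD mE Doo mf fB; have mDE : measurable (D `*` E) by exact: measurableX.
apply/integrableP; split; first by apply/measurable_EFinP; exact: measurable_funTS.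
pose F : T1 * T2 -> \bar R := (fun z => `|(f z)%:E|%E) \_ (D `*` E).
have mF : measurable_fun setT F.
  apply: (measurable_restrictT _ mDE).1; apply: measurable_funTS.
  by apply: measurableT_comp => //; exact/measurable_EFinP.
have F0 z : (0 <= F z)%E by rewrite /F patchE; case: ifPn.
rewrite integral_mkcond -/F (fubini_tonelli1 _ mF F0).
apply: (@le_lt_trans _ _ (\int[m1]_(x in D) (`|B|%:E))%E); last first.
  rewrite integral_cst// lte_mul_pinfty//.
rewrite [leRHS]integral_mkcond; apply: ge0_le_integral => //.
- by move=> x _; exact: integral_ge0.
- exact: (measurable_fun_fubini_tonelli_F F).
- apply: (measurable_restrictT _ mD).1; exact: measurable_cst.
- move=> x _; rewrite patchE; case: ifPn => [/set_mem Dx|].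
    rewrite /fubini_F; apply: (@le_trans _ _ B%:E); last by rewrite lee_fin ler_norm.
    apply: le_trans (fB x Dx); rewrite [leRHS]integral_mkcond le_eqVlt; apply/orP; left; apply/eqP.
    apply: eq_integral => y _; rewrite /F /patch; case: ifPn => [/set_mem[_ Ey]|].
      by rewrite mem_set.
    by rewrite notin_setE => h; rewrite memNset// => Ey; exact: h.
  rewrite notin_setE => Dx; rewrite /fubini_F integral0_eq// => y _.
  by rewrite /F /patch memNset// => -[].
Qed.

End IntegrableProduct.

Section SignedSpherical.
Variable R : realType.
Notation mu := (@lebesgue_measure R).
Local Open Scope ereal_scope.

Definition sph_domain (d : R) : set (R * R * R) :=
  (`[0%R, d]%classic `*` `[0%R, pi]%classic) `*` `]0%R, pi[%classic.

Lemma measurable_sph_domain (d : R) : measurable (sph_domain d).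
Proof. by apply: measurableX; [apply: measurableX|]; exact: measurable_itv. Qed.

(** For signed functions the formula holds for the positive and for the negative
    part. *)
Lemma spherical_ball (d : R) (F : R * R * R -> R) :
  (mu3 R).-integrable (cball3 d) (EFin \o F) ->
  (forall x y z, F (x, (- y)%R, z) = F (x, y, z)) ->
  let F' := (fun q => F (spherical q) * (2 * q.1.1 ^+ 2 * sin q.1.2))%R in
  (mu3 R).-integrable (sph_domain d) (EFin \o F') /\
  (\int[mu3 R]_(y in cball3 d) F y = \int[mu3 R]_(q in sph_domain d) F' q)%R.
Proof.
move=> iF Fe F'.
have mB := @measurable_cball3 R d; have mQ := measurable_sph_domain d.
pose G : R * R * R -> \bar R := (EFin \o F) \_ (cball3 d).
have iG : (mu3 R).-integrable setT G.
  exact: ((@integrable_mkcond _ _ _ (mu3 R) (cball3 d) (EFin \o F) mB).1 iF).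
have mG : measurable_fun [set: R * R * R] G by have /integrableP[] := iG.
have Ge x y z : G (x, (- y)%R, z) = G (x, y, z).
  rewrite /G !patchE /= Fe; congr (if _ then _ else _).
  by apply/idP/idP; rewrite !inE /cball3 /= !enormE /= sqrrN.
have HE q : G (spherical q) * (sph_jac q)%:E = ((EFin \o F') \_ (sph_domain d)) q.
  case: q => [[r a] b]; rewrite /sph_jac /= [RHS]patchE; case: ifPn => [/set_mem|].
    move=> [[/= + +] +]; rewrite !in_itv/= => /andP[r0 rd] aI bI.
    rewrite /G patchE mem_set; last by rewrite /cball3 /= enorm_spherical.
    rewrite -EFinM /F' /=; congr (_ * _)%:E; rewrite ind_posE !ind_piE bI mulr1.
    move: r0; rewrite le_eqVlt => /predU1P[<-|r0]; first by rewrite expr0n/= !(mul0r, mulr0).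
    rewrite r0 mulr1; case: ifPn => a0; first by rewrite mulr1.
    move: aI a0; rewrite !le_eqVlt => /andP[/predU1P[<-|a0]]; first by rewrite sin0 !(mulr0, mul0r).
    by move=> /predU1P[->|a1]; [rewrite sinpi !(mulr0, mul0r)|rewrite a0 a1].
  rewrite notin_setE => hq.
  have [/andP[/andP[r0 aI] bI]|] := boolP ((0 < r) && (0 < a < pi) && (0 < b < pi))%R; last first.
    rewrite ind_posE !ind_piE; case: ifPn => r0; last by rewrite !(mulr0, mul0r) mule0.
    case: ifPn => a0; last by rewrite !(mulr0, mul0r) mule0.
    by rewrite /= => /negbTE ->; rewrite !(mulr0, mul0r) mule0.
  rewrite /G patchE memNset ?mul0e// /cball3 /= (enorm_spherical _ _ (ltW r0)) => rd.
  apply: hq; split; first split; rewrite /= in_itv/=.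
  - by rewrite ltW.
  - by case/andP: aI => ? ?; rewrite !ltW.
  - exact: bI.
have mS : measurable_fun [set: R * R * R] (G \o @spherical R).
  exact: (measurableT_comp mG (@measurable_spherical R)).
have mJ := @measurable_sph_jac R.
have mH : measurable_fun [set: R * R * R] (fun q => G (spherical q) * (sph_jac q)%:E).
  by apply: emeasurable_funM; [exact: mS|exact/measurable_EFinP].
have sphG (K : \bar R -> \bar R) : measurable_fun setT K -> (forall x, 0 <= K x) ->
    \int[mu3 R]_y K (G y) = \int[mu3 R]_q (K (G (spherical q)) * (sph_jac q)%:E).
  move=> mK K0; apply: (@spherical_coordinates R (fun y => K (G y))).
  - exact: (measurableT_comp mK mG).
  - by move=> y; exact: K0.
  - by move=> x y z; rewrite Ge.
have iH : (mu3 R).-integrable setT (fun q => G (spherical q) * (sph_jac q)%:E).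
  apply/integrableP; split; first exact: mH.
  have := sphG abse (@abse_measurable R setT) (@abse_ge0 R) => e.
  apply: (@le_lt_trans _ _ (\int[mu3 R]_y `|G y|)); last by have /integrableP[] := iG.
  rewrite e le_eqVlt; apply/orP; left; apply/eqP; apply: eq_integral => q _.
  by rewrite abseM [X in _ * X]gee0_abs// lee_fin sph_jac_ge0.
split.
  apply: (@integrable_mkcond _ _ _ (mu3 R) (sph_domain d) (EFin \o F') mQ).2.
  by apply: eq_integrable iH => // q _; exact: HE.
rewrite /Rintegral; congr fine.
rewrite [LHS]integral_mkcond -/G [RHS]integral_mkcond.
transitivity (\int[mu3 R]_q (G (spherical q) * (sph_jac q)%:E)); last first.
  by apply: eq_integral => q _; exact: HE.
rewrite [LHS]integralE [RHS]integralE; congr (_ - _).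
  transitivity (\int[mu3 R]_q (maxe (G (spherical q)) 0 * (sph_jac q)%:E)).
    have h0 (x : \bar R) : 0 <= maxe x 0 by rewrite le_max lexx orbT.
    have hm : measurable_fun setT (fun x : \bar R => maxe x 0).
      by apply: measurable_maxe; [exact: measurable_id|exact: measurable_cst].
    rewrite -(sphG _ hm h0); apply: eq_integral => y _; exact: funeposE.
  apply: eq_integral => q _.
  by rewrite funeposE -{2}(mul0e (sph_jac q)%:E) maxe_pMl// lee_fin sph_jac_ge0.
transitivity (\int[mu3 R]_q (maxe (- G (spherical q)) 0 * (sph_jac q)%:E)).
  have h0 (x : \bar R) : 0 <= maxe (- x) 0 by rewrite le_max lexx orbT.
  have hm : measurable_fun setT (fun x : \bar R => maxe (- x) 0).
    by apply: measurable_maxe; [exact: oppe_measurable|exact: measurable_cst].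
  rewrite -(sphG _ hm h0); apply: eq_integral => y _; exact: funenegE.
apply: eq_integral => q _.
by rewrite funenegE -mulNe -{2}(mul0e (sph_jac q)%:E) maxe_pMl// lee_fin sph_jac_ge0.
Qed.

End SignedSpherical.

Lemma sph_norm (R : realType) (r a : R) : 0 <= r ->
  enorm ((r * sin a, 0, r * cos a) : R * R * R) = r.
Proof.
move=> r0; rewrite enormE /= expr0n addr0 !exprMn -mulrDr addrC cos2Dsin2 mulr1.
by rewrite sqrtr_sqr ger0_norm.
Qed.

Lemma measurable_sph (R : realType) (f : R * R * R -> R) :
  measurable_fun setT f -> measurable_fun [set: R * R] (sph f).
Proof.
move=> mf; apply: (measurableT_comp mf).
apply/measurable_fun_pairP; split => /=.
  apply/measurable_fun_pairP; split => /=; last exact: measurable_cst.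
  apply: measurable_funM; first exact: measurable_fst.
  exact: (measurableT_comp (@measurable_sin R) measurable_snd).
apply: measurable_funM; first exact: measurable_fst.
exact: (measurableT_comp (@measurable_cos R) measurable_snd).
Qed.

Section Potential.
Variable R : realType.
Notation mu := (@lebesgue_measure R).
Notation P := (@legendre R).
Variables (d : R) (g : R -> R) (C : R) (f : R * R * R -> R) (M : R).
Hypothesis d0 : 0 < d.
Hypothesis mg : measurable_fun setT g.
Hypothesis C0 : 0 <= C.
Hypothesis gC : forall r, 0 <= r -> `|g r| <= C * r^-1.
Hypothesis gcont : forall r, 0 < r -> {for r, continuous g}.
Hypothesis mf : measurable_fun setT f.
Hypothesis M0 : 0 <= M.
Hypothesis fM : forall y, cball3 d y -> `|f y| <= M.
Hypothesis faxi : axisymmetric f.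

(** A rotation about the axis maps [(x, y, z)] to [(x, - y, z)]. *)
Lemma axisymmetric_even (x y z : R) : f (x, - y, z) = f (x, y, z).
Proof.
have [r0|r0] := eqVneq (x ^+ 2 + y ^+ 2) 0.
  have y0 : y = 0.
    apply/eqP; rewrite -sqrf_eq0; apply/eqP.
    by have := sqr_ge0 x; have := sqr_ge0 y; lra.
  by rewrite y0 oppr0.
pose r : R := Num.sqrt (x ^+ 2 + y ^+ 2).
have rp : 0 < x ^+ 2 + y ^+ 2 by rewrite lt0r r0 addr_ge0 ?sqr_ge0.
have rgt : 0 < r by rewrite sqrtr_gt0.
have rn : r != 0 by rewrite lt0r_neq0.
have r2 : r ^+ 2 = x ^+ 2 + y ^+ 2 by rewrite sqr_sqrtr// ltW.
have xr : -1 <= x / r <= 1.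
  rewrite ler_pdivlMr// ler_pdivrMr// mulN1r mul1r -ler_norml.
  by rewrite -sqrtr_sqr /r ler_wsqrtr// lerDl sqr_ge0.
pose a := acos (x / r).
have ca : cos a = x / r by rewrite acosK// in_itv.
have sa : sin a = Num.sqrt (1 - (x / r) ^+ 2) by exact: sin_acos.
have sy : `|y| = r * sin a.
  have e : (r * sin a) ^+ 2 = y ^+ 2.
    rewrite exprMn sin2cos2 ca exprMn exprVn mulrBr mulr1 mulrCA mulfV ?sqrf_eq0// mulr1 r2.
    by ring.
  have rs0 : 0 <= r * sin a by rewrite mulr_ge0 ?(ltW rgt)// sa sqrtr_ge0.
  by rewrite -sqrtr_sqr -e sqrtr_sqr ger0_norm.
have xE : x = cos a * r - sin a * 0 by rewrite ca mulr0 subr0 divfK.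
have h : f (x, `|y|, z) = f (r, 0, z).
  have <- := faxi a r 0 z; rewrite -xE mulr0 addr0.
  by rewrite [sin a * r]mulrC -sy.
have h' : f (x, - `|y|, z) = f (r, 0, z).
  have <- := faxi (- a) r 0 z; rewrite cosN sinN !(mulr0, addr0, oppr0).
  rewrite [in RHS]ca divfK// [- sin a * r]mulNr [sin a * r]mulrC -sy.
  by [].
have [y0|y0] := ger0P y.
  by move: h h'; rewrite ger0_norm// => -> ->.
by move: h h'; rewrite ltr0_norm// opprK => -> ->.
Qed.

Lemma axisymmetric_spherical r a b : f (spherical (r, a, b)) = sph f (r, a).
Proof.
rewrite /sph /spherical /= -(faxi b (r * sin a) 0 (r * cos a)) !mulr0 subr0 addr0.
by rewrite [cos b * _]mulrC [sin b * _]mulrC.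
Qed.

Let g0 : g 0 = 0.
Proof. by apply/eqP; rewrite -normr_le0; have := gC (lexx 0); rewrite invr0 mulr0. Qed.

Let mball := @measurable_cball3 R d.

Lemma potential_integrable x : enorm x <= d ->
  (mu3 R).-integrable (cball3 d) (EFin \o (fun y => g (enorm (x - y)) * f y)).
Proof.
move=> xd; apply/integrableP; split.
  apply/measurable_EFinP; apply: measurable_funTS; apply: measurable_funM => //.
  apply: (measurableT_comp mg); apply: (measurableT_comp (@measurable_enorm R)).
  exact: measurable_subl3.
have := newton_bound (ltW d0) xd; set N := (_ * _ in X in (_ <= X)%E) => hN.
apply: (@le_lt_trans _ _ ((C * M)%:E * N%:E)%E); last by rewrite -EFinM ltry.
have mN : measurable_fun [set: R * R * R] (fun y => (enorm (x - y))^-1).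
  apply: (measurableT_comp (@measurable_invr R)); apply: (measurableT_comp (@measurable_enorm R)).
  exact: measurable_subl3.
apply: (@le_trans _ _ (\int[mu3 R]_(y in cball3 d) ((C * M)%:E * ((enorm (x - y))^-1)%:E))%E).
  apply: ge0_le_integral => //.
  - apply: measurableT_comp => //; apply/measurable_EFinP; apply: measurable_funTS.
    apply: measurable_funM => //.
    apply: (measurableT_comp mg); apply: (measurableT_comp (@measurable_enorm R)).
    exact: measurable_subl3.
  - apply: measurable_funTS; apply/measurable_EFinP; apply: measurable_funM => //.
  - move=> y yd /=; rewrite lee_fin normrM mulrAC ler_pM ?fM//.
    exact: gC (enorm_ge0 _).
rewrite ge0_integralZl//.
- by apply: lee_wpmul2l => //; rewrite lee_fin mulr_ge0.
- by apply: measurable_funTS; exact/measurable_EFinP.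
- by move=> y _; rewrite lee_fin invr_ge0 enorm_ge0.
- by rewrite lee_fin mulr_ge0.
Qed.

Variables (n : nat) (s : R).
Hypothesis s0 : 0 < s.
Hypothesis sd : s <= d.

Let pt (a : R) : R * R * R := (s * sin a, 0, s * cos a).
Let legendre_sin (a : R) : R := (P n).[cos a] * sin a.
Let k (z : R * (R * R * R)) : R := g (enorm (pt z.1 - z.2)) * f z.2 * legendre_sin z.1.

Local Lemma pt_norm a : enorm (pt a) = s.
Proof.
rewrite enormE /pt /= expr0n addr0 !exprMn -mulrDr addrC cos2Dsin2 mulr1.
by rewrite sqrtr_sqr gtr0_norm.
Qed.

Local Lemma legendre_sin_le1 a : `|legendre_sin a| <= 1.
Proof. by rewrite normrM mulr_ile1 ?legendre_cos_le1 ?sin_abs_le1. Qed.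

Local Lemma m_legendre_sin : measurable_fun setT legendre_sin.
Proof. by apply: continuous_measurable_fun; exact: cont_theta. Qed.

Local Lemma measurable_k : measurable_fun [set: R * (R * R * R)] k.
Proof.
have m1 : measurable_fun [set: R * (R * R * R)] (fun z : R * (R * R * R) => z.1) by exact: measurable_fst.
have m2 : measurable_fun [set: R * (R * R * R)] (fun z : R * (R * R * R) => z.2) by exact: measurable_snd.
apply: measurable_funM; last exact: (measurableT_comp m_legendre_sin m1).
apply: measurable_funM; last exact: (measurableT_comp mf m2).
apply: (measurableT_comp mg); apply: (measurableT_comp (@measurable_sqrtr R)).
have m21 : measurable_fun [set: R * (R * R * R)] (fun z : R * (R * R * R) => z.2.1) by exact: (measurableT_comp measurable_fst m2).
have m211 : measurable_fun [set: R * (R * R * R)] (fun z : R * (R * R * R) => z.2.1.1) by exact: (measurableT_comp measurable_fst m21).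
have m212 : measurable_fun [set: R * (R * R * R)] (fun z : R * (R * R * R) => z.2.1.2) by exact: (measurableT_comp measurable_snd m21).
have m22 : measurable_fun [set: R * (R * R * R)] (fun z : R * (R * R * R) => z.2.2) by exact: (measurableT_comp measurable_snd m2).
have ms : measurable_fun [set: R * (R * R * R)] (fun z : R * (R * R * R) => s * sin z.1).
  by apply: measurable_funM; [exact: measurable_cst|exact: (measurableT_comp (@measurable_sin R) m1)].
have mc : measurable_fun [set: R * (R * R * R)] (fun z : R * (R * R * R) => s * cos z.1).
  by apply: measurable_funM; [exact: measurable_cst|exact: (measurableT_comp (@measurable_cos R) m1)].
apply: measurable_funD; first apply: measurable_funD.
- by apply: measurable_funX; exact: measurable_funB.
- by apply: measurable_funX; apply: measurable_funB => //; exact: measurable_cst.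
- by apply: measurable_funX; exact: measurable_funB.
Qed.

Local Lemma ik : (mu \x mu3 R)%E.-integrable (`[0, pi]%classic `*` cball3 d) (EFin \o k).
Proof.
apply: (@integrable_prod_bound _ _ (measurableTypeR R)
  (measurableTypeR R * measurableTypeR R * measurableTypeR R)%type R mu (mu3 R)
  `[0, pi] (cball3 d) k (C * M * (2 * (2 * d) * (2 * d * pi * pi)))).
- exact: measurable_itv.
- exact: mball.
- exact: mu_itv_oo.
- exact: measurable_k.
move=> a _; have ad : enorm (pt a) <= d by rewrite pt_norm.
have hN := newton_bound (ltW d0) ad.
have mN : measurable_fun [set: R * R * R] (fun y => (enorm (pt a - y))^-1).
  apply: (measurableT_comp (@measurable_invr R)); apply: (measurableT_comp (@measurable_enorm R)).
  exact: measurable_subl3.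
rewrite EFinM.
apply: (@le_trans _ _ (\int[mu3 R]_(y in cball3 d) ((C * M)%:E * ((enorm (pt a - y))^-1)%:E))%E).
  apply: ge0_le_integral => //.
  - apply/measurable_EFinP; apply: measurableT_comp => //; apply: measurable_funTS.
    by apply: (measurableT_comp measurable_k); exact: measurable_pair1.
  - apply: measurable_funTS; apply/measurable_EFinP; apply: measurable_funM => //.
  - move=> y yd /=; rewrite lee_fin /k normrM -[leRHS]mulr1 ler_pM ?legendre_sin_le1 ?mulr_ge0//.
    by rewrite normrM mulrAC ler_pM ?fM//; exact: gC (enorm_ge0 _).
rewrite ge0_integralZl//.
- by apply: lee_wpmul2l => //; rewrite lee_fin mulr_ge0.
- by apply: measurable_funTS; exact/measurable_EFinP.
- by move=> y _; rewrite lee_fin invr_ge0 enorm_ge0.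
- by rewrite lee_fin mulr_ge0.
Qed.

Let H (y : R * R * R) : R := \int[mu]_(a in `[0, pi]) k (a, y).

Local Lemma potential_swap :
  mu.-integrable `[0, pi] (EFin \o (fun a => \int[mu3 R]_(y in cball3 d) k (a, y))) /\
  \int[mu]_(a in `[0, pi]) \int[mu3 R]_(y in cball3 d) k (a, y) =
  \int[mu3 R]_(y in cball3 d) H y.
Proof.
have mpi := measurable_itv `[0, pi] : measurable (`[0, pi]%classic : set R).
have [i1 e1] := @Rintegral_fubini12 _ _ (measurableTypeR R)
  (measurableTypeR R * measurableTypeR R * measurableTypeR R)%type R mu (mu3 R) _ _ _ mpi mball ik.
have [_ e2] := @Rintegral_fubini21 _ _ (measurableTypeR R)
  (measurableTypeR R * measurableTypeR R * measurableTypeR R)%type R mu (mu3 R) _ _ _ mpi mball ik.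
by split => //; rewrite e1 -e2.
Qed.

Local Lemma iH : (mu3 R).-integrable (cball3 d) (EFin \o H).
Proof.
have mpi := measurable_itv `[0, pi] : measurable (`[0, pi]%classic : set R).
by have [] := @Rintegral_fubini21 _ _ (measurableTypeR R)
  (measurableTypeR R * measurableTypeR R * measurableTypeR R)%type R mu (mu3 R) _ _ _ mpi mball ik.
Qed.

Local Lemma H_even x y z : H (x, - y, z) = H (x, y, z).
Proof.
apply: eq_Rintegral => a _; rewrite /k /= axisymmetric_even; congr (g _ * _ * _).
by rewrite !enormBE /=; congr (Num.sqrt _); ring.
Qed.

Local Lemma dist_spherical a r b c :
  enorm (pt a - spherical (r, b, c)) = Num.sqrt (dist2 s r (cos a * cos b + sin a * sin b * cos c)).
Proof.
rewrite enormBE /pt /spherical /dist2 /=; congr (Num.sqrt _).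
have ha := cos2Dsin2 a; have hb := cos2Dsin2 b; have hc := cos2Dsin2 c.
have -> : s ^+ 2 = s ^+ 2 * (cos a ^+ 2 + sin a ^+ 2) by rewrite ha mulr1.
have -> : r ^+ 2 = r ^+ 2 * (cos b ^+ 2 + sin b ^+ 2 * (cos c ^+ 2 + sin c ^+ 2)).
  by rewrite hc mulr1 hb mulr1.
ring.
Qed.

Variable lam : R -> R.
Hypothesis lamE : forall r, 0 < r -> r != s ->
  \int[mu]_(x in `[-1, 1]) (g (Num.sqrt (dist2 s r x)) * (P n).[x]) = lam r.

Local Lemma dist2_ne r x : 0 < r -> r != s -> -1 <= x <= 1 -> 0 < dist2 s r x.
Proof.
move=> r0 rs x1; have /andP[h _] := dist2_bounds (ltW s0) (ltW r0) x1.
apply: lt_le_trans h; rewrite exprn_even_gt0//= subr_eq0 eq_sym; exact: rs.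
Qed.

Local Lemma zonal_kernel r : 0 < r -> r != s -> forall x, -1 <= x <= 1 ->
  {for x, continuous (fun x => g (Num.sqrt (dist2 s r x)))}.
Proof.
move=> r0 rs x x1; have h := dist2_ne r0 rs x1.
apply: (@continuous_comp _ _ _ (fun x => Num.sqrt (dist2 s r x)) g x); last first.
  by apply: gcont; rewrite sqrtr_gt0.
apply: (@continuous_comp _ _ _ (dist2 s r) Num.sqrt x); last exact: sqrt_continuous.
rewrite /dist2; apply: cvgB; first exact: cvg_cst.
by apply: cvgM; [exact: cvg_cst|exact: cvg_id].
Qed.

(** The azimuthal average of the kernel, by the Funk-Hecke formula. *)
Local Lemma azimuth r b : 0 < r -> r != s -> 0 <= b <= pi ->
  \int[mu]_(c in `]0, pi[) (H (spherical (r, b, c)) * (2 * r ^+ 2 * sin b)) =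
  2 * pi * (lam r * sph f (r, b) * ((P n).[cos b] * sin b * r ^+ 2)).
Proof.
move=> r0 rs bI.
pose phi x := g (Num.sqrt (dist2 s r x)).
have cphi := cont_clamp (zonal_kernel r0 rs).
pose K (c : R) : R := \int[mu]_(a in `[0, pi])
  (phi (clamp (cos a * cos b + sin a * sin b * cos c)) * (P n).[cos a] * sin a).
have HK c : H (spherical (r, b, c)) = sph f (r, b) * K c.
  have iK : mu.-integrable `[0, pi] (EFin \o (fun a => phi (clamp (cos a * cos b + sin a * sin b * cos c)) * (P n).[cos a] * sin a)).
    apply: cont_integrable => a _; apply: cvgM; last exact: continuous_sin.
    apply: cvgM; last exact: cont_horner_cos.
    apply: (@continuous_comp _ _ _ (fun a => cos a * cos b + sin a * sin b * cos c) (fun x => phi (clamp x)) a); last exact: cphi.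
    apply: cvgD; first by apply: cvgM; [exact: continuous_cos|exact: cvg_cst].
    apply: cvgM; last exact: cvg_cst.
    by apply: cvgM; [exact: continuous_sin|exact: cvg_cst].
  rewrite /K -RintegralZl//; apply: eq_Rintegral => a _.
  rewrite /k /= axisymmetric_spherical dist_spherical /phi /legendre_sin clamp_id; first by ring.
  by apply: zonal_le1; exact: cos_max.
have iz := @zonal_integrable R n b _ cphi.
have [iK eK] := fubini_lebesgue (measurable_itv `[0, pi]) (measurable_itv `[0, pi]) iz.
have KE : \int[mu]_(c in `]0, pi[) K c = pi * (P n).[cos b] * lam r.
  have -> : \int[mu]_(c in `]0, pi[) K c = \int[mu]_(c in `[0, pi]) K c.
    rewrite /Rintegral; congr fine; apply/esym/integral_itv_bndoo.
    have /integrableP[mK _] := iK.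
    apply: measurable_funS mK => //.
    by move=> x /=; rewrite !in_itv/= => /andP[x0 x1]; rewrite !ltW.
  rewrite (@funk_hecke R n b _ cphi); congr (_ * _).
  rewrite -(lamE r0 rs) -Rintegral_theta; last first.
    apply: cont_within => x x1; apply: cvgM; last exact: continuous_horner.
    exact: (zonal_kernel r0 rs x1).
  apply: eq_Rintegral => a _; rewrite /phi clamp_id//.
  by rewrite cos_geN1 cos_le1.
transitivity (\int[mu]_(c in `]0, pi[) ((sph f (r, b) * (2 * r ^+ 2 * sin b)) * K c)).
  by apply: eq_Rintegral => c _; rewrite HK; ring.
rewrite RintegralZl//; last first.
  have iK' : mu.-integrable `[0, pi] (EFin \o K) by exact: iK.
  apply: integrableS iK' => //.
  by move=> x /=; rewrite !in_itv/= => /andP[x0 x1]; rewrite !ltW.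
by rewrite KE; ring.
Qed.

(** The angular average of the volume potential: Fubini, then spherical
    coordinates for the source point. *)
Lemma potential_legendre :
  mu.-integrable `[0, pi] (EFin \o (fun a =>
    (\int[mu3 R]_(y in cball3 d) (g (enorm (pt a - y)) * f y)) * legendre_sin a)) /\
  \int[mu]_(a in `[0, pi]) ((\int[mu3 R]_(y in cball3 d) (g (enorm (pt a - y)) * f y)) * legendre_sin a) =
  \int[mu]_(r in `[0, d]) (2 * pi * \int[mu]_(b in `[0, pi])
    (lam r * sph f (r, b) * ((P n).[cos b] * sin b * r ^+ 2))).
Proof.
have ka a : \int[mu3 R]_(y in cball3 d) k (a, y) =
    (\int[mu3 R]_(y in cball3 d) (g (enorm (pt a - y)) * f y)) * legendre_sin a.
  by rewrite -RintegralZr//; apply: potential_integrable; rewrite pt_norm.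
have [i1 e1] := potential_swap.
split; first by apply: eq_integrable i1 => // a _; rewrite /= ka.
transitivity (\int[mu3 R]_(y in cball3 d) H y).
  by rewrite -e1; apply: eq_Rintegral => a _; rewrite ka.
have [iQ ->] := spherical_ball iH H_even.
set F' := fun q => _ in iQ *.
have mdp : measurable (`[0, d]%classic `*` `[0, pi]%classic : set (R * R)).
  by apply: measurableX; exact: measurable_itv.
have mpo : measurable (`]0, pi[%classic : set R) by exact: measurable_itv.
have [i2 <-] := @Rintegral_fubini12 _ _ (measurableTypeR R * measurableTypeR R)%type
  (measurableTypeR R) R (mu2 R) mu _ _ _ mdp mpo iQ.
have [i3 <-] := fubini_lebesgue (measurable_itv `[0, d]) (measurable_itv `[0, pi]) i2.
pose X r := \int[mu]_(b in `[0, pi]) \int[mu]_(c in `]0, pi[) F' (r, b, c).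
pose Y r := 2 * pi * \int[mu]_(b in `[0, pi]) (lam r * sph f (r, b) * ((P n).[cos b] * sin b * r ^+ 2)).
have XY r : 0 <= r <= d -> r != s -> X r = Y r.
  move=> /andP[+ rd] rs; rewrite le_eqVlt => /predU1P[<-|r0].
    rewrite /X /Y [in RHS](_ : (fun b => _) = cst 0); last first.
      by apply/funext => b; rewrite expr0n/= !mulr0.
    rewrite Rintegral_cst// mul0r mulr0 [LHS](_ : _ = \int[mu]_(b in `[0, pi]) (cst 0 b)); last first.
      apply: eq_Rintegral => b _; rewrite (_ : (fun c => _) = cst 0) ?Rintegral_cst ?mul0r//.
      by apply/funext => c; rewrite /F' /= expr0n/= mulr0 mul0r mulr0.
    by rewrite Rintegral_cst// mul0r.
  rewrite /X /Y.
  have rI : `[0, d]%classic r by rewrite /= in_itv/= (ltW r0).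
  have e b : 0 <= b <= pi -> \int[mu]_(c in `]0, pi[) F' (r, b, c) =
      2 * pi * (lam r * sph f (r, b) * ((P n).[cos b] * sin b * r ^+ 2)).
    by move=> bI; exact: azimuth.
  have ib : mu.-integrable `[0, pi] (EFin \o (fun b => lam r * sph f (r, b) * ((P n).[cos b] * sin b * r ^+ 2))).
    apply: (bounded_integrable (M := `|lam r| * M * (1 * `|r ^+ 2|))).
    - exact: measurable_itv.
    - exact: mu_itv_oo.
    - apply: measurable_funTS; apply: measurable_funM.
        apply: measurable_funM; first exact: measurable_cst.
        by apply: (measurableT_comp (measurable_sph mf)); exact: measurable_pair1.
      by apply: measurable_funM; [exact: m_legendre_sin|exact: measurable_cst].
    - move=> b _; rewrite normrM ler_pM//.
        by rewrite normrM ler_pM// fM// /cball3 /= sph_norm// ltW.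
      by rewrite normrM ler_pM// legendre_sin_le1.
  rewrite -RintegralZl//; apply: eq_Rintegral => b; rewrite inE/= in_itv/=; exact: e.
rewrite /Rintegral; congr fine.
have [iX _] := fubini_lebesgue (measurable_itv `[0, d]) (measurable_itv `[0, pi]) i2.
have /integrableP[mX _] := iX.
have ms : measurable (`[0, d]%classic `\ s : set R).
  by apply: measurableD; [exact: measurable_itv|exact: measurable_set1].
have mX' : measurable_fun (`[0, d]%classic `\ s : set R) (EFin \o X).
  by apply: measurable_funS mX.
have eXY : {in (`[0, d]%classic `\ s : set R), EFin \o X =1 EFin \o Y}.
  move=> r; rewrite inE => -[/=]; rewrite in_itv/= => rd /eqP rs.
  by rewrite XY.
have mY' : measurable_fun (`[0, d]%classic `\ s : set R) (EFin \o Y).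
  exact: eq_measurable_fun eXY mX'.
rewrite -[LHS](integral_setD1 ms mX') -[RHS](integral_setD1 ms mY').
by apply: eq_integral => r rD; exact: eXY.
Qed.

End Potential.

(** * The radial kernels *)
Section RadialKernels.
Variable R : realType.
Notation mu := (@lebesgue_measure R).
Implicit Types (s r t : R).

Lemma cont_bessel_j n t : 0 < t -> {for t, continuous (@sph_bessel_j R n)}.
Proof.
move=> t0; have -> : @sph_bessel_j R n = (fun t => t ^+ n * W n.+1 t).
  by apply/funext => x; exact: bessel_jE.
have h := is_deriveMf (is_deriveXf n (is_derive_id t 1)) (bseq_d (@W_seq R) n.+1 t0).
exact: is_derive_cont h.
Qed.

Lemma cont_bessel_y n t : 0 < t -> {for t, continuous (@sph_bessel_y R n)}.
Proof.
move=> t0.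
have h := is_deriveMf (is_deriveXf n (is_derive_id t 1)) (bseq_d (@Z_seq R) n.+1 t0).
have : is_derive t 1 (@sph_bessel_y R n) (n%:R * t ^+ n.-1 * 1 * Z n.+1 t + t ^+ n * (- t * Z n.+2 t)).
  apply: near_eq_is_derive h; have : \forall y \near t, y \in `]0, t + 1[.
    by apply: near_in_itv; rewrite in_itv/= t0; lra.
  by apply: filterS => y; rewrite in_itv/= => /andP[y0 _]; rewrite bessel_yE.
exact: is_derive_cont.
Qed.

Lemma open_pos : open (`]0, +oo[%classic : set R).
Proof. exact: interval_open. Qed.

Lemma measurable_bessel_y n : measurable_fun (`]0, +oo[%classic : set R) (@sph_bessel_y R n).
Proof.
apply: open_continuous_measurable_fun; first exact: open_pos.
by move=> x; rewrite inE/= in_itv/= andbT => x0; exact: cont_bessel_y.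
Qed.

Lemma measurable_bessel_j n : measurable_fun (`[0, +oo[%classic : set R) (@sph_bessel_j R n).
Proof.
rewrite (_ : `[0, +oo[%classic = [set 0] `|` `]0, +oo[%classic); last first.
  apply/seteqP; split => x /=; rewrite !in_itv/= !andbT.
    by rewrite le_eqVlt => /predU1P[<-|]; [left|right].
  by case=> [->|/ltW].
apply/measurable_funU; [exact: measurable_set1|exact: measurable_itv|split].
  exact: measurable_fun_set1.
apply: open_continuous_measurable_fun; first exact: open_pos.
by move=> x; rewrite inE/= in_itv/= andbT => x0; exact: cont_bessel_j.
Qed.

Variables (kappa d : R).
Hypotheses (kappa0 : 0 < kappa) (d0 : 0 < d).

Definition besJ (n : nat) (z : R * R) : R :=
  sph_bessel_j n (kappa * Num.max z.1 z.2) * sph_bessel_j n (kappa * Num.min z.1 z.2).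

Definition besY (n : nat) (z : R * R) : R :=
  sph_bessel_y n (kappa * Num.max z.1 z.2) * sph_bessel_j n (kappa * Num.min z.1 z.2).

Let Q : set (R * R) := `]0, d]%classic `*` `[0, d]%classic.

Let mQ : measurable Q.
Proof. by apply: measurableX; exact: measurable_itv. Qed.

Local Lemma kmax_meas : measurable_fun Q (fun z : R * R => kappa * Num.max z.1 z.2).
Proof.
apply: measurable_funTS; apply: measurable_funM; first exact: measurable_cst.
by apply: measurable_maxr; [exact: measurable_fst|exact: measurable_snd].
Qed.

Local Lemma kmin_meas : measurable_fun Q (fun z : R * R => kappa * Num.min z.1 z.2).
Proof.
apply: measurable_funTS; apply: measurable_funM; first exact: measurable_cst.
by apply: measurable_minr; [exact: measurable_fst|exact: measurable_snd].
Qed.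

Local Lemma jmin_meas n : measurable_fun Q (fun z : R * R => sph_bessel_j n (kappa * Num.min z.1 z.2)).
Proof.
apply: (measurable_comp _ _ (measurable_bessel_j n) kmin_meas); first exact: measurable_itv.
move=> y [[s r] [/= + +] <-]; rewrite !in_itv/= => /andP[s0 _] /andP[r0 _].
by rewrite andbT mulr_ge0 ?(ltW kappa0)// le_min (ltW s0).
Qed.

Local Lemma max_pos s r : 0 < s -> 0 < kappa * Num.max s r.
Proof. by move=> s0; rewrite mulr_gt0// lt_max s0. Qed.

Lemma measurable_besJ n : measurable_fun Q (besJ n).
Proof.
apply: measurable_funM; last exact: jmin_meas.
apply: (measurable_comp _ _ (measurable_bessel_j n) kmax_meas); first exact: measurable_itv.
move=> y [[s r] [/= + _] <-]; rewrite !in_itv/= => /andP[s0 _].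
by rewrite andbT ltW// max_pos.
Qed.

Lemma measurable_besY n : measurable_fun Q (besY n).
Proof.
apply: measurable_funM; last exact: jmin_meas.
apply: (measurable_comp _ _ (measurable_bessel_y n) kmax_meas); first exact: measurable_itv.
move=> y [[s r] [/= + _] <-]; rewrite !in_itv/= => /andP[s0 _].
by rewrite andbT max_pos.
Qed.

Let X := kappa * d.
Let E := expR (X ^+ 2).

Local Lemma E0 : 0 < E. Proof. exact: expR_gt0. Qed.
Local Lemma X0 : 0 < X. Proof. exact: mulr_gt0. Qed.

Local Lemma exp_le t : 0 <= t <= X -> expR (t ^+ 2) <= E.
Proof. by move=> /andP[t0 tX]; rewrite ler_expR lerXn2r ?nnegrE// (ltW X0). Qed.

Local Lemma kmm s r : 0 < s <= d -> 0 <= r <= d ->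
  [/\ 0 < Num.max s r, Num.max s r <= d, 0 <= Num.min s r & Num.min s r <= Num.max s r].
Proof.
move=> /andP[s0 sd] /andP[r0 rd]; split.
- by rewrite lt_max s0.
- by rewrite ge_max sd.
- by rewrite le_min (ltW s0).
- by rewrite ge_min !le_max !lexx.
Qed.

(** The factors [t ^ n] and [T ^ - n] of the regular and the singular function
    combine to the ratio of the two radii. *)
Lemma besY_bound n s r : 0 < s <= d -> 0 <= r <= d ->
  `|besY n (s, r)| <= (Num.min s r / Num.max s r) ^+ n / Num.max s r * (E ^+ 2 / (kappa * (2 * n + 1)%:R)).
Proof.
move=> hs hr; have [M0 Md m0 mM] := kmm hs hr; rewrite /besY /=.
move: (Num.max s r) (Num.min s r) M0 Md m0 mM => T t T0 Td t0 tT.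
have kT0 : 0 < kappa * T by rewrite mulr_gt0.
have kt0 : 0 <= kappa * t by rewrite mulr_ge0// ltW.
have o0 := oddfact_gt0 R n; have E0 := E0.
have hy : `|sph_bessel_y n (kappa * T)| <= oddfact R n / (kappa * T) ^+ n.+1 * E.
  apply: le_trans (bessel_y_bound n kT0) _; rewrite ler_pM2l ?divr_gt0 ?exprn_gt0//.
  by apply: exp_le; rewrite (ltW kT0) ler_pM2l.
have hj : `|sph_bessel_j n (kappa * t)| <= (kappa * t) ^+ n * ((oddfact R n.+1)^-1 * E).
  apply: le_trans (bessel_j_bound n _) _; rewrite (ger0_norm kt0).
  apply: ler_wpM2l; first exact: exprn_ge0.
  rewrite ler_pM2l ?invr_gt0 ?oddfact_gt0//; apply: exp_le; rewrite kt0/= ler_pM2l//.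
  exact: le_trans tT Td.
rewrite normrM; apply: le_trans (ler_pM _ _ hy hj) _ => //.
rewrite oddfactS le_eqVlt; apply/orP; left; apply/eqP.
have h1 : (2 * n + 1)%:R != 0 :> R by rewrite addn1 pnatr_eq0.
move: ((2 * n + 1)%:R : R) h1 => c c0.
have k0 : kappa ^+ n != 0 by rewrite expf_neq0 ?lt0r_neq0.
have T1 : T ^+ n != 0 by rewrite expf_neq0 ?lt0r_neq0.
have o1 := lt0r_neq0 o0; have k1 := lt0r_neq0 kappa0; have T2 := lt0r_neq0 T0.
rewrite !exprMn exprVn [T ^+ n.+1]exprS [kappa ^+ n.+1]exprS; move: (kappa ^+ n) (T ^+ n) (t ^+ n) k0 T1 => kn Tn tn kn0 Tn0.
move: (oddfact R n) o1 => o o1.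
by field; rewrite ?c0 ?o1 ?kn0 ?Tn0 ?k1 ?T2.
Qed.

Local Lemma oddfact_ge_fact m : m`!%:R <= oddfact R m.
Proof.
elim: m => [|m IH]; first exact: oddfact_ge1.
rewrite oddfactS factS natrM mulrC ler_pM// ler_nat; lia.
Qed.

Local Lemma pow_fact_le n t : 0 <= t <= X -> t ^+ n / oddfact R n <= expR X.
Proof.
move=> /andP[t0 tX]; have o0 := oddfact_gt0 R n.
apply: (@le_trans _ _ (X ^+ n / n`!%:R)).
  apply: ler_pM => //; first exact: exprn_ge0.
  - by rewrite invr_ge0 ltW.
  - by rewrite lerXn2r ?nnegrE// (ltW X0).
  - by rewrite lef_pV2 ?oddfact_ge_fact ?posrE// ltr0n fact_gt0.
case: n {o0} => [|n]; first by rewrite expr0 fact0 divr1 -expR0 ler_expR (ltW X0).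
by apply: le_trans (expR_ge1Dxn n (ltW X0)); rewrite lerDr.
Qed.

Lemma bessel_j_decay n t : 0 <= t <= X -> `|sph_bessel_j n t| <= expR X * E / (2 * n + 1)%:R.
Proof.
move=> /[dup] tI /andP[t0 tX]; apply: le_trans (bessel_j_bound n t) _.
have c0 : 0 < (2 * n + 1)%:R :> R by rewrite ltr0n addn1.
have o0 := oddfact_gt0 R n.
rewrite (ger0_norm t0) oddfactS invfM.
have -> : t ^+ n * ((oddfact R n)^-1 / (2 * n + 1)%:R * expR (t ^+ 2)) =
   (t ^+ n / oddfact R n) * expR (t ^+ 2) / (2 * n + 1)%:R by ring.
rewrite ler_pM2r ?invr_gt0//; apply: ler_pM.
- by rewrite divr_ge0 ?exprn_ge0// ltW.
- exact: expR_ge0.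
- exact: pow_fact_le.
- exact: exp_le.
Qed.

(** The regular function decays factorially in [n]; one factor [1 / n] for each of
    the two functions is enough here. *)
Lemma besJ_bound n s r : 0 < s <= d -> 0 <= r <= d ->
  `|besJ n (s, r)| <= (expR X * E) ^+ 2 / (2 * n + 1)%:R ^+ 2.
Proof.
move=> hs hr; have [M0 Md m0 mM] := kmm hs hr; rewrite /besJ /=.
rewrite normrM -expr_div_n [leRHS]expr2; apply: ler_pM => //; apply: bessel_j_decay.
  by rewrite mulr_ge0 ?(ltW kappa0) ?(ltW M0)//= ler_pM2l.
by rewrite mulr_ge0 ?(ltW kappa0)//= ler_pM2l// (le_trans mM).
Qed.

Let sq (n : nat) s r := (Num.min s r / Num.max s r) ^+ n / Num.max s r * r ^+ 2.

Local Lemma sq_le n s r : 0 < s <= d -> 0 <= r <= d -> 0 <= sq n s r <= d.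
Proof.
move=> hs hr; have [M0 Md m0 mM] := kmm hs hr; case/andP: hr => r0 rd.
have rM : r <= Num.max s r by rewrite le_max lexx orbT.
rewrite /sq; move: (Num.max s r) (Num.min s r) M0 Md m0 mM rM => T t T0 Td t0 tT rT.
have q0 : 0 <= t / T by rewrite divr_ge0// ltW.
have q1 : t / T <= 1 by rewrite ler_pdivrMr// mul1r.
apply/andP; split; first by rewrite mulr_ge0 ?sqr_ge0// divr_ge0 ?exprn_ge0// ltW.
apply: (@le_trans _ _ (1 / T * r ^+ 2)).
  by rewrite ler_wpM2r ?sqr_ge0// ler_pM2r ?invr_gt0// exprn_ile1.
rewrite mul1r mulrC ler_pdivrMr// expr2; apply: ler_pM => //.
Qed.

Local Lemma sq_small n s r : 0 < s <= d -> 0 <= r <= s -> sq n s r <= d * (r / s) ^+ n.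
Proof.
move=> /andP[s0 sd] /andP[r0 rs]; rewrite /sq (max_l rs) (min_r rs) mulrAC mulrC.
have h : 0 <= (r / s) ^+ n by rewrite exprn_ge0 ?divr_ge0// ltW.
rewrite mulrA [leLHS]mulrAC; rewrite ler_wpM2r// mulrC ler_pdivrMr//.
nra.
Qed.

Local Lemma sq_large n s r : 0 < s -> s <= r -> sq n s r = (s / r) ^+ n * r.
Proof.
move=> s0 sr; have r0 : 0 < r by exact: lt_le_trans sr.
rewrite /sq (max_r sr) (min_l sr); field.
by rewrite lt0r_neq0.
Qed.

Local Lemma sq_meas n s : measurable_fun setT (sq n s).
Proof.
have mM : measurable_fun setT (fun r : R => Num.max s r).
  by apply: measurable_maxr; [exact: measurable_cst|exact: measurable_id].
have mV : measurable_fun setT (fun r : R => (Num.max s r)^-1).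
  exact: (measurableT_comp (@measurable_invr R) mM).
have mm : measurable_fun setT (fun r : R => Num.min s r).
  by apply: measurable_minr; [exact: measurable_cst|exact: measurable_id].
apply: measurable_funM; last by apply: measurable_funX; exact: measurable_id.
by apply: measurable_funM => //; apply: measurable_funX; exact: measurable_funM.
Qed.

Local Lemma sq_integrable n s : 0 < s <= d -> mu.-integrable `[0, d] (EFin \o sq n s).
Proof.
move=> hs; apply: (bounded_integrable (M := d)).
- exact: measurable_itv.
- exact: mu_itv_oo.
- exact: measurable_funTS (sq_meas n s).
- by move=> r /=; rewrite in_itv/= => /(sq_le n hs)/andP[h1 h2]; rewrite ger0_norm.
Qed.

Local Lemma int_small n s : 0 < s <= d ->
  \int[mu]_(r in `[0, s]) sq n s r <= d * s / n.+1%:R.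
Proof.
move=> /[dup] hs /andP[s0 sd]; have sn : s ^+ n != 0 by rewrite expf_neq0 ?lt0r_neq0.
have n0 : n.+1%:R != 0 :> R by rewrite pnatr_eq0.
have cX r : {for r, continuous (fun r : R => d * (r / s) ^+ n)}.
  have h := is_deriveZf d (is_deriveXf n (is_deriveMf (is_derive_id r 1) (is_derive_cst s^-1 r 1))).
  exact: is_derive_cont h.
have e : \int[mu]_(r in `[0, s]) (d * (r / s) ^+ n) = d * s / n.+1%:R.
  transitivity (d * s / n.+1%:R * (s / s) ^+ n.+1 - d * s / n.+1%:R * (0 / s) ^+ n.+1).
    apply: (@Rintegral_FTC R (fun r => d * (r / s) ^+ n) (fun r => d * s / n.+1%:R * (r / s) ^+ n.+1) 0 s (ltW s0)).
    - move=> r _; have h := is_deriveZf (d * s / n.+1%:R) (is_deriveXf n.+1 (is_deriveMf (is_derive_id r 1) (is_derive_cst s^-1 r 1))).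
      apply: (is_derive_eq h) => /=; move: (n.+1%:R : R) n0 => c c0.
      by field; rewrite c0 lt0r_neq0.
    - by move=> r _; exact: cX.
  by rewrite mul0r expr0n/= mulr0 subr0 divff ?lt0r_neq0// expr1n mulr1.
rewrite -e; apply: le_Rintegral => //.
- apply: integrableS (sq_integrable n hs) => //.
  by move=> x /=; rewrite !in_itv/= => /andP[-> h]; exact: le_trans h sd.
- by apply: cont_integrable => r _; exact: cX.
- by move=> r /=; rewrite in_itv/= => hr; exact: sq_small.
Qed.

Local Lemma int_large n s : 0 < s <= d ->
  \int[mu]_(r in `]s, d]) sq n s r <= 4 * d ^+ 2 / n.+1%:R.
Proof.
move=> /[dup] hs /andP[s0 sd].
have iS : mu.-integrable `[s, d] (EFin \o sq n s).
  apply: integrableS (sq_integrable n hs) => //.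
  by move=> x /=; rewrite !in_itv/= => /andP[h ->]; rewrite (le_trans (ltW s0)).
have -> : \int[mu]_(r in `]s, d]) sq n s r = \int[mu]_(r in `[s, d]) sq n s r.
  apply: Rintegral_itv_obnd_cbnd; apply: integrableS iS => //.
  by move=> x /=; rewrite !in_itv/= => /andP[h ->]; rewrite ltW.
have n0 : 0 < n.+1%:R :> R by rewrite ltr0n.
(* the antiderivative below needs [n >= 3]; the first indices are absorbed by
   the constant 4 *)
case: (ltnP n 3) => n3.
  apply: le_trans (ler_norm _) _.
  apply: le_trans (Rintegral_itv_bound (M := d) sd iS _) _.
    move=> r /andP[sr rd]; have hr : 0 <= r <= d by rewrite rd (le_trans (ltW s0) sr).
    by have /andP[h1 h2] := sq_le n hs hr; rewrite ger0_norm.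
  rewrite ler_pdivlMr// [4 * _]mulrC expr2 -mulrA.
  have : n.+1%:R <= 4 :> R by rewrite ler_nat; lia.
  move: (n.+1%:R : R) n0 => c c0 c4.
  rewrite -mulrA ler_pM2l//; apply: ler_pM => //; lra.
case: n n3 iS n0 => [//|[//|[//|m]]] _ iS n0.
have m0 : 0 < m.+1%:R :> R by rewrite ltr0n.
have e : \int[mu]_(r in `[s, d]) sq m.+3 s r = s ^+ 2 / m.+1%:R * (1 - (s / d) ^+ m.+1).
  transitivity (- (s ^+ 2 / m.+1%:R) * (s / d) ^+ m.+1 - - (s ^+ 2 / m.+1%:R) * (s / s) ^+ m.+1).
    have dV r : s <= r <= d -> is_derive r 1 (fun r => s / r) (- s / r ^+ 2).
      move=> /andP[sr _]; have r0 : r != 0 by rewrite lt0r_neq0// (lt_le_trans s0).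
      have h := is_deriveZf s (is_deriveVf r0 (is_derive_id r 1)).
      by apply: (is_derive_eq h); rewrite mulrA mulrN1.
    rewrite (@eq_Rintegral _ _ _ mu _ (fun r => (s / r) ^+ m.+3 * r)); last first.
      by move=> r; rewrite inE/= in_itv/= => /andP[sr _]; rewrite sq_large.
    apply: (@Rintegral_FTC R (fun r => (s / r) ^+ m.+3 * r) (fun r => - (s ^+ 2 / m.+1%:R) * (s / r) ^+ m.+1) s d sd).
    - move=> r hr; have h := is_deriveZf (- (s ^+ 2 / m.+1%:R)) (is_deriveXf m.+1 (dV r hr)).
      have r0 : r != 0 by rewrite lt0r_neq0//; case/andP: hr => sr _; exact: lt_le_trans sr.
      apply: (is_derive_eq h) => /=; rewrite !exprS; move: (m.+1%:R : R) m0 => c c0.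
      by field; rewrite r0 lt0r_neq0.
    - move=> r hr; have h := is_deriveMf (is_deriveXf m.+3 (dV r hr)) (is_derive_id r 1).
      exact: is_derive_cont h.
  by rewrite divff ?lt0r_neq0// expr1n; ring.
rewrite e; apply: (@le_trans _ _ (d ^+ 2 / m.+1%:R)).
  apply: (@le_trans _ _ (s ^+ 2 / m.+1%:R)).
    rewrite -[leRHS]mulr1 ler_pM2l ?divr_gt0 ?exprn_gt0//.
    by rewrite gerBl exprn_ge0// divr_ge0// ltW.
  by rewrite ler_pM2r ?invr_gt0// lerXn2r ?nnegrE// ltW.
have h : m.+4%:R <= 4 * m.+1%:R :> R by rewrite -natrM ler_nat; lia.
rewrite ler_pdivlMr// mulrAC ler_pdivrMr// -[leRHS]mulrA [leRHS]mulrCA.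
by rewrite ler_pM2l ?exprn_gt0.
Qed.

(** Integrating the ratio of the radii over the source point gains a second
    factor [1 / n]. *)
Lemma kernel_mass : exists2 C : R, 0 <= C & forall n s, 0 < s <= d ->
  (2 * n + 1)%:R * \int[mu]_(r in `[0, d]) `|besJ n (s, r) * r ^+ 2| <= C / n.+1%:R /\
  (2 * n + 1)%:R * \int[mu]_(r in `[0, d]) `|besY n (s, r) * r ^+ 2| <= C / n.+1%:R.
Proof.
have k1 := lt0r_neq0 kappa0; have E0 := E0.
pose CY := E ^+ 2 / kappa * (5 * d ^+ 2).
pose CJ := (expR X * E) ^+ 2 * d ^+ 3.
have CY0 : 0 <= CY by rewrite !mulr_ge0 ?sqr_ge0 ?invr_ge0// ltW.
have CJ0 : 0 <= CJ by rewrite !mulr_ge0 ?sqr_ge0 ?exprn_ge0// ltW.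
exists (CY + CJ); first exact: addr_ge0.
move=> n s /[dup] hs /andP[s0 sd].
have n0 : 0 < n.+1%:R :> R by rewrite ltr0n.
have c0 : 0 < (2 * n + 1)%:R :> R by rewrite ltr0n addn1.
have mitv := measurable_itv `[0, d] : measurable (`[0, d]%classic : set R).
have sec (f : R * R -> R) : measurable_fun Q f -> measurable_fun `[0, d] (fun r => f (s, r)).
  move=> mf; apply: (measurable_comp mQ _ mf); last exact: measurable_funTS (measurable_pair1 s).
  by move=> y [r hr <-]; split => //=; rewrite in_itv/= s0.
have r2 : measurable_fun `[0, d] (fun r : R => r ^+ 2).
  by apply: measurable_funTS; apply: measurable_funX; exact: measurable_id.
split.
  apply: (@le_trans _ _ ((2 * n + 1)%:R * ((expR X * E) ^+ 2 / (2 * n + 1)%:R ^+ 2 * d ^+ 2 * (d - 0)))).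
    rewrite ler_pM2l//; apply: le_trans (ler_norm _) _.
    have bd r : 0 <= r <= d -> `|(`|besJ n (s, r) * r ^+ 2|)| <= (expR X * E) ^+ 2 / (2 * n + 1)%:R ^+ 2 * d ^+ 2.
      move=> /[dup] hr /andP[r0 rd]; rewrite normr_id normrM; apply: ler_pM => //; first exact: besJ_bound.
      by rewrite ger0_norm ?sqr_ge0// lerXn2r ?nnegrE// ltW.
    apply: Rintegral_itv_bound => //; first exact: ltW.
    apply: (bounded_integrable (M := (expR X * E) ^+ 2 / (2 * n + 1)%:R ^+ 2 * d ^+ 2)) => //.
    - exact: mu_itv_oo.
    - apply: measurableT_comp => //; apply: measurable_funM => //.
      by apply: sec; exact: measurable_besJ.
  apply: (@le_trans _ _ (CJ / (2 * n + 1)%:R)).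
    rewrite le_eqVlt; apply/orP; left; apply/eqP; rewrite /CJ subr0.
    by move: ((2 * n + 1)%:R : R) c0 => c c0; field; rewrite lt0r_neq0.
  apply: ler_pM => //; first by rewrite lerDr.
  by rewrite lef_pV2 ?posrE// ler_nat; lia.
have bd r : 0 <= r <= d -> `|besY n (s, r) * r ^+ 2| <= E ^+ 2 / (kappa * (2 * n + 1)%:R) * sq n s r.
  move=> hr; rewrite normrM (ger0_norm (sqr_ge0 r)).
  apply: (@le_trans _ _ ((Num.min s r / Num.max s r) ^+ n / Num.max s r * (E ^+ 2 / (kappa * (2 * n + 1)%:R)) * r ^+ 2)).
    by rewrite ler_wpM2r ?sqr_ge0//; exact: besY_bound.
  by rewrite /sq le_eqVlt; apply/orP; left; apply/eqP; ring.
have e0 : 0 <= E ^+ 2 / (kappa * (2 * n + 1)%:R) by rewrite divr_ge0 ?sqr_ge0// mulr_ge0// ltW.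
have iZ : mu.-integrable `[0, d] (EFin \o (fun r => E ^+ 2 / (kappa * (2 * n + 1)%:R) * sq n s r)).
  apply: (bounded_integrable (M := E ^+ 2 / (kappa * (2 * n + 1)%:R) * d)) => //.
  - exact: mu_itv_oo.
  - by apply: measurable_funTS; apply: measurable_funM; [exact: measurable_cst|exact: sq_meas].
  - move=> r /=; rewrite in_itv/= => /(sq_le n hs)/andP[h1 h2].
    by rewrite ger0_norm; [rewrite ler_wpM2l|rewrite mulr_ge0].
have iY : mu.-integrable `[0, d] (EFin \o (fun r => `|besY n (s, r) * r ^+ 2|)).
  apply: (bounded_integrable (M := E ^+ 2 / (kappa * (2 * n + 1)%:R) * d)) => //.
  - exact: mu_itv_oo.
  - apply: measurableT_comp => //; apply: measurable_funM => //.
    by apply: sec; exact: measurable_besY.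
  - move=> r /=; rewrite in_itv/= => hr; rewrite normr_id; apply: le_trans (bd r hr) _.
    by have /andP[h1 h2] := sq_le n hs hr; rewrite ler_wpM2l.
have split_ : \int[mu]_(r in `[0, d]) sq n s r <= 5 * d ^+ 2 / n.+1%:R.
  have h := Rintegral_itvB (x := s) (sq_integrable n hs).
  have {}h : \int[mu]_(r in `[0, d]) sq n s r - \int[mu]_(r in `[0, s]) sq n s r =
      \int[mu]_(r in `]s, d]) sq n s r by apply: h; rewrite bnd_simp// ltW.
  have h1 := int_small n hs; have h2 := int_large n hs.
  have h3 : d * s / n.+1%:R <= d ^+ 2 / n.+1%:R by rewrite ler_pM2r ?invr_gt0// expr2 ler_pM2l.
  have -> : 5 * d ^+ 2 / n.+1%:R = d ^+ 2 / n.+1%:R + 4 * d ^+ 2 / n.+1%:R by ring.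
  rewrite -[leLHS](subrK (\int[mu]_(r in `[0, s]) sq n s r)) h addrC.
  by apply: lerD h2; exact: le_trans h1 h3.
apply: (@le_trans _ _ ((2 * n + 1)%:R * (E ^+ 2 / (kappa * (2 * n + 1)%:R) * (5 * d ^+ 2 / n.+1%:R)))).
  rewrite ler_pM2l//; apply: (@le_trans _ _ (\int[mu]_(r in `[0, d]) (E ^+ 2 / (kappa * (2 * n + 1)%:R) * sq n s r))).
    by apply: le_Rintegral => // r /=; rewrite in_itv/=; exact: bd.
  rewrite RintegralZl//; last exact: sq_integrable.
  by rewrite ler_wpM2l.
apply: (@le_trans _ _ (CY / n.+1%:R)); last by rewrite ler_pM2r ?invr_gt0// lerDl.
rewrite le_eqVlt; apply/orP; left; apply/eqP; rewrite /CY.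
move: (n.+1%:R : R) ((2 * n + 1)%:R : R) n0 c0 => a c a0 c0.
by field; rewrite k1 !lt0r_neq0.
Qed.

(** A bound at each pair of radii, for integrability. *)
Lemma kernel_bounded n : exists2 B : R, 0 <= B & forall s r, 0 < s <= d -> 0 <= r <= d ->
  `|besJ n (s, r) * r ^+ 2| <= B /\ `|besY n (s, r) * r ^+ 2| <= B.
Proof.
have E0 := E0; have k0 := ltW kappa0.
pose BY := E ^+ 2 / (kappa * (2 * n + 1)%:R) * d.
pose BJ := (expR X * E) ^+ 2 / (2 * n + 1)%:R ^+ 2 * d ^+ 2.
have BY0 : 0 <= BY by rewrite !mulr_ge0 ?sqr_ge0 ?invr_ge0 ?mulr_ge0// ltW.
have BJ0 : 0 <= BJ.
  apply: mulr_ge0; last exact: sqr_ge0.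
  by apply: divr_ge0; exact: sqr_ge0.
exists (BY + BJ); first exact: addr_ge0.
move=> s r hs /[dup] hr /andP[r0 rd]; split; rewrite normrM (ger0_norm (sqr_ge0 r)).
  apply: (@le_trans _ _ BJ); last by rewrite lerDr.
  by apply: ler_pM => //; [exact: sqr_ge0|exact: besJ_bound|rewrite lerXn2r ?nnegrE// ltW].
apply: (@le_trans _ _ BY); last by rewrite lerDl.
apply: (@le_trans _ _ ((Num.min s r / Num.max s r) ^+ n / Num.max s r * (E ^+ 2 / (kappa * (2 * n + 1)%:R)) * r ^+ 2)).
  by rewrite ler_wpM2r ?sqr_ge0//; exact: besY_bound.
have /andP[h1 h2] := sq_le n hs hr.
have -> : (Num.min s r / Num.max s r) ^+ n / Num.max s r * (E ^+ 2 / (kappa * (2 * n + 1)%:R)) * r ^+ 2 =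
  E ^+ 2 / (kappa * (2 * n + 1)%:R) * sq n s r by rewrite /sq; ring.
by rewrite ler_wpM2l// divr_ge0 ?sqr_ge0// mulr_ge0.
Qed.

End RadialKernels.

Section RealIntegrable.
Context d (T : measurableType d) (R : realType) (m : {measure set T -> \bar R}).
Variables (D : set T) (mD : measurable D).

Lemma integrable_addr (f g : T -> R) : m.-integrable D (EFin \o f) -> m.-integrable D (EFin \o g) ->
  m.-integrable D (EFin \o (fun x => f x + g x)).
Proof.
move=> i1 i2; have := integrableD mD i1 i2.
by apply: eq_integrable => // x _; rewrite /= EFinD.
Qed.

Lemma integrable_subr (f g : T -> R) : m.-integrable D (EFin \o f) -> m.-integrable D (EFin \o g) ->
  m.-integrable D (EFin \o (fun x => f x - g x)).
Proof.
move=> i1 i2; have := integrableB mD i1 i2.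
by apply: eq_integrable => // x _; rewrite /= EFinB.
Qed.

Lemma integrable_mulr (c : R) (f : T -> R) : m.-integrable D (EFin \o f) ->
  m.-integrable D (EFin \o (fun x => c * f x)).
Proof.
move=> i1; have := integrableZl mD c i1.
by apply: eq_integrable => // x _; rewrite /= EFinM.
Qed.

End RealIntegrable.

(** * The integral operators in real form *)
Section ComplexParts.
Variable R : realType.
Notation Re := complex.Re.
Notation Im := complex.Im.
Implicit Types (z w : R[i]) (c : R).

Lemma ReM z w : Re (z * w) = Re z * Re w - Im z * Im w.
Proof. by case: z; case: w. Qed.
Lemma ImM z w : Im (z * w) = Re z * Im w + Im z * Re w.
Proof. by case: z => a b; case: w. Qed.
Lemma ReD z w : Re (z + w) = Re z + Re w.
Proof. by case: z; case: w. Qed.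
Lemma ImD z w : Im (z + w) = Im z + Im w.
Proof. by case: z; case: w. Qed.
Lemma ReN z : Re (- z) = - Re z.
Proof. by case: z. Qed.
Lemma ImN z : Im (- z) = - Im z.
Proof. by case: z. Qed.
Lemma ReB z w : Re (z - w) = Re z - Re w.
Proof. by case: z; case: w. Qed.
Lemma ImB z w : Im (z - w) = Im z - Im w.
Proof. by case: z; case: w. Qed.
Lemma Re_sum (I : Type) (s : seq I) (P : pred I) (F : I -> R[i]) :
  Re (\sum_(i <- s | P i) F i) = \sum_(i <- s | P i) Re (F i).
Proof. by apply: (big_morph _ ReD). Qed.
Lemma Im_sum (I : Type) (s : seq I) (P : pred I) (F : I -> R[i]) :
  Im (\sum_(i <- s | P i) F i) = \sum_(i <- s | P i) Im (F i).
Proof. by apply: (big_morph _ ImD). Qed.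
Lemma ReMr z c : Re (z * c%:C) = Re z * c.
Proof. by rewrite ReM /= mulr0 subr0. Qed.
Lemma ImMr z c : Im (z * c%:C) = Im z * c.
Proof. by rewrite ImM /= mulr0 add0r. Qed.
Lemma ReMl z c : Re (c%:C * z) = c * Re z.
Proof. by rewrite mulrC ReMr mulrC. Qed.
Lemma ImMl z c : Im (c%:C * z) = c * Im z.
Proof. by rewrite mulrC ImMr mulrC. Qed.

Lemma complex_eq z w : Re z = Re w -> Im z = Im w -> z = w.
Proof. by case: z => a b; case: w => c d /= -> ->. Qed.

Lemma Re_half_i z : Re ('i / 2 * z) = - Im z / 2.
Proof.
have -> : ('i / 2 : R[i]) = 0 +i* (1 / 2).
  have -> : (2 : R[i])^-1 = (2^-1)%:C by rewrite -[in RHS]/(2%:R) fmorphV/= rmorph_nat.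
  by rewrite -complexiE; apply: complex_eq; rewrite ?ReMr ?ImMr/= ?mul0r.
by rewrite ReM /= mul0r sub0r; ring.
Qed.

Lemma Im_half_i z : Im ('i / 2 * z) = Re z / 2.
Proof.
have -> : ('i / 2 : R[i]) = 0 +i* (1 / 2).
  have -> : (2 : R[i])^-1 = (2^-1)%:C by rewrite -[in RHS]/(2%:R) fmorphV/= rmorph_nat.
  by rewrite -complexiE; apply: complex_eq; rewrite ?ReMr ?ImMr/= ?mul0r.
by rewrite ImM /= mul0r add0r; ring.
Qed.

Lemma Re_le_norm z : `|Re z| <= Normc.normc z.
Proof.
by case: z => a b /=; rewrite -sqrtr_sqr ler_wsqrtr// lerDl sqr_ge0.
Qed.

Lemma Im_le_norm z : `|Im z| <= Normc.normc z.
Proof.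
by case: z => a b /=; rewrite -sqrtr_sqr ler_wsqrtr// lerDr sqr_ge0.
Qed.

Lemma normc_le z : Normc.normc z <= `|Re z| + `|Im z|.
Proof.
case: z => a b /=; rewrite -[leRHS]ger0_norm ?addr_ge0// -sqrtr_sqr ler_wsqrtr//.
by rewrite sqrrD !real_normK ?num_real// lerD2r lerDl mulrn_wge0// mulr_ge0.
Qed.

Lemma normc_ge0 z : 0 <= Normc.normc z.
Proof. exact: le_trans (Re_le_norm z). Qed.

End ComplexParts.

Section Kint.
Variable R : realType.
Notation mu := (@lebesgue_measure R).
Notation P := (@legendre R).
Variables (d : R) (d0 : 0 < d).

Definition legendre_sin (n : nat) (b : R) : R := (P n).[cos b] * sin b.

Lemma legendre_sin_bound n b : `|legendre_sin n b| <= 1.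
Proof. by rewrite normrM mulr_ile1 ?legendre_cos_le1 ?sin_abs_le1. Qed.

Lemma measurable_legendre_sin n : measurable_fun setT (legendre_sin n).
Proof. by apply: continuous_measurable_fun; exact: cont_theta. Qed.

Definition kernel_int (n : nat) (a : R -> R) (phi : R * R -> R) : R :=
  \int[mu]_(r in `[0, d]) \int[mu]_(b in `[0, pi]) (a r * phi (r, b) * (legendre_sin n b * r ^+ 2)).

Definition rect : set (R * R) := `[0, d]%classic `*` `[0, pi]%classic.

Lemma measurable_rect : measurable rect.
Proof. by apply: measurableX; exact: measurable_itv. Qed.

Lemma measurable_domain : measurable (domain d).
Proof. by apply: measurableX; exact: measurable_itv. Qed.

(** Admissible radial factors: the weight [r ^ 2] of the volume element
    compensates the singularity of the kernels. *)
Definition kernel_adm (a : R -> R) : Prop :=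
  measurable_fun `[0, d] a /\ exists B : R, forall r, 0 <= r <= d -> `|a r * r ^+ 2| <= B.

Definition domain_bm (phi : R * R -> R) : Prop :=
  measurable_fun (domain d) phi /\ exists M : R, forall p, domain d p -> `|phi p| <= M.

Lemma rectE : rect = ([set 0] `*` `[0, pi]%classic) `|` domain d.
Proof.
apply/seteqP; split => [[r b]|[r b]] /=.
  move=> [/=]; rewrite !in_itv/= => /andP[+ rd] bI.
  by rewrite le_eqVlt => /predU1P[<-|r0]; [left|right; split; rewrite /= in_itv/= ?r0].
case=> [[/= -> bI]|[/= rI bI]]; split => //=; rewrite !in_itv/= ?lexx ?(ltW d0)//.
by move: rI; rewrite in_itv/= => /andP[r0 ->]; rewrite (ltW r0).
Qed.

Lemma kernel_int_integrable n a phi : kernel_adm a -> domain_bm phi ->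
  (mu \x mu)%E.-integrable rect
    (EFin \o (fun z => a z.1 * phi z * (legendre_sin n z.2 * z.1 ^+ 2))).
Proof.
move=> [ma [B aB]] [mphi [M phiM]].
have M0 : 0 <= M.
  have := phiM (d, 0); rewrite /domain /= !in_itv/= d0 lexx pi_ge0 lexx => /(_ (conj isT isT)).
  by apply: le_trans.
have B0 : 0 <= B by apply: le_trans (aB d _); rewrite ?lexx ?(ltW d0).
apply: (@bounded_integrable2 _ _ (measurableTypeR R) (measurableTypeR R) R mu mu
  `[0, d]%classic `[0, pi]%classic _ (B * M)).
- exact: measurable_itv.
- exact: measurable_itv.
- exact: mu_itv_oo.
- exact: mu_itv_oo.
- rewrite -/rect rectE; apply/measurable_funU.
  + by apply: measurableX; [exact: measurable_set1|exact: measurable_itv].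
  + exact: measurable_domain.
  + split.
      have e : {in [set 0] `*` `[0, pi]%classic, (fun=> 0 : R) =1
          (fun z : R * R => a z.1 * phi z * (legendre_sin n z.2 * z.1 ^+ 2))}.
        by move=> [r b]; rewrite inE/= => -[/= -> _]; rewrite expr0n/= !mulr0.
      exact: eq_measurable_fun e (measurable_cst _).
    apply: measurable_funM.
      apply: measurable_funM => //.
      apply: (measurable_comp (measurable_itv `[0, d]) _ ma); last exact: measurable_funTS measurable_fst.
      move=> _ [[r b] [/= + _] <-]; rewrite !in_itv/= => /andP[r0 ->].
      by rewrite (ltW r0).
    apply: measurable_funTS; apply: measurable_funM.
      exact: (measurableT_comp (measurable_legendre_sin n) measurable_snd).
    by apply: measurable_funX; exact: measurable_fst.
- move=> r b /=; rewrite !in_itv/= => /andP[+ rd] bI.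
  rewrite le_eqVlt => /predU1P[<-|r0]; first by rewrite expr0n/= !mulr0 normr0 mulr_ge0.
  have -> : a r * phi (r, b) * (legendre_sin n b * r ^+ 2) = (a r * r ^+ 2) * phi (r, b) * legendre_sin n b by ring.
  rewrite normrM -[leRHS]mulr1 ler_pM ?legendre_sin_bound// normrM ler_pM//.
    by apply: aB; rewrite (ltW r0).
  by apply: phiM; split; rewrite /= in_itv/= ?r0.
Qed.

Lemma kernel_int_outer n a phi : kernel_adm a -> domain_bm phi ->
  mu.-integrable `[0, d] (EFin \o (fun r =>
    \int[mu]_(b in `[0, pi]) (a r * phi (r, b) * (legendre_sin n b * r ^+ 2)))) /\
  kernel_int n a phi = \int[(mu \x mu)%E]_(z in rect) (a z.1 * phi z * (legendre_sin n z.2 * z.1 ^+ 2)).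
Proof.
move=> ha hp.
exact: (fubini_lebesgue (measurable_itv `[0, d]) (measurable_itv `[0, pi]) (kernel_int_integrable n ha hp)).
Qed.

(** Inner integrals may be added only where both exist; on the rectangle both
    terms are integrable and the sum is unconditional. *)
Lemma kernel_int_comb n a1 a2 phi1 phi2 : kernel_adm a1 -> kernel_adm a2 -> domain_bm phi1 -> domain_bm phi2 ->
  \int[mu]_(r in `[0, d]) \int[mu]_(b in `[0, pi])
    (a1 r * phi1 (r, b) * (legendre_sin n b * r ^+ 2) + a2 r * phi2 (r, b) * (legendre_sin n b * r ^+ 2)) =
  kernel_int n a1 phi1 + kernel_int n a2 phi2.
Proof.
move=> h1 h2 p1 p2.
have i1 := kernel_int_integrable n h1 p1; have i2 := kernel_int_integrable n h2 p2.
rewrite (kernel_int_outer n h1 p1).2 (kernel_int_outer n h2 p2).2 -RintegralD//; last exact: measurable_rect.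
have i3 : (mu \x mu)%E.-integrable rect (EFin \o (fun z => a1 z.1 * phi1 z * (legendre_sin n z.2 * z.1 ^+ 2)
    + a2 z.1 * phi2 z * (legendre_sin n z.2 * z.1 ^+ 2))).
  exact: (@integrable_addr _ _ _ (mu2 R) rect measurable_rect _ _ i1 i2).
by have [_ <-] := fubini_lebesgue (measurable_itv `[0, d]) (measurable_itv `[0, pi]) i3.
Qed.

Lemma kernel_admZ c a : kernel_adm a -> kernel_adm (fun r => c * a r).
Proof.
move=> [ma [B aB]]; split; first by apply: measurable_funM => //; exact: measurable_cst.
by exists (`|c| * B) => r rd; rewrite -mulrA normrM ler_wpM2l ?aB.
Qed.

Lemma kernel_intZ n c a phi : kernel_adm a -> domain_bm phi ->
  kernel_int n (fun r => c * a r) phi = c * kernel_int n a phi.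
Proof.
move=> ha hp; have i1 := kernel_int_integrable n ha hp.
rewrite (kernel_int_outer n (kernel_admZ c ha) hp).2 (kernel_int_outer n ha hp).2 -RintegralZl//; last exact: measurable_rect.
by apply: eq_Rintegral => z _; ring.
Qed.

Lemma kernel_intZr n c a phi : kernel_adm a -> domain_bm phi ->
  kernel_int n a (fun z => c * phi z) = c * kernel_int n a phi.
Proof.
move=> ha hp; rewrite -kernel_intZ//; apply: eq_Rintegral => r _; apply: eq_Rintegral => b _.
by ring.
Qed.

Lemma domain_bmD phi psi : domain_bm phi -> domain_bm psi -> domain_bm (fun z => phi z + psi z).
Proof.
move=> [m1 [M1 h1]] [m2 [M2 h2]]; split; first exact: measurable_funD.
by exists (M1 + M2) => p dp; apply: le_trans (ler_normD _ _) _; rewrite lerD ?h1 ?h2.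
Qed.

Lemma domain_bmN phi : domain_bm phi -> domain_bm (fun z => - phi z).
Proof.
move=> [m1 [M1 h1]]; split; first by apply: measurableT_comp => //.
by exists M1 => p dp; rewrite normrN h1.
Qed.

Lemma domain_bmB phi psi : domain_bm phi -> domain_bm psi -> domain_bm (fun z => phi z - psi z).
Proof. by move=> h1 h2; apply: domain_bmD => //; exact: domain_bmN. Qed.

Lemma domain_bmM phi psi : domain_bm phi -> domain_bm psi -> domain_bm (fun z => phi z * psi z).
Proof.
move=> [m1 [M1 h1]] [m2 [M2 h2]]; split; first exact: measurable_funM.
by exists (M1 * M2) => p dp; rewrite normrM ler_pM ?h1 ?h2.
Qed.

Lemma domain_bm_cst c : domain_bm (fun=> c).
Proof. by split; [exact: measurable_cst|exists `|c|]. Qed.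

Lemma kernel_intDr n a phi psi : kernel_adm a -> domain_bm phi -> domain_bm psi ->
  kernel_int n a (fun z => phi z + psi z) = kernel_int n a phi + kernel_int n a psi.
Proof.
move=> ha h1 h2; rewrite -kernel_int_comb//; apply: eq_Rintegral => r _; apply: eq_Rintegral => b _.
by ring.
Qed.

Lemma kernel_intNr n a phi : kernel_adm a -> domain_bm phi -> kernel_int n a (fun z => - phi z) = - kernel_int n a phi.
Proof.
move=> ha h1; rewrite -mulN1r -kernel_intZr//; apply: eq_Rintegral => r _; apply: eq_Rintegral => b _.
by rewrite mulN1r.
Qed.

(** For each radius the kernel factors out of the angular integral, so [phi]
    enters through its angular integrals alone.  This keeps the cancellations
    of the Legendre coefficient, which a pointwise bound would lose. *)
Lemma kernel_int_bound n a phi (D : R) : kernel_adm a -> domain_bm phi ->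
  (forall r, 0 < r <= d -> `|\int[mu]_(b in `[0, pi]) (phi (r, b) * legendre_sin n b)| <= D) ->
  `|kernel_int n a phi| <= D * \int[mu]_(r in `[0, d]) `|a r * r ^+ 2|.
Proof.
move=> /[dup] ha [ma [B aB]] /[dup] hp [mphi [M phiM]] hD.
have D0 : 0 <= D by apply: le_trans (hD d _); rewrite ?d0 ?lexx.
have [i1 _] := kernel_int_outer n ha hp.
have ia : mu.-integrable `[0, d] (EFin \o (fun r => `|a r * r ^+ 2|)).
  apply: (bounded_integrable (M := B)).
  - exact: measurable_itv.
  - exact: mu_itv_oo.
  - apply: measurableT_comp => //; apply: measurable_funM => //.
  - by move=> r /=; rewrite in_itv/= normr_id; exact: aB.
rewrite -RintegralZl//.
apply: le_trans (le_normr_Rintegral _ i1) _; first exact: measurable_itv.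
apply: le_Rintegral => //.
- exact: integrable_norm.
- exact: integrable_mulr.
move=> r /=; rewrite in_itv/= => /andP[+ rd].
rewrite le_eqVlt => /predU1P[<-|r0].
  rewrite expr0n/= mulr0 normr0 mulr0 (_ : (fun b => _) = cst 0); last first.
    by apply/funext => b; rewrite !mulr0.
  by rewrite Rintegral_cst// mul0r normr0.
have ip : mu.-integrable `[0, pi] (EFin \o (fun b => phi (r, b) * legendre_sin n b)).
  apply: (bounded_integrable (M := M * 1)).
  - exact: measurable_itv.
  - exact: mu_itv_oo.
  - apply: measurable_funM; last exact: measurable_funTS (measurable_legendre_sin n).
    apply: (measurable_comp measurable_domain _ mphi); last exact: measurable_funTS (measurable_pair1 r).
    by move=> _ [b bI <-]; split => //=; rewrite in_itv/= r0.
  - move=> b bI; rewrite normrM ler_pM ?legendre_sin_bound//.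
    by apply: phiM; split => //=; rewrite in_itv/= r0.
have -> : \int[mu]_(b in `[0, pi]) (a r * phi (r, b) * (legendre_sin n b * r ^+ 2)) =
    (a r * r ^+ 2) * \int[mu]_(b in `[0, pi]) (phi (r, b) * legendre_sin n b).
  by rewrite -RintegralZl//; apply: eq_Rintegral => b _; ring.
by rewrite normrM mulrC ler_wpM2r// hD// r0.
Qed.

End Kint.

(** * The radial equations *)
Section RadialEquations.
Variable R : realType.
Notation mu := (@lebesgue_measure R).
Notation P := (@legendre R).
Notation Re := complex.Re.
Notation Im := complex.Im.
Variables (kappa d : R).
Hypotheses (kappa0 : 0 < kappa) (d0 : 0 < d).

Lemma kernel_adm_sec (K : R * R -> R) s (B : R) : 0 < s <= d ->
  measurable_fun (`]0, d]%classic `*` `[0, d]%classic) K ->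
  (forall r, 0 <= r <= d -> `|K (s, r) * r ^+ 2| <= B) -> kernel_adm d (fun r => K (s, r)).
Proof.
move=> hs mK hB; split; last by exists B.
apply: (measurable_comp _ _ mK); last exact: measurable_funTS (measurable_pair1 s).
  by apply: measurableX; exact: measurable_itv.
by move=> y [r hr <-]; split => //=; rewrite in_itv/=.
Qed.

Lemma kernel_adm_besJ n s : 0 < s <= d -> kernel_adm d (fun r => besJ kappa n (s, r)).
Proof.
move=> hs; have [B _ hB] := kernel_bounded kappa0 d0 n.
apply: (kernel_adm_sec (B := B) hs); first exact: measurable_besJ.
by move=> r hr; have [] := hB s r hs hr.
Qed.

Lemma kernel_adm_besY n s : 0 < s <= d -> kernel_adm d (fun r => besY kappa n (s, r)).
Proof.
move=> hs; have [B _ hB] := kernel_bounded kappa0 d0 n.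
apply: (kernel_adm_sec (B := B) hs); first exact: measurable_besY.
by move=> r hr; have [] := hB s r hs hr.
Qed.

Definition domain_cbm (f : R * R -> R[i]) : Prop :=
  domain_bm d (fun z => Re (f z)) /\ domain_bm d (fun z => Im (f z)).

(** The kernel is [h j = j j + i y j], so the operator splits into real integrals
    of the parts of [w m]. *)
Lemma KnE (m w : R * R -> R[i]) n s : 0 < s <= d -> domain_cbm (fun z => w z * m z) ->
  Kn kappa d m n w s =
  - ((2 * n + 1)%:R * kappa ^+ 3)%:C *
   ((kernel_int d n (fun r => besJ kappa n (s, r)) (fun z => Re (w z * m z)) -
     kernel_int d n (fun r => besY kappa n (s, r)) (fun z => Im (w z * m z))) +i*
    (kernel_int d n (fun r => besJ kappa n (s, r)) (fun z => Im (w z * m z)) +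
     kernel_int d n (fun r => besY kappa n (s, r)) (fun z => Re (w z * m z)))).
Proof.
move=> hs [h1 h2]; have aJ := kernel_adm_besJ n hs; have aY := kernel_adm_besY n hs.
rewrite /Kn /cintegral; congr (_ * _); apply: complex_eq => /=.
  rewrite -(kernel_intNr d0 n aY h2) -(kernel_int_comb d0 n aJ aY h1 (domain_bmN h2)).
  apply: eq_Rintegral => r _; apply: eq_Rintegral => b _.
  rewrite /besJ /besY /sph_hankel1 /legendre_sin /= !(ReMr, ReM, ImMr, ImM) /=.
  by ring.
rewrite -(kernel_int_comb d0 n aJ aY h2 h1).
apply: eq_Rintegral => r _; apply: eq_Rintegral => b _.
rewrite /besJ /besY /sph_hankel1 /legendre_sin /= !(ImMr, ReMr, ImM, ReM) /=.
by ring.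
Qed.

Definition gcos (r : R) : R := cos (kappa * r) / (4 * pi * r).
Definition gsin (r : R) : R := sin (kappa * r) / (4 * pi * r).

Lemma green_parts r : green kappa r = gcos r +i* gsin r.
Proof.
rewrite /green -fmorphV /=; apply: complex_eq; first by rewrite ReMr.
by rewrite ImMr.
Qed.

Let Cg : R := (4 * pi)^-1.

Let Cg0 : 0 <= Cg. Proof. by rewrite invr_ge0 mulr_ge0// pi_ge0. Qed.

Local Lemma green_measurable (h : R -> R) : measurable_fun setT h ->
  measurable_fun setT (fun r => h (kappa * r) / (4 * pi * r)).
Proof.
move=> mh; apply: measurable_funM.
  by apply: (measurableT_comp mh); apply: measurable_funM; [exact: measurable_cst|exact: measurable_id].
apply: (measurableT_comp (@measurable_invr R)).
by apply: measurable_funM; [exact: measurable_cst|exact: measurable_id].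
Qed.

Local Lemma green_bound (h : R -> R) : (forall x, `|h x| <= 1) -> forall r, 0 <= r ->
  `|h (kappa * r) / (4 * pi * r)| <= Cg * r^-1.
Proof.
move=> h1 r r0; have p0 : 0 <= 4 * pi :> R by rewrite mulr_ge0// pi_ge0.
rewrite normrM normfV (ger0_norm (mulr_ge0 p0 r0)) invfM.
by rewrite -[leRHS]mul1r ler_wpM2r ?mulr_ge0 ?invr_ge0.
Qed.

Local Lemma green_cont (h : R -> R) : continuous h -> forall r, 0 < r ->
  {for r, continuous (fun r => h (kappa * r) / (4 * pi * r))}.
Proof.
move=> ch r r0.
have c1 : {for r, continuous (fun r : R => kappa * r)}.
  by apply: cvgM; [exact: cvg_cst|exact: cvg_id].
apply: cvgM; first exact: (@continuous_comp _ _ _ (fun r => kappa * r) h r c1 (ch _)).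
apply: cvgV; first by rewrite lt0r_neq0// mulr_gt0// mulr_gt0// pi_gt0.
by apply: cvgM; [exact: cvg_cst|exact: cvg_id].
Qed.

Local Lemma dist_scale s r x :
  kappa * Num.sqrt (dist2 s r x) = Num.sqrt (dist2 (kappa * s) (kappa * r) x).
Proof.
rewrite -[in LHS](gtr0_norm kappa0) -sqrtr_sqr -sqrtrM ?sqr_ge0//; congr (Num.sqrt _).
by rewrite /dist2; ring.
Qed.

Local Lemma dist2_sym (s r x : R) : dist2 s r x = dist2 r s x.
Proof. by rewrite /dist2; ring. Qed.

(** The multipole expansion with the wavenumber restored; the expansion is
    symmetric in the two radii, the larger one going first. *)
Local Lemma lam_scale (h : R -> R) n s r (L : R -> R -> R) : continuous h -> 0 < s -> 0 < r -> r != s ->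
  (forall S T : R, 0 < T < S ->
    \int[mu]_(x in `[-1, 1]) (h (Num.sqrt (dist2 S T x)) / Num.sqrt (dist2 S T x) * (P n).[x]) = L S T) ->
  \int[mu]_(x in `[-1, 1]) (h (kappa * Num.sqrt (dist2 s r x)) / (4 * pi * Num.sqrt (dist2 s r x)) * (P n).[x]) =
  kappa / (4 * pi) * L (kappa * Num.max s r) (kappa * Num.min s r).
Proof.
move=> ch s0 r0 rs hL.
pose S := Num.max s r; pose T := Num.min s r.
have TS : 0 < kappa * T < kappa * S.
  rewrite /T /S mulr_gt0 ?lt_min ?s0//= ltr_pM2l//.
  by case: (ltgtP s r) rs => //; rewrite eq_sym => ->; rewrite eqxx.
have dST x : dist2 s r x = dist2 S T x.
  by rewrite /S /T; case: (leP s r) => _ //; exact: dist2_sym.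
rewrite -hL// -RintegralZl//; last first.
  apply: cont_integrable => x x1.
  have D0 := dist2_gt0 TS x1; have D1 : 0 < Num.sqrt (dist2 (kappa * S) (kappa * T) x) by rewrite sqrtr_gt0.
  have cs : {for x, continuous (fun x => Num.sqrt (dist2 (kappa * S) (kappa * T) x))}.
    apply: (@continuous_comp _ _ _ (dist2 (kappa * S) (kappa * T)) Num.sqrt x); last exact: sqrt_continuous.
    rewrite /dist2; apply: cvgB; first exact: cvg_cst.
    by apply: cvgM; [exact: cvg_cst|exact: cvg_id].
  apply: cvgM; last exact: continuous_horner.
  apply: cvgM; first exact: (@continuous_comp _ _ _ (fun x => Num.sqrt (dist2 (kappa * S) (kappa * T) x)) h x cs (ch _)).
  by apply: cvgV; [exact: lt0r_neq0|exact: cs].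
apply: eq_Rintegral => x; rewrite inE/= in_itv/= => x1.
have D0 : 0 < Num.sqrt (dist2 (kappa * S) (kappa * T) x) by rewrite sqrtr_gt0 dist2_gt0.
rewrite dST dist_scale; move: D0; rewrite -dist_scale => D0.
have k0 := lt0r_neq0 kappa0; have p0 := lt0r_neq0 (pi_gt0 R).
have q0 : Num.sqrt (dist2 S T x) != 0 by move: (lt0r_neq0 D0); rewrite mulf_eq0 negb_or => /andP[].
by move: (pi : R) p0 => p p0; field; rewrite ?k0 ?p0 ?q0.
Qed.

Let l1 n s (r : R) : R := - (kappa / (2 * pi)) * besY kappa n (s, r).
Let l2 n s (r : R) : R := kappa / (2 * pi) * besJ kappa n (s, r).

Local Lemma l1E n s r : 0 < s -> 0 < r -> r != s ->
  \int[mu]_(x in `[-1, 1]) (gcos (Num.sqrt (dist2 s r x)) * (P n).[x]) = l1 n s r.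
Proof.
move=> s0 r0 rs.
rewrite (@lam_scale cos n s r (fun S T => - (2 * sph_bessel_y n S * sph_bessel_j n T)) _ s0 r0 rs); last 2 first.
- exact: continuous_cos.
- by move=> S T TS; exact: cos_multipole.
have p0 := lt0r_neq0 (pi_gt0 R); rewrite /l1 /besY /=.
by move: (pi : R) p0 => p p0; field.
Qed.

Local Lemma l2E n s r : 0 < s -> 0 < r -> r != s ->
  \int[mu]_(x in `[-1, 1]) (gsin (Num.sqrt (dist2 s r x)) * (P n).[x]) = l2 n s r.
Proof.
move=> s0 r0 rs.
rewrite (@lam_scale sin n s r (fun S T => 2 * sph_bessel_j n S * sph_bessel_j n T) _ s0 r0 rs); last 2 first.
- exact: continuous_sin.
- by move=> S T TS; exact: sin_multipole.
have p0 := lt0r_neq0 (pi_gt0 R); rewrite /l2 /besJ /=.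
by move: (pi : R) p0 => p p0; field.
Qed.

Section Potentials.
Variables (f : R * R * R -> R) (M : R).
Hypotheses (mf : measurable_fun setT f) (M0 : 0 <= M).
Hypotheses (fM : forall y, cball3 d y -> `|f y| <= M) (faxi : axisymmetric f).

Lemma domain_bm_sph : domain_bm d (sph f).
Proof.
split; first by apply: measurable_funTS; exact: measurable_sph.
exists M => -[r b] [/= + _]; rewrite in_itv/= => /andP[r0 rd].
by apply: fM; rewrite /cball3 /= sph_norm// ltW.
Qed.

Let V (g : R -> R) s b : R := \int[mu3 R]_(y in cball3 d)
  (g (enorm ((s * sin b, 0, s * cos b) - y)) * f y).

Local Lemma V_kernel_int (g : R -> R) n s (c : R) (K : R * R -> R) :
  measurable_fun setT g -> (forall r, 0 <= r -> `|g r| <= Cg * r^-1) ->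
  (forall r, 0 < r -> {for r, continuous g}) -> 0 < s <= d ->
  kernel_adm d (fun r => K (s, r)) ->
  (forall r, 0 < r -> r != s ->
    \int[mu]_(x in `[-1, 1]) (g (Num.sqrt (dist2 s r x)) * (P n).[x]) = c * K (s, r)) ->
  mu.-integrable `[0, pi] (EFin \o (fun b => V g s b * legendre_sin n b)) /\
  \int[mu]_(b in `[0, pi]) (V g s b * legendre_sin n b) = 2 * pi * c * kernel_int d n (fun r => K (s, r)) (sph f).
Proof.
move=> mg gC cg /andP[s0 sd] aK lamE.
have [i1 e1] := potential_legendre d0 mg Cg0 gC cg mf M0 fM faxi s0 sd lamE.
split; first exact: i1.
rewrite [LHS]e1 -mulrA -(kernel_intZ d0 n c aK domain_bm_sph).
have [i2 _] := kernel_int_outer d0 n (kernel_admZ c aK) domain_bm_sph.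
by rewrite /kernel_int -RintegralZl.
Qed.

Lemma Vcos_kernel_int n s : 0 < s <= d ->
  mu.-integrable `[0, pi] (EFin \o (fun b => V gcos s b * legendre_sin n b)) /\
  \int[mu]_(b in `[0, pi]) (V gcos s b * legendre_sin n b) =
    - kappa * kernel_int d n (fun r => besY kappa n (s, r)) (sph f).
Proof.
move=> /[dup] hs /andP[s0 sd].
have [||||i ->] := @V_kernel_int gcos n s (- (kappa / (2 * pi))) (besY kappa n) _ _ _ hs (kernel_adm_besY n hs) _.
- by apply: green_measurable; exact: measurable_cos.
- by apply: green_bound => x; exact: cos_max.
- by apply: green_cont; exact: continuous_cos.
- by move=> r r0 rs; exact: l1E.
have p0 := lt0r_neq0 (pi_gt0 R); split=> //; congr (_ * _).
by move: (pi : R) p0 => p p0; field.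
Qed.

Lemma Vsin_kernel_int n s : 0 < s <= d ->
  mu.-integrable `[0, pi] (EFin \o (fun b => V gsin s b * legendre_sin n b)) /\
  \int[mu]_(b in `[0, pi]) (V gsin s b * legendre_sin n b) =
    kappa * kernel_int d n (fun r => besJ kappa n (s, r)) (sph f).
Proof.
move=> /[dup] hs /andP[s0 sd].
have [||||i ->] := @V_kernel_int gsin n s (kappa / (2 * pi)) (besJ kappa n) _ _ _ hs (kernel_adm_besJ n hs) _.
- by apply: green_measurable; exact: measurable_sin.
- by apply: green_bound => x; exact: sin_max.
- by apply: green_cont; exact: continuous_sin.
- by move=> r r0 rs; exact: l2E.
have p0 := lt0r_neq0 (pi_gt0 R); split=> //; congr (_ * _).
by move: (pi : R) p0 => p p0; field.
Qed.

Lemma V_integrable (g : R -> R) s b : measurable_fun setT g ->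
  (forall r, 0 <= r -> `|g r| <= Cg * r^-1) -> 0 < s <= d ->
  (mu3 R).-integrable (cball3 d) (EFin \o (fun y =>
    g (enorm ((s * sin b, 0, s * cos b) - y)) * f y)).
Proof.
move=> mg gC /andP[s0 sd]; apply: (potential_integrable d0 mg Cg0 gC mf M0 fM).
by rewrite sph_norm// ltW.
Qed.

End Potentials.

Lemma legendre_coef_parts (h : R * R -> R[i]) n r : legendre_coef h n r =
  ((2 * n + 1)%:R / 2 * \int[mu]_(b in `[0, pi]) (Re (h (r, b)) * legendre_sin n b)) +i*
  ((2 * n + 1)%:R / 2 * \int[mu]_(b in `[0, pi]) (Im (h (r, b)) * legendre_sin n b)).
Proof.
apply: complex_eq; rewrite /legendre_coef /cintegral ?ReMl ?ImMl /=; congr (_ * _).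
  by apply: eq_Rintegral => b _; rewrite ReMr.
by apply: eq_Rintegral => b _; rewrite ImMr.
Qed.

Section Scattering.
Variables (nref ui u : R * R * R -> R[i]).
Hypotheses (nref_axi : axisymmetric nref) (nref_reg : bounded_measurable setT nref).
Hypotheses (u_axi : axisymmetric u) (u_meas : cmeasurable setT u)
  (u_bounded : bounded_on (cball3 d) u).
Hypothesis u_LS : lippmann_schwinger kappa d (contrast nref) ui u.

Let m := contrast nref.
Let f1 y := Re (u y * m y).
Let f2 y := Im (u y * m y).

Lemma contrast_meas : cmeasurable setT m.
Proof.
have [[m1 m2] _] := nref_reg; split.
  rewrite (_ : (fun x => _) = (fun x => 1 - (Re (nref x) * Re (nref x) - Im (nref x) * Im (nref x)))).
    by apply: measurable_funB; [exact: measurable_cst|apply: measurable_funB; exact: measurable_funM].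
  by apply/funext => x; rewrite /m /contrast expr2 ReB ReM.
rewrite (_ : (fun x => _) = (fun x => - (Re (nref x) * Im (nref x) + Im (nref x) * Re (nref x)))).
  by apply: measurableT_comp => //; apply: measurable_funD; exact: measurable_funM.
by apply/funext => x; rewrite /m /contrast expr2 ImB ImM /= sub0r.
Qed.

Lemma contrast_bounded : exists2 M : R, 0 <= M & forall x, Normc.normc (m x) <= M.
Proof.
have [_ [M hM]] := nref_reg; exists (1 + M ^+ 2).
  by rewrite addr_ge0// sqr_ge0.
move=> x; rewrite /m /contrast; apply: le_trans (le_normcD _ _) _.
rewrite Normc.normc1 lerD2l normcN expr2 Normc.normcM.
by rewrite expr2 ler_pM ?normc_ge0 ?hM.
Qed.

Lemma u_bounded0 : exists2 M : R, 0 <= M & forall x, cball3 d x -> Normc.normc (u x) <= M.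
Proof.
have [M hM] := u_bounded; exists `|M| => // x /hM h; apply: le_trans h _; exact: ler_norm.
Qed.

Lemma um_bounded : exists2 M : R, 0 <= M & forall x, cball3 d x -> Normc.normc (u x * m x) <= M.
Proof.
have [M M0 hM] := u_bounded0; have [N N0 hN] := contrast_bounded.
exists (M * N); first exact: mulr_ge0.
by move=> x dx; rewrite Normc.normcM ler_pM ?normc_ge0 ?hM.
Qed.

Lemma m_axi : axisymmetric m.
Proof. by move=> a x y z; rewrite /m /contrast nref_axi. Qed.

Local Lemma f1_axi : axisymmetric f1.
Proof. by move=> a x y z; rewrite /f1 u_axi m_axi. Qed.
Local Lemma f2_axi : axisymmetric f2.
Proof. by move=> a x y z; rewrite /f2 u_axi m_axi. Qed.

Local Lemma f1_meas : measurable_fun setT f1.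
Proof.
have [m1 m2] := contrast_meas; have [u1 u2] := u_meas.
rewrite /f1 (_ : (fun x => _) = (fun y => Re (u y) * Re (m y) - Im (u y) * Im (m y))).
  by apply: measurable_funB; exact: measurable_funM.
by apply/funext => y; rewrite ReM.
Qed.

Local Lemma f2_meas : measurable_fun setT f2.
Proof.
have [m1 m2] := contrast_meas; have [u1 u2] := u_meas.
rewrite /f2 (_ : (fun x => _) = (fun y => Re (u y) * Im (m y) + Im (u y) * Re (m y))).
  by apply: measurable_funD; exact: measurable_funM.
by apply/funext => y; rewrite ImM.
Qed.

Let pt s b : R * R * R := (s * sin b, 0, s * cos b).

Let V (g : R -> R) (f : R * R * R -> R) s b : R :=
  \int[mu3 R]_(y in cball3 d) (g (enorm (pt s b - y)) * f y).

Local Lemma mgc : measurable_fun setT gcos. Proof. by apply: green_measurable; exact: measurable_cos. Qed.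
Local Lemma mgs : measurable_fun setT gsin. Proof. by apply: green_measurable; exact: measurable_sin. Qed.
Local Lemma gcC r : 0 <= r -> `|gcos r| <= Cg * r^-1.
Proof. by apply: green_bound => x; exact: cos_max. Qed.
Local Lemma gsC r : 0 <= r -> `|gsin r| <= Cg * r^-1.
Proof. by apply: green_bound => x; exact: sin_max. Qed.

Local Lemma LS_parts s b : 0 < s <= d ->
  Re (ui (pt s b)) = Re (u (pt s b)) + kappa ^+ 2 * (V gcos f1 s b - V gsin f2 s b) /\
  Im (ui (pt s b)) = Im (u (pt s b)) + kappa ^+ 2 * (V gcos f2 s b + V gsin f1 s b).
Proof.
move=> hs; have [M M0 hM] := um_bounded.
have h1 y : cball3 d y -> `|f1 y| <= M by move=> dy; exact: le_trans (Re_le_norm _) (hM y dy).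
have h2 y : cball3 d y -> `|f2 y| <= M by move=> dy; exact: le_trans (Im_le_norm _) (hM y dy).
have i11 := V_integrable f1_meas M0 h1 (g := gcos) (s := s) b mgc gcC hs.
have i12 := V_integrable f2_meas M0 h2 (g := gcos) (s := s) b mgc gcC hs.
have i21 := V_integrable f1_meas M0 h1 (g := gsin) (s := s) b mgs gsC hs.
have i22 := V_integrable f2_meas M0 h2 (g := gsin) (s := s) b mgs gsC hs.
have mB := @measurable_cball3 R d.
have e1 : V gcos f1 s b - V gsin f2 s b = \int[mu3 R]_(y in cball3 d)
    Re (green kappa (enorm (pt s b - y)) * u y * m y).
  rewrite /V -RintegralB//; apply: eq_Rintegral => y _.
  by rewrite green_parts -mulrA ReM.
have e2 : V gcos f2 s b + V gsin f1 s b = \int[mu3 R]_(y in cball3 d)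
    Im (green kappa (enorm (pt s b - y)) * u y * m y).
  rewrite /V -RintegralD//; apply: eq_Rintegral => y _.
  by rewrite green_parts -mulrA ImM.
rewrite e1 e2; have := u_LS (pt s b); set I := cintegral _ _ _ => h.
have -> : ui (pt s b) = u (pt s b) + (kappa ^+ 2)%:C * I by rewrite h subrK.
by rewrite ReD ImD ReMl ImMl.
Qed.

(** The axisymmetric Lippmann-Schwinger equation decouples into radial
    equations for the Legendre coefficients; the factor [i / 2] comes from
    [e^(i kappa r) / (4 pi r) = i kappa / (4 pi) * h_0 (kappa r)] and the
    azimuthal integral [2 pi]. *)
Lemma radial_equation n s : 0 < s <= d ->
  legendre_coef (sph u) n s =
  legendre_coef (sph ui) n s + 'i / 2 * Kn kappa d (sph m) n (sph u) s.
Proof.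
move=> /[dup] hs /andP[s0 sd]; have [M M0 hM] := um_bounded.
have h1 y : cball3 d y -> `|f1 y| <= M by move=> dy; exact: le_trans (Re_le_norm _) (hM y dy).
have h2 y : cball3 d y -> `|f2 y| <= M by move=> dy; exact: le_trans (Im_le_norm _) (hM y dy).
have r1 := domain_bm_sph f1_meas h1; have r2 := domain_bm_sph f2_meas h2.
have [j11 v11] := Vcos_kernel_int f1_meas M0 h1 f1_axi n hs.
have [j12 v12] := Vcos_kernel_int f2_meas M0 h2 f2_axi n hs.
have [j21 v21] := Vsin_kernel_int f1_meas M0 h1 f1_axi n hs.
have [j22 v22] := Vsin_kernel_int f2_meas M0 h2 f2_axi n hs.
have mpi := measurable_itv `[0, pi] : measurable (`[0, pi]%classic : set R).
have [U U0 hU] := u_bounded0; have [mu1 mu2] := u_meas.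
have iu (h : R[i] -> R) : measurable_fun setT (h \o u) -> (forall z, `|h z| <= Normc.normc z) ->
    mu.-integrable `[0, pi] (EFin \o (fun b => h (u (pt s b)) * legendre_sin n b)).
  move=> mh hn; apply: (bounded_integrable (M := U * 1)) => //; first exact: mu_itv_oo.
    apply: measurable_funTS; apply: measurable_funM; last exact: measurable_legendre_sin.
    exact: (measurableT_comp (measurable_sph mh) (measurable_pair1 s)).
  move=> b _; rewrite normrM ler_pM ?legendre_sin_bound//; apply: le_trans (hn _) (hU _ _).
  by rewrite /cball3 /= sph_norm// ltW.
have iu1 := iu (fun z => Re z) mu1 (@Re_le_norm R).
have iu2 := iu (fun z => Im z) mu2 (@Im_le_norm R).
have E1 : \int[mu]_(b in `[0, pi]) (Re (ui (pt s b)) * legendre_sin n b) =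
    \int[mu]_(b in `[0, pi]) (Re (u (pt s b)) * legendre_sin n b) + kappa ^+ 2 *
     (- kappa * kernel_int d n (fun r => besY kappa n (s, r)) (sph f1)
      - kappa * kernel_int d n (fun r => besJ kappa n (s, r)) (sph f2)).
  rewrite -v11 -v22 -RintegralB// -RintegralZl//; last first.
    by apply: integrable_subr; [exact: measurable_itv|exact: j11|exact: j22].
  rewrite -RintegralD//; last first.
    apply: integrable_mulr; first exact: measurable_itv.
    by apply: integrable_subr; [exact: measurable_itv|exact: j11|exact: j22].
  by apply: eq_Rintegral => b _; rewrite (LS_parts b hs).1 /V /pt; ring.
have E2 : \int[mu]_(b in `[0, pi]) (Im (ui (pt s b)) * legendre_sin n b) =
    \int[mu]_(b in `[0, pi]) (Im (u (pt s b)) * legendre_sin n b) + kappa ^+ 2 *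
     (- kappa * kernel_int d n (fun r => besY kappa n (s, r)) (sph f2)
      + kappa * kernel_int d n (fun r => besJ kappa n (s, r)) (sph f1)).
  rewrite -v12 -v21 -RintegralD// -RintegralZl//; last first.
    by apply: integrable_addr; [exact: measurable_itv|exact: j12|exact: j21].
  rewrite -RintegralD//; last first.
    apply: integrable_mulr; first exact: measurable_itv.
    by apply: integrable_addr; [exact: measurable_itv|exact: j12|exact: j21].
  by apply: eq_Rintegral => b _; rewrite (LS_parts b hs).2 /V /pt; ring.
have hc : domain_cbm (fun z => sph u z * sph m z) by split.
pose J1 := kernel_int d n (fun r => besJ kappa n (s, r)) (sph f1).
pose J2 := kernel_int d n (fun r => besJ kappa n (s, r)) (sph f2).
pose Y1 := kernel_int d n (fun r => besY kappa n (s, r)) (sph f1).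
pose Y2 := kernel_int d n (fun r => besY kappa n (s, r)) (sph f2).
have hK : Kn kappa d (sph m) n (sph u) s =
  - ((2 * n + 1)%:R * kappa ^+ 3)%:C * ((J1 - Y2) +i* (J2 + Y1)) := KnE n hs hc.
pose U1 := \int[mu]_(b in `[0, pi]) (Re (u (pt s b)) * legendre_sin n b).
pose U2 := \int[mu]_(b in `[0, pi]) (Im (u (pt s b)) * legendre_sin n b).
have hu : legendre_coef (sph u) n s =
  ((2 * n + 1)%:R / 2 * U1) +i* ((2 * n + 1)%:R / 2 * U2) := legendre_coef_parts (sph u) n s.
have hui : legendre_coef (sph ui) n s =
  ((2 * n + 1)%:R / 2 * \int[mu]_(b in `[0, pi]) (Re (ui (pt s b)) * legendre_sin n b)) +i*
  ((2 * n + 1)%:R / 2 * \int[mu]_(b in `[0, pi]) (Im (ui (pt s b)) * legendre_sin n b)).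
  exact: legendre_coef_parts.
rewrite E1 E2 -/J1 -/J2 -/Y1 -/Y2 -/U1 -/U2 in hui.
rewrite hK hu hui {hK hu hui}; move: J1 J2 Y1 Y2 U1 U2 ((2 * n + 1)%:R : R) => J1 J2 Y1 Y2 U1 U2 c.
by apply: complex_eq; rewrite ?ReD ?ImD ?Re_half_i ?Im_half_i mulNr ?ReN ?ImN ?ReMl ?ImMl /=
  !exprS expr0; field.
Qed.

End Scattering.

End RadialEquations.

(** * Legendre tails of a product *)
Section Density.
Variable R : realType.
Notation mu := (@lebesgue_measure R).

Local Lemma acos_itv (y : R) : -1 <= y <= 1 -> acos y \in `[0, pi].
Proof. by move=> y1; rewrite in_itv/= acos_ge0// acos_lepi. Qed.

Local Lemma acos_lt (y c : R) : -1 <= y <= 1 -> c \in `[0, pi] -> cos c < y -> acos y < c.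
Proof. by move=> y1 cI; rewrite -{1}(acosK y1) (ltr_cos (acos_itv y1) cI). Qed.

Local Lemma acos_gt (y c : R) : -1 <= y <= 1 -> c \in `[0, pi] -> y < cos c -> c < acos y.
Proof. by move=> y1 cI; rewrite -{1}(acosK y1) (ltr_cos cI (acos_itv y1)). Qed.

Lemma cont_acos_clamp : continuous (fun x : R => acos (clamp x)).
Proof.
have cc : continuous (@clamp R).
  have h : forall x : R, -1 <= x <= 1 -> {for x, continuous (@idfun R)} by move=> x _; exact: cvg_id.
  exact: (cont_clamp h).
move=> x; set a := acos (clamp x).
have a0 : 0 <= a by apply: acos_ge0; exact: clamp_itv.
have api : a <= pi by apply: acos_lepi; exact: clamp_itv.
have aI : a \in `[0, pi] by rewrite in_itv/= a0.
have ca : cos a = clamp x by apply: acosK; rewrite in_itv/= clamp_itv.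
apply/cvgrPdist_le => /= e e0.
have up : \forall y \near x, acos (clamp y) <= a + e.
  have [h|h] := leP pi (a + e).
    by near=> y; apply: le_trans h; apply: acos_lepi; exact: clamp_itv.
  have eI : a + e \in `[0, pi] by rewrite in_itv/= (ltW h) andbT; lra.
  have h1 : cos (a + e) < clamp x by rewrite -ca (ltr_cos aI eI) ltrDl.
  have : \forall y \near x, cos (a + e) < clamp y by apply: (cvgr_gt _ (cc x)).
  by apply: filterS => y hy; apply/ltW/acos_lt => //; exact: clamp_itv.
have dn : \forall y \near x, a - e <= acos (clamp y).
  have [h|h] := leP (a - e) 0.
    by near=> y; apply: le_trans h _; apply: acos_ge0; exact: clamp_itv.
  have eI : a - e \in `[0, pi] by rewrite in_itv/= (ltW h)/=; lra.
  have h1 : clamp x < cos (a - e) by rewrite -ca (ltr_cos eI aI) ltrBlDr ltrDl.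
  have : \forall y \near x, clamp y < cos (a - e) by apply: (cvgr_lt _ (cc x)).
  by apply: filterS => y hy; apply/ltW/acos_gt => //; exact: clamp_itv.
near=> y; rewrite -/a ler_norml.
have h1 : acos (clamp y) <= a + e by near: y.
have h2 : a - e <= acos (clamp y) by near: y.
by apply/andP; split; lra.
Unshelve. all: by end_near. Qed.

(** Continuous functions are dense in [L^1], and a continuous function of [b] is
    a continuous function of [cos b], to which Weierstrass' theorem applies. *)
Lemma poly_cos_dense (phi : R -> R) (M : R) : measurable_fun `[0, pi] phi ->
  (forall b, 0 <= b <= pi -> `|phi b| <= M) -> forall e : R, 0 < e ->
  exists p : {poly R}, \int[mu]_(b in `[0, pi]) `|phi b - p.[cos b]| <= e.
Proof.
move=> mphi phiM e e0; have pi0 := pi_gt0 R.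
have mpi := measurable_itv `[0, pi] : measurable (`[0, pi]%classic : set R).
have iphi : mu.-integrable `[0, pi] (EFin \o phi).
  by apply: (bounded_integrable (M := M)) => //; exact: mu_itv_oo.
have [g_ [cg ig gc]] := approximation_continuous_integrable mpi (mu_itv_oo _ _) iphi.
have e2 : 0 < e / 2 by rewrite divr_gt0.
have [g [cg' ig' ge]] : exists g : R -> R, [/\ continuous g, mu.-integrable `[0, pi] (EFin \o g) &
    \int[mu]_(b in `[0, pi]) `|phi b - g b| <= e / 2].
  move/fine_cvgP : gc => [fgc gc].
  move/cvgrPdist_le : gc => /(_ _ e2) gc.
  near \oo => N.
  exists (g_ N); split => //.
  have h : `|0 - fine (\int[mu]_(z in `[0%R, pi]) `|(phi z - g_ N z)%:E|)%E| <= e / 2 by near: N.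
  rewrite sub0r normrN in h; apply: le_trans h; rewrite /Rintegral; exact: ler_norm.
have ch : continuous (fun x => g (acos (clamp x))).
  by move=> x; apply: (@continuous_comp _ _ _ (fun x => acos (clamp x)) g x); [exact: cont_acos_clamp|exact: cg'].
have e3 : 0 < e / (2 * pi) by rewrite divr_gt0// mulr_gt0.
have [p hp] := weierstrass ch e3.
exists p.
have gp b : 0 <= b <= pi -> `|g b - p.[cos b]| <= e / (2 * pi).
  move=> bI; have := hp (cos b); rewrite cos_geN1 cos_le1 => /(_ isT).
  by rewrite clamp_id ?cos_geN1 ?cos_le1// cosK// in_itv.
have cgp : continuous (fun b => g b - p.[cos b]).
  by move=> b; apply: cvgB; [exact: cg'|exact: cont_horner_cos].
have i1 : mu.-integrable `[0, pi] (EFin \o (fun b => `|phi b - g b|)).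
  by apply: integrable_norm; apply: integrable_subr.
have i2 : mu.-integrable `[0, pi] (EFin \o (fun b => `|g b - p.[cos b]|)).
  by apply: integrable_norm; apply: cont_integrable => b _; exact: cgp.
apply: (@le_trans _ _ (\int[mu]_(b in `[0, pi]) (`|phi b - g b| + `|g b - p.[cos b]|))).
  apply: le_Rintegral => //.
  - apply: integrable_norm; apply: integrable_subr => //.
    by apply: cont_integrable => b _; exact: cont_horner_cos.
  - exact: integrable_addr.
  - by move=> b _; have := ler_normD (phi b - g b) (g b - p.[cos b]); rewrite addrA subrK.
rewrite RintegralD//.
have h2 : \int[mu]_(b in `[0, pi]) `|g b - p.[cos b]| <= e / 2.
  apply: le_trans (ler_norm _) _.
  apply: le_trans (Rintegral_itv_bound (M := e / (2 * pi)) (ltW pi0) i2 _) _.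
    by move=> b bI; rewrite normr_id gp.
  have p0 := lt0r_neq0 pi0; move: (pi : R) p0 => p0' q0.
  by rewrite subr0 le_eqVlt; apply/orP; left; apply/eqP; field.
by move: ge h2; lra.
Unshelve. all: by end_near. Qed.

End Density.

Section Triple.
Variable R : realType.
Notation P := (@legendre R).
Notation mu := (@lebesgue_measure R).
Implicit Types (p q : {poly R}).

Lemma pint_ge0 p : (forall x : R, -1 <= x <= 1 -> 0 <= p.[x]) -> 0 <= pint p.
Proof.
move=> p0; rewrite -Rintegral_theta_poly; apply: Rintegral_ge0 => b /=.
rewrite in_itv/= => bI; apply: mulr_ge0; last exact: sin_ge0_pi.
by apply: p0; rewrite cos_geN1 cos_le1.
Qed.

(** Cauchy-Schwarz, by the discriminant of [t |-> pint ((t p + q) ^ 2)]. *)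
Lemma pint_CS p q : pint (p * q) ^+ 2 <= pint (p * p) * pint (q * q).
Proof.
have H t : 0 <= pint (p * p) * t ^+ 2 + 2 * pint (p * q) * t + pint (q * q).
  have -> : pint (p * p) * t ^+ 2 + 2 * pint (p * q) * t + pint (q * q) =
      pint ((t *: p + q) * (t *: p + q)).
    have pZ (k : R) (r : {poly R}) : pint (k *: r) = k * pint r by exact: linearZ.
    have pD (r r' : {poly R}) : pint (r + r') = pint r + pint r' by exact: linearD.
    have -> : (t *: p + q) * (t *: p + q) = (t * t) *: (p * p) + (t + t) *: (p * q) + q * q.
      by rewrite -!mul_polyC polyCM polyCD; ring.
    by rewrite (pD _ (q * q)) pD !pZ; ring.
  by apply: pint_ge0 => x _; rewrite hornerM -expr2 sqr_ge0.
have a0 : 0 <= pint (p * p) by apply: pint_ge0 => x _; rewrite hornerM -expr2 sqr_ge0.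
move: H a0; move: (pint (p * p)) (pint (p * q)) (pint (q * q)) => a b c H a0.
have [a1|a1] := ltP 0 a.
  have := H (- b / a); have an := lt0r_neq0 a1.
  have -> : a * (- b / a) ^+ 2 + 2 * b * (- b / a) + c = (a * c - b ^+ 2) / a by field.
  by rewrite pmulr_lge0 ?invr_gt0// subr_ge0.
have {a0 a1} az : a = 0 by apply/eqP; rewrite eq_le a1 a0.
rewrite az mul0r; have H' t : 0 <= 2 * b * t + c by have := H t; rewrite az mul0r add0r.
have [b0|b0] := eqVneq b 0; first by rewrite b0 expr0n.
have := H' ((- c - 1) / (2 * b)).
have -> : 2 * b * ((- c - 1) / (2 * b)) + c = -1 by field.
by rewrite ler0N1.
Qed.

(** The integrals governing the product of two Legendre series. *)
Definition triple (s n l : nat) : R := pint (P s * P n * P l).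

Lemma triple0 s n l : (l + n < s)%N -> triple s n l = 0.
Proof.
move=> lns; rewrite /triple -mulrA legendre_orth//.
apply: leq_trans (size_polyMleq _ _) _; rewrite !size_legendre; lia.
Qed.

(** Cauchy-Schwarz, with [|P_l| <= 1]. *)
Lemma triple_bound s n l : `|triple s n l| <= 2 / (Num.sqrt (2 * s + 1)%:R * Num.sqrt (2 * n + 1)%:R).
Proof.
have s0 : 0 < (2 * s + 1)%:R :> R by rewrite ltr0n addn1.
have n0 : 0 < (2 * n + 1)%:R :> R by rewrite ltr0n addn1.
have r0 : 0 < Num.sqrt (2 * s + 1)%:R * Num.sqrt (2 * n + 1)%:R :> R by rewrite mulr_gt0 ?sqrtr_gt0.
rewrite -(ler_pXn2r (n := 2))// ?nnegrE ?divr_ge0 ?(ltW r0)// real_normK ?num_real//.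
rewrite /triple -mulrA; apply: le_trans (pint_CS _ _) _.
rewrite legendre_norm.
have h : pint (P n * P l * (P n * P l)) <= 2 / (2 * n + 1)%:R.
  rewrite -legendre_norm -subr_ge0.
  have pB r r' : pint r - pint r' = pint (r - r') by rewrite -linearB.
  rewrite pB; apply: pint_ge0 => x x1.
  rewrite !(hornerD, hornerN, hornerM).
  have := legendre_le1 l x1; rewrite ler_norml => /andP[h1 h2].
  move: ((P n).[x]) ((P l).[x]) h1 h2 => a b h1 h2.
  have -> : a * a - a * b * (a * b) = a ^+ 2 * ((1 - b) * (1 + b)) by ring.
  by rewrite mulr_ge0 ?sqr_ge0// mulr_ge0//; lra.
apply: le_trans (ler_wpM2l _ h) _; first by rewrite divr_ge0// ltW.
rewrite expr_div_n exprMn !sqr_sqrtr ?(ltW s0) ?(ltW n0)// le_eqVlt; apply/orP; left; apply/eqP.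
move: ((2 * s + 1)%:R : R) ((2 * n + 1)%:R : R) s0 n0 => a b a0 b0.
by field; rewrite !lt0r_neq0.
Qed.

End Triple.

Section Tail.
Variable R : realType.
Notation P := (@legendre R).
Notation mu := (@lebesgue_measure R).

Definition lcoef (a : R -> R) (s : nat) : R :=
  (2 * s + 1)%:R / 2 * \int[mu]_(b in `[0, pi]) (a b * legendre_sin s b).

Definition ltrunc (a : R -> R) (N : nat) (b : R) : R :=
  \sum_(s < N) lcoef a s * (P s).[cos b].

Definition angular_bm (a : R -> R) (M : R) : Prop :=
  measurable_fun `[0, pi] a /\ (forall b, 0 <= b <= pi -> `|a b| <= M).

Let mpi : measurable (`[0, pi]%classic : set R). Proof. exact: measurable_itv. Qed.

Lemma angular_bm_integrable a M : angular_bm a M -> mu.-integrable `[0, pi] (EFin \o a).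
Proof.
by move=> [ma aM]; apply: (bounded_integrable (M := M)) => //; exact: mu_itv_oo.
Qed.

Lemma angular_bmM a b M N : angular_bm a M -> angular_bm b N -> angular_bm (fun x => a x * b x) (M * N).
Proof.
move=> [ma aM] [mb bN]; split; first exact: measurable_funM.
by move=> x xI; rewrite normrM ler_pM ?aM ?bN.
Qed.

Lemma angular_bmB a b M N : angular_bm a M -> angular_bm b N -> angular_bm (fun x => a x - b x) (M + N).
Proof.
move=> [ma aM] [mb bN]; split; first exact: measurable_funB.
by move=> x xI; apply: le_trans (ler_normB _ _) _; rewrite lerD ?aM ?bN.
Qed.

Lemma angular_bm_sin : angular_bm (@sin R) 1.
Proof. by split=> [|b _]; [apply: measurable_funTS; exact: measurable_sin|exact: sin_abs_le1]. Qed.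

Lemma angular_bm_poly p : exists2 M, 0 <= M & angular_bm (fun b => p.[cos b]) M.
Proof.
have [|M M0 hM] := @cont_bounded R (horner p); first exact: continuous_horner.
exists M => //; split; first by apply: measurable_funTS; apply: continuous_measurable_fun; exact: cont_horner_cos.
by move=> b _; apply: hM; rewrite cos_geN1 cos_le1.
Qed.

Lemma ltruncE a N b : ltrunc a N b = (\sum_(s < N) lcoef a s *: P s).[cos b].
Proof. by rewrite /ltrunc horner_sum; apply: eq_bigr => s _; rewrite (hornerZ (lcoef a s) (P s)). Qed.

Lemma lcoef_poly a M p : angular_bm a M ->
  \int[mu]_(b in `[0, pi]) (a b * (p.[cos b] * sin b)) =
  \sum_(j < size p) ((2 * j + 1)%:R / 2 * pint (p * P j)) * (2 / (2 * j + 1)%:R * lcoef a j).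
Proof.
move=> ha; rewrite {1}(legendre_expand (leqnn (size p))).
under eq_Rintegral do rewrite horner_sum mulr_suml mulr_sumr.
have hi (j : nat) : mu.-integrable `[0, pi] (EFin \o (fun b => a b * (((((2 * j + 1)%:R / 2 * pint (p * P j)) *: P j).[cos b]) * sin b))).
  have [K K0 hK] := angular_bm_poly (((2 * j + 1)%:R / 2 * pint (p * P j)) *: P j).
  exact: angular_bm_integrable (angular_bmM ha (angular_bmM hK angular_bm_sin)).
rewrite Rintegral_sum; last by move=> j; exact: hi.
apply: eq_bigr => j _; rewrite /lcoef.
have -> : \int[mu]_(b in `[0, pi]) (a b * ((((2 * j + 1)%:R / 2 * pint (p * P j)) *: P j).[cos b] * sin b)) =
   (2 * j + 1)%:R / 2 * pint (p * P j) * \int[mu]_(b in `[0, pi]) (a b * legendre_sin j b).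
  rewrite -RintegralZl//; last first.
    have [K K0 hK] := angular_bm_poly (P j).
    exact: angular_bm_integrable (angular_bmM ha (angular_bmM hK angular_bm_sin)).
  by apply: eq_Rintegral => b _; rewrite hornerZ /legendre_sin; ring.
have c0 : (2 * j + 1)%:R != 0 :> R by rewrite pnatr_eq0 addn1.
by move: ((2 * j + 1)%:R : R) c0 => c c0; field.
Qed.

Lemma angular_bm_trunc a N : exists2 M, 0 <= M & angular_bm (ltrunc a N) M.
Proof.
have [M M0 [mM hM]] := angular_bm_poly (\sum_(s < N) lcoef a s *: P s).
exists M => //; split=> [|b bI]; last by rewrite ltruncE; exact: hM.
by apply: eq_measurable_fun mM => b _; rewrite ltruncE.
Qed.

Lemma lcoef_trunc a N j : (j < N)%N -> lcoef (ltrunc a N) j = lcoef a j.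
Proof.
move=> jN; rewrite /lcoef.
have -> : \int[mu]_(b in `[0, pi]) (ltrunc a N b * legendre_sin j b) =
    pint ((\sum_(s < N) lcoef a s *: P s) * P j).
  by rewrite -Rintegral_theta_poly; apply: eq_Rintegral => b _; rewrite ltruncE hornerM /legendre_sin; ring.
rewrite pint_sum_legendre//.
have c0 : (2 * j + 1)%:R != 0 :> R by rewrite pnatr_eq0 addn1.
by rewrite /lcoef; move: ((2 * j + 1)%:R : R) c0 => c c0; field.
Qed.

(** Such a polynomial only sees the first [N] coefficients, which [a] and its
    truncation share. *)
Lemma remainder_orth a M N (p : {poly R}) : angular_bm a M -> (size p <= N)%N ->
  \int[mu]_(b in `[0, pi]) ((a b - ltrunc a N b) * (p.[cos b] * sin b)) = 0.
Proof.
move=> ha sp; have [K K0 hK] := angular_bm_trunc a N.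
have [Kp Kp0 hp] := angular_bm_poly p.
under eq_Rintegral do rewrite mulrBl.
rewrite RintegralB//; try exact: (angular_bm_integrable (angular_bmM _ (angular_bmM hp angular_bm_sin))).
- rewrite (lcoef_poly p ha) (lcoef_poly p hK) -sumrB big1// => j _.
  by rewrite lcoef_trunc ?subrr// (leq_trans (ltn_ord j)).
- exact: angular_bm_integrable (angular_bmM ha (angular_bmM hp angular_bm_sin)).
- exact: angular_bm_integrable (angular_bmM hK (angular_bmM hp angular_bm_sin)).
Qed.

(** Weak convergence: a uniformly bounded remainder that is orthogonal to more
    and more polynomials tends to zero against every bounded function. *)
Lemma remainder_weak a M K phi L : angular_bm a M -> (forall N b, `|ltrunc a N b| <= K) -> angular_bm phi L ->
  forall e : R, 0 < e -> exists N0, forall N, (N0 <= N)%N ->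
  `|\int[mu]_(b in `[0, pi]) ((a b - ltrunc a N b) * (phi b * sin b))| <= e.
Proof.
move=> ha hK [mphi phiL] e e0.
have M0 : 0 <= M by apply: le_trans (ha.2 0 _) => //; rewrite lexx pi_ge0.
have K0 : 0 <= K by apply: le_trans (hK 0%N 0).
have e1 : 0 < e / (M + K + 1) by rewrite divr_gt0//; lra.
have [p hp] := poly_cos_dense mphi phiL e1.
exists (size p) => N sN.
have [KN KN0 [mN _]] := angular_bm_trunc a N.
have hN : angular_bm (ltrunc a N) K by split => // b _; exact: hK.
have hr := angular_bmB ha hN; have hphi : angular_bm phi L by split.
have [Kp Kp0 hbp] := angular_bm_poly p.
have -> : \int[mu]_(b in `[0, pi]) ((a b - ltrunc a N b) * (phi b * sin b)) =
   \int[mu]_(b in `[0, pi]) ((a b - ltrunc a N b) * ((phi b - p.[cos b]) * sin b)).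
  have := remainder_orth ha sN => o.
  transitivity (\int[mu]_(b in `[0, pi]) ((a b - ltrunc a N b) * (phi b * sin b)) -
    \int[mu]_(b in `[0, pi]) ((a b - ltrunc a N b) * (p.[cos b] * sin b))); first by rewrite o subr0.
  rewrite -RintegralB//.
  - by apply: eq_Rintegral => b _; ring.
  - exact: angular_bm_integrable (angular_bmM hr (angular_bmM hphi angular_bm_sin)).
  - exact: angular_bm_integrable (angular_bmM hr (angular_bmM hbp angular_bm_sin)).
have hd := angular_bmB hphi hbp.
have i1 := angular_bm_integrable (angular_bmM hr (angular_bmM hd angular_bm_sin)).
have i2 : mu.-integrable `[0, pi] (EFin \o (fun b => `|phi b - p.[cos b]|)).
  by apply: integrable_norm; exact: angular_bm_integrable hd.
apply: le_trans (le_normr_Rintegral _ i1) _; first exact: mpi.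
apply: (@le_trans _ _ (\int[mu]_(b in `[0, pi]) ((M + K) * `|phi b - p.[cos b]|))).
  apply: le_Rintegral => //.
  - exact: integrable_norm.
  - exact: integrable_mulr.
  - move=> b /=; rewrite in_itv/= => bI; rewrite normrM ler_pM//; first exact: hr.2.
    by rewrite normrM -[leRHS]mulr1 ler_pM// sin_abs_le1.
rewrite RintegralZl//; apply: (@le_trans _ _ ((M + K) * (e / (M + K + 1)))).
  by rewrite ler_wpM2l// addr_ge0.
by rewrite mulrA ler_pdivrMr; [nra|lra].
Qed.

(** [P_s P_n] has degree [s + n] and is orthogonal to [P_l] for [l < s - n], which
    leaves the window [s - n <= l <= s + n]. *)
Lemma product_coef a m M N n F : angular_bm m M -> (F <= N)%N -> (n <= F)%N ->
  \int[mu]_(b in `[0, pi]) ((ltrunc a N b - ltrunc a F b) * (m b * legendre_sin n b)) =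
  \sum_(F <= s < N) lcoef a s * \sum_(s - n <= l < s + n + 1) lcoef m l * triple R s n l.
Proof.
move=> hm FN nF.
have e b : ltrunc a N b - ltrunc a F b = \sum_(F <= s < N) lcoef a s * (P s).[cos b].
  rewrite /ltrunc -!(big_mkord xpredT (fun s => lcoef a s * (P s).[cos b])).
  by rewrite [X in X - _](big_cat_nat (n := F))//= addrAC subrr add0r.
have hi s : mu.-integrable `[0, pi] (EFin \o (fun b => lcoef a s * (P s).[cos b] * (m b * legendre_sin n b))).
  have [K1 _ h1] := angular_bm_poly (P s); have [K2 _ h2] := angular_bm_poly (P n).
  have -> : (fun b => lcoef a s * (P s).[cos b] * (m b * legendre_sin n b)) =
     (fun b => lcoef a s * ((P s).[cos b] * (m b * ((P n).[cos b] * sin b)))).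
    by apply/funext => b; rewrite /legendre_sin; ring.
  apply: integrable_mulr => //; exact: angular_bm_integrable (angular_bmM h1 (angular_bmM hm (angular_bmM h2 angular_bm_sin))).
under eq_Rintegral do rewrite e mulr_suml.
rewrite Rintegral_sum//; apply: eq_big_nat => s /andP[Fs sN].
have -> : \int[mu]_(b in `[0, pi]) (lcoef a s * (P s).[cos b] * (m b * legendre_sin n b)) =
   lcoef a s * \int[mu]_(b in `[0, pi]) (m b * ((P s * P n).[cos b] * sin b)).
  have [K1 _ h1] := angular_bm_poly (P s * P n).
  rewrite -RintegralZl//; last exact: angular_bm_integrable (angular_bmM hm (angular_bmM h1 angular_bm_sin)).
  by apply: eq_Rintegral => b _; rewrite hornerM /legendre_sin; ring.
congr (_ * _); rewrite (lcoef_poly _ hm).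
have ssz : size (P s * P n) = (s + n + 1)%N.
  by rewrite size_mul ?legendre_neq0// !size_legendre; lia.
transitivity (\sum_(0 <= l < s + n + 1) lcoef m l * triple R s n l).
  rewrite ssz big_mkord; apply: eq_bigr => l _; rewrite /triple.
  have c0 : (2 * l + 1)%:R != 0 :> R by rewrite pnatr_eq0 addn1.
  by move: ((2 * l + 1)%:R : R) (pint _) c0 => c t c0; field.
rewrite (big_cat_nat (n := s - n))//=; last by lia.
rewrite big_nat_cond big1 ?add0r// => l /andP[/andP[_ lsn] _].
by rewrite triple0 ?mulr0//; lia.
Qed.

(** The coefficients of low index of [(a - a_F) m] see only the products
    [a_s m_l] with [F <= s] and [|s - l| <= n].  Convergence of the Legendre
    series of [a] to [a] is used in the weak sense only. *)
Lemma product_tail a m M Mm K n F (A C : nat -> R) (D : R) : angular_bm a M -> angular_bm m Mm ->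
  (forall N b, `|ltrunc a N b| <= K) -> (n <= F)%N ->
  (forall s, (F <= s)%N -> `|lcoef a s| <= A s) -> (forall l, (F - n <= l)%N -> `|lcoef m l| <= C l) ->
  (forall N, (F <= N)%N -> \sum_(F <= s < N) A s * \sum_(s - n <= l < s + n + 1) C l *
     (2 / (Num.sqrt (2 * s + 1)%:R * Num.sqrt (2 * n + 1)%:R)) <= D) ->
  `|\int[mu]_(b in `[0, pi]) ((a b - ltrunc a F b) * (m b * legendre_sin n b))| <= D.
Proof.
move=> ha hm hK nF hA hC hD.
have [Kn _ hn] := angular_bm_poly (P n).
have hphi : angular_bm (fun b => m b * (P n).[cos b]) (Mm * Kn) by exact: angular_bmM.
apply/ler_addgt0Pr => e e0.
have [N0 hN0] := remainder_weak ha hK hphi e0.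
pose N := maxn N0 F; have FN : (F <= N)%N by rewrite leq_maxr.
have [K1 _ h1] := angular_bm_trunc a N; have [K2 _ h2] := angular_bm_trunc a F.
have hmn := angular_bmM hm (angular_bmM hn angular_bm_sin).
have -> : \int[mu]_(b in `[0, pi]) ((a b - ltrunc a F b) * (m b * legendre_sin n b)) =
    \int[mu]_(b in `[0, pi]) ((ltrunc a N b - ltrunc a F b) * (m b * legendre_sin n b)) +
    \int[mu]_(b in `[0, pi]) ((a b - ltrunc a N b) * (m b * (P n).[cos b] * sin b)).
  rewrite -RintegralD//.
  - by apply: eq_Rintegral => b _; rewrite /legendre_sin; ring.
  - exact: angular_bm_integrable (angular_bmM (angular_bmB h1 h2) hmn).
  - exact: angular_bm_integrable (angular_bmM (angular_bmB ha h1) (angular_bmM hphi angular_bm_sin)).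
apply: le_trans (ler_normD _ _) _; apply: lerD; last by apply: hN0; exact: leq_maxl.
rewrite (product_coef a hm FN nF); apply: le_trans (hD N FN).
apply: le_trans (ler_norm_sum _ _ _) _; rewrite big_nat_cond [leRHS]big_nat_cond.
apply: ler_sum => s /andP[/andP[Fs sN] _]; rewrite normrM; apply: ler_pM => //; first exact: hA.
apply: le_trans (ler_norm_sum _ _ _) _; rewrite big_nat_cond [leRHS]big_nat_cond.
apply: ler_sum => l /andP[/andP[l1 l2] _]; rewrite normrM; apply: ler_pM => //.
  by apply: hC; lia.
exact: triple_bound.
Qed.

End Tail.

(** * Power sums *)
Section PowerSums.
Variable R : realType.
Implicit Types (l s n F N : nat) (a b p q : R).

Lemma ltrSn l : 0 < l.+1%:R :> R. Proof. by rewrite ltr0n. Qed.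

Lemma powR_split (x p q : R) : 0 < x -> x `^ (p + q) = x `^ p * x `^ q.
Proof. by move=> x0; rewrite powRD// (lt0r_neq0 x0) implybT. Qed.

Lemma powR_decr (x y p : R) : 0 < x -> x <= y -> 0 <= p -> y `^ (- p) <= x `^ (- p).
Proof.
move=> x0 xy p0; have y0 := lt_le_trans x0 xy.
rewrite !powRN lef_pV2 ?posrE ?powR_gt0//.
by rewrite ge0_ler_powR// nnegrE ltW.
Qed.

Lemma powR_exp_le (x p q : R) : 1 <= x -> p <= q -> x `^ p <= x `^ q.
Proof. by move=> x1 pq; rewrite ler_powR. Qed.

(** [ln (1 - x) <= - x] at [x = 1 / (l + 2)]. *)
Lemma ln_step l : (l.+2%:R : R)^-1 <= ln (l.+2%:R) - ln l.+1%:R.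
Proof.
have e : l.+1%:R = l.+2%:R * (1 - l.+2%:R^-1) :> R.
  by rewrite mulrBr mulr1 divff ?lt0r_neq0 ?ltrSn// -[l.+2%:R]natr1 addrK.
have h : 0 < 1 - (l.+2%:R : R)^-1 by rewrite subr_gt0 invf_lt1 ?ltrSn// ltr1n.
rewrite e lnM ?posrE ?ltrSn// opprD addrA subrr sub0r lerNr.
by rewrite le_ln1Dx// ltrN2 invf_lt1 ?ltrSn// ltr1n.
Qed.

Lemma harmonic_sum N : \sum_(1 <= l < N.+2) (l%:R : R)^-1 <= 1 + ln N.+1%:R.
Proof.
elim: N => [|N IH]; first by rewrite big_nat1 invr1 ln1 addr0.
rewrite big_nat_recr//=; apply: le_trans (lerD IH (ln_step N)) _.
by rewrite -addrA lerD2l addrC subrK.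
Qed.

(** The discrete form of [(- t ^ (- p))' = p t ^ (- p - 1)], from
    [1 + y <= exp y] at [y = p ln ((l + 2) / (l + 1))]. *)
Lemma power_tail_step l p : 0 < p ->
  l.+2%:R `^ (- (p + 1)) * p <= l.+1%:R `^ (- p) - l.+2%:R `^ (- p).
Proof.
move=> p0; have x0 := ltrSn l; have y0 := ltrSn l.+1.
have h : 1 + p / l.+2%:R <= l.+1%:R `^ (- p) / l.+2%:R `^ (- p).
  have -> : l.+1%:R `^ (- p) / l.+2%:R `^ (- p) = expR (p * (ln l.+2%:R - ln l.+1%:R)) :> R.
    rewrite /powR !(negPf (lt0r_neq0 (ltrSn _))) -expRN -expRD; congr expR; ring.
  apply: le_trans (expR_ge1Dx _).
  by rewrite lerD2l; apply: ler_wpM2l; [exact: ltW|exact: ln_step].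
have z0 : 0 < l.+2%:R `^ (- p) :> R by rewrite powR_gt0.
move: h; rewrite ler_pdivlMr// => h.
rewrite opprD powR_split// powR_inv1 ?ler0n//.
move: h; move: (l.+1%:R `^ _) (l.+2%:R `^ _) z0 => A B B0 h.
rewrite lerBrDr; apply: le_trans h; rewrite le_eqVlt; apply/orP; left; apply/eqP; ring.
Qed.

Lemma power_tail F N p : (0 < F)%N -> 0 < p ->
  \sum_(F.+1 <= s < N) s%:R `^ (- (p + 1)) <= F%:R `^ (- p) / p.
Proof.
case: F => // F _ p0; rewrite ler_pdivlMr//.
have [NF|] := leqP N F.+2.
  by rewrite big_geq// mul0r powR_ge0.
move=> /ltnW FN; rewrite mulr_suml.
suff : \sum_(F.+2 <= s < N) s%:R `^ (- (p + 1)) * p <= F.+1%:R `^ (- p) - N.-1%:R `^ (- p).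
  by move/le_trans; apply; rewrite gerBl powR_ge0.
rewrite -(subnKC FN); elim: (N - _)%N => [|j IH].
  by rewrite addn0 big_geq//= subrr.
rewrite addnS big_nat_recr ?leq_addr//= addSn.
apply: le_trans (lerD IH (power_tail_step _ p0)) _.
by rewrite addSn /= addrA addrNK lexx.
Qed.

Lemma sqrt_sum N : \sum_(n < N) (Num.sqrt (n.+1%:R : R))^-1 <= 2 * Num.sqrt N%:R.
Proof.
elim: N => [|N IH]; first by rewrite big_ord0 sqrtr0 mulr0.
rewrite big_ord_recr/=; apply: le_trans (lerD IH (lexx _)) _.
have h0 : 0 <= Num.sqrt N%:R :> R by exact: sqrtr_ge0.
have h1 : 0 < Num.sqrt N.+1%:R :> R by rewrite sqrtr_gt0 ltrSn.
have e0 : Num.sqrt N%:R ^+ 2 = N%:R :> R by rewrite sqr_sqrtr.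
have e1 : Num.sqrt N.+1%:R ^+ 2 = N%:R + 1 :> R by rewrite sqr_sqrtr// natr1.
move: (Num.sqrt _) (Num.sqrt N.+1%:R) h0 h1 e0 e1 => x y x0 y0 ex ey.
rewrite -(ler_pM2r y0) mulrDl mulVf ?lt0r_neq0//.
nra.
Qed.

Lemma count_le (a b c : nat) : (\sum_(a <= s < b) (s <= c)%N <= c.+1 - a)%N.
Proof.
have [|ab] := leqP b a; first by move=> ba; rewrite big_geq.
rewrite -(subnKC (ltnW ab)); elim: (b - a)%N => [|j IH]; first by rewrite addn0 big_geq.
rewrite addnS big_nat_recr ?leq_addr//=.
suff h : (\sum_(a <= s < a + j) (s <= c)%N <= minn j (c.+1 - a))%N by case: leqP; lia.
elim: {IH} j => [|j IH]; first by rewrite addn0 big_geq.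
rewrite addnS big_nat_recr ?leq_addr//=.
case: leqP; lia.
Qed.

Lemma natr_sum_nat (a b : nat) (f : nat -> nat) :
  (\sum_(a <= s < b) f s)%:R = \sum_(a <= s < b) (f s)%:R :> R.
Proof. by rewrite natr_sum. Qed.

(** Exchanging the sums, the index [l] is met by those [s >= a] with
    [s <= l + n], of which there are at most [l + n + 1 - a]. *)
Lemma window_sum (a b n L : nat) (T : nat -> R) : (forall l, 0 <= T l) ->
  \sum_(a <= s < b) \sum_(s - n <= l < L) T l <=
  \sum_(0 <= l < L) (l + n + 1 - a)%:R * T l.
Proof.
move=> T0.
have e s : \sum_(s - n <= l < L) T l = \sum_(0 <= l < L) (s <= l + n)%:R * T l.
  rewrite (big_nat_widenl _ 0)// big_mkcond /=; apply: eq_bigr => l _.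
  by rewrite leq_subLR addnC; case: ifP; rewrite ?mul1r ?mul0r.
under eq_bigr do rewrite e.
rewrite exchange_big/=; apply: ler_sum_nat => l _.
rewrite -mulr_suml ler_wpM2r// -natr_sum_nat ler_nat addn1.
exact: count_le.
Qed.

Lemma triangle_sum (l F : nat) : (\sum_(n < F.+1) (l + n - F) <= l * l)%N.
Proof.
rewrite (reindex_inj rev_ord_inj)/=.
rewrite (eq_bigr (fun n : 'I_F.+1 => (l - n)%N)); last by move=> n _; have := ltn_ord n; lia.
suff h M : (\sum_(n < M) (l - n) <= l * minn M l)%N.
  by apply: leq_trans (h _) _; rewrite leq_mul2l geq_minr orbT.
elim: M => [|M IH]; first by rewrite big_ord0.
rewrite big_ord_recr/=; apply: leq_trans (leq_add IH (leqnn _)) _.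
have [lM|Ml] := leqP l M; first by rewrite (minn_idPr (leq_trans lM _))// ; lia.
by rewrite (minn_idPl Ml) mulnS addnC leq_add2r leq_subr.
Qed.

Section TailBound.
Variable b : R.
Hypothesis b0 : 0 < b.

Let cw s n : R := 2 / (Num.sqrt (2 * s + 1)%:R * Num.sqrt (2 * n + 1)%:R).
Let sq n : R := Num.sqrt (2 * n + 1)%:R.

Local Lemma sq_gt0 n : 0 < sq n.
Proof. by rewrite sqrtr_gt0 ltr0n addn1. Qed.

Local Lemma sqE n : sq n * sq n = (2 * n + 1)%:R.
Proof. by rewrite -expr2 sqr_sqrtr. Qed.

Local Lemma sqF F s : (F < s)%N -> Num.sqrt F%:R <= sq s.
Proof. by move=> Fs; rewrite ler_wsqrtr// ler_nat; lia. Qed.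

(** The majorant of the remainder of index [n] has two parts.  As long as
    [2 n <= s] the window consists of [2 n + 1] indices [l >= s / 2], so both
    coefficients are small.  When [s < 2 n] small indices [l] occur and only
    [s >= F] helps; this requires [F < 2 n], and then [1 / n] is of order
    [1 / F]. *)
Definition tail_low F n : R :=
  2 `^ b * 2 * sq n / Num.sqrt F%:R * F%:R `^ (- (2 * b + 1)).

Definition tail_high F n : R :=
  2 / F%:R * F%:R `^ (- (b + 2)) *
  \sum_(0 <= l < (3 * F).+1) (l + n + 1 - F.+1)%:R * l%:R `^ (- b).

Definition tail_majorant F n : R :=
  tail_low F n + (if (F < 2 * n)%N then tail_high F n else 0).

Local Lemma low_term F n s : (0 < F)%N -> (F < s)%N -> (2 * n <= s)%N ->
  s%:R `^ (- (b + 2)) * \sum_(s - n <= l < s + n + 1) l%:R `^ (- b) * cw s n <=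
  2 `^ b * 2 * sq n / Num.sqrt F%:R * s%:R `^ (- (2 * b + 1 + 1)).
Proof.
move=> F0 Fs ns; have s0 : 0 < s%:R :> R by rewrite ltr0n; lia.
have [qn qs] := (sq_gt0 n, sq_gt0 s); have qF : 0 < Num.sqrt F%:R :> R by rewrite sqrtr_gt0 ltr0n.
have cw0 : 0 <= cw s n by rewrite /cw divr_ge0// mulr_ge0.
have h l : (s - n <= l < s + n + 1)%N -> l%:R `^ (- b) <= 2 `^ b * s%:R `^ (- b).
  move=> hl; have -> : 2 `^ b * s%:R `^ (- b) = (s%:R / 2) `^ (- b) :> R.
    by rewrite powRM// -[2^-1]powR_inv1// -powRrM mulrNN mul1r mulrC.
  apply: powR_decr; [by rewrite divr_gt0| |exact: ltW].
  by rewrite ler_pdivrMr// -natrM ler_nat; lia.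
rewrite -mulr_suml; have -> : - (2 * b + 1 + 1) = - (b + 2) + - b by ring.
rewrite powR_split//; set x := s%:R `^ (- (b + 2)).
have : \sum_(s - n <= l < s + n + 1) l%:R `^ (- b) <= (2 * n + 1)%:R * (2 `^ b * s%:R `^ (- b)).
  apply: (@le_trans _ _ (\sum_(s - n <= l < s + n + 1) (2 `^ b * s%:R `^ (- b)))).
    by apply: ler_sum_nat => l hl; exact: h.
  rewrite sumr_const_nat (_ : s + n + 1 - (s - n) = 2 * n + 1)%N; last by lia.
  by rewrite mulr_natl.
move/(ler_wpM2r cw0)/(ler_wpM2l (powR_ge0 s%:R (- (b + 2)))) => /le_trans; apply.
rewrite -/x; set y := s%:R `^ (- b); set z := 2 `^ b.
have -> : x * ((2 * n + 1)%:R * (z * y) * cw s n) = z * 2 * sq n / sq s * (x * y).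
  rewrite -sqE /cw -/(sq s) -/(sq n); field.
  by rewrite !lt0r_neq0.
rewrite ler_wpM2r ?mulr_ge0 ?powR_ge0// ler_wpM2l ?mulr_ge0 ?powR_ge0// ?ler0n// ?(ltW qn)//.
by rewrite lef_pV2 ?posrE// sqF.
Qed.

Local Lemma high_term F n s : (0 < F)%N -> (n <= F)%N -> (F < s)%N -> (s < 2 * n)%N ->
  s%:R `^ (- (b + 2)) * \sum_(s - n <= l < s + n + 1) l%:R `^ (- b) * cw s n <=
  2 / F%:R * F%:R `^ (- (b + 2)) * \sum_(s - n <= l < (3 * F).+1) l%:R `^ (- b).
Proof.
move=> F0 nF Fs sn; have F0' : 0 < F%:R :> R by rewrite ltr0n.
have [qn qs] := (sq_gt0 n, sq_gt0 s).
have cwF : cw s n <= 2 / F%:R.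
  rewrite /cw ler_wpM2l// lef_pV2 ?posrE ?mulr_gt0//.
  rewrite -[leLHS](@sqr_sqrtr _ F%:R) ?ler0n// expr2.
  apply: ler_pM; rewrite ?sqrtr_ge0// ?(sqF Fs)//.
  by rewrite ler_wsqrtr// ler_nat; lia.
rewrite -mulr_suml mulrA mulrC -mulrA.
have S0 i j : 0 <= \sum_(i <= l < j) l%:R `^ (- b) :> R.
  by rewrite sumr_ge0// => l _; exact: powR_ge0.
apply: ler_pM => //; first by rewrite /cw divr_ge0// mulr_ge0.
  by rewrite mulr_ge0// powR_ge0.
apply: ler_pM => //.
  by apply: powR_decr => //; [rewrite ler_nat; lia|rewrite addr_ge0// ltW].
rewrite [leRHS](big_cat_nat (n := s + n + 1))/=; [|lia|lia].
by rewrite lerDl.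
Qed.

Lemma tail_majorantP F n N : (0 < F)%N -> (n <= F)%N ->
  \sum_(F.+1 <= s < N) s%:R `^ (- (b + 2)) *
    (\sum_(s - n <= l < s + n + 1) l%:R `^ (- b) *
       (2 / (Num.sqrt (2 * s + 1)%:R * Num.sqrt (2 * n + 1)%:R))) <= tail_majorant F n.
Proof.
move=> F0 nF; pose L s := 2 `^ b * 2 * sq n / Num.sqrt F%:R * s%:R `^ (- (2 * b + 1 + 1)).
pose H s := 2 / F%:R * F%:R `^ (- (b + 2)) * \sum_(s - n <= l < (3 * F).+1) l%:R `^ (- b).
have c0 : 0 <= 2 `^ b * 2 * sq n / Num.sqrt F%:R.
  by rewrite !mulr_ge0 ?invr_ge0 ?sqrtr_ge0 ?powR_ge0.
have L0 s : 0 <= L s by rewrite mulr_ge0 ?powR_ge0.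
have H0 s : 0 <= H s.
  by rewrite !mulr_ge0 ?powR_ge0 ?sumr_ge0// => l _; exact: powR_ge0.
have hL : \sum_(F.+1 <= s < N) L s <= tail_low F n.
  rewrite -mulr_sumr ler_wpM2l//; have p0 : 0 < 2 * b + 1 by rewrite addr_gt0 ?mulr_gt0.
  apply: le_trans (power_tail N F0 p0) _.
  by rewrite ler_pdivrMr// ler_peMr ?powR_ge0// lerDr mulr_ge0// ltW.
rewrite /tail_majorant; case: ltnP => [Fn|nF2]; last first.
  rewrite addr0; apply: le_trans hL; apply: ler_sum_nat => s /andP[Fs _].
  by apply: low_term => //; lia.
have hH : \sum_(F.+1 <= s < N) H s <= tail_high F n.
  rewrite -mulr_sumr ler_wpM2l ?mulr_ge0 ?powR_ge0//.
  by apply: window_sum => l; exact: powR_ge0.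
apply: le_trans (lerD hL hH); rewrite -big_split/=; apply: ler_sum_nat => s /andP[Fs _].
have [ns|sn] := leqP (2 * n) s.
  by apply: le_trans (low_term F0 Fs ns) _; rewrite lerDl.
by apply: le_trans (high_term F0 nF Fs sn) _; rewrite lerDr.
Qed.

Local Lemma low_sum F : (0 < F)%N ->
  \sum_(n < F.+1) tail_low F n / n.+1%:R <= 2 `^ b * 16 * F%:R `^ (- (2 * b + 1)).
Proof.
move=> F0; have F0' : 0 < F%:R :> R by rewrite ltr0n.
have qF : 0 < Num.sqrt F%:R :> R by rewrite sqrtr_gt0.
pose c := 2 `^ b * 2 / Num.sqrt F%:R * F%:R `^ (- (2 * b + 1)).
have c0 : 0 <= c by rewrite !mulr_ge0 ?invr_ge0 ?powR_ge0 ?ltW.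
have h (n : 'I_F.+1) : tail_low F n / n.+1%:R <= c * 2 * (Num.sqrt n.+1%:R)^-1.
  have q0 : 0 < Num.sqrt n.+1%:R :> R by rewrite sqrtr_gt0 ltrSn.
  have qq : Num.sqrt n.+1%:R * Num.sqrt n.+1%:R = n.+1%:R :> R by rewrite -expr2 sqr_sqrtr.
  have q2 : sq n <= 2 * Num.sqrt n.+1%:R.
    rewrite -[2](gtr0_norm (ltr0n R 2)) -sqrtr_sqr -sqrtrM ?sqr_ge0// ler_wsqrtr//.
    by rewrite -natrX -natrM ler_nat; lia.
  have -> : tail_low F n / n.+1%:R = c * (sq n / n.+1%:R).
    rewrite /tail_low /c; field; by rewrite !lt0r_neq0.
  rewrite -mulrA (ler_wpM2l c0)// ler_pdivrMr ?ltrSn// -[X in _ * X]qq mulrA mulfVK ?lt0r_neq0//.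
apply: (@le_trans _ _ (\sum_(n < F.+1) c * 2 * (Num.sqrt n.+1%:R)^-1)).
  by apply: ler_sum => n _; exact: h.
rewrite -mulr_sumr; apply: le_trans (ler_wpM2l _ (sqrt_sum _)) _; first by rewrite mulr_ge0.
have h2 : Num.sqrt F.+1%:R <= 2 * Num.sqrt F%:R :> R.
  rewrite -[X in X * _](gtr0_norm (ltr0n R 2)) -sqrtr_sqr -sqrtrM ?sqr_ge0// ler_wsqrtr//.
  by rewrite -natrX -natrM ler_nat; lia.
have -> : 2 `^ b * 16 * F%:R `^ (- (2 * b + 1)) = c * 2 * (2 * (2 * Num.sqrt F%:R)).
  by rewrite /c; field; rewrite lt0r_neq0.
by rewrite ler_wpM2l ?mulr_ge0// ler_wpM2l.
Qed.

Local Lemma high_sum F : (0 < F)%N ->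
  \sum_(n < F.+1) (if (F < 2 * n)%N then tail_high F n else 0) / n.+1%:R <=
  4 * F%:R `^ (- (b + 4)) * \sum_(0 <= l < (3 * F).+1) l%:R `^ (2 - b).
Proof.
move=> F0; have F0' : 0 < F%:R :> R by rewrite ltr0n.
pose c : R := 2 / F%:R * F%:R `^ (- (b + 2)).
have c0 : 0 <= c by rewrite !mulr_ge0 ?invr_ge0 ?powR_ge0 ?ltW.
pose S n : R := \sum_(0 <= l < (3 * F).+1) (l + n - F)%:R * l%:R `^ (- b).
have S0 n : 0 <= S n by rewrite sumr_ge0// => l _; rewrite mulr_ge0 ?powR_ge0.
have h n : (n <= F)%N -> (if (F < 2 * n)%N then tail_high F n else 0) / n.+1%:R <= c * (2 / F%:R) * S n.
  have e : tail_high F n = c * S n.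
    by congr (_ * _); apply: eq_bigr => l _; rewrite addn1 subSS.
  move=> nF; case: ifP => [Fn|_]; last by rewrite mul0r mulr_ge0// mulr_ge0// divr_ge0// ltW.
  rewrite e mulrAC ler_wpM2r// ler_wpM2l// ler_pdivlMr// mulrC ler_pdivrMr ?ltrSn//.
  by rewrite -natrM ler_nat; lia.
apply: (@le_trans _ _ (\sum_(n < F.+1) c * (2 / F%:R) * S n)).
  by apply: ler_sum => n _; apply: h; rewrite -ltnS.
rewrite -mulr_sumr exchange_big/=.
have -> : 4 * F%:R `^ (- (b + 4)) = c * (2 / F%:R).
  have -> : - (b + 4) = - (b + 2) + (- 1 + - 1) by ring.
  by rewrite !powR_split// powR_inv1 ?ler0n// /c; field; rewrite lt0r_neq0.
rewrite ler_wpM2l//; first by rewrite mulr_ge0// divr_ge0// ltW.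
apply: ler_sum_nat => l _; rewrite -mulr_suml -natr_sum.
have [->|l0] := posnP l.
  by rewrite big1 ?mul0r ?powR_ge0// => n _; have := ltn_ord n; lia.
rewrite powR_split ?ltr0n// ler_wpM2r ?powR_ge0// powR_mulrn ?ler0n//.
by rewrite -natrX ler_nat expnS expn1 triangle_sum.
Qed.

Lemma tail_majorant_sum F : (0 < F)%N ->
  \sum_(n < F.+1) tail_majorant F n / n.+1%:R <=
  2 `^ b * 16 * F%:R `^ (- (2 * b + 1)) +
  4 * F%:R `^ (- (b + 4)) * \sum_(0 <= l < (3 * F).+1) l%:R `^ (2 - b).
Proof.
move=> F0; apply: le_trans (lerD (low_sum F0) (high_sum F0)).
by rewrite -big_split/= le_eqVlt; apply/orP; left; apply/eqP; apply: eq_bigr => n _; rewrite mulrDl.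
Qed.

End TailBound.

Definition tail_total b F : R :=
  2 `^ b * 16 * F%:R `^ (- (2 * b + 1)) +
  4 * F%:R `^ (- (b + 4)) * \sum_(0 <= l < (3 * F).+1) l%:R `^ (2 - b).

Lemma nat_ge1 F : (0 < F)%N -> 1 <= F%:R :> R.
Proof. by rewrite ler1n. Qed.

Lemma power_sum_ge0 q F : (0 < F)%N -> 0 <= q ->
  \sum_(0 <= l < (3 * F).+1) l%:R `^ q <= 4 * 3 `^ q * F%:R `^ (q + 1).
Proof.
move=> F0 q0; have F0' : 0 < F%:R :> R by rewrite ltr0n.
apply: (@le_trans _ _ (\sum_(0 <= l < (3 * F).+1) (3 * F)%:R `^ q)).
  apply: ler_sum_nat => l hl; rewrite ge0_ler_powR// ?nnegrE ?ler0n// ler_nat; lia.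
rewrite sumr_const_nat subn0 -[leLHS]mulr_natl natrM powRM ?ler0n// powR_split// powRr1 ?ler0n//.
have -> : 4 * 3 `^ q * (F%:R `^ q * F%:R) = (4 * F)%:R * (3 `^ q * F%:R `^ q) :> R by rewrite natrM; ring.
by rewrite ler_wpM2r ?mulr_ge0 ?powR_ge0// ler_nat; lia.
Qed.

Lemma power_sum_conv a N : 0 < a -> \sum_(1 <= l < N) l%:R `^ (- (a + 1)) <= 1 + a^-1 :> R.
Proof.
move=> a0; have [N1|N1] := leqP N 1; first by rewrite big_geq// addr_ge0// invr_ge0 ltW.
rewrite big_ltn// powR1 lerD2l; apply: le_trans (@power_tail 1 N a _ a0) _ => //.
by rewrite powR1 mul1r.
Qed.

Lemma big_nat_from1 N (f : nat -> R) : f 0%N = 0 -> \sum_(0 <= l < N.+1) f l = \sum_(1 <= l < N.+1) f l.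
Proof. by move=> f0; rewrite big_ltn// f0 add0r. Qed.

Section Rates.
Variable a : R.
Hypotheses (a0 : 0 < a) (a1 : a < 1).

(** The sum of [l ^ (2 - b)] converges, so the two terms have the exponents
    [2 b + 1] and [b + 4], both at least the stated one. *)
Lemma rate_ge3 (k : nat) : (3 <= k)%N -> exists C : R, forall F, (0 < F)%N ->
  tail_total (k%:R + a) F <=
  C * (1 / F%:R `^ (k%:R + 5 / 2 + a + Num.min (3 / 2) (k%:R - 2 + a))).
Proof.
move=> k3; have p0 := a0; set b := k%:R + a; exists (2 `^ b * 16 + 4 * (1 + a^-1)) => F F0.
have F1 := nat_ge1 F0; rewrite mul1r -powRN mulrDl /tail_total.
have k3' : 3 <= k%:R :> R by rewrite ler_nat.
have m1 : Num.min (3 / 2) (k%:R - 2 + a) <= 3 / 2 by rewrite ge_min lexx.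
have m2 : Num.min (3 / 2) (k%:R - 2 + a) <= k%:R - 2 + a by rewrite ge_min lexx orbT.
apply: lerD.
  rewrite ler_wpM2l ?mulr_ge0 ?powR_ge0// powR_exp_le// lerN2 /b; lra.
rewrite -[leLHS]mulrA -[leRHS]mulrA ler_wpM2l// [leLHS]mulrC.
apply: ler_pM; rewrite ?powR_ge0//.
- by rewrite sumr_ge0// => l _; exact: powR_ge0.
- rewrite big_nat_from1; last by rewrite powR0// lt_eqF// subr_lt0 /b; lra.
  apply: le_trans (power_sum_conv (3 * F).+1 a0); apply: ler_sum_nat => l /andP[l1 _].
  by rewrite powR_exp_le ?nat_ge1// /b; lra.
by rewrite powR_exp_le// lerN2 /b; lra.
Qed.

(** The sum of [l ^ (- a)] is estimated by [(3 F) ^ (1 - a)] times a harmonic sum,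
    whence the logarithm. *)
Lemma rate_eq2 : exists C : R, forall F, (0 < F)%N -> expR 1 <= F%:R :> R ->
  tail_total (2 + a) F <=
  C * (ln F%:R / F%:R `^ (9 / 2 + a + Num.min 1 (1 / 2 + a))).
Proof.
have [p0 p1] := (a0, a1); set b := 2 + a; exists (2 `^ b * 16 + 4 * (4 * 3 `^ (1 - a))) => F F0 eF.
have F1 := nat_ge1 F0; have F0' := lt_le_trans ltr01 F1.
have ln1 : 1 <= ln F%:R :> R by rewrite -[X in X <= _](@expRK R) ler_ln ?posrE ?expR_gt0.
rewrite -powRN mulrDl /tail_total.
have m2 : Num.min 1 (1 / 2 + a) <= 1 / 2 + a by rewrite ge_min lexx orbT.
have h : F%:R `^ (- (5 + 2 * a)) <= F%:R `^ (- (9 / 2 + a + Num.min 1 (1 / 2 + a))) :> R.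
  by rewrite powR_exp_le// lerN2; lra.
apply: lerD.
  rewrite ler_wpM2l ?mulr_ge0 ?powR_ge0//; have -> : 2 * b + 1 = 5 + 2 * a by rewrite /b; ring.
  by apply: le_trans h _; rewrite ler_peMl ?powR_ge0.
rewrite -[leLHS]mulrA -[leRHS]mulrA ler_wpM2l//.
have hs : \sum_(0 <= l < (3 * F).+1) l%:R `^ (2 - b) <= (3 `^ (1 - a) * F%:R `^ (1 - a)) * (4 * ln F%:R).
  rewrite big_nat_from1; last by rewrite powR0// lt_eqF// subr_lt0 /b; lra.
  apply: (@le_trans _ _ (\sum_(1 <= l < (3 * F).+1) (3 `^ (1 - a) * F%:R `^ (1 - a)) * l%:R^-1)).
    apply: ler_sum_nat => l /andP[l1 lF]; have l0 : 0 < l%:R :> R by rewrite ltr0n.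
    have -> : 2 - b = (1 - a) + (- 1) by rewrite /b; ring.
    rewrite powR_split// powR_inv1 ?ler0n// ler_wpM2r ?invr_ge0 ?ler0n// -powRM ?ler0n//.
    rewrite ge0_ler_powR ?nnegrE ?mulr_ge0 ?ler0n ?subr_ge0 ?(ltW a1)//.
    by rewrite -natrM ler_nat.
  rewrite -mulr_sumr ler_wpM2l ?mulr_ge0 ?powR_ge0//.
  have := harmonic_sum (3 * F).-1; rewrite prednK ?muln_gt0// => /le_trans; apply.
  rewrite natrM lnM ?posrE//; have := @le_ln1Dx R 2; rewrite (_ : 1 + 2 = 3 :> R); last by ring.
  move: (ln F%:R) ln1 => x x1 /(_ _) h3; have {}h3 : ln 3 <= 2 :> R by apply: h3; lra.
  lra.
apply: le_trans (ler_wpM2l (powR_ge0 _ _) hs) _.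
set t := F%:R `^ (- (9 / 2 + a + Num.min 1 (1 / 2 + a))).
have -> : F%:R `^ (- (b + 4)) * (3 `^ (1 - a) * F%:R `^ (1 - a) * (4 * ln F%:R)) =
    4 * 3 `^ (1 - a) * (ln F%:R * (F%:R `^ (- (b + 4)) * F%:R `^ (1 - a))) by ring.
rewrite -powR_split// (_ : - (b + 4) + (1 - a) = - (5 + 2 * a)); last by rewrite /b; ring.
rewrite ler_wpM2l ?mulr_ge0 ?powR_ge0// ler_wpM2l//.
exact: le_trans ler01 ln1.
Qed.

(** For a nonnegative exponent the sum of [l ^ (2 - b)] is at most [4 F] times its
    last term, and the two parts of the majorant are of the same order. *)
Lemma rate_le1 b : 0 < b -> b <= 2 -> exists C : R, forall F, (0 < F)%N ->
  tail_total b F <= C * (1 / F%:R `^ (1 + 2 * b)).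
Proof.
move=> b0 b2; exists (2 `^ b * 16 + 4 * (4 * 3 `^ (2 - b))) => F F0.
have F1 := nat_ge1 F0; have F0' := lt_le_trans ltr01 F1.
rewrite mul1r -powRN mulrDl /tail_total [1 + _]addrC lerD2l.
rewrite -[leLHS]mulrA -[leRHS]mulrA ler_wpM2l//.
have b2' : 0 <= 2 - b by rewrite subr_ge0.
apply: le_trans (ler_wpM2l (powR_ge0 _ _) (power_sum_ge0 F0 b2')) _.
rewrite mulrCA -powR_split// (_ : - (b + 4) + (2 - b + 1) = - (2 * b + 1))//.
by ring.
Qed.

End Rates.

End PowerSums.

(** * The truncated operator on bounded functions *)
Section TruncatedOperator.
Variable R : realType.
Notation mu := (@lebesgue_measure R).
Notation P := (@legendre R).
Notation Re := complex.Re.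
Notation Im := complex.Im.
Variables (kappa d : R).
Hypotheses (kappa0 : 0 < kappa) (d0 : 0 < d).

Lemma domain_bm_ext (f g : R * R -> R) : (forall p, domain d p -> f p = g p) -> domain_bm d f -> domain_bm d g.
Proof.
move=> fg [mf [M fM]]; split; last by exists M => p dp; rewrite -fg// fM.
by apply: eq_measurable_fun mf => p; rewrite inE => /fg.
Qed.

Lemma domain_cbm_ext (f g : R * R -> R[i]) : (forall p, domain d p -> f p = g p) -> domain_cbm d f -> domain_cbm d g.
Proof.
by move=> fg [h1 h2]; split; [apply: domain_bm_ext h1|apply: domain_bm_ext h2] => p dp; rewrite fg.
Qed.

Lemma domain_cbmD f g : domain_cbm d f -> domain_cbm d g -> domain_cbm d (fun p => f p + g p).
Proof.
move=> [f1 f2] [g1 g2]; split.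
  by apply: domain_bm_ext (domain_bmD f1 g1) => p _; rewrite ReD.
by apply: domain_bm_ext (domain_bmD f2 g2) => p _; rewrite ImD.
Qed.

Lemma domain_cbmM f g : domain_cbm d f -> domain_cbm d g -> domain_cbm d (fun p => f p * g p).
Proof.
move=> [f1 f2] [g1 g2]; split.
  by apply: domain_bm_ext (domain_bmB (domain_bmM f1 g1) (domain_bmM f2 g2)) => p _; rewrite ReM.
by apply: domain_bm_ext (domain_bmD (domain_bmM f1 g2) (domain_bmM f2 g1)) => p _; rewrite ImM.
Qed.

Lemma domain_cbm_cst (c : R[i]) : domain_cbm d (fun=> c).
Proof. by split; exact: domain_bm_cst. Qed.

Lemma domain_cbmB f g : domain_cbm d f -> domain_cbm d g -> domain_cbm d (fun p => f p - g p).
Proof.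
move=> hf hg; apply: domain_cbm_ext (domain_cbmD hf (domain_cbmM (domain_cbm_cst (-1)) hg)) => p _.
by rewrite mulN1r.
Qed.

Lemma domain_cbm_real (f : R * R -> R) : domain_bm d f -> domain_cbm d (fun p => (f p)%:C).
Proof. by move=> hf; split; [exact: hf|exact: domain_bm_cst]. Qed.

Lemma domain_cbm_sum N (f : nat -> R * R -> R[i]) : (forall n, domain_cbm d (f n)) ->
  domain_cbm d (fun p => \sum_(n < N) f n p).
Proof.
move=> hf; elim: N => [|N IH].
  by apply: domain_cbm_ext (domain_cbm_cst 0) => p _; rewrite big_ord0.
by apply: domain_cbm_ext (domain_cbmD IH (hf N)) => p _; rewrite big_ord_recr.
Qed.

Lemma domain_bm_legendre n : domain_bm d (fun p => (P n).[cos p.2]).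
Proof.
split; last by exists 1 => p _; exact: legendre_cos_le1.
have mc : measurable_fun setT (fun t : R => (P n).[cos t]).
  by apply: continuous_measurable_fun; exact: cont_horner_cos.
exact: measurable_funTS (measurableT_comp mc measurable_snd).
Qed.

Lemma angular_integrable n phi r : domain_bm d phi -> 0 < r <= d ->
  mu.-integrable `[0, pi] (EFin \o (fun b => phi (r, b) * legendre_sin n b)).
Proof.
move=> [mphi [M phiM]] hr; apply: (bounded_integrable (M := M * 1)).
- exact: measurable_itv.
- exact: mu_itv_oo.
- apply: measurable_funM; last exact: measurable_funTS (measurable_legendre_sin n).
  apply: (measurable_comp (measurable_domain d) _ mphi); last exact: measurable_funTS (measurable_pair1 r).
  by move=> _ [b bI <-]; split => //=; rewrite in_itv/=.
- move=> b bI; rewrite normrM ler_pM ?legendre_sin_bound//.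
  by apply: phiM; split => //=; rewrite in_itv/=.
Qed.

Let angular_int n phi (r : R) : R := \int[mu]_(b in `[0, pi]) (1 * phi (r, b) * (legendre_sin n b * r ^+ 2)).

Let kernel_adm1 : kernel_adm d (fun=> 1).
Proof.
split; first exact: measurable_cst.
exists (d ^+ 2) => r /andP[r0 rd]; rewrite mul1r ger0_norm ?sqr_ge0//.
by rewrite !expr2 ler_pM.
Qed.

Lemma angular_int_bound n phi : domain_bm d phi -> exists2 M : R, 0 <= M & forall r, 0 <= r <= d -> `|angular_int n phi r| <= M * r ^+ 2.
Proof.
move=> hp; have [_ [M phiM]] := hp.
have M0 : 0 <= M.
  have := phiM (d, 0); rewrite /domain /= !in_itv/= d0 lexx pi_ge0 lexx => /(_ (conj isT isT)).
  by apply: le_trans.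
exists (M * pi); first by rewrite mulr_ge0// pi_ge0.
move=> r /andP[+ rd]; rewrite le_eqVlt => /predU1P[<-|r0].
  rewrite /angular_int expr0n/= mulr0 (_ : (fun b => _) = cst 0); last first.
    by apply/funext => b; rewrite !mulr0.
  by rewrite Rintegral_cst// mul0r normr0.
have hr : 0 < r <= d by rewrite r0.
have ip := angular_integrable n hp hr.
have -> : angular_int n phi r = r ^+ 2 * \int[mu]_(b in `[0, pi]) (phi (r, b) * legendre_sin n b).
  by rewrite -RintegralZl//; apply: eq_Rintegral => b _; ring.
rewrite normrM mulrC (ger0_norm (sqr_ge0 r)) ler_wpM2r ?sqr_ge0//.
rewrite -[pi in leRHS]subr0; apply: Rintegral_itv_bound => //; first exact: pi_ge0.
move=> b bI; rewrite normrM -[leRHS]mulr1 ler_pM ?legendre_sin_bound//.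
by apply: phiM; split => //=; rewrite in_itv/=.
Qed.

Lemma angular_int_measurable n phi : domain_bm d phi -> measurable_fun `[0, d] (angular_int n phi).
Proof.
by move=> hp; have [+ _] := kernel_int_outer d0 n kernel_adm1 hp => /measurable_int/measurable_EFinP.
Qed.

Lemma kernel_int_radial n a phi : domain_bm d phi ->
  kernel_int d n a phi = \int[mu]_(r in `[0, d]) (a r * angular_int n phi r).
Proof.
move=> hp; apply: eq_Rintegral => r; rewrite inE/= in_itv/= => /andP[+ rd].
rewrite le_eqVlt => /predU1P[<-|r0].
  have z (g : R -> R) : \int[mu]_(b in `[0, pi]) (g b * (legendre_sin n b * 0 ^+ 2)) = 0.
    rewrite expr0n/= (_ : (fun b => _) = cst 0); first by rewrite Rintegral_cst// mul0r.
    by apply/funext => b; rewrite !mulr0.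
  by rewrite /angular_int !z mulr0.
have hr : 0 < r <= d by rewrite r0.
rewrite -RintegralZl//; first by apply: eq_Rintegral => b _; ring.
rewrite (_ : (fun b => _) = (fun b => r ^+ 2 * (phi (r, b) * legendre_sin n b))); last by apply/funext => b; ring.
by apply: integrable_mulr; [exact: measurable_itv|exact: angular_integrable].
Qed.

Local Lemma mu_oc : (mu `]0%R, d]%classic < +oo)%E.
Proof.
apply: le_lt_trans (mu_itv_oo 0 d); apply: le_measure; rewrite ?inE; try exact: measurable_itv.
by move=> x /=; rewrite !in_itv/= => /andP[x0 ->]; rewrite ltW.
Qed.

(** As a function of the observation radius the radial integral is one of the
    two marginals of an integrable function, hence measurable. *)
Lemma kernel_int_measurable n (K : R * R -> R) (B : R) phi :
  measurable_fun (`]0, d]%classic `*` `[0, d]%classic) K ->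
  (forall s r, 0 < s <= d -> 0 <= r <= d -> `|K (s, r) * r ^+ 2| <= B) -> domain_bm d phi ->
  measurable_fun `]0, d] (fun s => kernel_int d n (fun r => K (s, r)) phi).
Proof.
move=> mK hB hp; have [M M0 hM] := angular_int_bound n hp.
have B0 : 0 <= B by apply: le_trans (hB d d _ _); rewrite ?d0 ?lexx ?(ltW d0).
have i2 : (mu \x mu)%E.-integrable (`]0, d]%classic `*` `[0, d]%classic)
    (EFin \o (fun z => K z * angular_int n phi z.2)).
  apply: (@bounded_integrable2 _ _ (measurableTypeR R) (measurableTypeR R) R mu mu
    `]0, d]%classic `[0, d]%classic _ (B * M)).
  - exact: measurable_itv.
  - exact: measurable_itv.
  - exact: mu_oc.
  - exact: mu_itv_oo.
  - apply: measurable_funM => //.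
    apply: (measurable_comp (measurable_itv `[0, d]) _ (angular_int_measurable n hp)).
      by move=> _ [[s r] [_ /= rI] <-].
    exact: measurable_funTS measurable_snd.
  - move=> s r /=; rewrite !in_itv/= => hs hr.
    apply: (@le_trans _ _ (`|K (s, r) * r ^+ 2| * M)); last by rewrite ler_wpM2r// hB.
    rewrite normrM [in leRHS]normrM (ger0_norm (sqr_ge0 r)) -mulrA ler_wpM2l// mulrC.
    exact: hM.
have [/measurable_int/measurable_EFinP + _] :=
  fubini_lebesgue (measurable_itv `]0, d]) (measurable_itv `[0, d]) i2.
by apply: eq_measurable_fun => s _; rewrite /= (kernel_int_radial _ _ hp).
Qed.

Lemma kernel_int_domain_bm n (K : R * R -> R) (B : R) phi :
  measurable_fun (`]0, d]%classic `*` `[0, d]%classic) K ->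
  (forall s r, 0 < s <= d -> 0 <= r <= d -> `|K (s, r) * r ^+ 2| <= B) -> domain_bm d phi ->
  domain_bm d (fun p => kernel_int d n (fun r => K (p.1, r)) phi).
Proof.
move=> mK hB hp; split.
  apply: (measurable_comp (measurable_itv `]0, d]) _ (kernel_int_measurable n mK hB hp)).
    by move=> _ [[s r] [/= sI _] <-].
  exact: measurable_funTS measurable_fst.
have [M M0 hM] := angular_int_bound n hp; exists (B * M * (d - 0)) => -[s b] [/= + _].
rewrite in_itv/= => hs; rewrite (kernel_int_radial _ _ hp).
have B0 : 0 <= B by apply: le_trans (hB d d _ _); rewrite ?d0 ?lexx ?(ltW d0).
have hb r : 0 <= r <= d -> `|K (s, r) * angular_int n phi r| <= B * M.
  move=> hr; apply: (@le_trans _ _ (`|K (s, r) * r ^+ 2| * M)); last by rewrite ler_wpM2r// hB.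
  by rewrite normrM [in leRHS]normrM (ger0_norm (sqr_ge0 r)) -mulrA ler_wpM2l// mulrC hM.
apply: Rintegral_itv_bound; [exact: ltW| |exact: hb].
apply: (bounded_integrable (M := B * M)).
- exact: measurable_itv.
- exact: mu_itv_oo.
- apply: measurable_funM; last exact: angular_int_measurable.
  by have [+ _] := kernel_adm_sec hs mK (fun r => hB s r hs).
- by move=> r /=; rewrite in_itv/=; exact: hb.
Qed.

Lemma domain_cbm_Kn (m w : R * R -> R[i]) n : domain_cbm d (fun z => w z * m z) ->
  domain_cbm d (fun p => Kn kappa d m n w p.1).
Proof.
move=> [h1 h2]; have [B B0 hB] := kernel_bounded kappa0 d0 n.
have hJ s r : 0 < s <= d -> 0 <= r <= d -> `|besJ kappa n (s, r) * r ^+ 2| <= B.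
  by move=> hs hr; have [] := hB s r hs hr.
have hY s r : 0 < s <= d -> 0 <= r <= d -> `|besY kappa n (s, r) * r ^+ 2| <= B.
  by move=> hs hr; have [] := hB s r hs hr.
have mJ := @measurable_besJ R kappa d kappa0 n; have mY := @measurable_besY R kappa d kappa0 n.
have hc : domain_cbm d (fun p => (kernel_int d n (fun r => besJ kappa n (p.1, r)) (fun z => Re (w z * m z)) -
     kernel_int d n (fun r => besY kappa n (p.1, r)) (fun z => Im (w z * m z))) +i*
    (kernel_int d n (fun r => besJ kappa n (p.1, r)) (fun z => Im (w z * m z)) +
     kernel_int d n (fun r => besY kappa n (p.1, r)) (fun z => Re (w z * m z)))).
  split.
    exact: (domain_bmB (kernel_int_domain_bm n mJ hJ h1) (kernel_int_domain_bm n mY hY h2)).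
  exact: (domain_bmD (kernel_int_domain_bm n mJ hJ h2) (kernel_int_domain_bm n mY hY h1)).
apply: domain_cbm_ext (domain_cbmM (domain_cbm_cst (- ((2 * n + 1)%:R * kappa ^+ 3)%:C)) hc) => -[s b] [/= + _].
by rewrite in_itv/= => hs; rewrite KnE.
Qed.

Lemma domain_cbm_halfKF (m w : R * R -> R[i]) F : domain_cbm d (fun z => w z * m z) ->
  domain_cbm d (halfKF kappa d m F w).
Proof.
move=> h; apply: (domain_cbmM (domain_cbm_cst ('i / 2))); apply: (@domain_cbm_sum F.+1 (fun n p => Kn kappa d m n w p.1 * ((P n).[cos p.2])%:C)) => n.
by apply: domain_cbmM; [exact: domain_cbm_Kn|apply: domain_cbm_real; exact: domain_bm_legendre].
Qed.

Lemma Kn_lin (m w1 w2 : R * R -> R[i]) (c : R) n s : 0 < s <= d ->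
  domain_cbm d (fun z => w1 z * m z) -> domain_cbm d (fun z => w2 z * m z) ->
  Kn kappa d m n (fun z => c%:C * (w1 z - w2 z)) s =
  c%:C * (Kn kappa d m n w1 s - Kn kappa d m n w2 s).
Proof.
move=> hs h1 h2; have [a1 a2] := h1; have [b1 b2] := h2.
have aJ := kernel_adm_besJ kappa0 d0 n hs; have aY := kernel_adm_besY kappa0 d0 n hs.
have h3 : domain_cbm d (fun z => c%:C * (w1 z - w2 z) * m z).
  by apply: domain_cbm_ext (domain_cbmM (domain_cbm_cst c%:C) (domain_cbmB h1 h2)) => p _; ring.
have eRe a : kernel_adm d a -> kernel_int d n a (fun z => Re (c%:C * (w1 z - w2 z) * m z)) =
    c * (kernel_int d n a (fun z => Re (w1 z * m z)) - kernel_int d n a (fun z => Re (w2 z * m z))).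
  move=> ha; rewrite -(kernel_intNr d0 n ha b1) -(kernel_intDr d0 n ha a1 (domain_bmN b1)).
  rewrite -(kernel_intZr d0 n c ha (domain_bmB a1 b1)).
  congr (kernel_int _ _ _ _); apply/funext => z.
  by rewrite -mulrA ReMl mulrBl ReB.
have eIm a : kernel_adm d a -> kernel_int d n a (fun z => Im (c%:C * (w1 z - w2 z) * m z)) =
    c * (kernel_int d n a (fun z => Im (w1 z * m z)) - kernel_int d n a (fun z => Im (w2 z * m z))).
  move=> ha; rewrite -(kernel_intNr d0 n ha b2) -(kernel_intDr d0 n ha a2 (domain_bmN b2)).
  rewrite -(kernel_intZr d0 n c ha (domain_bmB a2 b2)).
  congr (kernel_int _ _ _ _); apply/funext => z.
  by rewrite -mulrA ImMl mulrBl ImB.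
rewrite (KnE kappa0 d0 n hs h3) (KnE kappa0 d0 n hs h1) (KnE kappa0 d0 n hs h2).
rewrite !eRe// !eIm// -[in RHS]mulrBr [RHS]mulrCA; congr (_ * _).
have key (x1 x2 y1 y2 z1 z2 t1 t2 : R) : (c * (x1 - x2) - c * (y1 - y2)) +i* (c * (z1 - z2) + c * (t1 - t2)) =
    c%:C * (((x1 - y1) +i* (z1 + t1)) - ((x2 - y2) +i* (z2 + t2))).
  by apply: complex_eq; rewrite ?ReMl ?ImMl ?ReB ?ImB /=; ring.
exact: key.
Qed.

Lemma halfKF_lin (m w1 w2 : R * R -> R[i]) (c : R) F p : domain d p ->
  domain_cbm d (fun z => w1 z * m z) -> domain_cbm d (fun z => w2 z * m z) ->
  halfKF kappa d m F (fun z => c%:C * (w1 z - w2 z)) p =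
  c%:C * (halfKF kappa d m F w1 p - halfKF kappa d m F w2 p).
Proof.
case: p => s b [/= + _]; rewrite in_itv/= => hs h1 h2.
rewrite /halfKF -mulrBr mulrCA; congr (_ * _).
rewrite /KF -sumrB mulr_sumr; apply: eq_bigr => n _ /=.
by rewrite Kn_lin// -mulrA mulrBl.
Qed.

End TruncatedOperator.

(** * The truncation error *)
Section AngularTail.
Variable R : realType.
Notation mu := (@lebesgue_measure R).
Notation P := (@legendre R).

Lemma lcoef_bound (a : R -> R) (M : R) s : angular_bm a M ->
  `|lcoef a s| <= (2 * s + 1)%:R / 2 * (M * pi).
Proof.
move=> ha; rewrite /lcoef normrM ger0_norm ?divr_ge0// ler_wpM2l ?divr_ge0//.
have hp : angular_bm (legendre_sin s) (1 : R).
  by split=> [|x _]; [exact: measurable_funTS (measurable_legendre_sin s)|exact: legendre_sin_bound].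
have := angular_bmM ha hp => h; rewrite -[pi in leRHS]subr0 -[M]mulr1.
by apply: Rintegral_itv_bound; [exact: pi_ge0|exact: angular_bm_integrable h|exact: h.2].
Qed.

(** The coefficients are summable, so the partial sums are uniformly bounded, as
    weak convergence of the remainder requires. *)
Lemma ltrunc_bound (a : R -> R) (M A b : R) N x : angular_bm a M -> 0 <= M -> 0 <= A -> 0 < b ->
  (forall s, (0 < s)%N -> `|lcoef a s| <= A * s%:R `^ (- (b + 2))) ->
  `|ltrunc a N x| <= M * pi + A * (1 + (b + 1)^-1).
Proof.
move=> ha M0 A0 b0 hA; have p0 := pi_ge0 R.
have b1 : 0 < b + 1 by rewrite addr_gt0.
have K0 : 0 <= A * (1 + (b + 1)^-1) by rewrite mulr_ge0// addr_ge0// invr_ge0 ltW.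
apply: le_trans (ler_norm_sum _ _ _) _.
apply: (@le_trans _ _ (\sum_(s < N) `|lcoef a s|)).
  by apply: ler_sum => s _; rewrite normrM ler_piMr// legendre_cos_le1.
case: N => [|N]; first by rewrite big_ord0 addr_ge0// mulr_ge0.
rewrite -(big_mkord xpredT (fun s => `|lcoef a s|)) big_ltn//; apply: lerD.
  apply: le_trans (lcoef_bound 0 ha) _.
  by rewrite muln0 add0n ler_piMl ?mulr_ge0// ler_pdivrMr// mul1r ler_nat.
apply: (@le_trans _ _ (\sum_(1 <= s < N.+1) A * s%:R `^ (- (b + 1 + 1)))).
  by apply: ler_sum_nat => s /andP[s0 _]; rewrite -(addrA b 1 1); exact: hA.
by rewrite -mulr_sumr ler_wpM2l// power_sum_conv.
Qed.

(** The index [0], at which the powers are degenerate, never occurs: [s > F] and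
    [l >= F + 1 - n > 0]. *)
Lemma angular_tail (a m : R -> R) (M Mm A C b : R) F n :
  angular_bm a M -> angular_bm m Mm -> 0 <= M -> 0 <= A -> 0 <= C -> 0 < b ->
  (forall s, (0 < s)%N -> `|lcoef a s| <= A * s%:R `^ (- (b + 2))) ->
  (forall l, (0 < l)%N -> `|lcoef m l| <= C * l%:R `^ (- b)) ->
  (0 < F)%N -> (n <= F)%N ->
  `|\int[mu]_(x in `[0, pi]) ((a x - ltrunc a F.+1 x) * (m x * legendre_sin n x))| <=
  A * C * tail_majorant b F n.
Proof.
move=> ha hm M0 A0 C0 b0 hA hC F0 nF.
apply: (@product_tail R a m M Mm (M * pi + A * (1 + (b + 1)^-1)) n F.+1
  (fun s => A * s%:R `^ (- (b + 2))) (fun l => C * l%:R `^ (- b))) => //.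
- by move=> N x; exact: ltrunc_bound.
- exact: leq_trans nF _.
- by move=> s Fs; apply: hA; exact: leq_trans Fs.
- by move=> l Fl; apply: hC; lia.
move=> N _; apply: (@le_trans _ _ (A * C * \sum_(F.+1 <= s < N) s%:R `^ (- (b + 2)) *
    \sum_(s - n <= l < s + n + 1) l%:R `^ (- b) *
       (2 / (Num.sqrt (2 * s + 1)%:R * Num.sqrt (2 * n + 1)%:R)))).
  rewrite mulr_sumr; apply: ler_sum => s _; rewrite le_eqVlt; apply/orP; left; apply/eqP.
  rewrite -!mulrA; congr (_ * _); rewrite mulrCA; congr (_ * _).
  by rewrite mulr_sumr; apply: eq_bigr => l _; rewrite -!mulrA.
by rewrite ler_wpM2l ?mulr_ge0// tail_majorantP.
Qed.

End AngularTail.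

Section TruncationError.
Variable R : realType.
Notation mu := (@lebesgue_measure R).
Notation P := (@legendre R).
Notation Re := complex.Re.
Notation Im := complex.Im.
Variables (kappa d : R).
Hypotheses (kappa0 : 0 < kappa) (d0 : 0 < d).

Definition radially_bm (h : R * R -> R[i]) (M : R) : Prop := forall r, 0 < r <= d ->
  angular_bm (fun x => Re (h (r, x))) M /\ angular_bm (fun x => Im (h (r, x))) M.

(** Index [0] is left out: a negative power of [0] is no bound. *)
Definition coef_decays (h : R * R -> R[i]) (A p : R) : Prop := forall r l, 0 < r <= d -> (0 < l)%N ->
  `|lcoef (fun x => Re (h (r, x))) l| <= A * l%:R `^ (- p) /\
  `|lcoef (fun x => Im (h (r, x))) l| <= A * l%:R `^ (- p).

Lemma legendre_coef_lcoef (h : R * R -> R[i]) n r :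
  legendre_coef h n r = lcoef (fun x => Re (h (r, x))) n +i* lcoef (fun x => Im (h (r, x))) n.
Proof. exact: legendre_coef_parts. Qed.

Lemma Re_legendre_trunc (h : R * R -> R[i]) F r x :
  Re (legendre_trunc h F (r, x)) = ltrunc (fun x => Re (h (r, x))) F.+1 x.
Proof.
rewrite /legendre_trunc Re_sum; apply: eq_bigr => s _.
by rewrite ReMr legendre_coef_lcoef.
Qed.

Lemma Im_legendre_trunc (h : R * R -> R[i]) F r x :
  Im (legendre_trunc h F (r, x)) = ltrunc (fun x => Im (h (r, x))) F.+1 x.
Proof.
rewrite /legendre_trunc Im_sum; apply: eq_bigr => s _.
by rewrite ImMr legendre_coef_lcoef.
Qed.

(** The finitely many coefficients not controlled by the asymptotic bound are
    bounded because the function is. *)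
Lemma coef_decay h (M p : R) : 0 <= M -> radially_bm h M ->
  bigO_seq (fun l => supnorm `[0, d] (legendre_coef h l)) (fun l => 1 / l%:R `^ p) ->
  exists2 A : R, 0 <= A & coef_decays h A p.
Proof.
move=> M0 hM [C [N _ hC]].
pose c l : R := (2 * l + 1)%:R / 2 * (M * pi) * l%:R `^ p.
have c0 l : 0 <= c l by rewrite !mulr_ge0 ?powR_ge0 ?pi_ge0.
exists (`|C| + \sum_(l < N) c l); first by rewrite addr_ge0// sumr_ge0.
move=> r l hr l0; have l1 : 0 < l%:R :> R by rewrite ltr0n.
have q0 : 0 <= l%:R `^ (- p) :> R by exact: powR_ge0.
have [Nl|lN] := leqP N l.
  have hl : Normc.normc (legendre_coef h l r) <= C * l%:R `^ (- p).
    rewrite -lee_fin powRN -[_^-1]mul1r; apply: le_trans (hC l Nl).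
    apply: ereal_sup_ubound; exists r => //=.
    by rewrite in_itv/=; case/andP: hr => /ltW -> ->.
  have {}hl : Normc.normc (legendre_coef h l r) <= (`|C| + \sum_(l < N) c l) * l%:R `^ (- p).
    apply: le_trans hl _; rewrite ler_wpM2r//; apply: le_trans (ler_norm C) _.
    by rewrite lerDl sumr_ge0.
  have := le_trans (Re_le_norm _) hl; have := le_trans (Im_le_norm _) hl.
  by rewrite legendre_coef_lcoef.
have hl : (2 * l + 1)%:R / 2 * (M * pi) <= (`|C| + \sum_(l < N) c l) * l%:R `^ (- p).
  apply: (@le_trans _ _ (c l * l%:R `^ (- p))).
    by rewrite /c powRN mulfK// lt0r_neq0// powR_gt0.
  rewrite ler_wpM2r// (bigD1 (Ordinal lN))//= addrCA lerDl addr_ge0// sumr_ge0//.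
have [h1 h2] := hM r hr.
by split; apply: le_trans hl; exact: lcoef_bound.
Qed.

Section Tail.
Variables (m u : R * R -> R[i]) (M Mm A C b : R).
Hypotheses (M0 : 0 <= M) (A0 : 0 <= A) (C0 : 0 <= C) (b0 : 0 < b).
Hypotheses (hu : radially_bm u M) (hm : radially_bm m Mm).
Hypotheses (uA : coef_decays u A (b + 2)) (mC : coef_decays m C b).
Hypotheses (cm : domain_cbm d m) (cu : domain_cbm d u).

Let w F z := u z - legendre_trunc u F z.

Local Lemma angular_tail_parts F n r : (0 < F)%N -> (n <= F)%N -> 0 < r <= d ->
  `|\int[mu]_(x in `[0, pi]) (Re (w F (r, x) * m (r, x)) * legendre_sin n x)| <= 2 * (A * C * tail_majorant b F n) /\
  `|\int[mu]_(x in `[0, pi]) (Im (w F (r, x) * m (r, x)) * legendre_sin n x)| <= 2 * (A * C * tail_majorant b F n).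
Proof.
move=> F0 nF hr; have [u1 u2] := hu hr; have [m1 m2] := hm hr.
set D := A * C * _.
pose a1 x := Re (u (r, x)); pose a2 x := Im (u (r, x)).
pose g1 x := Re (m (r, x)); pose g2 x := Im (m (r, x)).
have hp : angular_bm (legendre_sin n) (1 : R).
  by split=> [|x _]; [exact: measurable_funTS (measurable_legendre_sin n)|exact: legendre_sin_bound].
have int (a g : R -> R) (N L : R) : angular_bm a N -> angular_bm g L ->
    mu.-integrable `[0, pi] (EFin \o (fun x => (a x - ltrunc a F.+1 x) * (g x * legendre_sin n x))).
  move=> ha hg; have [K _ hK] := angular_bm_trunc a F.+1.
  exact: angular_bm_integrable (angular_bmM (angular_bmB ha hK) (angular_bmM hg hp)).
have bd (a g : R -> R) : angular_bm a M -> angular_bm g Mm ->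
    (forall s, (0 < s)%N -> `|lcoef a s| <= A * s%:R `^ (- (b + 2))) ->
    (forall l, (0 < l)%N -> `|lcoef g l| <= C * l%:R `^ (- b)) ->
    `|\int[mu]_(x in `[0, pi]) ((a x - ltrunc a F.+1 x) * (g x * legendre_sin n x))| <= D.
  by move=> ha hg hA hC; exact: angular_tail ha hg _ _ _ _ hA hC _ _.
have uA1 s : (0 < s)%N -> `|lcoef a1 s| <= A * s%:R `^ (- (b + 2)) by move=> s0; have [] := uA hr s0.
have uA2 s : (0 < s)%N -> `|lcoef a2 s| <= A * s%:R `^ (- (b + 2)) by move=> s0; have [] := uA hr s0.
have mC1 s : (0 < s)%N -> `|lcoef g1 s| <= C * s%:R `^ (- b) by move=> s0; have [] := mC hr s0.
have mC2 s : (0 < s)%N -> `|lcoef g2 s| <= C * s%:R `^ (- b) by move=> s0; have [] := mC hr s0.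
split.
  rewrite (_ : (fun x => _) = (fun x => (a1 x - ltrunc a1 F.+1 x) * (g1 x * legendre_sin n x) -
      (a2 x - ltrunc a2 F.+1 x) * (g2 x * legendre_sin n x))); last first.
    apply/funext => x; rewrite /w ReM ReB ImB Re_legendre_trunc Im_legendre_trunc.
    by rewrite /a1 /a2 /g1 /g2; ring.
  rewrite RintegralB//; [|exact: int u1 m1|exact: int u2 m2].
  apply: le_trans (ler_normB _ _) _; rewrite mulr_natl mulr2n; apply: lerD; exact: bd.
rewrite (_ : (fun x => _) = (fun x => (a1 x - ltrunc a1 F.+1 x) * (g2 x * legendre_sin n x) +
    (a2 x - ltrunc a2 F.+1 x) * (g1 x * legendre_sin n x))); last first.
  apply/funext => x; rewrite /w ImM ReB ImB Re_legendre_trunc Im_legendre_trunc.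
  by rewrite /a1 /a2 /g1 /g2; ring.
rewrite RintegralD//; [|exact: int u1 m2|exact: int u2 m1].
apply: le_trans (ler_normD _ _) _; rewrite mulr_natl mulr2n; apply: lerD; exact: bd.
Qed.

Local Lemma split_bound (j1 j2 y1 y2 D p q : R) :
  `|j1| <= D * p -> `|j2| <= D * p -> `|y1| <= D * q -> `|y2| <= D * q ->
  `|j1 - y2| + `|j2 + y1| <= D * (2 * p + 2 * q).
Proof.
move=> h1 h2 h3 h4; have -> : D * (2 * p + 2 * q) = (D * p + D * q) + (D * p + D * q) by ring.
by apply: lerD; [apply: le_trans (ler_normB _ _) _|apply: le_trans (ler_normD _ _) _]; apply: lerD.
Qed.

Local Lemma double_bound (x y z : R) : y <= x -> z <= x -> 2 * y + 2 * z <= 4 * x.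
Proof. lra. Qed.

(** Gain of [1 / n] from the radial kernels, of the majorant from the angular
    integrals. *)
Lemma Kn_tail : exists2 E : R, 0 <= E & forall F n s, (0 < F)%N -> (n <= F)%N -> 0 < s <= d ->
  domain_cbm d (legendre_trunc u F) ->
  Normc.normc (Kn kappa d m n (w F) s) <= E * (tail_majorant b F n / n.+1%:R).
Proof.
have [E E0 hE] := kernel_mass kappa0 d0.
have k3 : 0 <= kappa ^+ 3 by rewrite exprn_ge0// ltW.
exists (kappa ^+ 3 * (8 * (A * C) * E)); first by rewrite mulr_ge0// !mulr_ge0.
move=> F n s F0 nF hs ct; have [hJ hY] := hE n s hs.
have [h1 h2] : domain_cbm d (fun z => w F z * m z) by apply: domain_cbmM => //; exact: domain_cbmB.
rewrite (KnE kappa0 d0 n hs (conj h1 h2)).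
set D := A * C * tail_majorant b F n.
have t1 r : 0 < r <= d -> `|\int[mu]_(x in `[0, pi]) (Re (w F (r, x) * m (r, x)) * legendre_sin n x)| <= 2 * D.
  by move=> hr; have [] := angular_tail_parts F0 nF hr.
have t2 r : 0 < r <= d -> `|\int[mu]_(x in `[0, pi]) (Im (w F (r, x) * m (r, x)) * legendre_sin n x)| <= 2 * D.
  by move=> hr; have [] := angular_tail_parts F0 nF hr.
have D0 : 0 <= 2 * D by apply: le_trans (t1 d _) => //; rewrite d0 lexx.
have aJ := kernel_adm_besJ kappa0 d0 n hs; have aY := kernel_adm_besY kappa0 d0 n hs.
have b1 := kernel_int_bound d0 aJ h1 t1; have b2 := kernel_int_bound d0 aJ h2 t2.
have b3 := kernel_int_bound d0 aY h1 t1; have b4 := kernel_int_bound d0 aY h2 t2.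
move: b1 b2 b3 b4 hJ hY.
set J1 := kernel_int _ _ _ _; set J2 := kernel_int _ _ _ _; set Y1 := kernel_int _ _ _ _; set Y2 := kernel_int _ _ _ _.
move: (\int[mu]_(r in _) _) (\int[mu]_(r in _) _) => IY IJ b1 b2 b3 b4 hJ hY.
rewrite Normc.normcM normcN; set c : R := (2 * n + 1)%:R.
move: (kappa ^+ 3) k3 => K3 k3.
have -> : Normc.normc (c * K3)%:C = c * K3.
  by rewrite /= expr0n/= addr0 sqrtr_sqr ger0_norm// mulr_ge0.
rewrite -!mulrA mulrCA ler_wpM2l//.
have c0 : 0 <= c by exact: ler0n.
have h : Normc.normc ((J1 - Y2) +i* (J2 + Y1)) <= 2 * D * (2 * IJ + 2 * IY).
  by apply: le_trans (normc_le _) _; exact: (split_bound b1 b2 b3 b4).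
apply: le_trans (ler_wpM2l c0 h) _.
have -> : c * (2 * D * (2 * IJ + 2 * IY)) = 2 * D * (2 * (c * IJ) + 2 * (c * IY)) by ring.
apply: (@le_trans _ _ (2 * D * (4 * (E / n.+1%:R)))).
  by rewrite ler_wpM2l// double_bound.
rewrite le_eqVlt; apply/orP; left; apply/eqP; rewrite /D; ring.
Qed.

Lemma normc_sum N (f : nat -> R[i]) :
  Normc.normc (\sum_(n < N) f n) <= \sum_(n < N) Normc.normc (f n).
Proof.
elim: N => [|N IH]; first by rewrite !big_ord0 Normc.normc0.
by rewrite !big_ord_recr/=; apply: le_trans (le_normcD _ _) _; rewrite lerD2r.
Qed.

Lemma halfKF_tail : exists2 E : R, 0 <= E & forall F p, (0 < F)%N -> domain d p ->
  domain_cbm d (legendre_trunc u F) ->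
  Normc.normc (halfKF kappa d m F (w F) p) <= E * tail_total b F.
Proof.
have [E E0 hE] := Kn_tail; exists E => // F -[s x] F0 [/= + _]; rewrite in_itv/= => hs ct.
have hhalf z : Normc.normc ('i / 2 * z : R[i]) <= Normc.normc z.
  apply: le_trans (normc_le _) _; rewrite Re_half_i Im_half_i !normrM normrN.
  have := Re_le_norm z; have := Im_le_norm z; rewrite ger0_norm ?invr_ge0//.
  lra.
apply: le_trans (hhalf _) _.
apply: le_trans (normc_sum F.+1 (fun n => Kn kappa d m n (w F) s * ((P n).[cos x])%:C)) _.
apply: (@le_trans _ _ (\sum_(n < F.+1) E * (tail_majorant b F n / n.+1%:R))).
  apply: ler_sum => n _; have nF : (n <= F)%N by rewrite -ltnS.
  apply: le_trans (hE F n s F0 nF hs ct).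
  rewrite Normc.normcM; apply: ler_piMr; first exact: normc_ge0.
  by rewrite /= expr0n/= addr0 sqrtr_sqr legendre_cos_le1.
by rewrite -mulr_sumr ler_wpM2l// tail_majorant_sum.
Qed.

End Tail.

(** The bound on the resolvent is used on [e] rescaled so that its residual has
    norm at most 1. *)
Lemma resolvent_bound (A S : (R * R -> R[i]) -> (R * R -> R[i])) (e : R * R -> R[i]) (B delta : R) :
  inverse_operator (domain d) A S -> (opnorm (domain d) S <= B%:E)%E ->
  (forall c : R, bounded_measurable (domain d) (fun p => c%:C * e p)) ->
  (forall c : R, bounded_measurable (domain d) (A (fun p => c%:C * e p))) ->
  (forall (c : R) p, domain d p -> Normc.normc (A (fun p => c%:C * e p) p) <= `|c| * delta) ->
  0 < delta -> forall p, domain d p -> Normc.normc (e p) <= B * delta.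
Proof.
move=> [_ _ _ hinv] hB he hA hd delta0 p dp.
pose c := delta^-1; pose f := fun p => c%:C * e p.
have h1 : (supnorm (domain d) (A f) <= 1)%E.
  apply: ge_ereal_sup => _ [q dq <-]; rewrite lee_fin.
  by apply: le_trans (hd c q dq) _; rewrite gtr0_norm ?invr_gt0// mulVf ?lt0r_neq0.
have h2 : (supnorm (domain d) (S (A f)) <= B%:E)%E.
  apply: le_trans hB; apply: ereal_sup_ubound; exists (A f) => //.
  by split; [exact: hA|exact: h1].
have h3 : ((Normc.normc (f p))%:E <= B%:E)%E.
  apply: le_trans h2; rewrite -(hinv f (he c) p dp).
  by apply: ereal_sup_ubound; exists p.
move: h3; rewrite lee_fin /f Normc.normcM.
have -> : Normc.normc c%:C = c.
  by rewrite /= expr0n/= addr0 sqrtr_sqr ger0_norm// invr_ge0 ltW.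
by rewrite mulrC ler_pdivrMr.
Qed.

End TruncationError.

Lemma domain_cbm_bounded_measurable (R : realType) (d : R) (f : R * R -> R[i]) :
  domain_cbm d f <-> bounded_measurable (domain d) f.
Proof.
split.
  move=> [[m1 [M1 h1]] [m2 [M2 h2]]]; split; first by split.
  by exists (M1 + M2) => p dp; apply: le_trans (normc_le _) _; rewrite lerD ?h1 ?h2.
move=> [[m1 m2] [M hM]]; split; split=> //; exists M => p dp; apply: le_trans (hM p dp).
  exact: Re_le_norm.
exact: Im_le_norm.
Qed.

Lemma radially_bm_sph (R : realType) (d M : R) (f : R * R * R -> R[i]) :
  cmeasurable setT f -> (forall x, cball3 d x -> Normc.normc (f x) <= M) -> radially_bm d (sph f) M.
Proof.
move=> [m1 m2] fM r /andP[r0 rd].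
have h x : Normc.normc (f (r * sin x, 0, r * cos x)) <= M.
  by apply: fM; rewrite /cball3 /= sph_norm// ltW.
split; (split; last first).
- by move=> x _; apply: le_trans (h x); exact: Re_le_norm.
- apply: measurable_funTS; exact: (measurableT_comp (measurable_sph m1) (measurable_pair1 r)).
- by move=> x _; apply: le_trans (h x); exact: Im_le_norm.
- apply: measurable_funTS; exact: (measurableT_comp (measurable_sph m2) (measurable_pair1 r)).
Qed.

Lemma domain_cbm_sph (R : realType) (d M : R) (f : R * R * R -> R[i]) :
  cmeasurable setT f -> (forall x, cball3 d x -> Normc.normc (f x) <= M) -> domain_cbm d (sph f).
Proof.
move=> [m1 m2] fM; split.
  by apply: (domain_bm_sph m1) => y dy; exact: le_trans (Re_le_norm _) (fM y dy).
by apply: (domain_bm_sph m2) => y dy; exact: le_trans (Im_le_norm _) (fM y dy).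
Qed.

Theorem corollary6p7 (R : realType) (kappa rad : R)
  (nref ui u : R * R * R -> R[i]) (v : nat -> R * R -> R[i])
  (res : nat -> (R * R -> R[i]) -> (R * R -> R[i]))
  (k : nat) (alpha : R)
  (kappa_gt0 : 0 < kappa) (rad_gt0 : 0 < rad)
  (nref_axi : axisymmetric nref)
  (nref_out : forall x, rad < enorm x -> nref x = 1)
  (nref_reg : bounded_measurable setT nref)
  (ui_axi : axisymmetric ui)
  (ui_helmholtz : helmholtz kappa ui)
  (u_axi : axisymmetric u)
  (u_meas : cmeasurable setT u)
  (u_bounded : bounded_on (cball3 rad) u)
  (u_LS : lippmann_schwinger kappa rad (contrast nref) ui u)
  (v_reg : forall F, (0 < F)%N -> bounded_measurable (domain rad) (v F))
  (v_eq : forall F, (0 < F)%N ->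
     eq_on (domain rad) (v F) (fun p =>
       legendre_trunc (sph ui) F p
       + halfKF kappa rad (sph (contrast nref)) F (v F) p))
  (alpha_gt0 : 0 < alpha) (alpha_lt1 : alpha < 1)
  (m_decay : bigO_seq
     (fun l => supnorm `[0, rad] (legendre_coef (sph (contrast nref)) l))
     (fun l => 1 / l%:R `^ (k%:R + alpha)))
  (u_decay : bigO_seq
     (fun s => supnorm `[0, rad] (legendre_coef (sph u) s))
     (fun s => 1 / s%:R `^ (k%:R + 2 + alpha)))
  (res_inv : forall F, (0 < F)%N ->
     inverse_operator (domain rad)
       (fun w p => w p - halfKF kappa rad (sph (contrast nref)) F w p) (res F))
  (res_bound : exists B : R, forall F, (0 < F)%N ->
     (opnorm (domain rad) (res F) <= B%:E)%E) :
  let eps (F : nat) : \bar R :=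
    supnorm (domain rad) (fun p => legendre_trunc (sph u) F p - v F p) in
  [/\ (3 <= k)%N ->
        bigO_seq eps (fun F =>
          1 / F%:R `^ (k%:R + 5 / 2 + alpha
                       + Num.min (3 / 2) (k%:R - 2 + alpha))),
      k = 2%N ->
        bigO_seq eps (fun F =>
          ln F%:R / F%:R `^ (9 / 2 + alpha + Num.min 1 (1 / 2 + alpha))),
      k = 1%N ->
        bigO_seq eps (fun F => 1 / F%:R `^ (3 + 2 * alpha))
    & k = 0%N ->
        bigO_seq eps (fun F => 1 / F%:R `^ (1 + 2 * alpha))].
Proof.
move=> eps; pose b : R := k%:R + alpha.
have b0 : 0 < b by rewrite ltr_wpDl.
have [Mm Mm0 hMm] := contrast_bounded nref_reg.
have [M M0 hM] := u_bounded0 u_bounded.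
have cm := contrast_meas nref_reg.
have hMm' x : cball3 rad x -> Normc.normc (contrast nref x) <= Mm by move=> _; exact: hMm.
pose m := sph (contrast nref).
have rm : radially_bm rad m Mm := radially_bm_sph cm hMm'.
have ru : radially_bm rad (sph u) M := radially_bm_sph u_meas hM.
have angular_bm_ : domain_cbm rad m := domain_cbm_sph cm hMm'.
have bu : domain_cbm rad (sph u) := domain_cbm_sph u_meas hM.
have [C C0 hC] : exists2 C : R, 0 <= C & coef_decays rad m C b := coef_decay Mm0 rm m_decay.
have [A A0 hA] : exists2 A : R, 0 <= A & coef_decays rad (sph u) A (b + 2).
  rewrite (_ : b + 2 = k%:R + 2 + alpha); last by rewrite /b; ring.
  exact: coef_decay M0 ru u_decay.
have [E E0 hE] := halfKF_tail kappa_gt0 rad_gt0 M0 A0 C0 b0 ru rm hA hC angular_bm_ bu.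
have [B hB] := res_bound.
have main F p : (0 < F)%N -> domain rad p ->
    Normc.normc (legendre_trunc (sph u) F p - v F p) <= `|B| * (E + 1) * tail_total b F.
  move=> F0 dp; pose T := legendre_trunc (sph u) F.
  pose H w := halfKF kappa rad m F w.
  have bv : domain_cbm rad (v F) by apply/domain_cbm_bounded_measurable; exact: v_reg.
  (* the truncated total field solves the truncated equation up to the
     contribution of its own tail *)
  have eE q : domain rad q -> T q - v F q = H (sph u) q - H (v F) q.
    move=> dq; have -> : T q = legendre_trunc (sph ui) F q + H (sph u) q.
      case: q dq => s x [/= + _]; rewrite in_itv/= => hs.
      rewrite /H /halfKF /KF mulr_sumr -big_split/=; apply: eq_bigr => n _.
      rewrite (radial_equation kappa_gt0 rad_gt0 nref_axi nref_reg u_axi u_meas u_bounded u_LS n hs).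
      by rewrite /= mulrDl; congr (_ + _); exact: (esym (mulrA _ _ _)).
    by rewrite (v_eq F F0 q dq) opprD addrACA subrr add0r.
  have be : domain_cbm rad (fun q => T q - v F q).
    apply: (@domain_cbm_ext _ _ (fun q => H (sph u) q - H (v F) q)); first by move=> q /eE ->.
    by apply: domain_cbmB; apply: domain_cbm_halfKF => //; exact: domain_cbmM.
  have bT : domain_cbm rad T by apply: (domain_cbm_ext _ (domain_cbmD be bv)) => q _; rewrite subrK.
  (* the residual of the error is the operator applied to the tail of [u] *)
  have hlin (c : R) q : domain rad q ->
      c%:C * (T q - v F q) - H (fun z => c%:C * (T z - v F z)) q =
      c%:C * H (fun z => sph u z - T z) q.
    move=> dq; rewrite /H halfKF_lin//; [|exact: domain_cbmM|exact: domain_cbmM].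
    have -> : (fun z => sph u z - T z) = (fun z => 1%:C * (sph u z - T z)).
      by apply/funext => z; rewrite mul1r.
    rewrite (@halfKF_lin _ _ _ kappa_gt0 rad_gt0)//; [|exact: domain_cbmM|exact: domain_cbmM].
    by rewrite mul1r eE// -mulrBr opprB addrA subrK.
  have t0 : 0 < tail_total b F.
    rewrite /tail_total ltr_pwDl ?mulr_gt0 ?powR_gt0 ?ltr0n//.
    by rewrite !mulr_ge0 ?powR_ge0// sumr_ge0// => l _; exact: powR_ge0.
  have d0 : 0 < (E + 1) * tail_total b F by rewrite mulr_gt0// ltr_wpDl.
  apply: (@le_trans _ _ (B * ((E + 1) * tail_total b F))); last first.
    by rewrite -mulrA ler_wpM2r ?ler_norm// ltW.
  apply: (@resolvent_bound R rad _ _ (fun q => T q - v F q) B _ (res_inv F F0) (hB F F0) _ _ _ d0 p dp) => c.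
  - by apply/domain_cbm_bounded_measurable; exact: domain_cbmM (domain_cbm_cst _ _) be.
  - apply/domain_cbm_bounded_measurable; have bc := domain_cbmM (domain_cbm_cst _ c%:C) be.
    by apply: domain_cbmB => //; apply: domain_cbm_halfKF => //; exact: domain_cbmM.
  - move=> q dq; rewrite -/m -/(H _) hlin// Normc.normcM.
    have -> : Normc.normc c%:C = `|c| by rewrite /= expr0n/= addr0 sqrtr_sqr.
    rewrite ler_wpM2l//; apply: le_trans (hE F q F0 dq bT) _.
    by rewrite ler_wpM2r ?lerDl// ltW.
have fin (g : nat -> R) (N0 : nat) : (exists D : R, forall F, (0 < F)%N -> (N0 <= F)%N ->
    tail_total b F <= D * g F) -> bigO_seq eps g.
  move=> [D hD]; exists (`|B| * (E + 1) * D); exists N0.+1 => // F /= NF.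
  have F0 : (0 < F)%N by exact: leq_trans NF.
  apply: ge_ereal_sup => _ [p dp <-]; rewrite lee_fin.
  apply: le_trans (main F p F0 dp) _; rewrite -[leRHS]mulrA ler_wpM2l ?mulr_ge0 ?addr_ge0//.
  by apply: hD => //; exact: ltnW.
split.
- move=> k3; apply: (fin _ 0%N); have [D hD] := rate_ge3 alpha_gt0 k3.
  by exists D => F F0 _; exact: hD.
- move=> k2; have [N0 _ hN0] := nbhs_infty_ger (expR 1 : R).
  apply: (fin _ N0); have [D hD] := rate_eq2 alpha_gt0 alpha_lt1.
  by exists D => F F0 NF; rewrite /b k2; apply: hD => //; exact: hN0.
- move=> k1; apply: (fin _ 0%N); have b2 : b <= 2 by rewrite /b k1; lra.
  have [D hD] := rate_le1 b0 b2; exists D => F F0 _.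
  by apply: le_trans (hD F F0) _; rewrite /b k1 (_ : 1 + 2 * (1%:R + alpha) = 3 + 2 * alpha)//; ring.
- move=> k0; apply: (fin _ 0%N); have b2 : b <= 2 by rewrite /b k0; lra.
  have [D hD] := rate_le1 b0 b2; exists D => F F0 _.
  by apply: le_trans (hD F F0) _; rewrite /b k0 add0r.
Qed.
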